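(* Let $n\ge 2$ be an integer and let $\Omega\subset\mathbb{R}^n$ be an open bounded convex set with diameter $\mathrm{diam}(\Omega)$ and smooth boundary $\partial\Omega$. Then the first two eigenvalues $\lambda_1(2,\Omega)$ and $\lambda_2(2,\Omega)$ of the Dirichlet Laplacian on $\Omega$ (with eigenfunctions normalized in $L^2(\Omega)$) satisfy $$\lambda_2(2,\Omega)-\lambda_1(2,\Omega)\;\ge\;\frac{\pi^2}{\mathrm{diam}(\Omega)^2}.$$
   Context: Let $\mathcal{S}_2=\{u\in W_0^{1,2}(\Omega):\|u\|_{L^2(\Omega)}=1\}$. The first eigenvalue is $\lambda_1(2,\Omega)=\min_{u\in\mathcal{S}_2}\int_\Omega|\nabla u|^2\,dx$, attained at the positive first eigenfunction $u_1$ with $\|u_1\|_{L^2(\Omega)}=1$. The second eigenvalue is $$\lambda_2(2,\Omega)=\inf_{\sigma\in\Gamma(u_1,-u_1)}\ \max_{u\in\sigma([0,1])}\int_\Omega|\nabla u|^2\,dx,$$ where $\Gamma(u_1,-u_1)$ is the family of all continuous maps $\sigma:[0,1]\to\mathcal{S}_2$ with endpoints $u_1$ and $-u_1$; it coincides with the standard second eigenvalue of the Dirichlet Laplacian $-\Delta$ on $\Omega$. *)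

(* Defs.v *)
From HB Require Import structures.
From mathcomp Require Import all_boot all_order all_algebra.
From mathcomp Require Import all_classical all_reals all_analysis.

Set Implicit Arguments.
Unset Strict Implicit.
Unset Printing Implicit Defensive.

Import Order.TTheory GRing.Theory Num.Theory.
Import numFieldNormedType.Exports.

Local Open Scope classical_set_scope.
Local Open Scope ring_scope.

(* R^n is 'rV[R]_n. The library equips it with the sup norm, which gives the
   usual topology, bounded sets and derivatives; Euclidean lengths are written
   with enorm below. *)

(* The sigma-algebra generated by the coordinates, as the library does for
   n.-tuple T: it is the Borel sigma-algebra of R^n. *)
Definition rV_display : measure_display.
Proof. exact: default_measure_display. Qed.

Section rV_measurable.
Context {R : realType} {n : nat}.

Definition rV_coord (i : 'I_n) (x : 'rV[R]_n) : R := x ord0 i.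

Let rV_set0 : g_sigma_preimage rV_coord set0.
Proof. exact: sigma_algebra0. Qed.

Let rV_setC A : g_sigma_preimage rV_coord A -> g_sigma_preimage rV_coord (~` A).
Proof. exact: sigma_algebraC. Qed.

Let rV_bigcup (F : _^nat) : (forall i, g_sigma_preimage rV_coord (F i)) ->
  g_sigma_preimage rV_coord (\bigcup_i (F i)).
Proof. exact: sigma_algebra_bigcup. Qed.

HB.instance Definition _ := @isMeasurable.Build rV_display
  'rV[R]_n (g_sigma_preimage rV_coord) rV_set0 rV_setC rV_bigcup.

Lemma measurable_rV_coord (i : 'I_n) :
  measurable_fun [set: 'rV[R]_n] (rV_coord i).
Proof.
move=> _ Y mY; rewrite setTI; apply: sub_sigma_algebra => /=.
rewrite -bigcup_seq/=; exists i => /=; first by rewrite mem_index_enum.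
by exists Y => //; rewrite setTI.
Qed.

Lemma measurable_fun_rV d (T : measurableType d) (f : T -> 'rV[R]_n) :
  (forall i, measurable_fun [set: T] (rV_coord i \o f)) ->
  measurable_fun [set: T] f.
Proof.
move=> mf; suff : g_sigma_preimage (fun i => rV_coord i \o f) `<=` measurable.
  rewrite g_sigma_preimage_comp => prefS.
  by move=> _ A mA; apply: prefS; exists A.
apply: smallest_sub; first exact: sigma_algebra_measurable.
elim/big_ind : _ => //= [X Y XS YS|i _]; first by rewrite subUset.
by move=> A [B mB <-]; exact: mf.
Qed.

End rV_measurable.

(* Lebesgue measure on R^n, as the n-fold product of Lebesgue measure on R. *)
Section lebesgue_rV.
Context {R : realType}.

Definition rV_cons n (p : R * 'rV[R]_n) : 'rV[R]_n.+1 :=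
  \row_i (if unlift ord0 i is Some j then p.2 ord0 j else p.1).

Definition rV_uncons n (x : 'rV[R]_n.+1) : R * 'rV[R]_n :=
  (x ord0 ord0, \row_j x ord0 (lift ord0 j)).

Lemma rV_consK n : cancel (@rV_cons n) (@rV_uncons n).
Proof.
case=> a v; rewrite /rV_uncons /rV_cons mxE unlift_none; congr pair.
by apply/rowP => j; rewrite !mxE liftK.
Qed.

Lemma measurable_rV_cons n : measurable_fun [set: R * 'rV[R]_n] (@rV_cons n).
Proof.
apply: measurable_fun_rV => i; rewrite /comp /rV_coord.
have [j ij|i0] := unliftP ord0 i.
  rewrite (_ : (fun _ => _) = rV_coord j \o snd).
    exact: measurableT_comp (measurable_rV_coord _) measurable_snd.
  by apply/funext => p; rewrite mxE ij liftK.
rewrite (_ : (fun _ => _) = fst); first exact: measurable_fst.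
by apply/funext => p; rewrite mxE i0 unlift_none.
Qed.

Lemma measurable_rV_uncons n :
  measurable_fun [set: 'rV[R]_n.+1] (@rV_uncons n).
Proof.
apply: measurable_fun_pair; first exact: (measurable_rV_coord ord0).
apply: measurable_fun_rV => j.
rewrite (_ : _ \o _ = rV_coord (lift ord0 j)); first exact: measurable_rV_coord.
by apply/funext => x; rewrite /comp /rV_coord mxE.
Qed.

Section step.
Context (n : nat) (m : {sigma_finite_measure set 'rV[R]_n -> \bar R}).

Let prod_measure :
    {measure set (measurableTypeR R * 'rV[R]_n)%type -> \bar R} :=
  (lebesgue_measure \x m)%E.

Definition lebesgue_rV_step : set 'rV[R]_n.+1 -> \bar R :=
  pushforward (lebesgue_measure \x m)%E (@rV_cons n).

HB.instance Definition _ := Measure.copy lebesgue_rV_step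
  (measure_function_pushforward__canonical__measure_function_Measure
    prod_measure (@measurable_rV_cons n)).

Let lebesgue_rV_step_sigma_finite : sigma_finite setT lebesgue_rV_step.
Proof.
have /sigma_finiteP[F [TF ndF Foo]] := sigma_finiteT (@lebesgue_measure R).
have /sigma_finiteP[G [TG ndG Goo]] := sigma_finiteT m.
exists (fun k => @rV_uncons n @^-1` (F k `*` G k)).
  rewrite -preimage_bigcup (_ : \bigcup_k _ = setT) ?preimage_setT//.
  apply/seteqP; split => // -[x y] _.
  have [k _ Fkx] : (\bigcup_k F k) x by rewrite -TF.
  have [l _ Gly] : (\bigcup_k G k) y by rewrite -TG.
  exists (maxn k l) => //; split.
    by move: x Fkx; exact/subsetPset/ndF/leq_maxl.
  by move: y Gly; exact/subsetPset/ndG/leq_maxr.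
move=> k; have [mF Fk] := Foo k; have [mG Gk] := Goo k; split.
  rewrite -[X in measurable X]setTI; apply: measurable_rV_uncons => //.
  exact: measurableX.
rewrite /lebesgue_rV_step /pushforward -comp_preimage.
rewrite (_ : _ \o _ = id); last by apply/funext => p; exact: rV_consK.
rewrite preimage_id product_measure1E//.
by rewrite lte_mul_pinfty// ge0_fin_numE.
Qed.

HB.instance Definition _ := Measure_isSigmaFinite.Build _ _ _
  lebesgue_rV_step lebesgue_rV_step_sigma_finite.

End step.

Fixpoint lebesgue_rV n : {sigma_finite_measure set 'rV[R]_n -> \bar R} :=
  if n is n'.+1 then lebesgue_rV_step (lebesgue_rV n')
  else dirac (0 : 'rV[R]_0).

End lebesgue_rV.

Section smooth_domains.
Context {R : realType}.

Definition enorm n (x : 'rV[R]_n) : R := Num.sqrt (\sum_i x ord0 i ^+ 2).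

Definition diam n (A : set 'rV[R]_n) : R :=
  sup [set enorm (x - y) | x in A & y in A].

Definition partial n (i : 'I_n) (f : 'rV[R]_n -> R) : 'rV[R]_n -> R :=
  'D_(delta_mx ord0 i) f.

(* C^infinity: every iterated partial derivative (of any order, including
   order 0) is Frechet differentiable everywhere. *)
Definition smooth n (f : 'rV[R]_n -> R) :=
  forall (s : seq 'I_n) (x : 'rV[R]_n),
    differentiable (foldr (@partial n) f s) x.

(* Near each boundary point, and after relabelling (choice of i) and
   reorienting (choice of b) the coordinate axes, Omega is the region above the
   graph of a smooth function of the other n - 1 coordinates. *)
Definition smooth_boundary n (Omega : set 'rV[R]_n) :=
  forall x0, (closure Omega `\` interior Omega) x0 ->
    exists r : R, 0 < r /\
    exists (i : 'I_n) (b : bool) (gamma : 'rV[R]_n.-1 -> R), smooth gamma /\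
      forall x, enorm (x - x0) < r ->
        (Omega x <-> gamma (col' i x) < (-1) ^+ b * x ord0 i).

End smooth_domains.

(* Elements of L^2(Omega) and W^{1,2}(Omega) are represented by real functions
   on R^n; only their values on Omega matter, up to null sets. *)
Section sobolev.
Context {R : realType} {n : nat}.
Local Notation fct := ('rV[R]_n -> R).
Local Notation mu := (@lebesgue_rV R n).
Local Notation I01 := (`[0%R : R, 1%R]%classic).
Implicit Types (Omega : set 'rV[R]_n) (u v phi : fct) (g : 'I_n -> fct).

Definition L2 Omega u := (u \_ Omega) \in Lfun mu 2%:E.

Definition L2norm Omega u : \bar R := 'N[mu]_2%:E[EFin \o (u \_ Omega)].

Definition test_function Omega phi :=
  [/\ smooth phi,
      compact (closure [set x | phi x != 0]) &
      closure [set x | phi x != 0] `<=` Omega].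

Definition weak_partial Omega (i : 'I_n) u v :=
  forall phi, test_function Omega phi ->
    \int[mu]_(x in Omega) (u x * partial i phi x) =
    - \int[mu]_(x in Omega) (v x * phi x).

Definition weak_gradient Omega u g :=
  forall i, L2 Omega (g i) /\ weak_partial Omega i u (g i).

Definition W12 Omega u := L2 Omega u /\ exists g, weak_gradient Omega u g.

(* The weak gradient is unique up to null sets, so the choice made by xget does
   not affect the integrals below; it is used only for u in W^{1,2}(Omega). *)
Definition wgrad Omega u : 'I_n -> fct :=
  xget (fun _ _ => 0) (weak_gradient Omega u).

Definition energy Omega u : \bar R :=
  (\int[mu]_(x in Omega) (\sum_i (wgrad Omega u i x) ^+ 2)%:E)%E.

Definition W12norm Omega u : \bar R :=
  sqrte (L2norm Omega u ^+ 2 + energy Omega u)%E.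

(* W_0^{1,2}(Omega): the W^{1,2}-closure of C_c^infinity(Omega). *)
Definition W012 Omega u :=
  W12 Omega u /\ forall e : R, 0 < e ->
    exists2 phi, test_function Omega phi & (W12norm Omega (u \- phi)%R < e%:E)%E.

Definition S2 Omega : set fct :=
  [set u | W012 Omega u /\ L2norm Omega u = 1%E].

Definition lambda1 Omega : \bar R := ereal_inf [set energy Omega u | u in S2 Omega].

Definition is_first_eigenfunction Omega u :=
  [/\ S2 Omega u, energy Omega u = lambda1 Omega &
      {ae mu, forall x, Omega x -> 0 < u x}].

(* The positive normalized minimizer exists and is unique up to null sets on the
   connected bounded domains considered here; lambda2 does not depend on the
   representative because Gamma fixes endpoints up to null sets. *)
Definition first_eigenfunction Omega : fct :=
  xget (fun=> 0) (is_first_eigenfunction Omega).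

(* Continuous paths in S_2 (for the W^{1,2} norm) from u to v. *)
Definition Gamma Omega u v : set (R -> fct) :=
  [set sigma | [/\ forall t : R, I01 t -> S2 Omega (sigma t),
    forall t : R, I01 t ->
      W12norm Omega (sigma s \- sigma t)
        @[s --> within I01 (nbhs t)] --> 0%E,
    ae_eq mu Omega (sigma 0) u & ae_eq mu Omega (sigma 1) v]].

(* The energy is continuous along sigma and [0, 1] is compact, so the supremum
   is a maximum. *)
Definition lambda2 Omega : \bar R :=
  let u1 := first_eigenfunction Omega in
  ereal_inf [set ereal_sup [set energy Omega (sigma t) | t in I01]
            | sigma in Gamma Omega u1 (\- u1)].

End sobolev.

(* Main.v *)
From HB Require Import structures.
Require Import Defs.
From mathcomp Require Import all_boot all_order all_algebra.
From mathcomp Require Import all_classical all_reals all_analysis.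
From mathcomp Require Import measurable_realfun ring lra zify.

Set Implicit Arguments.
Unset Strict Implicit.
Unset Printing Implicit Defensive.

Import Order.TTheory GRing.Theory Num.Theory.
Import numFieldNormedType.Exports.
Local Open Scope classical_set_scope.
Local Open Scope ring_scope.

(** The proof compares three exponential rates of one discrete heat flow. Fix a small time [eps] and
    let T f be the restriction to Omega of the convolution of f with the Gaussian density
    [gaussp eps], whose coordinates have variance g eps with g = [gvar] ([killed_conv]). Let u be
    the first eigenfunction, d the diameter, and suppose that a path in S_2 from u to -u has energy
    at most Lam, where Lam < lambda_1 + pi^2 / d^2.

    Lower rate: if f is normalized with energy at most Lam, then <f, T f> >= kappa = 1 - g eps Lam /
    2 ([heat_form_S2]). Self-adjointness and Cauchy-Schwarz give <f, T^N f> >= kappa^N when N is a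
    power of 2 ([killed_form_lower]).

    Decay of the positive solution: T^N 1 = O(fac^N), where 1 is the indicator of Omega and fac = 1
    - q^2 g eps lambda_1 / 2 + O(eps^(3/2)), for any q < 1. The reason is a positive supersolution,
    the mollified eigenfunction composed with a homothety of ratio q into Omega ([supersolution],
    [fN_upper]).

    Decay of oscillation: measured against the modulus sin(a r), with a = pi / (2 r0) and r0 > d,
    the quotient T^N f / T^N 1 contracts at each step by theta = 1 - 2 a^2 g eps + O(eps^(3/2))
    ([contraction], [quotient_modulus]). One step is a Gaussian average weighted by T^N 1, whose
    heat regularizations are log-concave by Prekopa-Leindler ([conv_logconcave]). Over a very short
    time, the average at x with a log-concave weight is to leading order the unweighted Gaussian
    average at the proximal point of x ([doob_average]), and the proximal map does not increase
    distances ([prox_nonexpansive]). Reflection coupling then compares the averages at two points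
    ([reflection_coupling]): their distance is driven by twice a one-dimensional Gaussian, so moduli
    evolve under the heat operator [opw]. Under it sin(a r), a Neumann eigenfunction of [-r0, r0],
    decays at rate 2 a^2 g.

    Contradiction: at a fixed point, the value of T^N along the path is continuous and takes
    opposite values at the two ends, so T^N f vanishes there for some f on the path
    ([path_vanishes]). The quotient is then bounded by its oscillation, so T^N f = O((theta fac)^N),
    against <f, T^N f> >= kappa^N ([killed_nonvanishing]). With r0 = d / q the inequality theta fac
    < kappa holds for small eps once Lam < q^2 (lambda_1 + pi^2 / d^2), and q close to 1 achieves
    this ([path_energy_lower]). *)

(** * Integrals of real functions over a whole measure space *)

Section real_integral.
Context d (T : measurableType d) (R : realType) (mu : {measure set T -> \bar R}).
Implicit Types f g h b : T -> R.

Definition intble f := mu.-integrable [set: T] (EFin \o f).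
Definition int f : R := \int[mu]_x f x.

Lemma intble_mfun f : intble f -> measurable_fun [set: T] f.
Proof. by move=> /measurable_int /measurable_EFinP. Qed.

Lemma intble_dom f g : measurable_fun [set: T] f ->
  (forall x, `|f x| <= g x) -> intble g -> intble f.
Proof.
move=> mf fg ig; apply: le_integrable ig => //; first exact/measurable_EFinP.
move=> x _ /=; rewrite lee_fin; apply: le_trans (fg x) _; exact: ler_norm.
Qed.

Lemma intble_norm f : intble f -> intble (fun x => `|f x|).
Proof. exact: integrable_abse. Qed.

Lemma intbleD f g : intble f -> intble g -> intble (fun x => f x + g x).
Proof. by move=> i1 i2; have := integrableD measurableT i1 i2. Qed.

Lemma intbleB f g : intble f -> intble g -> intble (fun x => f x - g x).
Proof. by move=> i1 i2; have := integrableB measurableT i1 i2. Qed.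

Lemma intbleZ k f : intble f -> intble (fun x => k * f x).
Proof. by move=> i; have := integrableZl measurableT k i. Qed.

Lemma intble_mulb b f C : measurable_fun [set: T] b ->
  (forall x, `|b x| <= C) -> intble f -> intble (fun x => b x * f x).
Proof.
move=> mb bC fi; apply: (@intble_dom _ (fun x => C * `|f x|)).
- by apply: measurable_funM => //; exact: intble_mfun.
- by move=> x; rewrite normrM ler_wpM2r.
- exact/intbleZ/intble_norm.
Qed.

Lemma intble0 : intble (fun=> 0).
Proof. exact: integrable0. Qed.

Lemma intble_sum (I : Type) (s : seq I) (F : I -> T -> R) :
  (forall i, intble (F i)) -> intble (fun x => \sum_(i <- s) F i x).
Proof.
move=> Fi; elim: s => [|i s ih].
  by rewrite (_ : (fun _ => _) = fun=> 0)//; [exact: intble0|apply/funext => x; rewrite big_nil].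
rewrite (_ : (fun _ => _) = fun x => F i x + \sum_(j <- s) F j x); first exact: intbleD.
by apply/funext => x; rewrite big_cons.
Qed.

Lemma intD f g : intble f -> intble g ->
  int (fun x => f x + g x) = int f + int g.
Proof. exact: RintegralD. Qed.

Lemma intB f g : intble f -> intble g ->
  int (fun x => f x - g x) = int f - int g.
Proof. exact: RintegralB. Qed.

Lemma intZ k f : intble f -> int (fun x => k * f x) = k * int f.
Proof. exact: RintegralZl. Qed.

Lemma intN f : intble f -> int (fun x => - f x) = - int f.
Proof.
move=> fi; rewrite -mulN1r -intZ//; congr int; apply/funext => x.
by rewrite mulN1r.
Qed.

Lemma int0 : int (fun=> 0) = 0.
Proof. by rewrite /int /Rintegral integral0. Qed.

Lemma int_sum (I : Type) (s : seq I) (F : I -> T -> R) :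
  (forall i, intble (F i)) ->
  int (fun x => \sum_(i <- s) F i x) = \sum_(i <- s) int (F i).
Proof.
move=> Fi; elim: s => [|i s ih].
  by rewrite big_nil -[RHS]int0; congr int; apply/funext => x; rewrite big_nil.
rewrite big_cons -ih -intD//; last exact: intble_sum.
by congr int; apply/funext => x; rewrite big_cons.
Qed.

Lemma int_ge0 f : (forall x, 0 <= f x) -> 0 <= int f.
Proof. by move=> f0; apply: Rintegral_ge0. Qed.

Lemma int_le f g : intble f -> intble g -> (forall x, f x <= g x) ->
  int f <= int g.
Proof. by move=> fi gi fg; apply: le_Rintegral. Qed.

Lemma int_norm f : intble f -> `|int f| <= int (fun x => `|f x|).
Proof. by move=> fi; apply: le_normr_Rintegral. Qed.

Lemma int_norm_le f g : intble f -> intble g -> (forall x, `|f x| <= g x) ->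
  `|int f| <= int g.
Proof.
move=> fi gi fg; apply: le_trans (int_norm fi) _.
by apply: int_le => //; exact: intble_norm.
Qed.

Lemma intE f : intble f -> (int f)%:E = (\int[mu]_x (f x)%:E)%E.
Proof.
by move=> fi; rewrite /int /Rintegral fineK//; apply: integrable_fin_num.
Qed.

Lemma ge0_intbleP f : measurable_fun [set: T] f -> (forall x, 0 <= f x) ->
  intble f <-> (\int[mu]_x (f x)%:E < +oo)%E.
Proof.
move=> mf f0; have h : (\int[mu]_x (f x)%:E = \int[mu]_x `|(f x)%:E|)%E.
  by apply: eq_integral => x _; rewrite gee0_abs ?lee_fin.
split=> [/integrableP[_]|]; first by rewrite h.
by move=> hf; apply/integrableP; split; [exact/measurable_EFinP|rewrite /= -h].
Qed.

Lemma ae_eq_int f g : measurable_fun [set: T] f -> measurable_fun [set: T] g ->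
  {ae mu, forall x, f x = g x} -> int f = int g.
Proof.
move=> mf mg fg; rewrite /int /Rintegral; congr fine.
apply: ae_eq_integral => //; [exact/measurable_EFinP|exact/measurable_EFinP|].
by apply: filterS fg => x /= -> _.
Qed.

(** Integrating the square of s f + t g gives a nonnegative quadratic form in s and t; at s = C, t =
    - B its value is C (A C - B^2). *)
Lemma cauchy_schwarz f g : intble (fun x => f x ^+ 2) ->
  intble (fun x => g x ^+ 2) -> intble (fun x => f x * g x) ->
  int (fun x => f x * g x) ^+ 2 <=
  int (fun x => f x ^+ 2) * int (fun x => g x ^+ 2).
Proof.
move=> f2 g2 fg.
set A := int (fun x => f x ^+ 2); set B := int _; set C := int (fun x => g x ^+ 2).
have A0 : 0 <= A by apply: int_ge0 => x; exact: sqr_ge0.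
have C0 : 0 <= C by apply: int_ge0 => x; exact: sqr_ge0.
have H s t : 0 <= s ^+ 2 * A + 2 * (s * t) * B + t ^+ 2 * C.
  rewrite -!intZ// -!intD//; try (by repeat (apply: intbleD || apply: intbleZ)).
  apply: int_ge0 => x; apply: le_trans (sqr_ge0 (s * f x + t * g x)) _.
  by rewrite le_eqVlt; apply/orP; left; apply/eqP; ring.
have [C0'|Cn] := eqVneq C 0.
  rewrite C0' mulr0; have [->|Bn] := eqVneq B 0; first by rewrite expr0n.
  (* With C = 0 the form is affine in t, and this t gives it the value - A - 2 < 0. *)
  have := H 1 (- (A + 1) / B); rewrite C0'.
  have -> : 1 ^+ 2 * A + 2 * (1 * (- (A + 1) / B)) * B + (- (A + 1) / B) ^+ 2 * 0 = - A - 2.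
    by field.
  lra.
have Cp : 0 < C by rewrite lt_def Cn.
have := H C (- B).
have -> : C ^+ 2 * A + 2 * (C * - B) * B + (- B) ^+ 2 * C = C * (A * C - B ^+ 2) by ring.
by rewrite pmulr_rge0// subr_ge0.
Qed.

End real_integral.

(** * Fubini's theorem for real integrals *)

Section real_fubini.
Context d1 d2 (T1 : measurableType d1) (T2 : measurableType d2) (R : realType).
Context (m1 : {sigma_finite_measure set T1 -> \bar R}).
Context (m2 : {sigma_finite_measure set T2 -> \bar R}).

Lemma intble_prod (f : T1 * T2 -> R) : measurable_fun [set: T1 * T2] f ->
  (\int[m1]_x \int[m2]_y (`|f (x, y)|)%:E < +oo)%E ->
  (m1 \x m2)%E.-integrable setT (EFin \o f).
Proof. by move=> mf ?; apply/integrable12ltyP => //; exact/measurable_EFinP. Qed.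

Lemma int_fubini (f : T1 -> T2 -> R) :
  measurable_fun [set: T1 * T2] (fun z => f z.1 z.2) ->
  (\int[m1]_x \int[m2]_y (`|f x y|)%:E < +oo)%E ->
  (forall x, intble m2 (f x)) -> (forall y, intble m1 (f ^~ y)) ->
  [/\ intble m1 (fun x => int m2 (f x)), intble m2 (fun y => int m1 (f ^~ y)) &
  int m1 (fun x => int m2 (f x)) = int m2 (fun y => int m1 (f ^~ y))].
Proof.
move=> mf fi f1 f2.
have := @intble_prod (fun z => f z.1 z.2) mf fi => fi'.
have E1 x : (\int[m2]_y (f x y)%:E)%E = (int m2 (f x))%:E by rewrite intE.
have E2 y : (\int[m1]_x (f x y)%:E)%E = (int m1 (f ^~ y))%:E by rewrite intE.
have := Fubini fi' => /=.
under eq_integral do rewrite /fubini_F/= E1.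
under [in RHS]eq_integral do rewrite /fubini_G/= E2.
move=> H; split; last by rewrite /int /Rintegral H.
- have := integrable_fubini_F fi'; apply: eq_integrable => // x _ /=.
  by rewrite /fubini_F /= E1.
- apply/integrableP; split.
    have := measurable_fubini_G fi'; rewrite (_ : fubini_G _ _ = (EFin \o (fun y => int m1 (f ^~ y))))//.
    by apply/funext => y; rewrite /fubini_G/= E2.
  apply: (@le_lt_trans _ _ (\int[m2]_y \int[m1]_x (`|f x y|)%:E)%E); last first.
    rewrite -(fubini_tonelli (fun z => (`|f z.1 z.2|)%:E)) => //.
    by apply/measurable_EFinP/measurableT_comp.
  apply: ge0_le_integral => //.
  - apply: measurableT_comp => //; have := measurable_fubini_G fi'; rewrite (_ : fubini_G _ _ = (EFin \o (fun y => int m1 (f ^~ y))))//.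
    by apply/funext => y; rewrite /fubini_G/= E2.
  - have := (@measurable_fun_fubini_tonelli_G _ _ _ _ _ m1 (fun z => (`|f z.1 z.2|)%:E)).
    rewrite /fubini_G /=; apply => //.
    by apply/measurable_EFinP/measurableT_comp.
  - move=> y _ /=; rewrite -intE ?lee_fin; last exact: intble_norm.
    exact: int_norm.
Qed.

Lemma int_fubini_eq (f : T1 -> T2 -> R) (F : T1 -> R) (G : T2 -> R) :
  measurable_fun [set: T1 * T2] (fun z => f z.1 z.2) ->
  (\int[m1]_x \int[m2]_y (`|f x y|)%:E < +oo)%E ->
  (forall x, intble m2 (f x)) -> (forall y, intble m1 (f ^~ y)) ->
  (forall x, int m2 (f x) = F x) -> (forall y, int m1 (f ^~ y) = G y) ->
  [/\ intble m1 F, intble m2 G & int m1 F = int m2 G].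
Proof.
move=> mf fi f1 f2 /funext <- /funext <-; exact: int_fubini.
Qed.

End real_fubini.

(** * Borel measurability on R^n *)

Section rV_borel.
Context {R : realType} {n : nat}.
Implicit Types (U : set 'rV[R]_n) (f : 'rV[R]_n -> R).

Let ratbox (p : 'rV[rat]_n * rat) : set 'rV[R]_n :=
  [set y | forall i, `|y ord0 i - ratr (p.1 ord0 i)| < ratr p.2].

Let measurable_ratbox p : measurable (ratbox p).
Proof.
have -> : ratbox p = \bigcap_(i in [set: 'I_n])
    (@rV_coord R n i @^-1` [set s | `|s - ratr (p.1 ord0 i)| < ratr p.2]).
  by apply/seteqP; split => [y yp i _|y yp i]; [exact: yp|exact: yp].
apply: fin_bigcap_measurable => // i _; rewrite -[X in measurable X]setTI.
apply: measurable_rV_coord => //.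
rewrite (_ : [set s | _] = ball (ratr (p.1 ord0 i) : R) (ratr p.2)).
  exact: measurable_ball.
by apply/seteqP; split => s /=; rewrite /ball/= distrC.
Qed.

(** The sigma-algebra is generated by the coordinates, so openness has to be converted into
    countable operations: an open set is the union of the rational boxes that it contains. *)
Lemma open_measurable_rV U : open U -> measurable U.
Proof.
move=> oU.
have -> : U = \bigcup_p (if pselect (ratbox p `<=` U) then ratbox p else set0).
  apply/seteqP; split => [x Ux|x [p _]]; last first.
    by case: pselect => // pU; exact: pU.
  have /nbhs_ballP[e /= e0 xeU] : nbhs x U by exact: open_nbhs_nbhs.
  have [r] := rat_in_itvoo (divr_gt0 e0 (ltr0n R 2)).
  rewrite in_itv/= => /andP[r0 re].
  have H i : {q : rat | `|x ord0 i - ratr q| < ratr r}.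
    apply: cid; have [q] := @rat_in_itvoo _ (x ord0 i - ratr r) (x ord0 i + ratr r) ltac:(lra).
    by rewrite in_itv/= => qx; exists q; rewrite ltr_norml; lra.
  have sub : ratbox (\row_i sval (H i), r) `<=` U.
    move=> y /= yp; apply: xeU; split => // i j; rewrite (ord1 i) /ball/=.
    have := yp j; rewrite mxE; have := svalP (H j).
    rewrite !ltr_norml; lra.
  exists (\row_i sval (H i), r) => //; case: pselect => //= _ i.
  by rewrite mxE; exact: svalP (H i).
apply: countable_bigcupT_measurable => [|p]; first exact: countableP.
by case: pselect => pU; [exact: measurable_ratbox|exact: measurable0].
Qed.

Lemma continuous_measurable_rV f : continuous f -> measurable_fun setT f.
Proof.
move=> cf; apply: (measurability _ (RGenOpens.measurableE R)).
move=> _ [_ [a [b ->] <-]]; rewrite setTI; apply: open_measurable_rV.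
by move/continuousP : cf; apply; exact: interval_open.
Qed.

Lemma measurable_rVD : measurable_fun setT
  (fun z : 'rV[R]_n * 'rV[R]_n => z.1 + z.2).
Proof.
apply: measurable_fun_rV => i.
rewrite (_ : _ \o _ = (fun z => rV_coord i z.1 + rV_coord i z.2)).
  apply: measurable_funD; apply: measurableT_comp => //;
  exact: measurable_rV_coord.
by apply/funext => z; rewrite /rV_coord /= mxE.
Qed.

Lemma measurable_rVZ (a : R) : measurable_fun setT (fun x : 'rV[R]_n => a *: x).
Proof.
apply: measurable_fun_rV => i.
rewrite (_ : _ \o _ = (fun z => a * rV_coord i z)).
  by apply: measurable_funM => //; exact: measurable_rV_coord.
by apply/funext => z; rewrite /rV_coord /= mxE.
Qed.

End rV_borel.

(** * Lebesgue measure under translations and linear maps *)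

Section lebesgue_invariance.
Context {R : realType}.
Local Open Scope ereal_scope.

(** The image of Lebesgue measure under a translation agrees with it on half-open intervals, hence
    everywhere. *)
Lemma ge0_integral_lebesgueD (a : R) (f : measurableTypeR R -> \bar R) :
  measurable_fun setT f -> (forall x, 0 <= f x) ->
  \int[lebesgue_measure]_x f (x + a)%R = \int[lebesgue_measure]_x f x.
Proof.
move=> mf f0.
have mD : measurable_fun setT (fun x : measurableTypeR R => (x + a)%R : measurableTypeR R).
  exact: measurable_funD.
pose nu := measure_function_pushforward__canonical__measure_function_Measure
  (@lebesgue_measure R) mD.
transitivity (\int[nu]_x f x).
  by rewrite ge0_integral_pushforward//.
apply: (@eq_measure_integral _ (measurableTypeR R) R setT (@lebesgue_measure R) nu) => A mA _; apply/esym.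
apply: lebesgue_measure_unique => // X /ocitvP[->|[[u v]/= uv ->]].
  by rewrite !measure0.
rewrite /= /pushforward.
have -> : (fun x => x + a)%R @^-1` `]u, v]%classic = `](u - a)%R, (v - a)%R]%classic.
  by apply/seteqP; split => x /=; rewrite !in_itv/=; lra.
rewrite !lebesgue_measure_itv/= !lte_fin uv ltrD2r uv -!EFinB.
by congr EFin; ring.
Qed.

Lemma ge0_integral_lebesgue_rVS n (f : 'rV[R]_n.+1 -> \bar R) :
  measurable_fun setT f -> (forall x, 0 <= f x) ->
  \int[lebesgue_rV n.+1]_x f x =
  \int[lebesgue_measure]_s \int[lebesgue_rV n]_z f (rV_cons (s, z)).
Proof.
move=> mf f0.
pose pm : {measure set (measurableTypeR R * 'rV[R]_n)%type -> \bar R} :=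
  (lebesgue_measure \x lebesgue_rV n)%E.
have mc : measurable_fun [set: measurableTypeR R * 'rV[R]_n] (@rV_cons R n).
  exact: measurable_rV_cons.
transitivity (\int[pushforward pm (@rV_cons R n)]_x f x) => //.
rewrite (ge0_integral_pushforward mc)// preimage_setT /pm.
have := (fubini_tonelli1 (m1 := @lebesgue_measure R) (m2 := lebesgue_rV n)
  (f \o @rV_cons R n) (measurableT_comp mf mc)).
by apply => z; exact: f0.
Qed.

(** Induction on the dimension: Tonelli splits off the first coordinate, the induction hypothesis
    absorbs the shift of the others, and the one-dimensional case the shift of the first. *)
Lemma ge0_integral_rVD n (a : 'rV[R]_n) (f : 'rV[R]_n -> \bar R) :
  measurable_fun setT f -> (forall x, 0 <= f x) ->
  \int[lebesgue_rV n]_x f (x + a)%R = \int[lebesgue_rV n]_x f x.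
Proof.
have mD k (b : 'rV[R]_k) : measurable_fun setT (fun x : 'rV[R]_k => x + b)%R.
  have := measurableT_comp (@measurable_rVD R k) (measurable_fun_pair (@measurable_id _ _ setT) (measurable_cst b)).
  exact.
elim: n a f => [|n ih] a f mf f0.
  by apply: eq_integral => x _; congr f; rewrite [LHS]thinmx0 [RHS]thinmx0.
rewrite (ge0_integral_lebesgue_rVS mf)// ge0_integral_lebesgue_rVS//; last first.
  exact: (measurableT_comp mf (mD _ a)).
have E s z : (rV_cons (s, z) + a = rV_cons (s + a ord0 ord0, z + (rV_uncons a).2))%R.
  apply/rowP => i; rewrite !mxE; case: (unliftP ord0 i) => [j ->|->].
    by rewrite ?liftK !mxE.
  by rewrite ?unlift_none.
transitivity (\int[lebesgue_measure]_s \int[lebesgue_rV n]_z f (rV_cons (s + a ord0 ord0, z)%R)).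
  apply: eq_integral => s _; under eq_integral do rewrite E.
  rewrite (ih _ (fun z => f (rV_cons ((s + a ord0 ord0)%R, z))))//.
  apply: measurableT_comp => //; apply: measurableT_comp; first exact: measurable_rV_cons.
  exact: measurable_fun_pair.
rewrite (ge0_integral_lebesgueD _ (f := fun s => \int[lebesgue_rV n]_z f (rV_cons (s, z))))//.
  have mc : measurable_fun [set: measurableTypeR R * 'rV[R]_n] (@rV_cons R n).
    exact: measurable_rV_cons.
  have := @measurable_fun_fubini_tonelli_F _ _ (measurableTypeR R) _ R
    (lebesgue_rV n) (f \o @rV_cons R n) (measurableT_comp mf mc).
  by apply => z; exact: f0.
by move=> s; exact: integral_ge0.
Qed.

Lemma integral_rVD_real n (a : 'rV[R]_n) (f : 'rV[R]_n -> R) :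
  measurable_fun setT f ->
  \int[lebesgue_rV n]_x (f (x + a)%R)%:E = \int[lebesgue_rV n]_x (f x)%:E.
Proof.
move=> mf; have mf' : measurable_fun setT (EFin \o f) by exact/measurable_EFinP.
rewrite integralE [RHS]integralE.
have hp := @ge0_integral_rVD n a (EFin \o f)^\+ (measurable_funepos mf') (fun=> funepos_ge0 _ _).
have hn := @ge0_integral_rVD n a (EFin \o f)^\- (measurable_funeneg mf') (fun=> funeneg_ge0 _ _).
rewrite -hp -hn; congr adde; [|congr oppe]; apply: eq_integral => x _;
  by rewrite ?funeposE ?funenegE.
Qed.

End lebesgue_invariance.

Section linear_change.
Context {R : realType} {n : nat}.
Local Notation E := 'rV[R]_n.
Local Notation mu := (@lebesgue_rV R n).
Local Open Scope ereal_scope.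

(* The usual uniqueness-of-Haar-measure computation, which avoids determinants. *)
Lemma ge0_integral_linear_mul (A B : E -> E) (f g : E -> \bar R) :
  measurable_fun setT A -> measurable_fun setT f -> measurable_fun setT g ->
  (forall x y, A (x + y)%R = A x + A y)%R -> cancel B A ->
  (forall x, 0 <= f x) -> (forall x, 0 <= g x) ->
  (\int[mu]_x f (A x)) * (\int[mu]_x g x) =
  (\int[mu]_x f x) * \int[mu]_x g (- A x)%R.
Proof.
move=> mA mf mg AD BK f0 g0.
have mN : measurable_fun setT (fun x : E => - x)%R.
  by have := @measurable_rVZ R n (-1); under eq_fun do rewrite scaleN1r.
have mfA : measurable_fun setT (fun x => f (A x)) by exact: measurableT_comp.
have mgA : measurable_fun setT (fun x => g (- A x)%R).
  by apply: measurableT_comp => //; exact: measurableT_comp.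
have mp1 : measurable_fun setT (fun z : E * E => A z.1 + z.2)%R.
  apply: (measurableT_comp (@measurable_rVD R n) (g := fun z : E * E => (A z.1, z.2)%R)).
  by apply: measurable_fun_pair => //; exact: measurableT_comp.
have mp2 : measurable_fun setT (fun z : E * E => z.2 - A z.1)%R.
  apply: (measurableT_comp (@measurable_rVD R n) (g := fun z : E * E => (z.2, - A z.1)%R)).
  apply: measurable_fun_pair => //; apply: measurableT_comp => //.
  exact: measurableT_comp.
transitivity (\int[mu]_y \int[mu]_x (g y * f (A x + y)%R)).
  rewrite -ge0_integralZl//; last exact: integral_ge0.
  apply: eq_integral => y _; rewrite muleC -ge0_integralZl//.
  rewrite -(ge0_integral_rVD (B y) (f := fun x => g y * f (A x))).
  - by apply: eq_integral => x _; rewrite AD BK.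
  - exact: measurable_funeM.
  - by move=> x; rewrite mule_ge0.
have mF : measurable_fun setT (fun z : E * E => g z.2 * f (A z.1 + z.2)%R).
  apply: emeasurable_funM; first exact: measurableT_comp.
  exact: (measurableT_comp mf).
rewrite -(fubini_tonelli (m1 := mu) (m2 := mu) _ mF); last first.
  by move=> z; rewrite mule_ge0.
transitivity (\int[mu]_x \int[mu]_y (f y * g (y - A x)%R)).
  apply: eq_integral => x _ /=.
  rewrite -[RHS](ge0_integral_rVD (A x)).
  - by apply: eq_integral => y _; rewrite addrK addrC muleC.
  - apply: emeasurable_funM => //; apply: measurableT_comp => //.
    apply: (measurableT_comp (@measurable_rVD R n) (g := fun z : E => (z, - A x)%R)).
    exact: measurable_fun_pair.
  - by move=> y; rewrite mule_ge0.
have mG : measurable_fun setT (fun z : E * E => f z.2 * g (z.2 - A z.1)%R).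
  apply: emeasurable_funM; first exact: measurableT_comp.
  exact: (measurableT_comp mg).
rewrite (fubini_tonelli (m1 := mu) (m2 := mu) _ mG); last first.
  by move=> z; rewrite mule_ge0.
rewrite muleC -ge0_integralZl//; last exact: integral_ge0.
apply: eq_integral => y _ /=; rewrite muleC -ge0_integralZl//.
rewrite -[LHS](ge0_integral_rVD (B y)).
- apply: eq_integral => x _; congr (_ * g _).
  by rewrite AD BK opprD addrCA subrr addr0.
- apply: measurable_funeM; apply: measurableT_comp => //.
  apply: (measurableT_comp (@measurable_rVD R n) (g := fun z : E => (y, - A z)%R)).
  by apply: measurable_fun_pair => //; exact: measurableT_comp.
- by move=> x; rewrite mule_ge0.
Qed.

End linear_change.

(** * Volume of cubes *)

Section boxes.
Context {R : realType}.
Local Open Scope ereal_scope.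

Definition cube n (L : R) : set 'rV[R]_n := [set x | forall i, (`|x ord0 i| <= L)%R].
Arguments cube : clear implicits.

Lemma measurable_cube n (L : R) : measurable (cube n L).
Proof.
have -> : cube n L = \bigcap_(i in [set: 'I_n])
    (@rV_coord R n i @^-1` `[(- L)%R, L]%classic).
  apply/seteqP; split => [y yp i _|y yp i]; last first.
    by have := yp i I; rewrite /= in_itv/= ler_norml.
  by rewrite /= in_itv/= -ler_norml; exact: yp.
apply: fin_bigcap_measurable => // i _; rewrite -[X in measurable X]setTI.
by apply: measurable_rV_coord => //; exact: measurable_itv.
Qed.

Lemma lebesgue_cube n (L : R) : (0 <= L)%R ->
  lebesgue_rV n (cube n L) = ((2 * L) ^+ n)%:E.
Proof.
move=> L0; elim: n => [|n ih].
  rewrite /= diracE expr0 mem_set//; by case.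
rewrite -[cube n.+1 L]setIT -integral_indic//; last exact: measurable_cube.
rewrite ge0_integral_lebesgue_rVS/=; last 2 first.
  by apply/measurable_EFinP; apply: measurable_indic; exact: measurable_cube.
  by move=> x; rewrite lee_fin.
transitivity (\int[lebesgue_measure]_s
   (((2 * L) ^+ n)%:E * (\1_(`[(- L)%R, L]%classic : set R) s)%:E)).
  apply: eq_integral => s _.
  transitivity (\int[lebesgue_rV n]_z ((\1_(`[(- L)%R, L]%classic : set R) s)%:E * (\1_(cube n L) z)%:E)).
    apply: eq_integral => z _; rewrite !indicE -EFinM -natrM mulnb.
    suff -> : (rV_cons (s, z) \in cube n.+1 L) = (s \in (`[(- L)%R, L]%classic : set R)) && (z \in cube n L).
      by [].
    apply/idP/idP.
      rewrite inE => h; apply/andP; split; rewrite inE.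
        by have := h ord0; rewrite mxE unlift_none/= in_itv/= ler_norml.
      by move=> i; have := h (lift ord0 i); rewrite mxE liftK.
    move=> /andP[/set_mem h1 /set_mem h2]; apply/mem_set => i; rewrite mxE.
    case: (unliftP ord0 i) => [j _|_]; first exact: h2.
    by move: h1; rewrite /= in_itv/= ler_norml.
  rewrite ge0_integralZl//; last first.
    by apply/measurable_EFinP; apply: measurable_indic; exact: (@measurable_cube n L).
  rewrite integral_indic//; last exact: measurable_cube.
  by rewrite setIT muleC; congr mule; exact: ih.
have mI : measurable_fun [set: measurableTypeR R]
    (fun x => (\1_(`[(- L)%R, L]%classic : set R) x : R)%:E).
  by apply/measurable_EFinP; apply: measurable_indic; exact: measurable_itv.
rewrite (ge0_integralZl _ measurableT mI)//; last first.
  by rewrite lee_fin exprn_ge0// mulr_ge0.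
transitivity (((2 * L) ^+ n)%:E * (2 * L)%:E); last by rewrite -EFinM exprSr.
congr mule; rewrite integral_indic// setIT.
transitivity (@lebesgue_measure R `[(- L)%R, L]%classic) => //.
rewrite lebesgue_measure_itv/= lte_fin; case: ifPn => h.
  by rewrite -EFinB; congr EFin; ring.
have -> : L = 0%R by move: h; rewrite -leNgt; lra.
by rewrite mulr0.
Qed.

End boxes.
Arguments cube {R} n L _.

(** * Euclidean inner product, norm and reflections *)

Section euclid.
Context {R : realType} {n : nat}.
Local Notation E := 'rV[R]_n.
Implicit Types x y z : E.

Definition dot x y : R := \sum_i x ord0 i * y ord0 i.
Definition sqn x : R := \sum_i x ord0 i ^+ 2.

Lemma sqnE x : sqn x = dot x x.
Proof. by apply: eq_bigr => i _; rewrite expr2. Qed.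

Lemma dotC x y : dot x y = dot y x.
Proof. by apply: eq_bigr => i _; rewrite mulrC. Qed.

Lemma dotDl x y z : dot (x + y) z = dot x z + dot y z.
Proof. by rewrite /dot -big_split; apply: eq_bigr => i _; rewrite mxE mulrDl. Qed.

Lemma dotDr x y z : dot z (x + y) = dot z x + dot z y.
Proof. by rewrite dotC dotDl !(dotC _ z). Qed.

Lemma dotZl a x y : dot (a *: x) y = a * dot x y.
Proof. by rewrite /dot mulr_sumr; apply: eq_bigr => i _; rewrite mxE mulrA. Qed.

Lemma dotZr a x y : dot y (a *: x) = a * dot y x.
Proof. by rewrite dotC dotZl dotC. Qed.

Lemma dotNl x y : dot (- x) y = - dot x y.
Proof. by rewrite -scaleN1r dotZl mulN1r. Qed.

Lemma dotNr x y : dot y (- x) = - dot y x.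
Proof. by rewrite -scaleN1r dotZr mulN1r. Qed.

Lemma sqn_ge0 x : 0 <= sqn x.
Proof. by apply: sumr_ge0 => i _; exact: sqr_ge0. Qed.

Lemma sqnD x y : sqn (x + y) = sqn x + 2 * dot x y + sqn y.
Proof. by rewrite !sqnE dotDl !dotDr (dotC y x); ring. Qed.

Lemma sqnB x y : sqn (x - y) = sqn x - 2 * dot x y + sqn y.
Proof. by rewrite !sqnE dotDl !dotDr !dotNl !dotNr (dotC y x); ring. Qed.

Lemma sqnN x : sqn (- x) = sqn x.
Proof. by rewrite !sqnE dotNl dotNr opprK. Qed.

Lemma sqnZ a x : sqn (a *: x) = a ^+ 2 * sqn x.
Proof. by rewrite !sqnE dotZl dotZr; ring. Qed.

Lemma sqn_eq0 x : (sqn x == 0) = (x == 0).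
Proof.
apply/eqP/eqP => [/eqP|->]; last first.
  by rewrite /sqn big1// => i _; rewrite mxE expr0n.
rewrite psumr_eq0 => [/allP h|i _]; last exact: sqr_ge0.
apply/rowP => i; rewrite mxE; have := h i (mem_index_enum i).
by rewrite /= sqrf_eq0 => /eqP.
Qed.

Lemma enormE x : enorm x = Num.sqrt (sqn x). Proof. by []. Qed.

Lemma enorm_ge0 x : 0 <= enorm x. Proof. exact: sqrtr_ge0. Qed.

Lemma sqr_enorm x : enorm x ^+ 2 = sqn x.
Proof. by rewrite sqr_sqrtr// sqn_ge0. Qed.

Lemma enormN x : enorm (- x) = enorm x. Proof. by rewrite !enormE sqnN. Qed.

Lemma enormBC x y : enorm (x - y) = enorm (y - x).
Proof. by rewrite -enormN opprB. Qed.

Lemma enormZ a x : enorm (a *: x) = `|a| * enorm x.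
Proof. by rewrite !enormE sqnZ sqrtrM ?sqr_ge0// sqrtr_sqr. Qed.

Lemma enorm0 : enorm (0 : E) = 0.
Proof. by rewrite -(scale0r (0 : E)) enormZ normr0 mul0r. Qed.

Lemma enorm_eq0 x : (enorm x == 0) = (x == 0).
Proof. by rewrite -sqn_eq0 -sqr_enorm sqrf_eq0. Qed.

(** Nonnegativity of the squared norm of |x|^2 y - (x.y) x. *)
Lemma sqr_dot_le x y : dot x y ^+ 2 <= sqn x * sqn y.
Proof.
have [->|x0] := eqVneq x 0.
  by rewrite -(scale0r (0 : E)) dotZl mul0r expr0n mulr_ge0// sqn_ge0.
have sx : 0 < sqn x by rewrite lt_def sqn_eq0 x0 sqn_ge0.
have := sqn_ge0 (sqn x *: y - dot x y *: x).
rewrite sqnB !sqnZ dotZl dotZr (dotC y x).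
have -> : sqn x ^+ 2 * sqn y - 2 * (sqn x * (dot x y * dot x y)) + dot x y ^+ 2 * sqn x
   = sqn x * (sqn x * sqn y - dot x y ^+ 2) by ring.
by rewrite pmulr_rge0// subr_ge0.
Qed.

Lemma dot_le x y : `|dot x y| <= enorm x * enorm y.
Proof.
rewrite -(@ler_pXn2r _ 2)// ?nnegrE ?mulr_ge0 ?enorm_ge0//.
by rewrite real_normK ?num_real// exprMn !sqr_enorm sqr_dot_le.
Qed.

Lemma enorm_triangle x y : enorm (x + y) <= enorm x + enorm y.
Proof.
rewrite -(@ler_pXn2r _ 2)// ?nnegrE ?addr_ge0 ?enorm_ge0//.
rewrite sqr_enorm sqnD sqrrD !sqr_enorm lerD2r lerD2l.
rewrite mulr2n mulrDl mul1r; have := dot_le x y; have := ler_norm (dot x y).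
lra.
Qed.

Lemma enorm_dist x y : `|enorm x - enorm y| <= enorm (x - y).
Proof.
have := enorm_triangle (x - y) y; have := enorm_triangle (y - x) x.
by rewrite !subrK (enormBC y x) ler_norml; lra.
Qed.

Lemma coord_le_enorm x i : `|x ord0 i| <= enorm x.
Proof.
rewrite -(@ler_pXn2r _ 2)// ?nnegrE ?enorm_ge0//.
rewrite real_normK ?num_real// sqr_enorm /sqn (bigD1 i)//= lerDl.
by apply: sumr_ge0 => j _; exact: sqr_ge0.
Qed.

Lemma enorm_le_cube x L : 0 <= L -> cube n L x -> enorm x <= n%:R * L.
Proof.
move=> L0 h; rewrite -(@ler_pXn2r _ 2)// ?nnegrE ?mulr_ge0 ?enorm_ge0//.
rewrite sqr_enorm; apply: (@le_trans _ _ (\sum_(i < n) L ^+ 2)).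
  apply: ler_sum => i _; rewrite -real_normK ?num_real//.
  by rewrite ler_pXn2r ?nnegrE.
rewrite sumr_const card_ord -[_ *+ _]mulr_natl exprMn ler_wpM2r ?sqr_ge0//.
rewrite -natrX ler_nat; case: (n) => // k; exact: leq_pmulr.
Qed.

Lemma measurable_dotl x : measurable_fun [set: E] (dot x).
Proof.
apply: measurable_sum => i; apply: measurable_funM => //.
exact: measurable_rV_coord.
Qed.

Lemma measurable_sqn : measurable_fun [set: E] sqn.
Proof.
apply: measurable_sum => i; apply: measurable_funX.
exact: measurable_rV_coord.
Qed.

Lemma measurable_enorm : measurable_fun [set: E] (@enorm R n).
Proof.
apply: (measurableT_comp (f := @Num.sqrt R)); last exact: measurable_sqn.
by apply: continuous_measurable_fun; exact: sqrt_continuous.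
Qed.

(* Reflection in the hyperplane orthogonal to [v]. *)
Definition householder (v x : E) : E := x - (2 * dot x v / sqn v) *: v.

Lemma householderD v x y : householder v (x + y) = householder v x + householder v y.
Proof.
rewrite /householder dotDl mulrDr mulrDl scalerDl opprD addrACA; congr (_ + _).
Qed.

Lemma sqn_householder v x : sqn (householder v x) = sqn x.
Proof.
rewrite /householder sqnB dotZr sqnZ.
have [v0|v0] := eqVneq (sqn v) 0; first by rewrite v0 invr0; ring.
by field.
Qed.

Lemma householderK v : v != 0 -> cancel (householder v) (householder v).
Proof.
move=> v0 x; rewrite /householder dotDl dotNl dotZl -sqnE.
have sv : sqn v != 0 by rewrite sqn_eq0.
rewrite -addrA -opprD -scalerDl.
have -> : 2 * dot x v / sqn v + 2 * (dot x v - 2 * dot x v / sqn v * sqn v) / sqn v = 0.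
  by field.
by rewrite scale0r subr0.
Qed.

Lemma measurable_householder v : measurable_fun setT (householder v).
Proof.
apply: measurable_fun_rV => i.
rewrite (_ : _ \o _ = (fun x => rV_coord i x - 2 * dot v x / sqn v * v ord0 i)).
  apply: measurable_funB; first exact: measurable_rV_coord.
  apply: measurable_funM => //; apply: measurable_funM => //.
  by apply: measurable_funM => //; exact: measurable_dotl.
by apply/funext => x; rewrite /comp /rV_coord !mxE dotC.
Qed.

End euclid.

Lemma continuous_sumr (R : realType) (T : topologicalType) (I : Type)
  (s : seq I) (F : I -> T -> R) : (forall i, continuous (F i)) ->
  continuous (fun x => \sum_(i <- s) F i x).
Proof.
move=> cF; elim: s => [|i s ih].
  by rewrite (_ : (fun _ => _) = cst 0); [exact: cst_continuous|apply/funext => x; rewrite big_nil].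
rewrite (_ : (fun _ => _) = (fun x => F i x + \sum_(j <- s) F j x)).
  by move=> x; apply: cvgD; [exact: cF|exact: ih].
by apply/funext => x; rewrite big_cons.
Qed.

(** * Changes of variables with an abstract Jacobian factor *)

Section change_real.
Context {R : realType} {n : nat}.
Local Notation E := 'rV[R]_n.
Local Notation mu := (@lebesgue_rV R n).
Implicit Types f : E -> R.

(** For the affine maps considered, [k] is the inverse of the absolute determinant, carried as an
    abstract constant. Integrable functions reduce to nonnegative integrands by splitting into
    positive and negative parts. *)
Definition rescales (k : R) (A : E -> E) := measurable_fun [set: E] A /\
  forall f, measurable_fun [set: E] f -> (forall x, 0 <= f x) ->
  (\int[mu]_x (f (A x))%:E = k%:E * \int[mu]_x (f x)%:E)%E.

Lemma rescales_intble k A f : 0 <= k -> rescales k A ->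
  intble mu f -> intble mu (fun x => f (A x)).
Proof.
move=> k0 [mA kA] fi; have mf := intble_mfun fi.
apply/integrableP; split; first by apply/measurable_EFinP; exact: measurableT_comp.
have /integrableP[_ /= H] := fi.
rewrite (kA (fun x => `|f x|))//; last exact: measurableT_comp.
by rewrite lte_mul_pinfty// lee_fin.
Qed.

Lemma rescales_int k A f : 0 <= k -> rescales k A ->
  intble mu f -> int mu (fun x => f (A x)) = k * int mu f.
Proof.
move=> k0 kA fi; have mf := intble_mfun fi.
pose p x := Num.max (f x) 0; pose q x := Num.max (- f x) 0.
have pq x : f x = p x - q x by rewrite /p /q; case: (leP (f x)); case: (leP (- f x)); lra.
have mp : measurable_fun setT p by apply: measurable_maxr.
have mq : measurable_fun setT q.
  by apply: measurable_maxr => //; exact: measurableT_comp.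
have p0 x : 0 <= p x by rewrite le_max lexx orbT.
have q0 x : 0 <= q x by rewrite le_max lexx orbT.
have ip : intble mu p.
  apply: (intble_dom mp _ (intble_norm fi)) => x; rewrite ger0_norm// /p ge_max normr_ge0.
  by rewrite ler_norm.
have iq : intble mu q.
  apply: (intble_dom mq _ (intble_norm fi)) => x; rewrite ger0_norm// /q ge_max normr_ge0.
  by rewrite -normrN ler_norm.
have H (g : E -> R) : measurable_fun setT g -> (forall x, 0 <= g x) -> intble mu g ->
    int mu (fun x => g (A x)) = k * int mu g.
  move=> mg g0 gi; apply: EFin_inj; rewrite intE; last exact: (rescales_intble k0 kA gi).
  by rewrite EFinM intE//; case: kA => _; exact.
transitivity (int mu (fun x => p (A x) - q (A x))).
  by congr int; apply/funext => x; rewrite -pq.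
rewrite intB ?H//; try exact: (rescales_intble k0 kA).
by rewrite -mulrBr -intB//; congr (k * int mu _); apply/funext => x; rewrite -pq.
Qed.

Lemma rescales_shift a : rescales 1 (fun x : E => x + a).
Proof.
split.
  have := measurableT_comp (@measurable_rVD R n) (measurable_fun_pair (@measurable_id _ _ setT) (measurable_cst a)).
  exact.
by move=> f mf f0; rewrite mul1e integral_rVD_real.
Qed.

Lemma intble_shift a f : intble mu f -> intble mu (fun x => f (x + a)).
Proof. by apply: rescales_intble (rescales_shift a). Qed.

Lemma int_shift a f : intble mu f -> int mu (fun x => f (x + a)) = int mu f.
Proof. by move=> fi; rewrite (rescales_int _ (rescales_shift a))// mul1r. Qed.

Lemma lebesgue_cube_sub (D : set E) L : 0 <= L -> measurable D ->
  D `<=` cube n L -> (mu D < +oo)%E.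
Proof.
move=> L0 mD DL; apply: (@le_lt_trans _ _ (mu (cube n L))).
  apply: le_measure => //; rewrite inE//; exact: measurable_cube.
by rewrite (lebesgue_cube _ L0)// ltry.
Qed.

Lemma open_rV_gt0 (D : set E) : open D -> D !=set0 -> (0 < mu D)%E.
Proof.
move=> oD [x Dx].
have /nbhs_ballP[e /= e0 xD] : nbhs x D by exact: open_nbhs_nbhs.
have L0 : 0 < e / 2 by rewrite divr_gt0.
have mS : measurable [set y : E | cube n (e / 2) (y - x)].
  rewrite (_ : [set _ | _] = (fun y => y + (- x)) @^-1` cube n (e / 2))//.
  rewrite -[X in measurable X]setTI; apply: (rescales_shift (- x)).1 => //.
  exact: measurable_cube.
apply: (@lt_le_trans _ _ (mu [set y | cube n (e / 2) (y - x)])).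
  rewrite -[X in mu X]setIT -integral_indic//.
  have E1 : (\int[mu]_y (\1_(cube n (e / 2)) y)%:E = ((2 * (e / 2)) ^+ n)%:E)%E.
    rewrite integral_indic//; last exact: measurable_cube.
    by rewrite setIT; exact: lebesgue_cube (ltW L0).
  have := @integral_rVD_real R n (- x) (\1_(cube n (e / 2))).
  rewrite E1 (_ : (fun y => _) = (fun y => (\1_[set y | cube n (e / 2) (y - x)] y)%:E)).
    move=> ->; last by apply: measurable_indic; exact: measurable_cube.
    by rewrite lte_fin exprn_gt0// mulr_gt0.
  by apply/funext => y; congr (_%:E); rewrite !indicE; congr ((_ : bool)%:R); apply/idP/idP; rewrite !inE.
apply: le_measure; rewrite ?inE//; first exact: open_measurable_rV.
move=> y yx; apply: xD; split => // i j; rewrite (ord1 i) /ball/= distrC.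
by have := yx j; rewrite !mxE; lra.
Qed.

Lemma open_sqn_lt (r : R) : open [set x : E | sqn x < r].
Proof.
rewrite (_ : [set _ | _] = sqn @^-1` [set x | x < r])//.
apply: open_comp; last exact: open_lt.
move=> x _; apply: continuous_sumr => i {}x.
apply: (@continuous_comp _ _ _ (fun x : E => x ord0 i) (fun s => s ^+ 2)).
  exact: coord_continuous.
exact: exprn_continuous.
Qed.

Lemma sqn_lt_neq0 (r : R) : 0 < r -> [set x : E | sqn x < r] !=set0.
Proof. by exists 0; rewrite /= /sqn big1// => i _; rewrite mxE expr0n. Qed.

(** Test body for the Haar identity [ge0_integral_linear_mul]: of finite positive measure and
    preserved by linear isometries. *)
Let unitball : set E := [set x | sqn x <= 1].

Let measurable_unitball : measurable unitball.
Proof.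
rewrite (_ : unitball = sqn @^-1` `]-oo, 1]%classic).
  by rewrite -[X in measurable X]setTI; apply: measurable_sqn => //; exact: measurable_itv.
by apply/seteqP; split => x; rewrite /= in_itv.
Qed.

Let unitball_fin : (mu unitball < +oo)%E.
Proof.
apply: (@lebesgue_cube_sub _ 1) => // x xb i.
apply: le_trans (coord_le_enorm x i) _.
by rewrite -(@ler_pXn2r _ 2)// ?nnegrE ?enorm_ge0// sqr_enorm expr1n.
Qed.

Let unitball_gt0 : (0 < mu unitball)%E.
Proof.
apply: (@lt_le_trans _ _ (mu [set x : E | sqn x < 1])); last first.
  apply: le_measure; rewrite ?inE//; last by move=> x /= /ltW.
  rewrite (_ : [set _ | _] = sqn @^-1` `]-oo, 1[%classic).
    by rewrite -[X in measurable X]setTI; apply: measurable_sqn => //; exact: measurable_itv.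
  by apply/seteqP; split => x; rewrite /= in_itv.
by apply: open_rV_gt0; [exact: open_sqn_lt|exact: sqn_lt_neq0].
Qed.

(** In the Haar identity with the indicator of the unit ball, the reflection preserves the ball, so
    both sides carry the same finite positive factor, which cancels. *)
Lemma rescales_householder v : v != 0 -> rescales 1 (@householder R n v).
Proof.
move=> v0; split; first exact: measurable_householder.
move=> f mf f0; rewrite mul1e.
have mb : measurable_fun setT (EFin \o (\1_unitball : E -> R)).
  by apply/measurable_EFinP; exact: measurable_indic.
have H := @ge0_integral_linear_mul R n (householder v) (householder v)
  (EFin \o f) (EFin \o (\1_unitball : E -> R)) (measurable_householder v)
  (proj2 (measurable_EFinP _ _) mf) mb (householderD v) (householderK v0) f0
  (fun x => ler0n _ _).
have E1 : (\int[mu]_x (EFin \o (\1_unitball : E -> R)) (- householder v x)%R = mu unitball)%E.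
  rewrite -[in RHS](setIT unitball) -integral_indic//; apply: eq_integral => x _.
  rewrite /= !indicE; congr ((_ : bool)%:R%:E).
  by apply/idP/idP; rewrite !inE /unitball /= sqnN sqn_householder.
have E2 : (\int[mu]_x (EFin \o (\1_unitball : E -> R)) x = mu unitball)%E.
  by rewrite -[in RHS](setIT unitball) -integral_indic.
move: H; rewrite E1 E2 => H.
have fu : mu unitball \is a fin_num by rewrite ge0_fin_numE.
by apply/eqP; rewrite eq_le -(lee_pmul2r fu)// H lexx -(lee_pmul2r fu)// H lexx.
Qed.

(** Same identity as for reflections; the multiplier is now the ratio of the volume of [D], the
    preimage of the unit ball, to that of the ball. *)
Lemma rescales_scale c : c != 0 -> exists2 k, 0 < k & rescales k (fun x : E => c *: x).
Proof.
move=> c0; pose D : set E := [set x | sqn (c *: x) <= 1].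
have DE : D = (fun x : E => c *: x) @^-1` unitball by [].
have mD : measurable D.
  by rewrite DE -[X in measurable X]setTI; exact: measurable_rVZ.
have Dfin : (mu D < +oo)%E.
  apply: (@lebesgue_cube_sub _ `|c|^-1) => // x xD i.
  rewrite -(@ler_pM2l _ `|c|) ?normr_gt0// mulfV ?normr_eq0// -normrM.
  have := coord_le_enorm (c *: x) i; rewrite mxE => /le_trans; apply.
  by rewrite -(@ler_pXn2r _ 2)// ?nnegrE ?enorm_ge0// sqr_enorm expr1n.
have fu : mu unitball \is a fin_num by rewrite ge0_fin_numE.
have mb : measurable_fun setT (EFin \o (\1_unitball : E -> R)).
  by apply/measurable_EFinP; exact: measurable_indic.
have BK : cancel (fun x : E => c^-1 *: x) (fun x => c *: x).
  by move=> x; rewrite scalerA divff// scale1r.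
pose k := fine (mu D) / fine (mu unitball).
have kE f : measurable_fun setT f -> (forall x, 0 <= f x) ->
    (\int[mu]_x (f (c *: x))%:E = k%:E * \int[mu]_x (f x)%:E)%E.
  move=> mf f0.
  have := @ge0_integral_linear_mul R n (fun x => c *: x) (fun x => c^-1 *: x)
    (EFin \o f) (EFin \o (\1_unitball : E -> R)) (@measurable_rVZ R n c)
    (proj2 (measurable_EFinP _ _) mf) mb (scalerDr c) BK f0
    (fun x => ler0n _ _).
  have -> : (\int[mu]_x (EFin \o (\1_unitball : E -> R)) (- (c *: x))%R = mu D)%E.
    rewrite -[in RHS](setIT D) -integral_indic//; apply: eq_integral => x _.
    rewrite /= !indicE; congr ((_ : bool)%:R%:E).
    by apply/idP/idP; rewrite !inE /unitball /D /= sqnN.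
  have -> : (\int[mu]_x (EFin \o (\1_unitball : E -> R)) x = mu unitball)%E.
    by rewrite -[in RHS](setIT unitball) -integral_indic.
  move=> H; apply/eqP.
  have H2 : (k%:E * mu unitball = mu D)%E.
    rewrite -(fineK fu) -EFinM /k divfK ?fineK// ?ge0_fin_numE//.
    by rewrite gt_eqF// fine_gt0// unitball_gt0 unitball_fin.
  rewrite eq_le -(lee_pmul2r fu)// [X in _ && X]( _ : _ = (k%:E * (\int[mu]_x (f x)%:E) * mu unitball <= \int[mu]_x (f (c *: x))%:E * mu unitball)%E); last by rewrite lee_pmul2r.
  by rewrite H muleAC H2 muleC lexx.
have D0 : (0 < mu D)%E.
  apply: (@lt_le_trans _ _ (mu [set x : E | sqn x < c ^- 2])).
    apply: open_rV_gt0; first exact: open_sqn_lt.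
    by apply: sqn_lt_neq0; rewrite invr_gt0 exprn_even_gt0//= c0.
  apply: le_measure; rewrite ?inE//; first by apply: open_measurable_rV; exact: open_sqn_lt.
  move=> x /= xc; rewrite /D /= sqnZ -(@ler_pM2l _ (c ^- 2)); last first.
    by rewrite invr_gt0 exprn_even_gt0//= c0.
  by rewrite mulKf ?expf_neq0// mulr1 ltW.
exists k; last by split => //; exact: measurable_rVZ.
apply: divr_gt0; apply: fine_gt0; first by rewrite D0 Dfin.
by apply/andP; split; [exact: unitball_gt0|exact: unitball_fin].
Qed.

End change_real.

(** * Gaussian densities *)

Section gaussian.
Context {R : realType} {n : nat}.
Local Notation E := 'rV[R]_n.
Local Notation mu := (@lebesgue_rV R n).
Implicit Types (f g b : E -> R) (t : R).

Lemma intble_expR_sqn k : intble (@lebesgue_rV R k) (fun x => expR (- sqn x)).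
Proof.
have mf j : measurable_fun setT (fun x : 'rV[R]_j => expR (- sqn x)).
  apply: measurableT_comp => //; apply: measurableT_comp => //.
  exact: measurable_sqn.
apply: (proj2 (ge0_intbleP _ (mf k) _)); first by move=> x; exact: expR_ge0.
elim: k => [|k ih].
  have mf0 := proj2 (measurable_EFinP _ _) (mf 0%N).
  rewrite -[X in (X < _)%E]/(\int[dirac (0%R : 'rV[R]_0)]_x (expR (- sqn x))%:E)%E.
  by rewrite integral_dirac// diracT mul1e ltry.
rewrite ge0_integral_lebesgue_rVS; last 2 first.
- by apply/measurable_EFinP; exact: mf.
- by move=> x; rewrite lee_fin expR_ge0.
set c := (\int[_]_x _)%E in ih.
have c0 : (0 <= c)%E by apply: integral_ge0 => x _; rewrite lee_fin expR_ge0.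
have cf : c \is a fin_num by rewrite ge0_fin_numE.
have -> : (\int[lebesgue_measure]_s \int[lebesgue_rV k]_z (expR (- sqn (rV_cons (s, z))))%:E =
    \int[lebesgue_measure]_s ((fine c)%:E * (gauss_fun s)%:E))%E.
  apply: eq_integral => s _.
  transitivity (\int[lebesgue_rV k]_z ((gauss_fun s)%:E * (expR (- sqn z))%:E))%E.
    apply: eq_integral => z _; rewrite -EFinM /gauss_fun -expRD.
    rewrite /sqn big_ord_recl mxE unlift_none /= opprD; congr (expR (_ - _))%:E.
    by apply: eq_bigr => i _; rewrite mxE liftK.
  rewrite ge0_integralZl//.
  - by rewrite muleC fineK.
  - by apply/measurable_EFinP; exact: mf.
  - by rewrite lee_fin expR_ge0.
rewrite integralZl//; last exact: integrableT_gauss.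
by rewrite integralT_gauss -EFinM ltry.
Qed.

(** Up to normalization, the kernel of exp(t Laplacian / 2). The normalizing constant [gsZ] stays an
    integral and enters only as a positive number. *)
Definition gs t (x : E) : R := expR (- (sqn x / (2 * t))).
Definition gsZ t : R := int mu (gs t).
Definition gaussp t x : R := gs t x / gsZ t.
Definition Ex t f : R := int mu (fun y => gaussp t y * f y).

Lemma gs_gt0 t x : 0 < gs t x. Proof. exact: expR_gt0. Qed.

Lemma measurable_gs t : measurable_fun setT (gs t).
Proof.
apply: measurableT_comp => //; apply: measurableT_comp => //.
by apply: measurable_funM => //; exact: measurable_sqn.
Qed.

Lemma gs_scale t s x : 0 < t -> 0 < s -> gs (s * t) (Num.sqrt s *: x) = gs t x.
Proof.
move=> t0 s0; rewrite /gs sqnZ sqr_sqrtr ?ltW//; congr (expR (- _)).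
by field; rewrite !gt_eqF.
Qed.

Lemma intble_gs t : 0 < t -> intble mu (gs t).
Proof.
move=> t0.
have c0 : 0 < Num.sqrt (2 * t)^-1 by rewrite sqrtr_gt0 invr_gt0 mulr_gt0.
have [k k0 kE] := @rescales_scale R n (Num.sqrt (2 * t)^-1) (lt0r_neq0 c0).
have := rescales_intble (ltW k0) kE (intble_expR_sqn n).
rewrite (_ : (fun x => _) = gs t)//; apply/funext => x.
by rewrite sqnZ sqr_sqrtr ?ltW ?invr_gt0 ?mulr_gt0// mulrC.
Qed.

Lemma gsZ_gt0 t : 0 < t -> 0 < gsZ t.
Proof.
move=> t0; rewrite lt_def int_ge0 ?andbT; last by move=> x; exact/ltW/gs_gt0.
apply/negP => /eqP H.
pose D : set E := [set x | sqn x < 1].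
have mD : measurable D by apply: open_measurable_rV; exact: open_sqn_lt.
have : (0 < mu D)%E by apply: open_rV_gt0; [exact: open_sqn_lt|exact: sqn_lt_neq0].
pose c := expR (- (1 / (2 * t))).
have c0 : 0 < c by exact: expR_gt0.
have : (c%:E * mu D <= (gsZ t)%:E)%E.
  rewrite intE; last exact: intble_gs.
  rewrite -[X in (_ * mu X)%E]setIT -integral_indic// -ge0_integralZl//; last 2 first.
  - by apply/measurable_EFinP; exact: measurable_indic.
  - by rewrite lee_fin ltW.
  apply: ge0_le_integral => //.
  - by move=> x _; rewrite mule_ge0// lee_fin ltW.
  - by apply: measurable_funeM; apply/measurable_EFinP; exact: measurable_indic.
  - by apply/measurable_EFinP; exact: measurable_gs.
  move=> x _; rewrite -EFinM lee_fin indicE; case: (boolP (x \in D)) => xD; last first.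
    by rewrite mulr0 ltW// gs_gt0.
  rewrite mulr1 ler_expR lerN2 ler_wpM2r ?invr_ge0 ?mulr_ge0// ?ltW//.
  by move: xD; rewrite inE.
rewrite H => H1 H2; have c0' : (0 < c%:E)%E by rewrite lte_fin.
by have := lt_le_trans (mule_gt0 c0' H2) H1; rewrite lte_fin ltxx.
Qed.



Lemma gaussp_gt0 t x : 0 < t -> 0 < gaussp t x.
Proof. by move=> t0; rewrite divr_gt0 ?gs_gt0 ?gsZ_gt0. Qed.

Lemma gaussp_le t x : 0 < t -> gaussp t x <= (gsZ t)^-1.
Proof.
move=> t0; rewrite /gaussp ler_piMl ?invr_ge0 ?(ltW (gsZ_gt0 t0))//.
by rewrite -expR0 ler_expR oppr_le0 divr_ge0 ?sqn_ge0 ?mulr_ge0// ltW.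
Qed.

Lemma gausspN t x : gaussp t (- x) = gaussp t x.
Proof. by rewrite /gaussp /gs sqnN. Qed.

Lemma gausspC t x y : gaussp t (x - y) = gaussp t (y - x).
Proof. by rewrite -gausspN opprB. Qed.

Lemma gaussp_sqn t x y : sqn x = sqn y -> gaussp t x = gaussp t y.
Proof. by rewrite /gaussp /gs => ->. Qed.

Lemma measurable_gaussp t : measurable_fun setT (gaussp t).
Proof. by apply: measurable_funM => //; exact: measurable_gs. Qed.

Lemma intble_gaussp t : 0 < t -> intble mu (gaussp t).
Proof.
move=> t0; have := intbleZ (gsZ t)^-1 (intble_gs t0).
by under eq_fun do rewrite mulrC.
Qed.

Lemma int_gaussp t : 0 < t -> int mu (gaussp t) = 1.
Proof.
move=> t0; rewrite /gaussp; under eq_fun do rewrite mulrC.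
by rewrite intZ ?intble_gs// mulVf// gt_eqF// gsZ_gt0.
Qed.

(** Dilation by the square root of t carries [gaussp 1] to [gaussp t]; this is why the k-th moment
    at time t is a multiple of t^(k/2). *)
Lemma Ex_scale t f : 0 < t -> intble mu (fun y => gaussp t y * f y) ->
  intble mu (fun y => gaussp 1 y * f (Num.sqrt t *: y)) /\
  Ex t f = Ex 1 (fun y => f (Num.sqrt t *: y)).
Proof.
move=> t0 fi; have c0 : 0 < Num.sqrt t by rewrite sqrtr_gt0.
have [k k0 kE] := @rescales_scale R n (Num.sqrt t) (lt0r_neq0 c0).
have E1 : gsZ 1 = k * gsZ t.
  rewrite /gsZ -(rescales_int (ltW k0) kE (intble_gs t0)); congr int; apply/funext => x.
  by rewrite -(gs_scale x ltr01 t0) mulr1.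
have p1 x : gaussp 1 x = k^-1 * gaussp t (Num.sqrt t *: x).
  by rewrite /gaussp E1 -(gs_scale x ltr01 t0) mulr1 invfM; ring.
have H1 := rescales_intble (ltW k0) kE fi.
have H2 : (fun y => gaussp 1 y * f (Num.sqrt t *: y)) =
   (fun y => k^-1 * (gaussp t (Num.sqrt t *: y) * f (Num.sqrt t *: y))).
  by apply/funext => y; rewrite p1 -mulrA.
rewrite /Ex H2; split; first exact: (intbleZ k^-1 H1).
by rewrite (intZ _ H1) (rescales_int (ltW k0) kE fi) mulKf// gt_eqF.
Qed.

Lemma intble_gaussp_b t b C : 0 < t -> measurable_fun setT b ->
  (forall x, `|b x| <= C) -> intble mu (fun y => gaussp t y * b y).
Proof.
move=> t0 mb bC; have := intble_mulb mb bC (intble_gaussp t0).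
by under eq_fun do rewrite mulrC.
Qed.

(** Dominates all moments up to order four. Half of the exponent stays in [gs (2 * t)]; the other
    half, written as a square, absorbs 1 + |y|^2 through exp s >= 1 + s. *)
Lemma intble_gaussp_sqn2 t : 0 < t ->
  intble mu (fun y => gaussp t y * (1 + sqn y) ^+ 2).
Proof.
move=> t0; pose C := (Num.max 1 (8 * t)) ^+ 2.
have C0 : 0 <= Num.max 1 (8 * t) by rewrite le_max ler01.
have mf : measurable_fun setT (fun y => gaussp t y * (1 + sqn y) ^+ 2).
  apply: measurable_funM; first exact: measurable_gaussp.
  by apply: measurable_funX; apply: measurable_funD => //; exact: measurable_sqn.
have t20 : 0 < 2 * t by rewrite mulr_gt0.
have := intbleZ (C / gsZ t) (intble_gs t20).
apply: (intble_dom mf) => y.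
have z0 := gsZ_gt0 t0.
rewrite ger0_norm; last by rewrite mulr_ge0 ?sqr_ge0// ltW// gaussp_gt0.
rewrite /gaussp mulrAC [leRHS]mulrAC ler_pM2r ?invr_gt0//.
have -> : gs t y = gs (2 * t) y * expR (- (sqn y / (8 * t))) ^+ 2.
  rewrite /gs -expRM_natl -expRD; congr expR; field; lra.
rewrite mulrC mulrCA mulrC ler_pM2r ?gs_gt0//.
rewrite -exprMn ler_pXn2r// ?nnegrE//; last first.
  by rewrite mulr_ge0 ?addr_ge0 ?sqn_ge0 ?expR_ge0.
rewrite -ler_pdivlMr ?expR_gt0// -expRN opprK.
apply: (@le_trans _ _ (Num.max 1 (8 * t) * (1 + sqn y / (8 * t)))); last first.
  by rewrite ler_wpM2l// expR_ge1Dx.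
rewrite mulrDr mulr1 lerD//; first by rewrite le_max lexx.
rewrite mulrCA -[leLHS]mulr1 ler_wpM2l ?sqn_ge0//.
rewrite ler_pdivlMr ?mulr_gt0// mul1r le_max lexx orbT//.
Qed.

End gaussian.

Lemma int_gt0 d (T : measurableType d) (R : realType)
    (mu : {measure set T -> \bar R}) (f : T -> R) (D : set T) :
  intble mu f -> (forall x, 0 <= f x) -> measurable D -> (0 < mu D)%E ->
  (forall x, D x -> 0 < f x) -> 0 < int mu f.
Proof.
move=> fi f0 mD D0 fD; rewrite lt_def int_ge0// andbT; apply/negP => /eqP H.
have : (\int[mu]_x `|(f x)%:E| = 0)%E.
  transitivity (int mu f)%:E; last by rewrite H.
  by rewrite intE//; apply: eq_integral => x _; rewrite gee0_abs// lee_fin.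
move/(ae_eq_integral_abs mu measurableT (proj2 (measurable_EFinP _ _) (intble_mfun fi))).
move=> [N [mN N0 DN]]; move: D0.
suff ND : mu.-negligible D by rewrite (measure_negligible mD ND) ltxx.
exists N; split => // x Dx; apply: DN => /= /(_ I) [fx].
by have := fD x Dx; rewrite fx ltxx.
Qed.

(** * Gaussian convolution: symmetry, mass and the semigroup law *)

Section convolution.
Context {R : realType} {n : nat}.
Local Notation E := 'rV[R]_n.
Local Notation mu := (@lebesgue_rV R n).
Implicit Types (f g b : E -> R) (s t : R).

Lemma gaussp_ge0 t (x : E) : 0 < t -> 0 <= gaussp t x.
Proof. by move=> t0; exact/ltW/gaussp_gt0. Qed.

Lemma gaussp_norm t (x : E) : 0 < t -> `|gaussp t x| = gaussp t x.
Proof. by move=> t0; rewrite ger0_norm// gaussp_ge0. Qed.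

Definition conv t f (x : E) : R := int mu (fun y => gaussp t (x - y) * f y).

Lemma measurable_rVB (x : E) : measurable_fun setT (fun y : E => x - y).
Proof.
apply: (measurableT_comp (@measurable_rVD R n) (g := fun y : E => (x, - y))).
apply: measurable_fun_pair => //.
by have := @measurable_rVZ R n (-1); under eq_fun do rewrite scaleN1r.
Qed.

Lemma measurable_gausspB t : measurable_fun setT
  (fun z : E * E => gaussp t (z.2 - z.1)).
Proof.
apply: measurableT_comp; first exact: measurable_gaussp.
apply: (measurableT_comp (@measurable_rVD R n) (g := fun z : E * E => (z.2, - z.1))).
apply: measurable_fun_pair => //; apply: measurableT_comp => //.
by have := @measurable_rVZ R n (-1); under eq_fun do rewrite scaleN1r.
Qed.

Lemma measurable_gaussp_at t x : measurable_fun setT (fun y : E => gaussp t (x - y)).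
Proof. apply: measurableT_comp; [exact: measurable_gaussp|exact: measurable_rVB]. Qed.

Lemma intble_gaussp_at t x : 0 < t -> intble mu (fun y : E => gaussp t (x - y)).
Proof.
move=> t0; have := intble_shift (- x) (@intble_gaussp R n t t0).
by under eq_fun do rewrite -gausspC.
Qed.

Lemma int_gaussp_at t x : 0 < t -> int mu (fun y : E => gaussp t (x - y)) = 1.
Proof.
move=> t0; rewrite -(@int_gaussp R n t t0) -(int_shift (- x) (intble_gaussp t0)).
by under eq_fun do rewrite gausspC.
Qed.

Lemma intble_conv t f x : 0 < t -> intble mu f ->
  intble mu (fun y => gaussp t (x - y) * f y).
Proof.
move=> t0 fi; apply: (intble_mulb (C := (@gsZ R n t)^-1) (measurable_gaussp_at t x) _ fi).
by move=> y; rewrite gaussp_norm ?gaussp_le//.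
Qed.

Lemma intble_convb t b x C : 0 < t -> measurable_fun setT b ->
  (forall y, `|b y| <= C) -> intble mu (fun y => gaussp t (x - y) * b y).
Proof.
move=> t0 mb bC; have := intble_mulb mb bC (intble_gaussp_at x t0).
by under eq_fun do rewrite mulrC.
Qed.

Lemma conv_ge0 t f x : 0 < t -> (forall y, 0 <= f y) -> 0 <= conv t f x.
Proof. by move=> t0 f0; apply: int_ge0 => y; rewrite mulr_ge0// gaussp_ge0. Qed.

Lemma conv_norm_le t f x : 0 < t -> intble mu f ->
  `|conv t f x| <= (@gsZ R n t)^-1 * int mu (fun y => `|f y|).
Proof.
move=> t0 fi; rewrite -intZ; last exact: intble_norm.
apply: int_norm_le; [exact: intble_conv|exact/intbleZ/intble_norm|].
move=> y; rewrite normrM ler_wpM2r// gaussp_norm ?gaussp_le//.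
Qed.

Lemma conv_normb_le t b x C : 0 < t -> measurable_fun setT b ->
  (forall y, `|b y| <= C) -> `|conv t b x| <= C.
Proof.
move=> t0 mb bC; rewrite -[leRHS]mulr1 -(int_gaussp_at x t0) -intZ; last exact: intble_gaussp_at.
apply: int_norm_le; [exact: intble_convb bC|exact/intbleZ/intble_gaussp_at|].
move=> y; rewrite normrM mulrC ler_pM// gaussp_norm//.
Qed.

Lemma convE t b x : intble mu (fun y => gaussp t (x - y) * b y) ->
  intble mu (fun y => gaussp t y * b (x + y)) /\ conv t b x = Ex t (fun y => b (x + y)).
Proof.
move=> bi.
have H : (fun y => gaussp t y * b (x + y)) = (fun y => gaussp t (x - (y + x)) * b (y + x)).
  by apply/funext => y; rewrite gausspC addrK addrC.
by rewrite /Ex H; split; [exact: intble_shift bi|rewrite (int_shift x bi)].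
Qed.

(** Self-adjointness, by Fubini and evenness of the kernel. Pairing an integrable function with a
    bounded one makes the double integral absolutely convergent. *)
Lemma conv_sym t f g (C : R) : 0 < t -> intble mu f -> measurable_fun setT g ->
  (forall x, `|g x| <= C) ->
  [/\ intble mu (fun y => f y * conv t g y), intble mu (conv t f),
   intble mu (fun x => g x * conv t f x) &
   int mu (fun x => g x * conv t f x) = int mu (fun y => f y * conv t g y)].
Proof.
move=> t0 fi mg gC.
(* Stated for an arbitrary bounded [h] because it is used twice: for [g], and for the constant 1,
   which yields integrability of [conv t f]. *)
have H (h : E -> R) (D : R) : measurable_fun setT h -> (forall x, `|h x| <= D) ->
  [/\ intble mu (fun y => f y * conv t h y),
   intble mu (fun x => h x * conv t f x) &
   int mu (fun x => h x * conv t f x) = int mu (fun y => f y * conv t h y)].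
  move=> mh hD; have mf := intble_mfun fi.
  have iy y : intble mu (fun x => f y * (gaussp t (x - y) * h x)).
    apply: intbleZ; have := intble_convb y t0 mh hD.
    by under eq_fun do rewrite gausspC.
  have ix x : intble mu (fun y => f y * (gaussp t (x - y) * h x)).
    have := intbleZ (h x) (intble_conv x t0 fi).
    rewrite (_ : (fun _ => _) = (fun y => f y * (gaussp t (x - y) * h x)))//.
    by apply/funext => y; ring.
  have [] := @int_fubini_eq _ _ E E R mu mu
    (fun y x => f y * (gaussp t (x - y) * h x))
    (fun y => f y * conv t h y) (fun x => h x * conv t f x); last first.
  - by move=> h1 h2 h3; split; [exact: h1|exact: h2|exact: (esym h3)].
  - move=> x; rewrite -intZ; last exact: intble_conv.
    by congr int; apply/funext => y; ring.
  - move=> y; rewrite /conv; under eq_fun do rewrite gausspC.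
    by rewrite intZ//; exact: intble_convb hD.
  - exact: ix.
  - exact: iy.
  - have D0 : 0 <= D by apply: le_trans (hD 0); exact: normr_ge0.
    have fD := intbleZ D (intble_norm fi).
    apply: (@le_lt_trans _ _ (\int[mu]_y (D * `|f y|)%:E)%E); last first.
      by rewrite -intE// ltry.
    apply: ge0_le_integral => //.
    + by move=> y _; apply: integral_ge0.
    + have := (@measurable_fun_fubini_tonelli_F _ _ _ _ R mu
        (fun z : E * E => (`|f z.1 * (gaussp t (z.2 - z.1) * h z.2)|)%:E)).
      rewrite /fubini_F /=; apply => //.
      apply/measurable_EFinP/measurableT_comp => //.
      apply: measurable_funM; first exact: measurableT_comp.
      by apply: measurable_funM; [exact: measurable_gausspB|exact: measurableT_comp].
    + by apply/measurable_EFinP; exact: intble_mfun fD.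
    + move=> y _; rewrite -intE; last exact/intble_norm/iy.
      rewrite lee_fin.
      have -> : D * `|f y| = int mu (fun x => (D * `|f y|) * gaussp t (y - x)).
        by rewrite intZ ?int_gaussp_at ?mulr1//; exact: intble_gaussp_at.
      apply: int_le; first exact/intble_norm/iy.
        exact/intbleZ/intble_gaussp_at.
      move=> x; rewrite normrM (normrM (gaussp _ _)) gaussp_norm// gausspC.
      rewrite [leRHS](_ : _ = `|f y| * (gaussp t (y - x) * D)); last by ring.
      by rewrite !ler_wpM2l// gaussp_ge0.
  - apply: measurable_funM; first exact: measurableT_comp.
    by apply: measurable_funM; [exact: measurable_gausspB|exact: measurableT_comp].
have [h1 h2 h3] := H g C mg gC; split => //.
have [_ + _] := H (cst 1) 1 (measurable_cst _) (fun x => ltac:(by rewrite normr1)).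
by under eq_fun do rewrite mul1r.
Qed.

Lemma intble_convT t f : 0 < t -> intble mu f -> intble mu (conv t f).
Proof.
move=> t0 fi; have [|] := @conv_sym t f (cst 1) 1 t0 fi (measurable_cst _).
  by move=> x; rewrite normr1.
by [].
Qed.

Lemma int_conv t f : 0 < t -> intble mu f -> int mu (conv t f) = int mu f.
Proof.
move=> t0 fi; have [|_ _ _] := @conv_sym t f (cst 1) 1 t0 fi (measurable_cst _).
  by move=> x; rewrite normr1.
under eq_fun do rewrite mul1r; move=> ->; congr int; apply/funext => x.
rewrite /conv; under [X in _ * int _ X]eq_fun do rewrite mulr1.
by rewrite int_gaussp_at// mulr1.
Qed.

(** Completing the square shows that the convolution is a constant multiple [K] of [gaussp (s + t)];
    both have total mass 1, so K = 1. *)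
Lemma gaussp_semigroup s t x : 0 < s -> 0 < t ->
  conv s (gaussp t) x = gaussp (s + t) x.
Proof.
move=> s0 t0; have st : 0 < s + t by rewrite addr_gt0.
(* Variance parameter, in the integration variable, of the Gaussian left after completing the
   square. *)
pose r := s * t / (s + t); have r0 : 0 < r by rewrite divr_gt0 ?mulr_gt0.
pose K := (@gsZ R n r) * (@gsZ R n (s + t)) / ((@gsZ R n s) * (@gsZ R n t)).
have zs := @gsZ_gt0 R n s s0; have zt := @gsZ_gt0 R n t t0; have zst := @gsZ_gt0 R n (s + t) st.
have H y : conv s (gaussp t) y = K * gaussp (s + t) y.
  have -> : K * gaussp (s + t) y = int mu (fun z => gs (s + t) y / ((@gsZ R n s) * (@gsZ R n t)) * gs r (z + - (t / (s + t)) *: y)).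
    rewrite intZ; last exact: (intble_shift (- (t / (s + t)) *: y) (intble_gs r0)).
    rewrite (int_shift (- (t / (s + t)) *: y) (intble_gs r0)) -/(gsZ r) /K /gaussp.
    move: (gs (s + t) y) (gsZ r) zs zt zst => a b.
    move: (gsZ s) (gsZ t) (gsZ (s + t)) => A B D A0 B0 D0; field.
    by rewrite !lt0r_neq0.
  congr int; apply/funext => z; rewrite /gaussp.
  have -> : gs s (y - z) = gs (s + t) y * gs r (z + - (t / (s + t)) *: y) / gs t z.
    rewrite /gs -expRN -!expRD; congr expR.
    rewrite scaleNr !sqnB dotZr sqnZ (dotC y z) /r.
    move: (sqn y) (sqn z) (dot z y) => a b c; field.
    by rewrite !lt0r_neq0.
  have := @gs_gt0 R n t z; move: (gs (s + t) y) (gs r _) (gs t z) zs zt => a b c.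
  move: (gsZ s) (gsZ t) => A B A0 B0 c0; field.
  by rewrite !lt0r_neq0.
have : int mu (conv s (gaussp t)) = K.
  rewrite (_ : conv s (gaussp t) = fun y => K * gaussp (s + t) y); last exact/funext.
  by rewrite intZ ?int_gaussp ?mulr1//; exact: intble_gaussp.
rewrite int_conv ?int_gaussp//; last exact: intble_gaussp.
by rewrite H => <-; rewrite mul1r.
Qed.

Lemma gaussp_semigroup_at s t x z : 0 < s -> 0 < t ->
  int mu (fun y => gaussp t (z - y) * gaussp s (x - y)) = gaussp (s + t) (x - z).
Proof.
move=> s0 t0; rewrite -(gaussp_semigroup (x - z) s0 t0) /conv.
rewrite -[RHS](int_shift (- z) (intble_conv _ s0 (intble_gaussp t0))).
congr int; apply/funext => y; rewrite mulrC; congr (_ * _).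
  by rewrite opprB addrA subrK.
exact: gausspC.
Qed.

Lemma conv_semigroup s t f x : 0 < s -> 0 < t -> intble mu f ->
  conv s (conv t f) x = conv (s + t) f x.
Proof.
move=> s0 t0 fi; rewrite {1}/conv.
have [|_ _ _ ->] := @conv_sym t f (fun y => gaussp s (x - y)) (@gsZ R n s)^-1 t0 fi (measurable_gaussp_at s x).
  by move=> y; rewrite gaussp_norm ?gaussp_le//.
by congr int; apply/funext => y; rewrite mulrC; congr (_ * _); exact: gaussp_semigroup_at.
Qed.

End convolution.

Lemma ExE (R : realType) n t (f : 'rV[R]_n -> R) :
  Ex t f = int (@lebesgue_rV R n) (fun y => gaussp t y * f y).
Proof. by []. Qed.

Lemma convdefE (R : realType) n t (f : 'rV[R]_n -> R) x :
  conv t f x = int (@lebesgue_rV R n) (fun y => gaussp t (x - y) * f y).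
Proof. by []. Qed.

Lemma gausspE (R : realType) n t (x : 'rV[R]_n) :
  gaussp t x = expR (- (sqn x / (2 * t))) / @gsZ R n t.
Proof. by []. Qed.

#[global] Opaque int gaussp gsZ conv Ex.

(** * Gaussian expectations and second moments *)

Section moments.
Context {R : realType} {n : nat}.
Local Notation E := 'rV[R]_n.
Local Notation mu := (@lebesgue_rV R n).
Implicit Types (f g b : E -> R) (s t : R).

(** Vectors of equal length are exchanged by the reflection orthogonal to their difference, and this
    reflection preserves the Gaussian law. *)
Lemma Ex_dir t (e e' : E) (F : R -> R) : sqn e = sqn e' ->
  intble mu (fun y => gaussp t y * F (dot e y)) ->
  intble mu (fun y => gaussp t y * F (dot e' y)) /\
  Ex t (fun y => F (dot e' y)) = Ex t (fun y => F (dot e y)).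
Proof.
move=> ee iF; have [eE|ne] := eqVneq e e'; first by rewrite -eE.
have v0 : e - e' != 0 by rewrite subr_eq0.
have sv : sqn (e - e') != 0 by rewrite sqn_eq0.
have H y : dot e (householder (e - e') y) = dot e' y.
  rewrite /householder dotDr dotNr dotZr.
  have -> : dot e (e - e') = sqn (e - e') / 2.
    by rewrite sqnB dotDr dotNr -sqnE -ee; lra.
  have -> : 2 * dot y (e - e') / sqn (e - e') * (sqn (e - e') / 2) = dot y (e - e').
    by field.
  by rewrite dotDr dotNr !(dotC y); lra.
have Hg y : gaussp t (householder (e - e') y) = gaussp t y.
  by apply: gaussp_sqn; rewrite sqn_householder.
have E1 : (fun y => gaussp t y * F (dot e' y)) =
    (fun y => (fun z => gaussp t z * F (dot e z)) (householder (e - e') y)).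
  by apply/funext => y; rewrite Hg H.
rewrite !ExE E1; split; first exact: (rescales_intble ler01 (rescales_householder v0) iF).
by rewrite (rescales_int ler01 (rescales_householder v0) iF) mul1r.
Qed.

Lemma Ex1 t : 0 < t -> Ex t (fun _ : E => 1) = 1.
Proof.
by move=> t0; rewrite ExE; under eq_fun do rewrite mulr1; exact: int_gaussp.
Qed.

Definition gdom t f := intble mu (fun y => gaussp t y * f y).

Lemma gdom_le t f g : measurable_fun setT f -> 0 < t -> (forall y, `|f y| <= g y) ->
  gdom t g -> gdom t f.
Proof.
move=> mf t0 fg; apply: intble_dom.
  by apply: measurable_funM => //; exact: measurable_gaussp.
by move=> y; rewrite normrM gaussp_norm// ler_wpM2l// gaussp_ge0.
Qed.

Lemma gdomD t f g : gdom t f -> gdom t g -> gdom t (fun y => f y + g y).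
Proof.
move=> i1 i2; have := intbleD i1 i2; rewrite /gdom.
by under [X in _ -> intble mu X]eq_fun do rewrite mulrDr.
Qed.

Lemma gdomZ t k f : gdom t f -> gdom t (fun y => k * f y).
Proof.
move=> i1; have := intbleZ k i1; rewrite /gdom.
by under [X in _ -> intble mu X]eq_fun do rewrite mulrCA.
Qed.

Lemma ExD t f g : gdom t f -> gdom t g ->
  Ex t (fun y => f y + g y) = Ex t f + Ex t g.
Proof.
move=> i1 i2; rewrite !ExE -intD//.
by under eq_fun do rewrite mulrDr.
Qed.

Lemma ExZ t k f : gdom t f -> Ex t (fun y => k * f y) = k * Ex t f.
Proof. by move=> i1; rewrite !ExE -intZ//; under eq_fun do rewrite mulrCA. Qed.

Lemma gdomB t f g : gdom t f -> gdom t g -> gdom t (fun y => f y - g y).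
Proof.
move=> i1 i2; have := gdomD i1 (gdomZ (-1) i2); rewrite /gdom.
by under eq_fun do rewrite mulN1r.
Qed.

Lemma ExB t f g : gdom t f -> gdom t g ->
  Ex t (fun y => f y - g y) = Ex t f - Ex t g.
Proof.
move=> i1 i2; have := ExD i1 (gdomZ (-1) i2); rewrite ExZ// mulN1r => <-.
by congr (Ex t _); apply/funext => y; rewrite mulN1r.
Qed.

Lemma Ex_le t f g : 0 < t -> gdom t f -> gdom t g -> (forall y, f y <= g y) ->
  Ex t f <= Ex t g.
Proof.
move=> t0 i1 i2 fg; rewrite !ExE; apply: int_le => // y.
by rewrite ler_wpM2l// gaussp_ge0.
Qed.

Lemma Ex_ge0 t f : 0 < t -> (forall y, 0 <= f y) -> 0 <= Ex t f.
Proof. by move=> t0 f0; rewrite ExE; apply: int_ge0 => y; rewrite mulr_ge0// gaussp_ge0. Qed.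

Lemma Ex_norm t f : 0 < t -> gdom t f -> `|Ex t f| <= Ex t (fun y => `|f y|).
Proof.
move=> t0 fi; rewrite !ExE; apply: le_trans (int_norm fi) _.
rewrite le_eqVlt; apply/orP; left; apply/eqP; congr int; apply/funext => y.
by rewrite normrM gaussp_norm.
Qed.

Lemma gdom_norm t f : 0 < t -> gdom t f -> gdom t (fun y => `|f y|).
Proof.
move=> t0 /intble_norm; rewrite /gdom; under eq_fun do rewrite normrM gaussp_norm//.
exact.
Qed.

Lemma gdom_b t b C : 0 < t -> measurable_fun setT b -> (forall x, `|b x| <= C) ->
  gdom t b.
Proof. by move=> t0 mb bC; exact: intble_gaussp_b mb bC. Qed.

Lemma gdom_enorm t k : 0 < t -> (k <= 4)%N -> gdom t (fun y : E => enorm y ^+ k).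
Proof.
move=> t0 k4; apply: (gdom_le _ t0 _ (intble_gaussp_sqn2 t0)).
  by apply: measurable_funX; exact: measurable_enorm.
move=> y; rewrite normrX ger0_norm ?enorm_ge0// -sqr_enorm.
set a := enorm y; have a0 : 0 <= a by exact: enorm_ge0.
case: (lerP a 1) => a1.
  apply: (@le_trans _ _ 1); first exact: exprn_ile1.
  by rewrite -[leLHS](expr1n _ 2) ler_pXn2r// ?nnegrE ?addr_ge0 ?sqr_ge0// lerDl sqr_ge0.
apply: (@le_trans _ _ (a ^+ 4)); first by rewrite ler_eXn2l.
rewrite (_ : a ^+ 4 = (a ^+ 2) ^+ 2); last by rewrite -exprM.
by rewrite ler_pXn2r ?nnegrE ?addr_ge0 ?sqr_ge0// lerDr.
Qed.

Lemma Ex_enorm t k : 0 < t -> (k <= 4)%N ->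
  Ex t (fun y : E => enorm y ^+ k) = Num.sqrt t ^+ k * Ex 1 (fun y : E => enorm y ^+ k).
Proof.
move=> t0 k4; have [_ ->] := Ex_scale t0 (gdom_enorm t0 k4).
rewrite -ExZ; last exact: gdom_enorm.
congr (Ex 1 _); apply/funext => y.
by rewrite enormZ ger0_norm ?sqrtr_ge0// exprMn.
Qed.

(* The variance of one coordinate under [gaussp 1]. *)
Definition gvar : R := Ex 1 (fun y : E => enorm y ^+ 2) / n%:R.

Lemma dot_delta (i : 'I_n) (y : E) : dot (delta_mx ord0 i) y = y ord0 i.
Proof.
rewrite /dot (bigD1 i)//= mxE !eqxx mul1r big1 ?addr0// => j ji.
by rewrite mxE (negbTE ji) andbF mul0r.
Qed.

Lemma sqn_delta (i : 'I_n) : sqn (delta_mx ord0 i : E) = 1.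
Proof. by rewrite sqnE dot_delta mxE !eqxx. Qed.

Lemma gdom_dot2 t (e : E) : 0 < t -> gdom t (fun y => dot e y ^+ 2).
Proof.
move=> t0; apply: (gdom_le _ t0 _ (gdomZ (sqn e) (gdom_enorm t0 (isT : 2 <= 4)%N))).
  by apply: measurable_funX; exact: measurable_dotl.
by move=> y; rewrite ger0_norm ?sqr_ge0// sqr_enorm sqr_dot_le.
Qed.

Lemma Ex_sum t (F : 'I_n -> E -> R) : (forall i, gdom t (F i)) ->
  Ex t (fun y => \sum_i F i y) = \sum_i Ex t (F i).
Proof.
move=> Fi; rewrite ExE (eq_bigr (fun i => int mu (fun y => gaussp t y * F i y))).
  by rewrite -int_sum//; congr int; apply/funext => y; rewrite mulr_sumr.
by move=> i _; rewrite ExE.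
Qed.

Hypothesis n0 : (0 < n)%N.

(** By rotation invariance the moment is |w|^2 times the second moment of any coordinate; summing
    over the coordinates identifies the latter with a share 1/n of the mean of |y|^2. *)
Lemma Ex_dot2 t (w : E) : 0 < t ->
  Ex t (fun y => dot w y ^+ 2) = gvar * t * sqn w.
Proof.
move=> t0.
have H (i : 'I_n) : Ex t (fun y => dot w y ^+ 2) = sqn w * Ex t (fun y : E => y ord0 i ^+ 2).
  have ww : sqn w = sqn (enorm w *: (delta_mx ord0 i : E)).
    by rewrite sqnZ sqn_delta mulr1 sqr_enorm.
  have [_ <-] := Ex_dir (F := fun x => x ^+ 2) ww (gdom_dot2 w t0).
  rewrite -ExZ; last first.
    by have := gdom_dot2 (delta_mx ord0 i : E) t0; rewrite /gdom; under eq_fun do rewrite dot_delta.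
  by congr (Ex t _); apply/funext => y; rewrite dotZl dot_delta exprMn sqr_enorm.
have S : \sum_(i < n) Ex t (fun y => dot w y ^+ 2) = sqn w * Ex t (fun y : E => enorm y ^+ 2).
  rewrite (eq_bigr _ (fun i _ => H i)) -mulr_sumr -Ex_sum => [|i]; last first.
    by have := gdom_dot2 (delta_mx ord0 i : E) t0; rewrite /gdom; under eq_fun do rewrite dot_delta.
  by congr (_ * Ex t _); apply/funext => y; rewrite sqr_enorm.
move: S; rewrite sumr_const card_ord -mulr_natl Ex_enorm// sqr_sqrtr ?(ltW t0)// => S.
have nn : n%:R != 0 :> R by rewrite pnatr_eq0 -lt0n.
apply: (mulfI nn); rewrite S /gvar; field.
by [].
Qed.

(** Polarization along e_i + e_j and e_i - e_j: for distinct indices these have equal length, so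
    their second moments cancel. *)
Lemma Ex_coord2 t i j : 0 < t ->
  gdom t (fun y : E => y ord0 i * y ord0 j) /\
  Ex t (fun y : E => y ord0 i * y ord0 j) = gvar * t * (i == j)%:R.
Proof.
move=> t0.
pose p : E := delta_mx ord0 i + delta_mx ord0 j.
pose q : E := delta_mx ord0 i - delta_mx ord0 j.
have H : (fun y : E => y ord0 i * y ord0 j) =
    (fun y => 4^-1 * (dot p y ^+ 2 - dot q y ^+ 2)).
  by apply/funext => y; rewrite !dotDl dotNl !dot_delta; field.
have gB := gdomB (gdom_dot2 p t0) (gdom_dot2 q t0).
rewrite H; split; first exact: gdomZ.
rewrite ExZ// ExB; [|exact: gdom_dot2..]; rewrite !Ex_dot2// sqnD sqnB dot_delta mxE eqxx/=.
by field.
Qed.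

Lemma gvar_gt0 : 0 < gvar.
Proof.
apply: divr_gt0; last by rewrite ltr0n.
rewrite ExE; apply: (@int_gt0 _ _ R mu _ [set y : E | 0 < sqn y]).
- exact: gdom_enorm.
- by move=> y; rewrite mulr_ge0 ?gaussp_ge0// sqr_ge0.
- rewrite (_ : [set _ | _] = sqn @^-1` `]0, +oo[%classic).
    by rewrite -[X in measurable X]setTI; apply: measurable_sqn => //; exact: measurable_itv.
  by apply/seteqP; split => x; rewrite /= in_itv/= andbT.
- apply: open_rV_gt0; last first.
    by exists (delta_mx ord0 (Ordinal n0)); rewrite /= sqn_delta.
  rewrite (_ : [set _ | _] = sqn @^-1` [set x | 0 < x])//.
  apply: open_comp; last exact: open_gt.
  move=> x _; apply: continuous_sumr => i {}x.
  apply: (@continuous_comp _ _ _ (fun x : E => x ord0 i) (fun s => s ^+ 2)).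
    exact: coord_continuous.
  exact: exprn_continuous.
- by move=> y /= y0; rewrite mulr_gt0 ?gaussp_gt0// sqr_enorm.
Qed.

End moments.

(** * Lipschitz regularity of Gaussian kernels and averages *)

Section lipschitz.
Context {R : realType} {n : nat}.
Local Notation E := 'rV[R]_n.
Local Notation mu := (@lebesgue_rV R n).
Implicit Types (f g : E -> R) (s t : R).

Lemma is_derive_continuous (f df : R -> R) :
  (forall x : R, is_derive x 1 f (df x)) -> continuous f.
Proof.
move=> fd x; apply: differentiable_continuous; apply/derivable1_diffP.
by have [] := fd x.
Qed.

Lemma derive_lipschitz (f df : R -> R) (L : R) :
  (forall x : R, is_derive x 1 f (df x)) -> (forall x, `|df x| <= L) ->
  forall a b, `|f a - f b| <= L * `|a - b|.
Proof.
move=> fd dL a b.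
wlog ab : a b / a <= b.
  by move=> h; have [/h//|/ltW/h] := leP a b; rewrite distrC (distrC b).
move: ab; rewrite le_eqVlt => /orP[/eqP->|ab]; first by rewrite !subrr normr0 mulr0.
have [|c _] := @MVT R f df a b ab (fun x _ => fd x).
  by apply: continuous_subspaceT; exact: is_derive_continuous fd.
by rewrite distrC (distrC a) => ->; rewrite normrM ler_wpM2r.
Qed.

(** The derivative - (a / t) exp(- a^2 / (2 t)) is bounded, because |a| <= 1 + a^2 and the
    exponential absorbs a^2. *)
Lemma expR_sqr_lipschitz t : 0 < t -> exists2 L : R, 0 <= L & forall a b : R,
  `|expR (- (a ^+ 2 / (2 * t))) - expR (- (b ^+ 2 / (2 * t)))| <= L * `|a - b|.
Proof.
move=> t0; pose C := Num.max 1 (2 * t); exists (C / t).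
  by rewrite divr_ge0 ?ltW// lt_max ltr01.
apply: (@derive_lipschitz _ (fun a => - (a / t) * expR (- (a ^+ 2 / (2 * t))))).
  move=> x; rewrite [X in is_derive _ _ X _](_ : _ = expR \o (fun a => - (a ^+ 2 / (2 * t))))//.
  apply: is_derive_eq; rewrite /GRing.scale /=; field; lra.
move=> a; rewrite normrM normrN normrM [`|t^-1|]gtr0_norm ?invr_gt0// mulrAC.
rewrite ler_pM2r ?invr_gt0// [X in _ * X]gtr0_norm ?expR_gt0//.
rewrite expRN ler_pdivrMr ?expR_gt0//.
apply: (@le_trans _ _ (C * (1 + a ^+ 2 / (2 * t)))); last first.
  by rewrite ler_wpM2l ?expR_ge1Dx// le_max ler01.
apply: (@le_trans _ _ (1 + a ^+ 2)).
  by rewrite -(@real_normK _ a) ?num_real//; have := sqr_ge0 (`|a| - 1); rewrite sqrrB1; have := normr_ge0 a; lra.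
rewrite mulrDr mulr1 lerD//; first by rewrite le_max lexx.
rewrite mulrCA -[leLHS]mulr1 ler_wpM2l ?sqr_ge0//.
by rewrite ler_pdivlMr ?mulr_gt0// mul1r le_max lexx orbT.
Qed.

Lemma gaussp_lipschitz t : 0 < t -> exists2 L : R, 0 <= L & forall x y : E,
  `|gaussp t x - gaussp t y| <= L * enorm (x - y).
Proof.
move=> t0; have [L L0 H] := expR_sqr_lipschitz t0.
have z0 := @gsZ_gt0 R n t t0.
exists (L / (@gsZ R n t)) => [|x y]; first by rewrite divr_ge0// ltW.
rewrite !gausspE -mulrBl normrM [X in _ * X]gtr0_norm ?invr_gt0// [leRHS]mulrAC.
rewrite ler_pM2r ?invr_gt0// -!sqr_enorm; apply: le_trans (H _ _) _.
by rewrite ler_wpM2l// enorm_dist.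
Qed.

Lemma conv_lipschitz t : 0 < t -> exists2 L : R, 0 <= L & forall f, intble mu f ->
  forall x y, `|conv t f x - conv t f y| <= L * int mu (fun z => `|f z|) * enorm (x - y).
Proof.
move=> t0; have [L L0 H] := gaussp_lipschitz t0; exists L => // f fi x y.
rewrite !convdefE -intB; [|exact: intble_conv..].
rewrite mulrAC -intZ; last exact: intble_norm.
apply: int_norm_le; [apply: intbleB; exact: intble_conv|exact/intbleZ/intble_norm|].
move=> z; rewrite -mulrBl normrM ler_wpM2r//.
by have := H (x - z) (y - z); rewrite opprB addrA subrK.
Qed.

(* The sup norm of the library is dominated by the Euclidean norm. *)
Lemma lipschitz_continuous_rV f L : 0 <= L ->
  (forall x y, `|f x - f y| <= L * enorm (x - y)) -> continuous f.
Proof.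
move=> L0 fL x; apply/(@cvgrPdist_le _ _ _ (nbhs x) (nbhs_filter x)) => e e0.
have d0 : 0 < e / ((L + 1) * (n%:R + 1)) by rewrite divr_gt0// mulr_gt0// ltr_wpDl.
apply: (@filterS _ (nbhs x) (nbhs_filter x) _ _ _ (nbhsx_ballx x _ d0)) => y xy.
apply: le_trans (fL _ _) _.
have xyc : cube n (e / ((L + 1) * (n%:R + 1))) (x - y).
  by move=> i; case: xy => _ /(_ ord0 i); rewrite /ball/= !mxE => /ltW.
apply: le_trans (ler_wpM2l L0 (enorm_le_cube (ltW d0) xyc)) _.
have -> : L * (n%:R * (e / ((L + 1) * (n%:R + 1)))) =
    (L / (L + 1)) * (n%:R / (n%:R + 1)) * e.
  by field; rewrite !lt0r_neq0// ltr_wpDl.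
rewrite -[leRHS]mul1r ler_wpM2r ?(ltW e0)// mulr_ile1 ?divr_ge0 ?addr_ge0//.
  by rewrite ler_pdivrMr ?ltr_wpDl// mul1r lerDl.
by rewrite ler_pdivrMr ?ltr_wpDl// mul1r lerDl.
Qed.

End lipschitz.

(** * Moduli of continuity and reflection coupling *)

Section reflection.
Context {R : realType} {n : nat}.
Local Notation E := 'rV[R]_n.
Local Notation mu := (@lebesgue_rV R n).
Implicit Types (f g : E -> R) (s t : R) (w : R -> R).

Lemma rescales_comp k l (A B : E -> E) : 0 <= k -> 0 <= l ->
  rescales k A -> rescales l B -> rescales (l * k) (A \o B).
Proof.
move=> k0 l0 [mA kA] [mB lB]; split; first exact: measurableT_comp.
move=> f mf f0; rewrite (lB (fun x => f (A x)))//; last exact: measurableT_comp.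
by rewrite kA// EFinM muleA.
Qed.

Lemma rescales_comp1 (A B : E -> E) :
  rescales 1 A -> rescales 1 B -> rescales 1 (A \o B).
Proof. by move=> rA rB; rewrite -(mulr1 1); exact: rescales_comp. Qed.

Lemma gdom1 t : 0 < t -> gdom t (fun _ : E => 1).
Proof.
by move=> t0; apply: (gdom_b t0 (measurable_cst _) (C := 1)) => x; rewrite normr1.
Qed.

Variable i0 : 'I_n.

(* The heat semigroup acting on moduli of continuity: along the reflection
   coupling the distance [r] is driven by twice one coordinate of the noise. *)
Definition opw t w (r : R) : R := Ex t (fun y : E => w (r + 2 * y ord0 i0)).

(** A class that [opw] preserves with unchanged constants. Oddness encodes that coupled paths merge
    when they meet: the two mirror halves of the noise then cancel. *)
Definition modulus_ok (C a : R) w := [/\ (forall r, w (- r) = - w r),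
  (forall r r', r <= r' -> w r <= w r'), (forall r, `|w r| <= C),
  0 <= a & (forall r r', `|w r - w r'| <= a * `|r - r'|)].

Lemma modulus_measurable C a w : modulus_ok C a w -> measurable_fun [set: R] w.
Proof.
by move=> [_ mw _ _ _]; apply: nondecreasing_measurable.
Qed.

Lemma modulus_measurable_rV C a w (r : R) (e : E) k : modulus_ok C a w ->
  measurable_fun setT (fun y => w (r + k * dot e y)).
Proof.
move=> wok; apply: (measurableT_comp (modulus_measurable wok)).
apply: measurable_funD => //; apply: measurable_funM => //.
exact: measurable_dotl.
Qed.

Lemma modulus_gdom C a w (r : R) (e : E) k t : 0 < t -> modulus_ok C a w ->
  gdom t (fun y => w (r + k * dot e y)).
Proof.
move=> t0 wok; apply: (gdom_b t0 (modulus_measurable_rV r e k wok) (C := C)) => y.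
by case: wok.
Qed.

Lemma opw_dir C a w (r t : R) (e : E) : 0 < t -> modulus_ok C a w -> sqn e = 1 ->
  Ex t (fun y => w (r + 2 * dot e y)) = opw t w r.
Proof.
move=> t0 wok e1; have ee : sqn (delta_mx ord0 i0 : E) = sqn e by rewrite sqn_delta.
have [_ ->] := Ex_dir (F := fun x => w (r + 2 * x)) ee (modulus_gdom r _ 2 t0 wok).
by congr (Ex t _); apply/funext => y; rewrite dot_delta.
Qed.

Lemma opw_ok C a w t : 0 < t -> modulus_ok C a w -> modulus_ok C a (opw t w).
Proof.
move=> t0 wok; have [wN wm wC a0 wL] := wok.
have gd r : gdom t (fun y : E => w (r + 2 * y ord0 i0)).
  have := modulus_gdom r (delta_mx ord0 i0) 2 t0 wok; rewrite /gdom.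
  by under eq_fun do rewrite dot_delta.
split => //.
- move=> r; have e1 : sqn (- delta_mx ord0 i0 : E) = 1 by rewrite sqnN sqn_delta.
  rewrite -(opw_dir (- r) t0 wok e1) /opw -[RHS]mulN1r -ExZ//.
  congr (Ex t _); apply/funext => y.
  by rewrite dotNl dot_delta mulrN -opprD wN mulN1r.
- move=> r r' rr'; apply: Ex_le => // y; apply: wm; lra.
- move=> r; apply: le_trans (Ex_norm t0 (gd r)) _.
  rewrite -[leRHS]mulr1 -[X in _ <= _ * X](@Ex1 R n t t0) -ExZ; last first.
    exact: gdom1.
  apply: Ex_le => //; [exact: (gdom_norm t0 (gd r))| |by move=> y; rewrite mulr1].
  apply: gdomZ; exact: gdom1.
- move=> r r'; rewrite /opw -ExB//.
  apply: le_trans (Ex_norm t0 (gdomB (gd r) (gd r'))) _.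
  rewrite -[leRHS]mulr1 -[X in _ <= _ * X](@Ex1 R n t t0) -ExZ; last first.
    exact: gdom1.
  apply: Ex_le => //; first exact: (gdom_norm t0 (gdomB (gd r) (gd r'))).
    apply: gdomZ; exact: gdom1.
  by move=> y; rewrite mulr1; apply: le_trans (wL _ _) _; rewrite opprD addrACA subrr addr0.
Qed.

(** Self-adjointness moves one Gaussian average onto the density of the other, where the semigroup
    law of [gaussp] applies. *)
Lemma opw_semigroup C a w s t r : 0 < s -> 0 < t -> modulus_ok C a w ->
  opw s (opw t w) r = opw (s + t) w r.
Proof.
move=> s0 t0 wok; have [_ _ wC _ _] := wok.
have mb : measurable_fun setT (fun u : E => w (r + 2 * u ord0 i0)).
  have := modulus_measurable_rV r (delta_mx ord0 i0) 2 wok.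
  by under eq_fun do rewrite dot_delta.
have [_ _ _ H] := conv_sym t0 (intble_gaussp s0) mb (fun x => wC _).
have E1 y : conv t (fun u : E => w (r + 2 * u ord0 i0)) y = opw t w (r + 2 * y ord0 i0).
  have [_ ->] := convE (intble_convb y t0 mb (fun x => wC _)).
  by congr (Ex t _); apply/funext => z; rewrite mxE mulrDr addrA.
rewrite /opw [LHS]ExE [RHS]ExE.
transitivity (int mu (fun y : E => gaussp s y * conv t (fun u : E => w (r + 2 * u ord0 i0)) y)).
  by congr int; apply/funext => y; rewrite E1.
rewrite -H; congr int; apply/funext => y.
have -> : conv t (@gaussp R n s) y = gaussp (s + t) y.
  by rewrite (gaussp_semigroup y t0 s0) addrC.
by rewrite mulrC.
Qed.

(** Reflect in the hyperplane bisecting p and q. Symmetrizing writes twice the difference as the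
    integral of the kernel difference times V y - V (A y), with [A] the reflection. The two factors
    are compared on each side of the hyperplane, and the modulus integrates to [opw]. The slack [B]
    carries the error accumulated in earlier steps. *)
Lemma reflection_coupling C a w B Cv (V : E -> R) t (p q : E) :
  0 < t -> modulus_ok C a w -> 0 <= B -> measurable_fun setT V ->
  (forall y, `|V y| <= Cv) ->
  (forall y y', V y - V y' <= w (enorm (y - y')) + B) ->
  conv t V q - conv t V p <= opw t w (enorm (q - p)) + B.
Proof.
move=> t0 wok B0 mV VC Vw; have [wN wm wC a0 wL] := wok.
have w0 : w 0 = 0 by have := wN 0; rewrite oppr0; lra.
have [okN _ _ _ _] := opw_ok t0 wok.
have [->|pq] := eqVneq p q.
  rewrite !subrr enorm0; suff -> : opw t w 0 = 0 by rewrite add0r.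
  by have := okN 0; rewrite oppr0; lra.
set r := enorm (q - p); pose e := r^-1 *: (q - p).
have r0 : 0 < r.
  by rewrite lt_def enorm_ge0 andbT enorm_eq0 subr_eq0 eq_sym.
have e1 : sqn e = 1.
  by rewrite sqnZ -(sqr_enorm (q - p)) -exprMn mulVf ?gt_eqF// expr1n.
have de : dot e e = 1 by rewrite -sqnE.
have e0 : e != 0 by rewrite -sqn_eq0 e1 oner_eq0.
have qpe : q - p = r *: e by rewrite scalerA mulfV ?gt_eqF// scale1r.
clearbody e r.
pose c := 2^-1 *: (p + q).
have cp : c - p = (r / 2) *: e.
  have -> : c - p = 2^-1 *: (q - p).
    by rewrite /c scalerDr scalerBr addrAC -[X in _ - X + _](scale1r p) -scalerBl addrC -scaleNr; congr (_ + _ *: _); field.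
  by rewrite qpe scalerA mulrC.
have qc : q - c = (r / 2) *: e.
  have -> : q - c = (q - p) - (c - p) by rewrite opprB addrA subrK.
  by rewrite cp qpe -scalerBl; congr (_ *: _); field.
clearbody c.
(* Signed distance to the bisecting hyperplane: y and its mirror image are 2 |S y| apart. *)
pose S (y : E) := dot e (y - c).
pose A (y : E) := householder e (y - c) + c.
have AE y : A y = y - (2 * S y) *: e.
  by rewrite /A /householder e1 divr1 -/(S y) dotC -/(S y) addrAC subrK.
have rA : rescales 1 A.
  exact: (rescales_comp1 (rescales_shift c)
    (rescales_comp1 (rescales_householder e0) (rescales_shift (- c)))).
have SA y : S (A y) = - S y.
  transitivity (dot e ((y - c) - (2 * S y) *: e)); first by rewrite /S AE addrAC.
  by rewrite [LHS]dotDr dotNr dotZr de -/(S y); lra.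
have Sp y : S y = dot e (y - p) - r / 2.
  have -> : y - p = (y - c) + (c - p) by rewrite addrA subrK.
  by rewrite dotDr -/(S y) cp dotZr de; lra.
have AA y : A (A y) = y.
  by rewrite [LHS]AE SA {1}AE mulrN scaleNr opprK subrK.
have pA y : sqn (p - A y) = sqn (q - y).
  have -> : p - A y = (p - y) + (2 * S y) *: e by rewrite AE opprB addrA addrAC.
  have -> : q - y = (p - y) + r *: e by rewrite -qpe [RHS]addrC addrA subrK.
  rewrite [LHS]sqnD [RHS]sqnD !dotZr !sqnZ e1.
  rewrite Sp.
  rewrite -(opprB y p) sqnN dotNl (dotC (y - p)).
    by move: (sqn (y - p)) (dot e (y - p)) => u v; clear; lra.
have qA y : sqn (q - A y) = sqn (p - y) by rewrite -pA AA.
have gV z : intble mu (fun y => gaussp t (z - y) * V y) by exact: intble_convb VC.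
have mVA : measurable_fun setT (fun y => V (A y)) by exact: (measurableT_comp mV rA.1).
have gVA z : intble mu (fun y => gaussp t (z - y) * V (A y)).
  by apply: (intble_convb z t0 mVA (C := Cv)) => y.
have D1 : conv t V p = int mu (fun y => gaussp t (q - y) * V (A y)).
  rewrite convdefE -[LHS]mul1r -(rescales_int ler01 rA (gV p)).
  by congr int; apply/funext => y; rewrite (gaussp_sqn t (pA y)).
have D2 : conv t V q = int mu (fun y => gaussp t (p - y) * V (A y)).
  rewrite convdefE -[LHS]mul1r -(rescales_int ler01 rA (gV q)).
  by congr int; apply/funext => y; rewrite (gaussp_sqn t (qA y)).
pose wS y := w (2 * S y).
have mwS : measurable_fun setT wS.
  apply: (measurableT_comp (modulus_measurable wok)); apply: measurable_funM => //.
  apply: (measurableT_comp (measurable_dotl e)).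
  exact: (@rescales_shift R n (- c)).1.
have gwS z : intble mu (fun y => gaussp t (z - y) * wS y).
  by apply: (intble_convb z t0 mwS (C := C)) => y; exact: wC.
(* The reflection exchanges the two kernels and changes the sign of [S]; [w] is odd. *)
have W1 : int mu (fun y => gaussp t (p - y) * wS y) = - int mu (fun y => gaussp t (q - y) * wS y).
  rewrite -[LHS]mul1r -(rescales_int ler01 rA (gwS p)) -intN//.
  congr int; apply/funext => y.
  by rewrite (gaussp_sqn t (pA y)) /wS SA mulrN wN mulrN.
(* Under the kernel centred at [q], which lies at height r / 2, the quantity 2 S y is r plus twice
   one coordinate of the noise. *)
have W2 : int mu (fun y => gaussp t (q - y) * wS y) = opw t w r.
  rewrite -convdefE; have [_ ->] := convE (gwS q).
  rewrite -(opw_dir r t0 wok e1); congr (Ex t _); apply/funext => y.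
  rewrite /wS /S addrAC dotDr qc dotZr de mulr1 mulrDr.
  by rewrite (mulrC 2 (r / 2)) divfK ?pnatr_eq0.
have P1 : int mu (fun y => (gaussp t (q - y) - gaussp t (p - y)) * (V y - V (A y))) =
    2 * (conv t V q - conv t V p).
  transitivity (int mu (fun y => (gaussp t (q - y) * V y + gaussp t (p - y) * V (A y)) -
      (gaussp t (q - y) * V (A y) + gaussp t (p - y) * V y))).
    by congr int; apply/funext => y; ring.
  rewrite intB; [|by apply: intbleD..]; rewrite intD// intD// -D1 -D2 -!convdefE.
  by move: (conv t V q) (conv t V p) => u v; ring.
have i1 : intble mu (fun y => (gaussp t (q - y) - gaussp t (p - y)) * (V y - V (A y))).
  have := intbleB (intbleB (gV q) (gVA q)) (intbleB (gV p) (gVA p)).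
  rewrite (_ : (fun x => _) = (fun y => (gaussp t (q - y) - gaussp t (p - y)) * (V y - V (A y))))//.
  by apply/funext => y; ring.
have iB := intbleZ B (intbleD (intble_gaussp_at q t0) (intble_gaussp_at p t0)).
have i2 := intbleD (intbleB (gwS q) (gwS p)) iB.
have : 2 * (conv t V q - conv t V p) <= 2 * opw t w r + B * 2.
  rewrite -P1; apply: (@le_trans _ _ (int mu (fun y => (gaussp t (q - y) * wS y - gaussp t (p - y) * wS y) +
      B * (gaussp t (q - y) + gaussp t (p - y))))); last first.
    rewrite intD//; last exact: intbleB.
    rewrite intZ; last by apply: intbleD; exact: intble_gaussp_at.
    rewrite intB// intD; [|exact: intble_gaussp_at..].
    rewrite !int_gaussp_at// W1 W2.
    by move: (opw t w r) => u; rewrite le_eqVlt; apply/orP; left; apply/eqP; ring.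
  apply: int_le; [exact: i1|exact: i2|move=> y].
  have g1 := @gaussp_ge0 R n t (q - y) t0; have g2 := @gaussp_ge0 R n t (p - y) t0.
  have nS : enorm (y - A y) = `|2 * S y|.
    by rewrite AE opprB addrC subrK enormZ (_ : enorm e = 1) ?mulr1// enormE e1 sqrtr1.
  have sqd : sqn (p - y) - sqn (q - y) = 2 * r * S y.
    have -> : q - y = (p - y) + r *: e by rewrite -qpe [RHS]addrC addrA subrK.
    rewrite [X in _ - X]sqnD dotZr sqnZ e1.
    rewrite Sp.
    rewrite -(opprB y p) sqnN dotNl (dotC (y - p)).
    by move: (sqn (y - p)) (dot e (y - p)) => u v; clear; lra.
  have z0 := @gsZ_gt0 R n t t0.
  (* On the side of [q] the kernel difference is nonnegative and V y - V (A y) is bounded above; on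
     the other side both signs are reversed. *)
  have [S0|S0] := leP 0 (S y).
    have gg : gaussp t (p - y) <= gaussp t (q - y).
      rewrite !gausspE ler_pM2r ?invr_gt0// ler_expR lerN2 ler_pM2r ?invr_gt0 ?mulr_gt0//.
      by rewrite -subr_ge0 sqd !mulr_ge0// ltW.
    have VV : V y - V (A y) <= wS y + B.
      by apply: le_trans (Vw _ _) _; rewrite nS ger0_norm// mulr_ge0.
    apply: (@le_trans _ _ ((gaussp t (q - y) - gaussp t (p - y)) * (wS y + B))).
      by rewrite ler_wpM2l// subr_ge0.
    have := mulr_ge0 B0 g2.
    by move: (gaussp t (q - y)) (gaussp t (p - y)) (wS y) => u v z; clear; lra.
  have gg : gaussp t (q - y) <= gaussp t (p - y).
    rewrite !gausspE ler_pM2r ?invr_gt0// ler_expR lerN2 ler_pM2r ?invr_gt0 ?mulr_gt0//.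
    by rewrite -subr_le0 sqd nmulr_lle0// mulr_ge0// ltW.
  have VV : wS y - B <= V y - V (A y).
    have := Vw (A y) y; rewrite enormBC nS ltr0_norm ?wN//; last by rewrite nmulr_llt0.
    by rewrite /wS; move: (V (A y)) (V y) (w _) => v1 v2 v3; clear; lra.
  apply: (@le_trans _ _ ((gaussp t (q - y) - gaussp t (p - y)) * (wS y - B))).
    by rewrite ler_wnM2l// subr_le0.
  have := mulr_ge0 B0 g1.
  by move: (gaussp t (q - y)) (gaussp t (p - y)) (wS y) => u v z; clear; lra.
move: (conv t V q) (conv t V p) (opw t w r) => u v z; clear; lra.
Qed.

End reflection.

(** * Log-concave functions and their proximal map *)

Section prox.
Context {R : realType} {n : nat}.
Local Notation E := 'rV[R]_n.
Local Notation mu := (@lebesgue_rV R n).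
Implicit Types (F : E -> R) (s t : R).

(** Written with real powers instead of logarithms, so that functions vanishing off a domain
    qualify. *)
Definition logconcave F := forall x y (l : R), 0 < l -> l < 1 ->
  F x `^ (1 - l) * F y `^ l <= F ((1 - l) *: x + l *: y).

Lemma logconcave_ln F x y l : (forall x, 0 < F x) -> logconcave F -> 0 < l -> l < 1 ->
  (1 - l) * ln (F x) + l * ln (F y) <= ln (F ((1 - l) *: x + l *: y)).
Proof.
move=> F0 cF l0 l1; have := cF x y l l0 l1; rewrite -ler_ln ?posrE ?mulr_gt0 ?powR_gt0//.
by rewrite lnM ?posrE ?powR_gt0// !ln_powR.
Qed.

Lemma mx_norm_le (x : E) (r : R) : 0 <= r -> (forall i, `|x ord0 i| <= r) -> `|x| <= r.
Proof.
move=> r0 xr; rewrite -[`|x|]/(mx_norm x) mx_normrE; apply: bigmax_le => // -[i j] _ /=.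
by rewrite (ord1 i).
Qed.

Lemma continuous_sqnB (x : E) : continuous (fun y : E => sqn (y - x)).
Proof.
apply: continuous_sumr => i; rewrite (_ : (fun y : E => _) =
  (fun s => (s - x ord0 i) ^+ 2) \o (fun y : E => y ord0 i)); last first.
  by apply/funext => y; rewrite /= !mxE.
move=> y; apply: continuous_comp; first exact: coord_continuous.
apply: (@continuous_comp _ _ _ (fun s => s - x ord0 i) (fun s => s ^+ 2)).
  by apply: cvgB; [exact: cvg_id|exact: cvg_cst].
exact: exprn_continuous.
Qed.

Lemma compact_ball_sqn (x : E) (r : R) : compact [set y : E | sqn (y - x) <= r].
Proof.
apply: bounded_closed_compact.
  exists (Num.sqrt r + `|x|); split; first exact: num_real.
  move=> M rM y /= yr; apply: ltW; apply: le_lt_trans rM.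
  rewrite -{1}(subrK x y); apply: le_trans (ler_normD _ _) _; rewrite lerD2r.
  apply: mx_norm_le; first exact: sqrtr_ge0.
  move=> i; apply: le_trans (coord_le_enorm _ i) _.
  by rewrite enormE ler_sqrt ?sqn_ge0//; apply: le_trans yr; exact: sqn_ge0.
rewrite (_ : [set _ | _] = (fun y => sqn (y - x)) @^-1` [set z | z <= r])//.
apply: preimage_closed; last exact: closed_le.
by move=> y _; exact: continuous_sqnB.
Qed.

Lemma gs_continuous t (x : E) : 0 < t -> continuous (fun y : E => gs t (y - x)).
Proof.
move=> t0; have [L L0 H] := @gaussp_lipschitz R n t t0.
have z0 := @gsZ_gt0 R n t t0.
have gE (y : E) : gs t y = (@gsZ R n t) * gaussp t y.
  by rewrite gausspE mulrCA mulfV ?mulr1// gt_eqF.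
apply: (@lipschitz_continuous_rV R n _ ((@gsZ R n t) * L)) => [|y z].
  by rewrite mulr_ge0// ltW.
rewrite !gE -mulrBr normrM gtr0_norm// -mulrA ler_pM2l//.
by have := H (y - x) (z - x); rewrite opprB addrA subrK.
Qed.

Lemma prox_max F M t x : 0 < t -> (forall y, 0 < F y) -> (forall y, F y <= M) ->
  continuous F ->
  exists p, forall y, F y * gs t (y - x) <= F p * gs t (p - x).
Proof.
(* Beyond squared distance [r] the Gaussian factor is at most F x / M, because exp s >= s; no value
   out there exceeds the one at [x]. *)
move=> t0 F0 FM cF; pose r := 2 * t * (M / F x).
have M0 : 0 < M by apply: lt_le_trans (FM x).
have r0 : 0 <= r by rewrite !mulr_ge0// ?invr_ge0 ltW.
have [||p] := @compact_EVT_max _ R (fun y => F y * gs t (y - x)) _ _ (@compact_ball_sqn x r).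
- by exists x; rewrite /= subrr /sqn big1// => i _; rewrite mxE expr0n.
- by apply: continuous_subspaceT => y; exact: (cvgM (cF y) (@gs_continuous t x t0 y)).
rewrite inE => pr pmax; exists p => y.
have [yr|yr] := leP (sqn (y - x)) r; first by apply: pmax; rewrite inE.
apply: (@le_trans _ _ (F x * gs t (x - x))); last first.
  by apply: pmax; rewrite inE /= subrr /sqn big1// => i _; rewrite mxE expr0n.
rewrite subrr {2}/gs (_ : sqn 0 = 0) ?mul0r ?oppr0 ?expR0 ?mulr1; last first.
  by rewrite /sqn big1// => i _; rewrite mxE expr0n.
apply: (@le_trans _ _ (M * gs t (y - x))); first by rewrite ler_pM2r ?gs_gt0.
rewrite /gs expRN ler_pdivrMr ?expR_gt0// mulrC -ler_pdivrMr//.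
apply: le_trans (expR_ge1Dx _); rewrite ler_wpDl// ler_pdivlMr ?mulr_gt0//.
by rewrite mulrC ltW.
Qed.

(** First-order condition for [p] to maximize F(y) exp(- |y - x|^2 / (2 t)): ln F lies below the
    affine function that agrees with it at p and has slope (p - x) / t. *)
Definition prox_of t F (x p : E) := forall y,
  F y <= F p * expR (dot (p - x) (y - p) / t).

(** Compare the maximizer p with p + l (y - p). Log-concavity bounds the change of ln F below by a
    term linear in l, and the Gaussian changes by a linear term and one of order l^2; divide by l
    and let l tend to 0. *)
Lemma prox_exists F M t x : 0 < t -> (forall y, 0 < F y) -> (forall y, F y <= M) ->
  continuous F -> logconcave F -> exists p, prox_of t F x p.
Proof.
move=> t0 F0 FM cF lcF; have [p pmax] := prox_max x t0 F0 FM cF.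
exists p => y.
suff H : ln (F y) - ln (F p) <= dot (p - x) (y - p) / t.
  rewrite -ler_ln ?posrE ?mulr_gt0 ?expR_gt0// lnM ?posrE ?expR_gt0// expRK; lra.
have H l : 0 < l -> l < 1 ->
    ln (F y) - ln (F p) <= dot (p - x) (y - p) / t + l * (sqn (y - p) / (2 * t)).
  move=> l0 l1.
  have yl : (1 - l) *: p + l *: y = p + l *: (y - p).
    by rewrite scalerBl scale1r scalerBr addrAC -addrA addrC.
  have := logconcave_ln p y F0 lcF l0 l1; rewrite yl => h1.
  have := pmax (p + l *: (y - p)); rewrite -ler_ln ?posrE ?mulr_gt0 ?gs_gt0//.
  have E1 : p + l *: (y - p) - x = (p - x) + l *: (y - p) by rewrite addrAC.
  rewrite !lnM ?posrE ?gs_gt0// /gs !expRK E1 (sqnD (p - x)) dotZr sqnZ => h2.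
  rewrite -(ler_pM2l l0).
  have -> : l * (dot (p - x) (y - p) / t + l * (sqn (y - p) / (2 * t))) =
     (sqn (p - x) + 2 * (l * dot (p - x) (y - p)) + l ^+ 2 * sqn (y - p)) / (2 * t)
     - sqn (p - x) / (2 * t).
    by field; rewrite lt0r_neq0.
  move: h1 h2; set A := ln _; set B := ln _; set C := ln _; set D := _ / _; set D' := _ / _.
  by move=> h1 h2; clear -h1 h2; lra.
apply/ler_addgt0Pr => e e0.
pose q := sqn (y - p) / (2 * t); have q0 : 0 <= q by rewrite divr_ge0 ?sqn_ge0// mulr_ge0// ltW.
have l0 : 0 < e / (e + q + 1) by rewrite divr_gt0// -addrA ltr_wpDr// addr_ge0.
apply: le_trans (H (e / (e + q + 1)) l0 _) _.
  by rewrite ltr_pdivrMr ?mul1r; lra.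
rewrite lerD2l -/q mulrAC ler_pdivrMr; last by lra.
by rewrite ler_wpM2l ?(ltW e0)//; lra.
Qed.

(** Multiplying the two tangent inequalities, each tested at the other point, expresses the
    monotonicity of the slopes of ln F; Cauchy-Schwarz turns it into a 1-Lipschitz bound. *)
Lemma prox_nonexpansive F t x x' p p' : 0 < t -> (forall y, 0 < F y) ->
  prox_of t F x p -> prox_of t F x' p' -> enorm (p' - p) <= enorm (x' - x).
Proof.
move=> t0 F0 px px'.
have H : 0 <= dot (p - x) (p' - p) + dot (p' - x') (p - p').
  have h1 := px p'; have h2 := px' p.
  have := ler_pM (ltW (F0 _)) (ltW (F0 _)) h1 h2.
  rewrite mulrACA -expRD -[leLHS]mulr1 (mulrC (F p')) ler_pM2l ?mulr_gt0//.
  by rewrite -expR0 ler_expR -mulrDl pmulr_lge0 ?invr_gt0.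
have {}H : sqn (p' - p) <= dot (x' - x) (p' - p).
  move: H; rewrite -(opprB p' p) dotNr -dotNl -dotDl.
  have -> : p - x + - (p' - x') = (x' - x) - (p' - p).
    by apply/rowP => i; rewrite !mxE; ring.
  by rewrite dotDl dotNl -sqnE subr_ge0.
have [->|pp] := eqVneq (enorm (p' - p)) 0; first exact: enorm_ge0.
have pp0 : 0 < enorm (p' - p) by rewrite lt_def pp enorm_ge0.
rewrite -(ler_pM2r pp0); apply: le_trans (le_trans (ler_norm _) (dot_le _ _)).
by rewrite -expr2 sqr_enorm.
Qed.

End prox.

(** Normalization of a weighted average: the total weight [z] is within m2 / s of 1, hence at least
    1/2, which is the source of the factor 2. *)
Lemma doob_average_arith (R : realFieldType)
    (s a B z zU eU aU G aG m1 m2 m3 v : R) :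
  0 < s -> 0 <= a -> 0 <= B -> G = zU - eU -> `|G| <= aG ->
  aG <= (a * m3 + B * m2) / s -> `|eU| <= aU -> aU <= a * m1 + B ->
  1 - z <= m2 / s -> z <= 1 -> m2 / s <= 2^-1 -> 0 <= m2 ->
  `|(zU + v * z) / z - (eU + v)| <=
  2 / s * (a * m3 + B * m2 + m2 * (a * m1 + B)).
Proof.
move=> s0 a0 B0 E3 gEzU EzU gEU EU z1 z2 zp' m20.
have zp : 2^-1 <= z by lra.
have zn : z != 0 by rewrite gt_eqF//; lra.
have -> : (zU + v * z) / z - (eU + v) = (G + (1 - z) * eU) / z by rewrite E3; field.
rewrite normrM normfV [`|z|]gtr0_norm; last by lra.
rewrite ler_pdivrMr; last by lra.
have e1 : `|G + (1 - z) * eU| <= (a * m3 + B * m2) / s + m2 / s * (a * m1 + B).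
  apply: le_trans (ler_normD _ _) _; apply: lerD; first by apply: le_trans EzU.
  rewrite normrM ger0_norm ?subr_ge0//; apply: ler_pM => //; first by rewrite subr_ge0.
  by apply: le_trans EU.
apply: le_trans e1 _.
have e2 : (a * m3 + B * m2 + m2 * (a * m1 + B)) / s =
   (a * m3 + B * m2) / s + m2 / s * (a * m1 + B) by field; rewrite gt_eqF.
rewrite -e2.
have x0 : 0 <= (a * m3 + B * m2 + m2 * (a * m1 + B)) / s.
  rewrite e2; apply: addr_ge0; first by apply: le_trans EzU; apply: le_trans gEzU.
  by apply: mulr_ge0; [rewrite divr_ge0// ltW|apply: le_trans EU; apply: le_trans gEU].
have -> : 2 / s * (a * m3 + B * m2 + m2 * (a * m1 + B)) * z =
  (a * m3 + B * m2 + m2 * (a * m1 + B)) / s * (2 * z) by field; rewrite gt_eqF.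
by rewrite -[leLHS]mulr1 ler_wpM2l//; lra.
Qed.

(** * Averages weighted by a log-concave function *)

Section doob.
Context {R : realType} {n : nat}.
Local Notation E := 'rV[R]_n.
Local Notation mu := (@lebesgue_rV R n).
Implicit Types (s t : R).

Definition gmom t k : R := Ex t (fun y : E => enorm y ^+ k).

Lemma gdom_shift t (V : E -> R) (C : R) (p : E) : 0 < t -> measurable_fun setT V ->
  (forall y, `|V y| <= C) -> gdom t (fun y => V (p + y)).
Proof.
move=> t0 mV VC; apply: (gdom_b t0 (C := C)) => [|y]; last exact: VC.
apply: (measurableT_comp mV).
have := (@rescales_shift R n p).1; rewrite (_ : (fun x => _) = (fun y => p + y))//.
by apply/funext => y; rewrite addrC.
Qed.

(** Multiplicative form of the lower bound - |h|^2 / s for the symmetric second difference of ln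
    F. *)
Definition semiconvex s (F : E -> R) := forall p h,
  F p ^+ 2 * expR (- (sqn h / s)) <= F (p + h) * F (p - h).

Variables (F : E -> R) (s t : R).
Hypotheses (F0 : forall y, 0 < F y) (mF : measurable_fun setT F).
Hypotheses (iF : intble mu F) (scF : semiconvex s F) (s0 : 0 < s) (t0 : 0 < t).

(** Density of the weight F(p + h) [gs t (x - (p + h))] relative to the centred Gaussian in h, up to
    a constant factor. The tangent inequality at p bounds it by 1, and semiconvexity from below. *)
Let zeta (x p h : E) : R := F (p + h) / (F p * expR (dot (p - x) h / t)).

Let zeta_gt0 x p h : 0 < zeta x p h.
Proof. by rewrite divr_gt0// mulr_gt0// expR_gt0. Qed.

Let zeta_le1 x p h : prox_of t F x p -> zeta x p h <= 1.
Proof.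
move=> px; rewrite ler_pdivrMr ?mulr_gt0 ?expR_gt0// mul1r.
by have := px (p + h); rewrite addrAC subrr add0r.
Qed.

(** Semiconvexity gives zeta(h) zeta(- h) >= exp(- |h|^2 / s), and zeta(- h) <= 1. *)
Let zeta_ge x p h : prox_of t F x p -> 1 - zeta x p h <= sqn h / s.
Proof.
move=> px; have z1 := zeta_le1 (- h) px.
have zz : expR (- (sqn h / s)) <= zeta x p h * zeta x p (- h).
  rewrite /zeta mulrACA -invfM mulrACA -expRD dotNr mulNr subrr expR0 mulr1.
  rewrite ler_pdivlMr ?mulr_gt0// mulrC; apply: le_trans (scF p h).
  by rewrite expr2.
have := le_trans zz (ler_wpM2l (ltW (zeta_gt0 x p h)) z1); rewrite mulr1.
have := expR_ge1Dx (- (sqn h / s)); move=> h1 h2; rewrite lerBlDl -lerBlDr; exact: le_trans h1 h2.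
Qed.

Let measurable_shift (p : E) (f : E -> R) : measurable_fun setT f ->
  measurable_fun setT (fun y : E => f (p + y)).
Proof.
move=> mf; apply: (measurableT_comp mf).
have := (@rescales_shift R n p).1; rewrite (_ : (fun x => _) = (fun y => p + y))//.
by apply/funext => y; rewrite addrC.
Qed.

Let measurable_zeta x p : measurable_fun setT (zeta x p).
Proof.
rewrite (_ : zeta x p = fun h => F (p + h) * ((F p)^-1 * expR (- (dot (p - x) h / t)))); last first.
  by apply/funext => h; rewrite /zeta invfM expRN.
apply: measurable_funM; first exact: measurable_shift.
apply: measurable_funM => //; apply: measurableT_comp => //.
apply: measurableT_comp => //; apply: measurable_funM => //.
exact: measurable_dotl.
Qed.

(** Moving the origin to p splits the kernel into a centred Gaussian and an exponential of a linear
    function of h; [zeta] joins the latter to [F]. *)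
Let doob_shift (V : E -> R) (x p : E) : intble mu (fun y => F y * V y) ->
  conv t (fun y => F y * V y) x = F p * gs t (x - p) * Ex t (fun h => zeta x p h * V (p + h)) /\
  gdom t (fun h => zeta x p h * V (p + h)).
Proof.
move=> iFV; have [i1 ->] := convE (intble_conv x t0 iFV).
have k0 : 0 < F p * gs t (x - p) by rewrite mulr_gt0 ?gs_gt0.
have H : (fun y : E => gaussp t (x - (y + p)) * (F (y + p) * V (y + p))) =
   (fun h => F p * gs t (x - p) * (gaussp t h * (zeta x p h * V (p + h)))).
  apply/funext => h; rewrite /zeta (addrC h p).
  have -> : gaussp t (x - (p + h)) = gs t (x - p) * gaussp t h / expR (dot (p - x) h / t).
    rewrite -expRN !gausspE /gs mulrA -!expRD mulrAC -expRD; congr (expR _ / _).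
    have -> : x - (p + h) = (x - p) - h by rewrite opprD addrA.
    rewrite sqnB -(opprB p x) dotNl sqnN; move: (sqn h) (sqn _) (dot _ _) => a b c.
    by field; rewrite lt0r_neq0.
  have := F0 p; have := expR_gt0 (dot (p - x) h / t).
  move: (gs t _) (gaussp t h) (F p) (expR _) (F (p + h)) (V (p + h)) => a b c d e f d0 c0.
  by field; rewrite !lt0r_neq0.
have i2 : intble mu (fun h => F p * gs t (x - p) * (gaussp t h * (zeta x p h * V (p + h)))).
  by rewrite -H; exact: (intble_shift p (intble_conv x t0 iFV)).
have g : gdom t (fun h => zeta x p h * V (p + h)).
  have := intbleZ (F p * gs t (x - p))^-1 i2; rewrite /gdom.
  by under eq_fun do rewrite mulKf ?gt_eqF//.
split => //; rewrite ExE -(intZ _ g) -H.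
rewrite (int_shift p (intble_conv x t0 iFV)) -ExE.
by have [_ <-] := convE (intble_conv x t0 iFV).
Qed.

(** The weighted average at x is a Gaussian average at p with density [zeta], which is within |h|^2
    / s of 1. Against increments of size a |h| + B the error has order a t^(3/2) + B t, small enough
    to be summed over 1/t steps. *)
Lemma doob_average (V : E -> R) (C : R) (x p : E) (a B : R) : measurable_fun setT V ->
  (forall y, `|V y| <= C) -> prox_of t F x p -> 0 <= a -> 0 <= B ->
  (forall h, `|V (p + h) - V p| <= a * enorm h + B) -> gmom t 2 / s <= 2^-1 ->
  `|conv t (fun y => F y * V y) x / conv t F x - conv t V p| <=
  2 / s * (a * gmom t 3 + B * gmom t 2 + gmom t 2 * (a * gmom t 1 + B)).
Proof.
move=> mV VC px a0 B0 VU m2.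
have iFV : intble mu (fun y => F y * V y).
  by have := intble_mulb mV VC iF; under eq_fun do rewrite mulrC.
have [c1 g1] := doob_shift x p iFV.
have iF1 : intble mu (fun y => F y * (cst 1 : E -> R) y).
  by under eq_fun do rewrite mulr1.
have [c2 g2'] := doob_shift (V := cst 1) x p iF1.
have g2 : gdom t (zeta x p).
  by move: g2'; rewrite /gdom; under eq_fun do rewrite mulr1.
have c2' : conv t F x = F p * gs t (x - p) * Ex t (zeta x p).
  transitivity (conv t (fun y => F y * (cst 1 : E -> R) y) x).
    by congr (conv t _ x); apply/funext => y; rewrite mulr1.
  by rewrite c2; congr (_ * Ex t _); apply/funext => y; rewrite mulr1.
have [_ c3] := convE (intble_convb p t0 mV VC).
pose U h := V (p + h) - V p.
have gV := gdom_shift p t0 mV VC.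
have gU : gdom t U by apply: gdomB => //; apply: (gdom_b t0 (C := `|V p|)).
have mU : measurable_fun setT U.
  by apply: measurable_funB => //; exact: measurable_shift.
have U2C h : `|U h| <= C + C by apply: le_trans (ler_normB _ _) _; exact: lerD.
have gzU : gdom t (fun h => zeta x p h * U h).
  have -> : (fun h => zeta x p h * U h) = (fun h => zeta x p h * V (p + h) - V p * zeta x p h).
    by apply/funext => h; rewrite /U mulrBr (mulrC _ (V p)).
  by apply: gdomB => //; exact: gdomZ.
have E1 : Ex t (fun h => zeta x p h * V (p + h)) =
   Ex t (fun h => zeta x p h * U h) + V p * Ex t (zeta x p).
  rewrite -ExZ// -ExD//; last exact: gdomZ.
  by congr (Ex t _); apply/funext => h; rewrite /U mulrBr (mulrC _ (V p)) subrK.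
have E2 : Ex t (fun h => V (p + h)) = Ex t U + V p.
  rewrite -[X in _ = _ + X]mulr1 -(Ex1 t0 (n := n)) -(ExZ _ (gdom1 t0)) -ExD//.
    by congr (Ex t _); apply/funext => h; rewrite /U mulr1 subrK.
  exact: gdomZ (gdom1 t0).
have ge k : (k <= 4)%N -> gdom t (fun y : E => enorm y ^+ k) by exact: gdom_enorm.
have ge1 : gdom t (fun y : E => enorm y) by have := ge 1%N isT; under eq_fun do rewrite expr1.
have g1z : gdom t (fun h => 1 - zeta x p h) by apply: gdomB => //; exact: gdom1.
have z1 : 1 - Ex t (zeta x p) <= gmom t 2 / s.
  rewrite -[X in X - _](Ex1 t0 (n := n)) -(ExB (gdom1 t0) g2) /gmom mulrC -(ExZ _ (ge 2%N isT)).
  apply: Ex_le => //; first exact: gdomZ (ge 2%N isT).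
  by move=> h; rewrite sqr_enorm mulrC zeta_ge.
have z2 : Ex t (zeta x p) <= 1.
  rewrite -[leRHS](Ex1 t0 (n := n)); apply: Ex_le => //; first exact: gdom1.
  by move=> h; exact: zeta_le1.
have EU : Ex t (fun h => `|U h|) <= a * gmom t 1 + B.
  have gB : gdom t (fun _ : E => B * 1) by exact: gdomZ (gdom1 t0).
  have -> : a * gmom t 1 + B = Ex t (fun h : E => a * enorm h ^+ 1 + B * 1).
    by rewrite (ExD (gdomZ a (ge 1%N isT)) gB) (ExZ _ (ge 1%N isT)) (ExZ _ (gdom1 t0)) Ex1// mulr1.
  apply: Ex_le => //; [exact: gdom_norm|exact: gdomD (gdomZ a (ge 1%N isT)) gB|].
  by move=> h; rewrite expr1 mulr1; exact: VU.
have gzU1 : gdom t (fun h => (zeta x p h - 1) * U h).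
  have -> : (fun h => (zeta x p h - 1) * U h) = (fun h => zeta x p h * U h - U h).
    by apply/funext => h; rewrite mulrBl mul1r.
  exact: gdomB.
have EzU : Ex t (fun h => `|(zeta x p h - 1) * U h|) <= (a * gmom t 3 + B * gmom t 2) / s.
  have gR : gdom t (fun h : E => s^-1 * (a * enorm h ^+ 3 + B * enorm h ^+ 2)).
    by apply: gdomZ; apply: gdomD; apply: gdomZ; exact: ge.
  have -> : (a * gmom t 3 + B * gmom t 2) / s =
      Ex t (fun h : E => s^-1 * (a * enorm h ^+ 3 + B * enorm h ^+ 2)).
    rewrite ExZ; last by apply: gdomD; apply: gdomZ; exact: ge.
    by rewrite ExD ?ExZ//; [rewrite mulrC| exact: ge|exact: ge|apply: gdomZ; exact: ge..].
  apply: Ex_le => //; first exact: gdom_norm.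
  move=> h; have z1h : 0 <= 1 - zeta x p h by rewrite subr_ge0; exact: zeta_le1.
  rewrite normrM -(normrN (_ - 1)) opprB (ger0_norm z1h).
  apply: (@le_trans _ _ (sqn h / s * (a * enorm h + B))).
    by apply: ler_pM; [exact: z1h|exact: normr_ge0|exact: zeta_ge|exact: VU].
  rewrite -sqr_enorm le_eqVlt; apply/orP; left; apply/eqP.
  by move: (enorm h) => u; rewrite !exprS expr0; ring.
have k0 : 0 < F p * gs t (x - p) by rewrite mulr_gt0 ?gs_gt0.
rewrite c1 c2' c3 E1 E2 -mulf_div divff ?gt_eqF// mul1r.
have gEU := Ex_norm t0 gU.
have gEzU := Ex_norm t0 gzU1.
have E3 : Ex t (fun h => (zeta x p h - 1) * U h) = Ex t (fun h => zeta x p h * U h) - Ex t U.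
  rewrite -ExB//; congr (Ex t _); apply/funext => h; ring.
have m20 : 0 <= gmom t 2 by apply: Ex_ge0 => // h; rewrite exprn_ge0// enorm_ge0.
exact: doob_average_arith E3 gEzU EzU gEU EU z1 z2 m2 m20.
Qed.

End doob.

(** * Iterating the weighted average over many short steps *)

(** Discrete Gronwall bound for the accumulated error. *)
Lemma geometric_error (R : realFieldType) (D L tau q : R) (B : nat -> R) :
  0 <= D -> 0 <= L -> 0 <= tau -> 0 <= q -> B 0%N = 0 ->
  (forall j, B j.+1 = (1 + L * tau) * B j + D * q) ->
  forall j, 0 <= B j <= j%:R * D * q * (1 + L * tau) ^+ j.
Proof.
move=> D0 L0 t0 q0 B0 BS; have r1 : 1 <= 1 + L * tau by rewrite lerDl mulr_ge0.
have r0 : 0 <= 1 + L * tau by apply: le_trans r1.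
elim=> [|j /andP[ih0 ih]]; first by rewrite B0 !mul0r lexx.
rewrite BS addr_ge0 ?mulr_ge0//=.
have -> : j.+1%:R * D * q * (1 + L * tau) ^+ j.+1 =
    (1 + L * tau) * (j%:R * D * q * (1 + L * tau) ^+ j) + D * q * (1 + L * tau) ^+ j.+1.
  by rewrite exprS -natr1; ring.
apply: lerD; first by rewrite ler_wpM2l.
by rewrite -[leLHS]mulr1 ler_wpM2l ?mulr_ge0// exprn_ege1.
Qed.

Lemma coupling_arith (R : realFieldType) (X X' u v k l B e : R) :
  `|X - u| <= e -> `|X' - v| <= e -> u - v <= k + B -> k <= l ->
  X - X' <= l + B + 2 * e.
Proof. by rewrite !ler_norml; lra. Qed.

(** Removes from an inequality an error of order sqrt(eps / (K + 1)), the number of steps K being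
    arbitrarily large. *)
Lemma le_sqrt_small (R : realType) (x y c eps b : R) : 0 <= c -> 0 < eps ->
  (forall K : nat, b <= K.+1%:R -> x <= y + c * Num.sqrt (eps / K.+1%:R)) -> x <= y.
Proof.
move=> c0 e0 H; apply/ler_addgt0Pr => e ep.
pose B := Num.max b (eps * (c / e) ^+ 2); pose K := Num.bound B.
have BK : B <= K.+1%:R.
  apply: le_trans (ler_norm _) _; apply: le_trans (ltW (archi_boundP (normr_ge0 B))) _.
  by rewrite ler_nat; apply: leqW; rewrite /K /Num.bound normr_id.
have bK : b <= K.+1%:R by apply: le_trans BK; rewrite le_max lexx.
have eK : eps * (c / e) ^+ 2 <= K.+1%:R by apply: le_trans BK; rewrite le_max lexx orbT.
apply: le_trans (H K bK) _; rewrite lerD2l.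
have K0 : 0 < K.+1%:R :> R by rewrite ltr0n.
rewrite -[leRHS]ger0_norm ?(ltW ep)// -sqrtr_sqr -[c in leLHS]ger0_norm// -sqrtr_sqr.
rewrite -sqrtrM ?sqr_ge0// ler_wsqrtr// mulrA ler_pdivrMr// mulrC.
rewrite -ler_pdivrMl ?exprn_gt0//; move: eK; rewrite expr_div_n.
by rewrite mulrA (mulrC (e ^+ 2)^-1).
Qed.

Lemma doob_small (R : realFieldType) (eps g s k : R) : 0 < s -> 0 < k ->
  2 * (eps * g / s) <= k -> eps / k * g / s <= 2^-1.
Proof.
move=> s0 k0 H; have -> : eps / k * g / s = (eps * g / s) / k.
  by field; rewrite !gt_eqF.
by rewrite ler_pdivrMr//; lra.
Qed.

Section doob_iteration.
Context {R : realType} {n : nat}.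
Local Notation E := 'rV[R]_n.
Local Notation mu := (@lebesgue_rV R n).
Implicit Types (s t : R).
Variable i0 : 'I_n.

Definition doob_weight s (F : E -> R) := [/\ forall y, 0 < F y,
  exists M, forall y, F y <= M, continuous F, intble mu F &
  logconcave F /\ semiconvex s F].

(** Both weighted averages are replaced by Gaussian averages at the proximal points, at the cost of
    two errors. Reflection coupling compares these averages, and the proximal points are no farther
    apart than x and x', so monotonicity of [opw] concludes. *)
Lemma doob_step s t (F V : E -> R) (C Cw a B : R) w :
  0 < s -> 0 < t -> doob_weight s F -> measurable_fun setT V ->
  (forall y, `|V y| <= C) -> modulus_ok Cw a w -> 0 <= B ->
  (forall y y', V y - V y' <= w (enorm (y - y')) + B) ->
  @gmom R n t 2 / s <= 2^-1 ->
  forall x x', conv t (fun y => F y * V y) x / conv t F x -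
    conv t (fun y => F y * V y) x' / conv t F x' <=
  opw i0 t w (enorm (x - x')) + B + 2 * (2 / s * (a * @gmom R n t 3 +
   B * @gmom R n t 2 + @gmom R n t 2 * (a * @gmom R n t 1 + B))).
Proof.
move=> s0 t0 [F0 [M FM] cF iF [lcF scF]] mV VC wok B0 Vw m2 x x'.
have mF : measurable_fun setT F by exact: continuous_measurable_rV.
have [p px] := prox_exists x t0 F0 FM cF lcF.
have [p' px'] := prox_exists x' t0 F0 FM cF lcF.
have [wN wm wC a0 wL] := wok.
have w0 : w 0 = 0 by have := wN 0; rewrite oppr0; lra.
have VU q h : `|V (q + h) - V q| <= a * enorm h + B.
  have wa : w (enorm h) <= a * enorm h.
    by have := wL (enorm h) 0; rewrite w0 !subr0 (ger0_norm (enorm_ge0 h)); apply: le_trans; exact: ler_norm.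
  have h1 := Vw (q + h) q; have h2 := Vw q (q + h).
  move: h1 h2; rewrite (enormBC q) (_ : q + h - q = h); last by rewrite addrAC subrr add0r.
  by rewrite ler_norml; move: (V (q + h)) (V q) => u v; lra.
have h1 := doob_average F0 iF scF s0 t0 mV VC px a0 B0 (VU p) m2.
have h2 := doob_average F0 iF scF s0 t0 mV VC px' a0 B0 (VU p') m2.
have h3 := reflection_coupling i0 p' p t0 wok B0 mV VC Vw.
have [_ okm _ _ _] := opw_ok i0 t0 wok.
have h4 : opw i0 t w (enorm (p - p')) <= opw i0 t w (enorm (x - x')).
  by apply: okm; exact: prox_nonexpansive t0 F0 px' px.
exact: coupling_arith h1 h2 h3 h4.
Qed.

(** Cauchy-Schwarz for the square roots of the two integrands: by the parallelogram law, the product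
    of the kernels centred at p + h and p - h is exp(- |h|^2 / t) times the square of the kernel
    centred at p. *)
Lemma conv_semiconvex t (f : E -> R) : 0 < t -> intble mu f -> (forall y, 0 <= f y) ->
  semiconvex t (conv t f).
Proof.
move=> t0 fi f0 p h.
have g0 (z : E) : 0 <= gaussp t z by exact: gaussp_ge0.
pose u y := Num.sqrt (gaussp t (p + h - y) * f y).
pose v y := Num.sqrt (gaussp t (p - h - y) * f y).
have u2 y : u y ^+ 2 = gaussp t (p + h - y) * f y by rewrite sqr_sqrtr// mulr_ge0.
have v2 y : v y ^+ 2 = gaussp t (p - h - y) * f y by rewrite sqr_sqrtr// mulr_ge0.
have gg y : gaussp t (p + h - y) * gaussp t (p - h - y) =
    (expR (- (sqn h / (2 * t))) * gaussp t (p - y)) ^+ 2.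
  rewrite !gausspE mulrACA -invfM mulrA exprMn exprVn -!expr2; congr (_ / _).
  rewrite -expRD -expRD -expRM_natl; congr expR.
  have -> : p + h - y = (p - y) + h by rewrite addrAC.
  have -> : p - h - y = (p - y) - h by rewrite addrAC.
  rewrite (sqnD (p - y)) (sqnB (p - y)).
  move: (sqn (p - y)) (sqn h) (dot _ _) => b c d.
  by field; rewrite lt0r_neq0.
have uv y : u y * v y = expR (- (sqn h / (2 * t))) * (gaussp t (p - y) * f y).
  have gf q : 0 <= gaussp t (q - y) * f y by exact: mulr_ge0 (g0 _) (f0 _).
  rewrite /u /v -sqrtrM; last exact: gf.
  have -> : gaussp t (p + h - y) * f y * (gaussp t (p - h - y) * f y) =
     (expR (- (sqn h / (2 * t))) * (gaussp t (p - y) * f y)) ^+ 2.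
    by rewrite mulrACA gg -expr2 -exprMn mulrA.
  rewrite sqrtr_sqr ger0_norm//; apply: mulr_ge0; [exact: expR_ge0|exact: gf].
clearbody u v.
have iu : intble mu (fun y => u y ^+ 2).
  by rewrite (funext u2); exact: intble_conv.
have iv : intble mu (fun y => v y ^+ 2).
  by rewrite (funext v2); exact: intble_conv.
have iuv : intble mu (fun y => u y * v y).
  by rewrite (funext uv); apply: intbleZ; exact: intble_conv.
have := cauchy_schwarz iu iv iuv.
rewrite (congr1 (int mu) (funext u2)) (congr1 (int mu) (funext v2)) (congr1 (int mu) (funext uv)).
rewrite intZ -?convdefE; last exact: intble_conv.
apply: le_trans; rewrite exprMn mulrC ler_wpM2r ?sqr_ge0//.
rewrite -expRM_natl le_eqVlt; apply/orP; left; apply/eqP; congr expR.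
by field; rewrite lt0r_neq0.
Qed.

Lemma semiconvex_le s t (F : E -> R) : 0 < s -> s <= t -> semiconvex t F -> semiconvex s F.
Proof.
move=> s0 st sF p h; apply: le_trans (sF p h); rewrite ler_wpM2l ?sqr_ge0//.
rewrite ler_expR lerN2 ler_wpM2l ?sqn_ge0// lef_pV2 ?posrE//.
by apply: lt_le_trans st.
Qed.

Lemma conv_doob_weight s t (f : E -> R) (D : set E) : 0 < s -> s <= t ->
  intble mu f -> (forall y, 0 <= f y) -> measurable D -> (0 < mu D)%E ->
  (forall y, D y -> 0 < f y) -> logconcave (conv t f) -> doob_weight s (conv t f).
Proof.
move=> s0 st fi f0 mD D0 fD lc; have t0 : 0 < t by apply: lt_le_trans st.
split.
- move=> y; rewrite convdefE; apply: (int_gt0 (D := D)) => //.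
  + exact: intble_conv.
  + by move=> z; rewrite mulr_ge0 ?gaussp_ge0.
  + by move=> z Dz; rewrite mulr_gt0 ?gaussp_gt0// fD.
- exists ((@gsZ R n t)^-1 * int mu (fun y => `|f y|)) => y.
  by apply: le_trans (conv_norm_le _ t0 fi); exact: ler_norm.
- have [L L0 H] := @conv_lipschitz R n t t0.
  apply: (@lipschitz_continuous_rV R n _ (L * int mu (fun z => `|f z|))) => [|x y].
    by rewrite mulr_ge0// int_ge0.
  exact: H.
- exact: intble_convT.
- split => //; apply: semiconvex_le s0 st _; exact: conv_semiconvex.
Qed.

Lemma iter_conv tau (f : E -> R) j : 0 < tau -> intble mu f ->
  iter j.+1 (conv tau) f = conv (j.+1%:R * tau) f.
Proof.
move=> t0 fi; elim: j => [|j ih]; first by rewrite mul1r.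
rewrite iterS ih; apply/funext => x.
have jt : 0 < j.+1%:R * tau by rewrite mulr_gt0.
rewrite (conv_semigroup _ t0 jt fi); congr (conv _ f x).
by rewrite -[in RHS]natr1; ring.
Qed.

Variables (s : R) (phi : E -> R) (D : set E).
Hypotheses (s0 : 0 < s) (iphi : intble mu phi) (phi0 : forall y, 0 <= phi y).
Hypotheses (mD : measurable D) (D0 : (0 < mu D)%E) (phiD : forall y, D y -> 0 < phi y).
Hypothesis lcphi : forall t, 0 < t -> logconcave (conv t phi).

Let F := conv s phi.
Variables (V : E -> R) (C Cw a : R) (w : R -> R).
Hypotheses (mV : measurable_fun setT V) (VC : forall y, `|V y| <= C).
Hypotheses (wok : modulus_ok Cw a w).
Hypothesis Vw : forall y y', V y - V y' <= w (enorm (y - y')).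

Let gm k : R := @gmom R n 1 k.
(** With moments scaled to time 1, a step of length tau adds errD tau^(3/2) + errL tau B to the
    previous error B. *)
Let errD : R := 4 / s * a * (gm 3 + gm 2 * gm 1).
Let errL : R := 8 / s * gm 2.

Let gm_ge0 k : 0 <= gm k.
Proof. by apply: Ex_ge0 => // y; rewrite exprn_ge0// enorm_ge0. Qed.

Let gmomE t k : 0 < t -> (k <= 4)%N -> @gmom R n t k = Num.sqrt t ^+ k * gm k.
Proof. by move=> t0 k4; exact: Ex_enorm. Qed.

Let Fj tau j := iter j (conv tau) F.
Let Nj tau j := iter j (conv tau) (fun y => F y * V y).
Let Bj tau := fix B j : R := if j is j'.+1 then
  (1 + errL * tau) * B j' + errD * (tau * Num.sqrt tau) else 0.

Let FjE tau j : 0 < tau -> Fj tau j = conv (s + j%:R * tau) phi.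
Proof.
move=> t0; elim: j => [|j ih]; first by rewrite mul0r addr0.
rewrite /Fj iterS -/(Fj tau j) ih; apply/funext => x.
have jt : 0 < s + j%:R * tau by rewrite ltr_pwDl// mulr_ge0// ltW.
rewrite (conv_semigroup _ t0 jt iphi); congr (conv _ phi x).
by rewrite -natr1; ring.
Qed.

Let Fj_weight tau j : 0 < tau -> doob_weight s (Fj tau j).
Proof.
move=> t0; rewrite FjE//; have h : 0 <= j%:R * tau by rewrite mulr_ge0// ltW.
apply: (conv_doob_weight (D := D)) => //; first by rewrite lerDl.
by apply: lcphi; rewrite ltr_pwDl.
Qed.

(** After j steps the quotient is again bounded with a modulus in the same class, and the weight is
    the convolution of [phi] at time s + j tau, still semiconvex at scale [s]; so [doob_step]
    applies with the same constants each time. *)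
Let iteration tau j : 0 < tau -> @gmom R n tau 2 / s <= 2^-1 ->
  [/\ measurable_fun setT (fun y => Nj tau j y / Fj tau j y),
   (forall y, `|Nj tau j y / Fj tau j y| <= C), intble mu (Nj tau j) &
   exists2 wj, modulus_ok Cw a wj /\
   (forall r, wj r = if j is 0%N then w r else opw i0 (j%:R * tau) w r) &
   forall x x', Nj tau j x / Fj tau j x - Nj tau j x' / Fj tau j x' <=
     wj (enorm (x - x')) + Bj tau j].
Proof.
move=> t0 m2.
have eL : 0 <= errL by rewrite !mulr_ge0// ?invr_ge0// ltW.
have eD : 0 <= errD.
  by have [_ _ _ a0 _] := wok; rewrite !mulr_ge0 ?addr_ge0 ?mulr_ge0// ?invr_ge0// ltW.
have B0 i : 0 <= Bj tau i.
  have := @geometric_error R errD errL tau (tau * Num.sqrt tau) (Bj tau) eD eL (ltW t0).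
  by move=> /(_ (mulr_ge0 (ltW t0) (sqrtr_ge0 _)) erefl (fun _ => erefl) i)/andP[].
have VF0 : (fun y => Nj tau 0 y / Fj tau 0 y) = V.
  apply/funext => y; rewrite /Nj /Fj /= mulrAC mulfV ?mul1r// gt_eqF//.
  by have [+ _ _ _ _] := Fj_weight 0 t0; exact.
have mF i : measurable_fun setT (Fj tau i).
  by have [_ _ cF _ _] := Fj_weight i t0; exact: continuous_measurable_rV.
elim: j => [|j [ih1 ih2 ih3 [wj [wjok wjE] ih4]]].
  have VE y : Nj tau 0 y / Fj tau 0 y = V y by rewrite -[RHS](congr1 (@^~ y) VF0).
  split; first by rewrite VF0.
  - by move=> y; rewrite VE.
  - have [_ _ _ iF _] := Fj_weight 0 t0.
    by have := intble_mulb mV VC iF; under eq_fun do rewrite mulrC.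
  - by exists w => // x x'; rewrite !VE addr0.
have [F0 _ _ iF _] := Fj_weight j t0.
have [F0' _ _ _ _] := Fj_weight j.+1 t0.
have FV : (fun y => Fj tau j y * (Nj tau j y / Fj tau j y)) = Nj tau j.
  by apply/funext => y; rewrite mulrCA mulfV ?mulr1// gt_eqF.
have iN : intble mu (Nj tau j.+1) by exact: intble_convT.
have NF y : `|Nj tau j y| <= C * Fj tau j y.
  by have := ih2 y; rewrite normrM normfV (gtr0_norm (F0 y)) ler_pdivrMr.
split => //.
- apply: measurable_funM; first exact: intble_mfun iN.
  have mFi := mF j.+1.
  rewrite (_ : (fun x => (Fj tau j.+1 x)^-1) = (fun x => (Fj tau j.+1 x) `^ (-1))).
    exact: (measurableT_comp (measurable_powR (-1)) mFi).
  by apply/funext => y; rewrite powR_inv1//; exact: ltW (F0' y).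
- move=> y; rewrite normrM normfV (gtr0_norm (F0' y)) ler_pdivrMr//.
  rewrite [Nj _ _ _]convdefE [Fj _ _ _]convdefE -intZ; last exact: intble_conv.
  apply: int_norm_le; [exact: intble_conv|apply: intbleZ; exact: intble_conv|].
  by move=> z; rewrite normrM gaussp_norm// mulrCA ler_wpM2l// gaussp_ge0.
- exists (opw i0 tau wj).
    split; first exact: opw_ok.
    move=> r; case: j wjE {ih1 ih2 ih3 ih4 F0 iF F0' FV iN NF} => [|j] wjE.
      by rewrite mul1r; congr opw; apply/funext => z; exact: wjE.
    have -> : wj = opw i0 (j.+1%:R * tau) w by apply/funext => z; exact: wjE.
    have jt : 0 < j.+1%:R * tau by rewrite mulr_gt0.
    apply: etrans (opw_semigroup i0 r t0 jt wok) _.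
    by congr (opw i0 _ w r); rewrite -[in RHS]natr1; ring.
  move=> x x'.
  have := doob_step s0 t0 (Fj_weight j t0) ih1 ih2 wjok (B0 j) ih4 m2 x x'.
  rewrite FV => /le_trans; apply; rewrite -addrA lerD2l.
  rewrite !gmomE// expr1 sqr_sqrtr ?(ltW t0)//.
  have -> : Num.sqrt tau ^+ 3 = tau * Num.sqrt tau.
    by rewrite exprSr sqr_sqrtr ?(ltW t0).
  rewrite /= -/(Bj tau) /errD /errL le_eqVlt; apply/orP; left; apply/eqP.
  move: (Bj tau j) (Num.sqrt tau) => u v; field.
  by rewrite gt_eqF.
Qed.

(** Cut [eps] into K + 1 equal steps of length tau. Weight times quotient is the next numerator up
    to convolution, so the steps compose to convolutions at time [eps], while the total error is
    O(sqrt(tau)). *)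
Lemma doob_modulus eps : 0 < eps -> forall x x',
  conv eps (fun y => F y * V y) x / conv eps F x -
  conv eps (fun y => F y * V y) x' / conv eps F x' <= opw i0 eps w (enorm (x - x')).
Proof.
move=> e0 x x'; have [_ _ _ a0 _] := wok.
have eL : 0 <= errL by rewrite !mulr_ge0// ?invr_ge0// ltW.
have eD : 0 <= errD.
  by rewrite !mulr_ge0 ?addr_ge0 ?mulr_ge0// ?invr_ge0// ltW.
(* The threshold [b] ensures that the second moment over one step is at most s / 2, as [doob_step]
   demands. *)
apply: (le_sqrt_small (c := errD * eps * expR (errL * eps)) (b := 2 * (eps * gm 2 / s)) _ e0).
  by rewrite mulr_ge0 ?expR_ge0// mulr_ge0// ltW.
move=> K bK; pose tau := eps / K.+1%:R; rewrite -/tau.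
have K0 : 0 < K.+1%:R :> R by rewrite ltr0n.
have t0 : 0 < tau by rewrite divr_gt0.
have KT : K.+1%:R * tau = eps by rewrite /tau mulrCA mulfV ?mulr1// gt_eqF.
have m2 : @gmom R n tau 2 / s <= 2^-1.
  rewrite gmomE// sqr_sqrtr ?(ltW t0)//.
  by apply: doob_small bK.
clearbody tau.
have [_ _ _ [wK [_ wKE] H]] := iteration K.+1 t0 m2.
have [F0 _ _ iF _] := Fj_weight 0 t0.
have iN : intble mu (fun y => F y * V y).
  by have := intble_mulb mV VC iF; under eq_fun do rewrite mulrC.
have FK : Fj tau K.+1 = conv eps F by rewrite /Fj (iter_conv K t0 iF) KT.
have NK : Nj tau K.+1 = conv eps (fun y => F y * V y) by rewrite /Nj (iter_conv K t0 iN) KT.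
move: (H x x'); rewrite FK NK wKE KT => /le_trans; apply; rewrite lerD2l.
have := @geometric_error R errD errL tau (tau * Num.sqrt tau) (Bj tau) eD eL (ltW t0).
move=> /(_ (mulr_ge0 (ltW t0) (sqrtr_ge0 _)) erefl (fun _ => erefl) K.+1)/andP[_] /le_trans; apply.
have -> : K.+1%:R * errD * (tau * Num.sqrt tau) * (1 + errL * tau) ^+ K.+1 =
   errD * (K.+1%:R * tau) * (1 + errL * tau) ^+ K.+1 * Num.sqrt tau.
  move: (Num.sqrt tau) ((1 + errL * tau) ^+ K.+1) => u v; ring.
rewrite KT; apply: ler_wpM2r; first exact: sqrtr_ge0.
apply: ler_wpM2l; first exact: mulr_ge0 eD (ltW e0).
have -> : errL * eps = K.+1%:R * (errL * tau) by rewrite -KT mulrCA.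
rewrite expRM_natl.
have t1 : 0 <= 1 + errL * tau by rewrite addr_ge0// mulr_ge0// ltW.
by rewrite ler_pXn2r ?nnegrE ?expR_ge0//; exact: expR_ge1Dx.
Qed.

End doob_iteration.

(** * Taylor estimates and the sine modulus *)

Lemma derive_lipschitz_segment (R : realType) (f df : R -> R) (L b : R) :
  (forall x : R, is_derive x 1 f (df x)) ->
  (forall x, `|x| <= `|b| -> `|df x| <= L) -> `|f b - f 0| <= L * `|b|.
Proof.
move=> fd dL; have cf : continuous f by exact: is_derive_continuous fd.
have [b0|b0|->] := ltgtP b 0; last by rewrite subrr !normr0 mulr0.
- have [|c cb] := @MVT R f df b 0 b0 (fun x _ => fd x); first exact: continuous_subspaceT.
  rewrite distrC => ->; rewrite sub0r normrM normrN ler_wpM2r//; apply: dL.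
  move: cb; rewrite in_itv/= => /andP[h1 h2].
  by rewrite !ltr0_norm// lerN2 ltW.
- have [|c cb] := @MVT R f df 0 b b0 (fun x _ => fd x); first exact: continuous_subspaceT.
  move=> ->; rewrite subr0 normrM ler_wpM2r//; apply: dL.
  move: cb; rewrite in_itv/= => /andP[h1 h2].
  by rewrite !gtr0_norm// ltW.
Qed.

Lemma taylor3 (R : realType) (f0 f1 f2 f3 : R -> R) (M t : R) :
  (forall x : R, is_derive x 1 f0 (f1 x)) -> (forall x : R, is_derive x 1 f1 (f2 x)) ->
  (forall x : R, is_derive x 1 f2 (f3 x)) ->
  (forall x, `|x| <= `|t| -> `|f3 x| <= M) ->
  `|f0 t - f0 0 - t * f1 0 - t ^+ 2 / 2 * f2 0| <= M * `|t| ^+ 3.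
Proof.
move=> d0 d1 d2 h3.
have h2 x : `|x| <= `|t| -> `|f2 x - f2 0| <= M * `|t|.
  move=> xt; apply: le_trans (derive_lipschitz_segment d2 (L := M) _) _.
    by move=> y yx; apply: h3; exact: le_trans yx xt.
  by rewrite ler_wpM2l//; apply: le_trans (h3 0 _); rewrite ?normr0.
have h1 x : `|x| <= `|t| -> `|f1 x - f1 0 - x * f2 0| <= M * `|t| ^+ 2.
  move=> xt; have D (y : R) : is_derive y 1 (fun x => f1 x - f1 0 - x * f2 0) (f2 y - f2 0).
    by apply: is_derive_eq; rewrite /GRing.scale/= subr0 mulr0 mulr1 add0r.
  have := @derive_lipschitz_segment R _ _ (M * `|t|) x D.
  rewrite subrr mul0r subr0 subr0 => H; apply: le_trans (H _) _.
    by move=> y yx; apply: h2; exact: le_trans yx xt.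
  rewrite expr2 mulrA ler_wpM2l// mulr_ge0//.
  by apply: le_trans (h3 0 _); rewrite ?normr0.
have D (y : R) : is_derive y 1 (fun x => f0 x - f0 0 - x * f1 0 - x ^+ 2 / 2 * f2 0)
    (f1 y - f1 0 - y * f2 0).
  apply: is_derive_eq; rewrite /GRing.scale/=.
  by field.
have := @derive_lipschitz_segment R _ _ (M * `|t| ^+ 2) t D h1.
rewrite subrr !mul0r !subr0 expr0n /= !mul0r !subr0 => /le_trans; apply.
by rewrite -mulrA -exprSr.
Qed.

Lemma cos_le_taylor (R : realType) (x : R) : cos x <= 1 - x ^+ 2 / 2 + `|x| ^+ 3.
Proof.
have d1 (y : R) : is_derive y 1 (fun x : R => - sin x) (- cos y) by exact: is_deriveN.
have d2 (y : R) : is_derive y 1 (fun x : R => - cos x) (sin y).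
  by apply: is_derive_eq; rewrite opprK.
have s1 (y : R) : `|y| <= `|x| -> `|sin y| <= 1 by move=> _; rewrite ler_norml sin_geN1 sin_le1.
have := taylor3 (@is_derive_cos R) d1 d2 s1.
rewrite sin0 cos0 oppr0 mulr0 subr0 mul1r mulrN1 opprK ler_norml => /andP[_].
by move: (cos x) (`|x| ^+ 3) => u v; lra.
Qed.

Lemma sin_ge_linear (R : realType) (c x : R) : 0 <= x -> x <= c -> c <= pi ->
  cos c * x <= sin x.
Proof.
move=> x0 xc cp; move: x0; rewrite le_eqVlt => /orP[/eqP<-|x0].
  by rewrite mulr0 sin0.
have [|y yx] := @MVT R sin cos 0 x x0 (fun y _ => is_derive_sin y).
- by apply: continuous_subspaceT; exact: continuous_sin.
- rewrite sin0 !subr0 => ->; rewrite ler_pM2r//.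
  move: yx; rewrite in_itv/= => /andP[y0 yx].
  apply: ltW; rewrite ltr_cos ?in_itv/=; [exact: lt_le_trans xc|lra|lra].
Qed.

Lemma clampN (R : realDomainType) (c r : R) : 0 <= c ->
  Num.max (- c) (Num.min (- r) c) = - Num.max (- c) (Num.min r c).
Proof.
move=> c0; rewrite !maxEle !minEle; case: (leP (- r) c) => ?; case: (leP r c) => ?.
all: by repeat case: leP => ?; lra.
Qed.

Lemma clamp_lipschitz (R : realDomainType) (c r s : R) : 0 <= c -> r <= s ->
  `|Num.max (- c) (Num.min r c) - Num.max (- c) (Num.min s c)| <= `|r - s|.
Proof.
move=> c0 rs; rewrite (ler0_norm (_ : r - s <= 0)) ?subr_le0// ler_norml !maxEle !minEle.
case: (leP r c) => ?; case: (leP s c) => ?; case: (leP (- c) c) => ?;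
  case: (leP (- c) r) => ?; case: (leP (- c) s) => ?; apply/andP; split; lra.
Qed.

Lemma split_min (R : realDomainType) (c r s : R) : 0 <= c -> 0 <= r -> 0 <= s ->
  exists r' s', [/\ 0 <= r' <= r, r' <= c, 0 <= s' <= s, s' <= c &
    r' + s' = Num.min (r + s) c].
Proof.
move=> c0 r0 s0; exists (Num.min r c), (Num.min (r + s) c - Num.min r c).
rewrite !minEle; case: (leP r c) => ?; case: (leP (r + s) c) => ?.
all: by split => //; try (apply/andP; split); lra.
Qed.

Section sine_modulus.
Context {R : realType}.
Variable r0 : R.
Hypothesis r0_gt0 : 0 < r0.

(** First nonconstant Neumann eigenfunction of [- r0, r0], continued by constants. With r0 larger
    than the diameter, the clamping acts as a small perturbation. *)
Definition sine_modulus (r : R) : R := sin (pi / (2 * r0) * Num.max (- r0) (Num.min r r0)).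

Let a : R := pi / (2 * r0).
Let a0 : 0 < a. Proof. by rewrite divr_gt0 ?pi_gt0// mulr_gt0. Qed.
Let ar0 : a * r0 = pi / 2.
Proof. by rewrite /a; field; rewrite gt_eqF. Qed.

Lemma clamp_itv (r : R) : - r0 <= Num.max (- r0) (Num.min r r0) <= r0.
Proof.
by rewrite le_max lexx/= ge_max ge_min lexx orbT andbT (@le_trans _ _ 0)// ?oppr_le0 ltW.
Qed.

Lemma sine_modulusE r : `|r| <= r0 -> sine_modulus r = sin (a * r).
Proof.
rewrite ler_norml => /andP[h1 h2]; rewrite /sine_modulus -/a; congr (sin (a * _)).
by rewrite (min_idPl h2); apply/max_idPr.
Qed.

Lemma sine_modulus_ok : modulus_ok 1 a sine_modulus.
Proof.
have nondec r r' : r <= r' -> sine_modulus r <= sine_modulus r'.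
  move=> rr; have /andP[h1 h2] := clamp_itv r; have /andP[h3 h4] := clamp_itv r'.
  have cc : Num.max (- r0) (Num.min r r0) <= Num.max (- r0) (Num.min r' r0).
    rewrite ge_max le_max lexx/= le_max.
    by apply/orP; right; rewrite le_min !ge_min rr lexx orbT.
  rewrite /sine_modulus -/a; move: cc; rewrite le_eqVlt => /orP[/eqP->//|cc].
  by apply: ltW; rewrite ltr_sin ?in_itv/= -?ar0 -?mulrN ?ltr_pM2l// ?ler_pM2l ?h1 ?h2 ?h3 ?h4.
split => //.
- move=> r; rewrite /sine_modulus -sinN -mulrN; congr (sin (_ * _)).
  exact: clampN (ltW r0_gt0).
- by move=> r; rewrite ler_norml sin_geN1 sin_le1.
- exact: ltW.
- move=> r r'; wlog rr : r r' / r <= r'.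
    by move=> H; have [/H//|/ltW/H] := leP r r'; rewrite distrC (distrC r').
  have c1 (y : R) : `|cos y| <= 1 by rewrite ler_norml cos_geN1 cos_le1.
  apply: le_trans (derive_lipschitz (@is_derive_sin R) c1 _ _) _; rewrite mul1r -mulrBr normrM (gtr0_norm a0) ler_pM2l//.
  exact: clamp_lipschitz (ltW r0_gt0) rr.
Qed.

(** Clamping reduces to the case r + s <= r0, where the addition formula and cos <= 1 suffice. The
    McShane extension relies on this. *)
Lemma sine_modulus_subadd r s : 0 <= r -> 0 <= s ->
  sine_modulus (r + s) <= sine_modulus r + sine_modulus s.
Proof.
move=> r_ge0 s_ge0; have [_ nd _ _ _] := sine_modulus_ok.
have [r' [s' [/andP[r'0 r'r] r'r0 /andP[s'0 s's] s'r0 rs]]] :=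
  split_min (ltW r0_gt0) r_ge0 s_ge0.
have rs0 : r' + s' <= r0 by rewrite rs ge_min lexx orbT.
have -> : sine_modulus (r + s) = sine_modulus (r' + s').
  by rewrite /sine_modulus rs -minA minxx.
apply: (@le_trans _ _ (sine_modulus r' + sine_modulus s')); last by rewrite lerD ?nd.
have sin_pos x : 0 <= x -> x <= r0 -> 0 <= sin (a * x).
  move=> x0 xr; apply: sin_ge0_pi; rewrite mulr_ge0 ?(ltW a0)//=.
  apply: (@le_trans _ _ (a * r0)); first by rewrite ler_pM2l.
  by rewrite ar0; have := @pi_ge0 R; lra.
rewrite !sine_modulusE ?ger0_norm ?addr_ge0// mulrDr sinD.
by rewrite lerD// ?(mulrC (cos _)) -[leRHS]mulr1 ler_wpM2l ?cos_le1// sin_pos.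
Qed.

End sine_modulus.

Section sine_modulus_heat.
Context {R : realType} {n : nat}.
Local Notation E := 'rV[R]_n.
Local Notation mu := (@lebesgue_rV R n).
Variables (i0 : 'I_n) (r0 a : R).
Hypotheses (r0_gt0 : 0 < r0) (aE : a = pi / (2 * r0)).
Let a0 : 0 < a. Proof. by rewrite aE divr_gt0 ?pi_gt0// mulr_gt0. Qed.
Let n0 : (0 < n)%N. Proof. exact: leq_ltn_trans (leq0n _) (ltn_ord i0). Qed.

Lemma gdom_coord (h : R -> R) C t k r : 0 < t -> continuous h -> (forall x, `|h x| <= C) ->
  gdom t (fun y : E => h (r + k * y ord0 i0)).
Proof.
move=> t0 ch hC; apply: (gdom_b t0 (C := C)) => // .
apply: (measurableT_comp (continuous_measurable_fun ch)).
apply: measurable_funD => //; apply: measurable_funM => //.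
exact: (@measurable_rV_coord R n i0).
Qed.

Lemma Ex_coordN (h : R -> R) t : gdom t (fun y : E => h (y ord0 i0)) ->
  gdom t (fun y : E => h (- y ord0 i0)) /\
  Ex t (fun y : E => h (- y ord0 i0)) = Ex t (fun y : E => h (y ord0 i0)).
Proof.
move=> gh; have e1 : sqn (delta_mx ord0 i0 : E) = sqn (- delta_mx ord0 i0 : E) by rewrite sqnN.
have E1 : (fun y : E => h (dot (delta_mx ord0 i0) y)) = (fun y : E => h (y ord0 i0)).
  by apply/funext => y; rewrite dot_delta.
have E2 : (fun y : E => h (dot (- delta_mx ord0 i0) y)) = (fun y : E => h (- y ord0 i0)).
  by apply/funext => y; rewrite dotNl dot_delta.
by have := @Ex_dir R n t _ _ h e1; rewrite -!/(gdom t (fun y => h _)) E1 E2; apply.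
Qed.

Let g3 : R := @gmom R n 1 3.

(** In the addition formula the sine of the noise has mean zero by symmetry. The mean of the cosine
    is expanded to third order: the noise 2 a y has variance 4 a^2 gvar t, and half of it is
    lost. *)
Lemma Ex_sin_shift t r : 0 < t -> 0 <= sin (a * r) ->
  Ex t (fun y : E => sin (a * (r + 2 * y ord0 i0))) <=
  (1 - 2 * a ^+ 2 * @gvar R n * t + 8 * a ^+ 3 * g3 * Num.sqrt t ^+ 3) * sin (a * r).
Proof.
move=> t0 s0.
have bs (x : R) : `|sin x| <= 1 by rewrite ler_norml sin_geN1 sin_le1.
have bc (x : R) : `|cos x| <= 1 by rewrite ler_norml cos_geN1 cos_le1.
have gs_ : gdom t (fun y : E => sin (0 + (2 * a) * y ord0 i0)).
  by apply: gdom_coord bs => //; exact: continuous_sin.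
have gc : gdom t (fun y : E => cos (0 + (2 * a) * y ord0 i0)).
  by apply: gdom_coord bc => //; exact: continuous_cos.
have -> : (fun y : E => sin (a * (r + 2 * y ord0 i0))) =
   (fun y : E => sin (a * r) * cos (0 + 2 * a * y ord0 i0) +
      cos (a * r) * sin (0 + 2 * a * y ord0 i0)).
  by apply/funext => y; rewrite !add0r mulrDr sinD; congr (_ * cos _ + _ * sin _); ring.
rewrite ExD; [|exact: gdomZ gc|exact: gdomZ gs_].
rewrite (ExZ _ gc) (ExZ _ gs_).
have -> : Ex t (fun y : E => sin (0 + (2 * a) * y ord0 i0)) = 0.
  have [gN EN] := @Ex_coordN (fun x => sin (0 + 2 * a * x)) t gs_.
  move: EN; have -> : (fun y : E => sin (0 + 2 * a * - y ord0 i0)) =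
     (fun y : E => (-1) * sin (0 + 2 * a * y ord0 i0)).
    by apply/funext => y; rewrite !add0r mulrN sinN mulN1r.
  by rewrite (ExZ _ gs_); move: (Ex _ _) => u; lra.
rewrite mulr0 addr0 mulrC ler_wpM2r//.
have g2 : gdom t (fun y : E => y ord0 i0 * y ord0 i0) := (@Ex_coord2 R n n0 t i0 i0 t0).1.
have gg3 : gdom t (fun y : E => enorm y ^+ 3) by exact: gdom_enorm.
have E2 : Ex t (fun y : E => y ord0 i0 * y ord0 i0) = @gvar R n * t.
  by rewrite (@Ex_coord2 R n n0 t i0 i0 t0).2 eqxx mulr1.
have E3 : Ex t (fun y : E => enorm y ^+ 3) = Num.sqrt t ^+ 3 * g3 by exact: Ex_enorm.
have -> : 1 - 2 * a ^+ 2 * @gvar R n * t + 8 * a ^+ 3 * g3 * Num.sqrt t ^+ 3 =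
  Ex t (fun y : E => 1 + (- (2 * a ^+ 2)) * (y ord0 i0 * y ord0 i0) + (8 * a ^+ 3) * enorm y ^+ 3).
  rewrite ExD; [|by apply: gdomD; [exact: gdom1|exact: gdomZ]|exact: gdomZ].
  rewrite ExD; [|exact: gdom1|exact: gdomZ].
  rewrite (ExZ _ g2) (ExZ _ gg3) Ex1// E2 E3.
  by move: (Num.sqrt t ^+ 3) => u; ring.
apply: Ex_le => //.
  apply: gdomD; last exact: gdomZ.
  by apply: gdomD; [exact: gdom1|exact: gdomZ].
move=> y; apply: le_trans (cos_le_taylor _) _; rewrite add0r.
have -> : (2 * a * y ord0 i0) ^+ 2 / 2 = 2 * a ^+ 2 * (y ord0 i0 * y ord0 i0) by field.
rewrite mulNr lerD2l (normrM (2 * a)) (normrM 2 a).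
rewrite (gtr0_norm a0) (ger0_norm (ler0n R 2)).
have -> : 8 * a ^+ 3 * enorm y ^+ 3 = (2 * a * enorm y) ^+ 3 by ring.
have a20 : 0 <= 2 * a by rewrite mulr_ge0// ltW.
apply: lerXn2r; rewrite ?nnegrE; [by rewrite mulr_ge0|by rewrite mulr_ge0// enorm_ge0|].
by apply: ler_wpM2l => //; exact: coord_le_enorm.
Qed.

Let Dw (s : R) : R := sine_modulus r0 s - sin (a * s).

(** The clamping defect [Dw] is odd and zero on [- r0, r0]. Pairing y with - y leaves Dw(r + 2 y) -
    Dw(2 y - r), at most 4 a r and zero unless |y| > (r0 - d) / 2; Markov's inequality for the third
    moment gives t^(3/2). The factor r allows comparison with sin(a r). *)
Lemma Ex_sine_defect t r d : 0 < t -> 0 <= r -> r <= d -> d < r0 ->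
  gdom t (fun y : E => Dw (r + 2 * y ord0 i0)) /\
  Ex t (fun y : E => Dw (r + 2 * y ord0 i0)) <=
    16 * a * g3 / (r0 - d) ^+ 3 * Num.sqrt t ^+ 3 * r.
Proof.
move=> t0 rp rd dr; have wok := @sine_modulus_ok R r0 r0_gt0.
have [wN _ w1 _ wL] := wok; rewrite -aE in wL.
have cD : continuous Dw.
  move=> x; apply: continuousB; last first.
    apply: continuous_comp; last exact: continuous_sin.
    by apply: continuousM; [exact: cst_continuous|exact: id].
  apply/(@cvgrPdist_le _ _ _ (nbhs x)) => e e0; exists (e / a); first by rewrite /= divr_gt0.
  move=> y /= xy; apply: le_trans (wL _ _) _.
  by rewrite mulrC -ler_pdivlMr// ltW.
have bD x : `|Dw x| <= 1 + 1.
  apply: le_trans (ler_normB _ _) _; rewrite lerD//.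
  by rewrite ler_norml sin_geN1 sin_le1.
have gD : gdom t (fun y : E => Dw (r + 2 * y ord0 i0)) by exact: gdom_coord bD.
have [gN EN] := @Ex_coordN (fun x => Dw (r + 2 * x)) t gD.
split => //.
have DN x : Dw (- x) = - Dw x by rewrite /Dw wN mulrN sinN; move: (sin _) => u; lra.
have D0 x : `|x| <= r0 -> Dw x = 0 by move=> h; rewrite /Dw sine_modulusE// aE subrr.
have DL x y : `|Dw x - Dw y| <= 2 * a * `|x - y|.
  have c1 (z : R) : `|cos z| <= 1 by rewrite ler_norml cos_geN1 cos_le1.
  have -> : Dw x - Dw y = (sine_modulus r0 x - sine_modulus r0 y) - (sin (a * x) - sin (a * y)).
    by rewrite /Dw; move: (sin _) (sin _) => u v; ring.
  apply: le_trans (ler_normB _ _) _.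
  have h1 := wL x y.
  have h2 := derive_lipschitz (@is_derive_sin R) c1 (a * x) (a * y).
  move: h2; rewrite -mulrBr normrM (gtr0_norm a0) => h2.
  by move: h1 h2; move: `|x - y| (`|sin _ - _|) => u v; lra.
have gg3 : gdom t (fun y : E => enorm y ^+ 3) by exact: gdom_enorm.
have E3 : Ex t (fun y : E => enorm y ^+ 3) = Num.sqrt t ^+ 3 * g3 by exact: Ex_enorm.
have rd0 : 0 < r0 - d by rewrite subr_gt0.
pose K : R := 32 * a * r / (r0 - d) ^+ 3.
have K0 : 0 <= K.
  by apply: divr_ge0; [rewrite !mulr_ge0// ltW|rewrite exprn_ge0// ltW].
have H : Ex t (fun y : E => Dw (r + 2 * y ord0 i0)) + Ex t (fun y : E => Dw (r + 2 * - y ord0 i0)) <=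
    K * (Num.sqrt t ^+ 3 * g3).
  rewrite -ExD// -E3 -(ExZ K gg3); apply: Ex_le => //; [exact: gdomD|exact: gdomZ|].
  move=> y; have ye := coord_le_enorm y i0; move: (y ord0 i0) ye => z ze.
  have e0 := enorm_ge0 y; move: (enorm y) ze e0 => e ze e0.
  have -> : Dw (r + 2 * - z) = - Dw (2 * z - r) by rewrite -DN; congr Dw; ring.
  have [zr|zr] := leP (2 * `|z|) (r0 - d).
    have hz : `|2 * z| <= r0 - d by rewrite normrM ger0_norm.
    have [h1 h2] : `|r + 2 * z| <= r0 /\ `|2 * z - r| <= r0.
      split.
        by apply: le_trans (ler_normD _ _) _; rewrite (ger0_norm rp); lra.
      by apply: le_trans (ler_normB _ _) _; rewrite (ger0_norm rp); lra.
    by rewrite !D0// subrr mulr_ge0// exprn_ge0.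
  apply: le_trans (ler_norm _) _; apply: le_trans (DL _ _) _.
  have -> : r + 2 * z - (2 * z - r) = 2 * r by ring.
  rewrite ger0_norm ?mulr_ge0//.
  have -> : 2 * a * (2 * r) = (32 * a * r / 8) by field.
  rewrite /K -!mulrA !ler_wpM2l// ?(ltW a0)// ler_pdivlMl ?exprn_gt0//.
  have -> : (r0 - d) ^+ 3 / 8 = ((r0 - d) / 2) ^+ 3 by rewrite expr_div_n; congr (_ / _); rewrite !exprS expr0; ring.
  rewrite lerXn2r ?nnegrE ?divr_ge0 ?(ltW rd0)//; lra.
move: H; rewrite EN /K => H.
have -> : 16 * a * g3 / (r0 - d) ^+ 3 * Num.sqrt t ^+ 3 * r =
   32 * a * r / (r0 - d) ^+ 3 * (Num.sqrt t ^+ 3 * g3) / 2.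
  by move: (Num.sqrt t ^+ 3) (g3) ((r0 - d) ^+ 3)^-1 => u v w; field.
by move: H; move: (Ex _ _) (32 * _ * _ * _ * _) => u v; lra.
Qed.

(** Exact decay of the sine plus the clamping defect. The defect is proportional to r, and sin(a r)
    >= cos(a d) a r on [0, d] makes it a multiple of the modulus; d < r0 keeps cos(a d) positive. *)
Lemma opw_sine_modulus d : 0 <= d -> d < r0 ->
  exists2 C : R, 0 <= C & forall t r, 0 < t -> 0 <= r <= d ->
  opw i0 t (sine_modulus r0) r <=
   (1 - 2 * a ^+ 2 * @gvar R n * t + C * Num.sqrt t ^+ 3) * sine_modulus r0 r.
Proof.
move=> d0 dr; have adp : a * d < pi / 2.
  have -> : pi / 2 = a * r0 by rewrite aE; field; rewrite gt_eqF.
  by rewrite ltr_pM2l.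
have p0 := @pi_gt0 R.
have cd : 0 < cos (a * d).
  apply: cos_gt0_pihalf; rewrite adp andbT.
  by apply: (@lt_le_trans _ _ 0); [lra|rewrite mulr_ge0// ltW].
have g30 : 0 <= g3 by apply: Ex_ge0 => // y; rewrite exprn_ge0// enorm_ge0.
have rd0 : 0 < r0 - d by rewrite subr_gt0.
have [C1 C1E] : exists C1 : R, C1 = 16 * a * g3 / (r0 - d) ^+ 3 by eexists.
have C10 : 0 <= C1.
  rewrite C1E.
  by apply: divr_ge0; [rewrite !mulr_ge0// ltW|rewrite exprn_ge0// ltW].
exists (8 * a ^+ 3 * g3 + C1 / (cos (a * d) * a)).
  apply: addr_ge0; first by rewrite (mulr_ge0 _ g30)// (mulr_ge0 _ (exprn_ge0 3 (ltW a0))).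
  by apply: divr_ge0 => //; apply: mulr_ge0; exact: ltW.
move=> t r t0 /andP[rp rd].
have rr : `|r| <= r0 by rewrite ger0_norm// (le_trans rd)// ltW.
have lin : cos (a * d) * (a * r) <= sin (a * r).
  apply: sin_ge_linear; rewrite ?mulr_ge0 ?(ltW a0)//; first by rewrite ler_pM2l.
  by move: adp; lra.
have s0 : 0 <= sin (a * r) by apply: le_trans lin; apply: mulr_ge0; [exact: ltW|apply: mulr_ge0 => //; exact: ltW].
have H1 := Ex_sin_shift t0 s0.
have [gD H2] := Ex_sine_defect t0 rp rd dr.
have gs_ : gdom t (fun y : E => sin (a * (r + 2 * y ord0 i0))).
  have := @gdom_coord (fun x => sin (a * x)) 1 t 2 r t0; apply.
    move=> x; apply: continuous_comp; last exact: continuous_sin.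
    by apply: continuousM; [exact: cst_continuous|exact: id].
  by move=> x; rewrite ler_norml sin_geN1 sin_le1.
rewrite (sine_modulusE rr) -aE.
have -> : opw i0 t (sine_modulus r0) r = Ex t (fun y : E => sin (a * (r + 2 * y ord0 i0))) +
    Ex t (fun y : E => Dw (r + 2 * y ord0 i0)).
  by rewrite -ExD//; congr (Ex t _); apply/funext => y; rewrite /Dw addrCA subrr addr0.
have H3 : C1 * Num.sqrt t ^+ 3 * r <= C1 / (cos (a * d) * a) * Num.sqrt t ^+ 3 * sin (a * r).
  have -> : C1 * Num.sqrt t ^+ 3 * r = C1 / (cos (a * d) * a) * Num.sqrt t ^+ 3 * (cos (a * d) * (a * r)).
    move: (cos (a * d)) cd (Num.sqrt t ^+ 3) (C1 : R) => c cd0 u v; field.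
    by rewrite (gt_eqF a0) (gt_eqF cd0).
  apply: ler_wpM2l => //; apply: mulr_ge0; last by rewrite exprn_ge0 ?sqrtr_ge0.
  by apply: divr_ge0 => //; apply: mulr_ge0; exact: ltW.
apply: le_trans (lerD H1 H2) _; rewrite -C1E.
apply: le_trans (lerD (lexx _) H3) _.
by move: (Num.sqrt t ^+ 3) (C1 / _) (sin (a * r)) => u v w; lra.
Qed.

End sine_modulus_heat.

(** * Removing the mollification of the weight *)

Lemma cvg_sqrt_bound (R : realType) (u : nat -> R) (l K : R) :
  (forall k, `|u k - l| <= K * Num.sqrt (k.+1%:R^-1)) -> u k @[k --> \oo] --> l.
Proof.
move=> uK; have K0 : 0 <= K.
  by have := le_trans (normr_ge0 _) (uK 0%N); rewrite invr1 sqrtr1 mulr1.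
have h0 : (fun k : nat => (k.+1%:R : R)^-1) @ \oo --> (0 : R) by exact: cvg_harmonic.
have h1 : (fun k : nat => Num.sqrt ((k.+1%:R : R)^-1)) @ \oo --> (0 : R).
  by have := cvg_comp _ _ h0 (@sqrt_continuous R 0); rewrite sqrtr0; exact.
have h2 : (fun k : nat => K * Num.sqrt ((k.+1%:R : R)^-1)) @ \oo --> (0 : R).
  by rewrite -[X in _ --> X](mulr0 K); apply: cvgMr.
apply/cvgrPdist_le => e e0; have /cvgrPdist_le/(_ e e0) := h2.
apply: filterS => k; rewrite sub0r normrN => h; rewrite distrC.
by apply: le_trans (uK k) _; apply: le_trans h; exact: ler_norm.
Qed.

Section doob_limit.
Context {R : realType} {n : nat}.
Local Notation E := 'rV[R]_n.
Local Notation mu := (@lebesgue_rV R n).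
Implicit Types (s t : R).

Lemma conv_approx s (f : E -> R) C L x : 0 < s -> measurable_fun setT f ->
  (forall y, `|f y| <= C) -> 0 <= L ->
  (forall y y', `|f y - f y'| <= L * enorm (y - y')) ->
  `|conv s f x - f x| <= L * (Num.sqrt s * @gmom R n 1 1).
Proof.
move=> s0 mf fC L0 fL.
have gf : gdom s (fun y : E => f (x + y)) by exact: gdom_shift.
have gc : gdom s (fun _ : E => f x).
  by apply: (gdom_b s0 (measurable_cst _) (C := C)) => y; exact: fC.
have g1 : gdom s (fun y : E => enorm y ^+ 1) by exact: gdom_enorm.
have -> : conv s f x - f x = Ex s (fun y => f (x + y) - f x).
  rewrite (ExB gf gc) (convE (intble_convb x s0 mf fC)).2; congr (_ - _).
  have E1 : Ex s (fun _ : E => f x * 1) = f x * 1.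
    by rewrite (ExZ (f x) (@gdom1 R n s s0)); congr (_ * _); exact: Ex1.
  by move: E1; rewrite mulr1 => ->.
apply: le_trans (Ex_norm s0 (gdomB gf gc)) _.
have -> : Num.sqrt s * @gmom R n 1 1 = Ex s (fun y : E => enorm y ^+ 1).
  by rewrite Ex_enorm// expr1.
rewrite -(ExZ L g1); apply: Ex_le => //; [exact: gdom_norm (gdomB gf gc)|exact: gdomZ|].
by move=> y; rewrite expr1; apply: le_trans (fL _ _) _; rewrite addrAC subrr add0r.
Qed.

Variable i0 : 'I_n.
Variables (phi : E -> R) (D : set E).
Hypotheses (iphi : intble mu phi) (phi0 : forall y, 0 <= phi y).
Hypotheses (mD : measurable D) (D0 : (0 < mu D)%E) (phiD : forall y, D y -> 0 < phi y).

Lemma conv_pos t x : 0 < t -> 0 < conv t phi x.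
Proof.
move=> t0; rewrite convdefE; apply: (int_gt0 (D := D)) => //.
- exact: intble_conv.
- by move=> z; rewrite mulr_ge0 ?gaussp_ge0.
- by move=> z Dz; rewrite mulr_gt0 ?gaussp_gt0// phiD.
Qed.

(** Self-adjointness moves the mollifier from [phi] onto the Lipschitz function y ->
    [gaussp eps (x - y) * V y], where it converges uniformly at the rate of the square root of
    time. *)
Lemma conv_mollified_cvg eps (V : E -> R) (C a : R) x : 0 < eps ->
  (forall y, `|V y| <= C) -> 0 <= a -> (forall y y', `|V y - V y'| <= a * enorm (y - y')) ->
  conv eps (fun y => conv (k.+1%:R^-1) phi y * V y) x @[k --> \oo] -->
  conv eps (fun y => phi y * V y) x.
Proof.
move=> e0 VC a0 Va; have [L L0 gL] := @gaussp_lipschitz R n eps e0.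
have cV := lipschitz_continuous_rV a0 Va; have mV := continuous_measurable_rV cV.
have C0 : 0 <= C by apply: le_trans (VC 0).
have Z0 : 0 <= (@gsZ R n eps)^-1 by rewrite invr_ge0 ltW// gsZ_gt0.
have gle (y : E) : gaussp eps y <= (@gsZ R n eps)^-1 by exact: gaussp_le.
pose q (y : E) : R := gaussp eps (x - y) * V y.
have mq : measurable_fun setT q.
  by apply: measurable_funM => //; exact: measurable_gaussp_at.
have qC y : `|q y| <= (@gsZ R n eps)^-1 * C.
  by rewrite /q normrM ler_pM// gaussp_norm.
have qL y y' : `|q y - q y'| <= ((@gsZ R n eps)^-1 * a + L * C) * enorm (y - y').
  have -> : q y - q y' = gaussp eps (x - y) * (V y - V y') +
     (gaussp eps (x - y) - gaussp eps (x - y')) * V y'.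
    by rewrite /q; move: (gaussp _ _) (gaussp _ _) (V y) (V y') => u1 u2 v1 v2; ring.
  apply: le_trans (ler_normD _ _) _.
  rewrite (normrM (gaussp eps (x - y))) (normrM (gaussp _ _ - _)) mulrDl; apply: lerD.
    rewrite -mulrA; apply: ler_pM => //; first by rewrite gaussp_norm.
  rewrite mulrAC; apply: ler_pM => //.
  apply: le_trans (gL _ _) _; rewrite enormBC.
  by have -> : x - y' - (x - y) = y - y' by rewrite opprB addrC addrA subrK.
have Lq0 : 0 <= (@gsZ R n eps)^-1 * a + L * C by rewrite addr_ge0// mulr_ge0.
apply: (@cvg_sqrt_bound _ _ _ (((@gsZ R n eps)^-1 * a + L * C) * @gmom R n 1 1 * int mu phi)).
move=> k; set s := k.+1%:R^-1; have s0 : 0 < s by rewrite invr_gt0 ltr0n.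
have [ipq icp iqc E1] := conv_sym s0 iphi mq qC.
have -> : conv eps (fun y => conv s phi y * V y) x = int mu (fun y => q y * conv s phi y).
  by rewrite convdefE; congr (int mu); apply/funext => y; rewrite /q -mulrA (mulrC (V y)).
have -> : conv eps (fun y => phi y * V y) x = int mu (fun y => phi y * q y).
  by rewrite convdefE; congr (int mu); apply/funext => y; rewrite /q mulrCA.
have ipq' : intble mu (fun y => phi y * q y).
  have := intble_mulb mq qC iphi; rewrite (_ : (fun x => q x * phi x) = (fun y => phi y * q y))//.
  by apply/funext => y; rewrite mulrC.
rewrite E1 -intB// [leRHS]mulrAC -intZ//.
apply: int_norm_le; [exact: intbleB|exact: intbleZ|].
move=> y; rewrite -mulrBr normrM (ger0_norm (phi0 y)) mulrC ler_wpM2r//.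
apply: le_trans (conv_approx _ s0 mq qC Lq0 qL) _.
by rewrite -!mulrA (mulrC (Num.sqrt s)).
Qed.

Hypothesis lcphi : forall t, 0 < t -> logconcave (conv t phi).
Variables (V : E -> R) (C Cw a : R) (w : R -> R).
Hypotheses (VC : forall y, `|V y| <= C) (wok : modulus_ok Cw a w).
Hypothesis Vw : forall y y', V y - V y' <= w (enorm (y - y')).

Lemma modulus_le_lipschitz r : 0 <= r -> w r <= a * r.
Proof.
move=> r0; have [wN _ _ _ wL] := wok.
have w0 : w 0 = 0 by have := wN 0; rewrite oppr0; lra.
have := wL r 0; rewrite w0 !subr0 (ger0_norm r0); apply: le_trans; exact: ler_norm.
Qed.

Lemma modulus_lipschitz (U : E -> R) : (forall y y', U y - U y' <= w (enorm (y - y'))) ->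
  forall y y', `|U y - U y'| <= a * enorm (y - y').
Proof.
move=> Uw y y'; have h1 := le_trans (Uw y y') (modulus_le_lipschitz (enorm_ge0 _)).
have h2 := le_trans (Uw y' y) (modulus_le_lipschitz (enorm_ge0 _)).
rewrite (enormBC y') in h2; rewrite ler_norml.
by move: h1 h2; move: (V y) (V y') => u v; lra.
Qed.

(** The weight [phi] need not be positive or semiconvex. Its convolutions at times 1 / (k + 1) are,
    so [doob_modulus] applies to them with a bound independent of k, and the quotients converge. *)
Lemma doob_modulus0 eps x x' : 0 < eps ->
  conv eps (fun y => phi y * V y) x / conv eps phi x -
  conv eps (fun y => phi y * V y) x' / conv eps phi x' <= opw i0 eps w (enorm (x - x')).
Proof.
move=> e0; have [_ _ _ a0 _] := wok; have Va := modulus_lipschitz Vw.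
have mV := continuous_measurable_rV (lipschitz_continuous_rV a0 Va).
have cN (z : E) := @conv_mollified_cvg eps V C a z e0 VC a0 Va.
have one (z : E) : `|(1 : R)| <= 1 by rewrite normr1.
have lip1 (y y' : E) : `|(1 : R) - 1| <= 0 * enorm (y - y') by rewrite subrr normr0 mul0r.
have cF z : conv eps (fun y => conv (k.+1%:R^-1) phi y) z @[k --> \oo] --> conv eps phi z.
  have := @conv_mollified_cvg eps (fun=> 1) 1 0 z e0 one (lexx _) lip1.
  rewrite (_ : (fun y => phi y * 1) = phi); last by apply/funext => y; rewrite mulr1.
  rewrite (_ : (fun k => conv eps (fun y => conv k.+1%:R^-1 phi y * 1) z) =
    (fun k => conv eps (fun y => conv k.+1%:R^-1 phi y) z))//.
  by apply/funext => k; congr (conv eps _ z); apply/funext => y; rewrite mulr1.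
have cQ z : conv eps (fun y => conv (k.+1%:R^-1) phi y * V y) z /
    conv eps (fun y => conv (k.+1%:R^-1) phi y) z @[k --> \oo] -->
    conv eps (fun y => phi y * V y) z / conv eps phi z.
  by apply: cvgM; [exact: cN|apply: cvgV; [rewrite gt_eqF// conv_pos|exact: cF]].
have /(_ eventually_filter) cD := cvgB (cQ x) (cQ x').
rewrite -(cvg_lim _ cD)//; apply: limr_le; first exact: cvgP cD.
apply: nearW => k; have s0 : 0 < (k.+1%:R : R)^-1 by rewrite invr_gt0 ltr0n.
exact: (doob_modulus i0 s0 iphi phi0 mD D0 phiD lcphi mV VC wok Vw e0).
Qed.

End doob_limit.

(** * Contraction of the sine modulus on the domain *)

Section contraction.
Context {R : realType} {n : nat}.
Local Notation E := 'rV[R]_n.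
Local Notation mu := (@lebesgue_rV R n).

(** McShane's formula: the infimum of g y + w(|x - y|) over y in the domain. Monotonicity and
    subadditivity of [w] give the extension the same modulus. *)
Lemma mcshane (Om : set E) (g : E -> R) (w : R -> R) (Cw a C0 : R) : Om !=set0 ->
  modulus_ok Cw a w -> (forall r s, 0 <= r -> 0 <= s -> w (r + s) <= w r + w s) ->
  (forall y, Om y -> `|g y| <= C0) ->
  (forall x y, Om x -> Om y -> g x - g y <= w (enorm (x - y))) ->
  exists V : E -> R, [/\ (forall y, Om y -> V y = g y), (forall y, `|V y| <= C0 + Cw) &
    forall x y, V x - V y <= w (enorm (x - y))].
Proof.
move=> [p Op] wok wsub gC gw; have [wN wm wC a0 wL] := wok.
have w0 : w 0 = 0 by have := wN 0; rewrite oppr0; lra.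
have wp r : 0 <= r -> 0 <= w r by move=> r0; rewrite -w0 wm.
pose S x := [set g y + w (enorm (x - y)) | y in Om].
have S0 x : S x !=set0 by exists (g p + w (enorm (x - p))); exists p.
have Slb x : lbound (S x) (- C0).
  move=> _ [y Oy <-]; have := gC y Oy; have := wp _ (enorm_ge0 (x - y)).
  by rewrite ler_norml => h /andP[h1 h2]; lra.
have Slb' x : has_lbound (S x) by exists (- C0).
have Vle x y : Om y -> inf (S x) <= g y + w (enorm (x - y)).
  by move=> Oy; apply: ge_inf => //; exists y.
exists (fun x => inf (S x)); split.
- move=> y Oy; apply/eqP; rewrite eq_le; apply/andP; split.
    by apply: le_trans (Vle y y Oy) _; rewrite subrr enorm0 w0 addr0.
  apply: lb_le_inf => // _ [z Oz <-]; have := gw y z Oy Oz; lra.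
- move=> y; rewrite ler_norml; apply/andP; split.
    apply: (@le_trans _ _ (- C0)); last exact: lb_le_inf.
    have := le_trans (normr_ge0 _) (wC 0); lra.
  apply: le_trans (Vle y p Op) _; apply: lerD.
    by apply: le_trans (gC p Op); exact: ler_norm.
  by apply: le_trans (wC _); exact: ler_norm.
- move=> x y; rewrite lerBlDr; rewrite -lerBlDl; apply: lb_le_inf => // _ [z Oz <-].
  rewrite lerBlDl; apply: le_trans (Vle x z Oz) _.
  rewrite addrCA lerD2l; apply: le_trans (wsub _ _ (enorm_ge0 _) (enorm_ge0 _)).
  by apply: wm; have := enorm_triangle (x - y) (y - z); rewrite addrA subrK.
Qed.

Variables (i0 : 'I_n) (Om : set E) (r0 a d : R).
Hypotheses (r0_gt0 : 0 < r0) (aE : a = pi / (2 * r0)) (d0 : 0 <= d) (dr : d < r0).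
Hypotheses (Om0 : Om !=set0) (Od : forall x y, Om x -> Om y -> enorm (x - y) <= d).

(** Since [phi] vanishes off [Om], [g] can be replaced by its McShane extension, whose modulus
    evolves under [opw]. The constant is chosen before [phi], [g] and [t], so that steps can be
    iterated. *)
Lemma contraction : exists2 C : R, 0 <= C &
  forall (phi g : E -> R) (D : set E) (A C0 t : R),
  0 < t -> intble mu phi -> (forall y, 0 <= phi y) -> measurable D -> (0 < mu D)%E ->
  (forall y, D y -> 0 < phi y) -> (forall y, ~ Om y -> phi y = 0) ->
  (forall s, 0 < s -> logconcave (conv s phi)) ->
  0 <= A -> (forall y, Om y -> `|g y| <= C0) ->
  (forall x y, Om x -> Om y -> g x - g y <= A * sine_modulus r0 (enorm (x - y))) ->
  forall x y, Om x -> Om y ->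
  conv t (fun z => phi z * g z) x / conv t phi x -
  conv t (fun z => phi z * g z) y / conv t phi y <=
  A * (1 - 2 * a ^+ 2 * @gvar R n * t + C * Num.sqrt t ^+ 3) * sine_modulus r0 (enorm (x - y)).
Proof.
have [C C0 HC] := opw_sine_modulus i0 r0_gt0 aE d0 dr; exists C => //.
move=> phi g D A Cg t t0 iphi phi0 mD D0 phiD phiO lc A0 gC gw x y Ox Oy.
have wok0 := sine_modulus_ok r0_gt0.
have wok : modulus_ok A (A * (pi / (2 * r0))) (fun r => A * sine_modulus r0 r).
  have [wN wm wC a0 wL] := wok0; split.
  - by move=> r; rewrite wN mulrN.
  - by move=> r r' rr; rewrite ler_wpM2l// wm.
  - by move=> r; rewrite normrM (ger0_norm A0) -[leRHS]mulr1 ler_wpM2l.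
  - by rewrite mulr_ge0.
  - by move=> r r'; rewrite -mulrBr normrM (ger0_norm A0) -mulrA ler_wpM2l.
have wsub r s : 0 <= r -> 0 <= s ->
    A * sine_modulus r0 (r + s) <= A * sine_modulus r0 r + A * sine_modulus r0 s.
  by move=> r_ s_; rewrite -mulrDr ler_wpM2l// sine_modulus_subadd.
have [V [VO VC Vw]] := mcshane Om0 wok wsub gC gw.
have -> : (fun z => phi z * g z) = (fun z => phi z * V z).
  apply/funext => z; have [Oz|nOz] := pselect (Om z); first by rewrite VO.
  by rewrite phiO// !mul0r.
apply: le_trans (doob_modulus0 i0 iphi phi0 mD D0 phiD lc VC wok Vw x y t0) _.
have -> : opw i0 t (fun r => A * sine_modulus r0 r) (enorm (x - y)) =
    A * opw i0 t (sine_modulus r0) (enorm (x - y)).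
  rewrite /opw ExZ//; have := modulus_gdom (enorm (x - y)) (delta_mx ord0 i0) 2 t0 wok0.
  rewrite (_ : (fun y0 : E => _) = (fun z : E => sine_modulus r0 (enorm (x - y) + 2 * z ord0 i0)))//.
  by apply/funext => z; rewrite dot_delta.
by rewrite -mulrA ler_wpM2l// HC// enorm_ge0 Od.
Qed.

End contraction.

(** * The Prekopa-Leindler inequality *)

Lemma powR_amgm (R : realType) (x y l : R) : 0 <= x -> 0 <= y -> 0 < l -> l < 1 ->
  x `^ (1 - l) * y `^ l <= (1 - l) * x + l * y.
Proof.
move=> x0 y0 l0 l1; have k0 : 0 < 1 - l by rewrite subr_gt0.
(* Young's inequality with conjugate exponents 1 / (1 - l) and 1 / l. *)
have := @conjugate_powR R (x `^ (1 - l)) (y `^ l) (1 - l)^-1 l^-1 (powR_ge0 _ _) (powR_ge0 _ _).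
rewrite !invr_gt0 !invrK => /(_ k0 l0) H.
have {H} := H (subrK _ _); rewrite -!powRrM !mulfV ?gt_eqF// !powRr1//.
by rewrite (mulrC x) (mulrC y).
Qed.

Lemma powRV (R : realType) (a r : R) : 0 < a -> a^-1 `^ r = (a `^ r)^-1.
Proof.
move=> a0; apply: (mulIf (lt0r_neq0 (powR_gt0 r a0))).
rewrite mulVf ?gt_eqF ?powR_gt0// -powRM ?invr_ge0 ?(ltW a0)//.
by rewrite mulVf ?gt_eqF// powR1.
Qed.

Section layer_cake.
Context d (T : measurableType d) (R : realType) (mu : {sigma_finite_measure set T -> \bar R}).

(** Truncated to levels in [0, 1): for functions with supremum 1, these are the nonnegative levels
    whose superlevel sets are nonempty. *)
Definition cake (u : T -> R) (t : R) : \bar R :=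
  if (0 <= t) && (t < 1) then mu [set x | t < u x] else 0%E.

Lemma layer_cake (u : T -> R) : measurable_fun setT u -> (forall x, 0 <= u x) ->
  measurable_fun setT (fun t : measurableTypeR R => cake u t) /\
  (\int[mu]_x (Num.min (u x) 1)%:E = \int[lebesgue_measure]_t cake u t)%E.
Proof.
move=> mu_ u0.
pose A : set (T * measurableTypeR R) := [set z | ((0 <= z.2) && (z.2 < 1)) && (z.2 < u z.1)].
have mA : measurable A.
  have m2 : measurable_fun setT (fun z : T * measurableTypeR R => z.2 : R) by exact: measurable_snd.
  have m1 : measurable_fun setT (fun z : T * measurableTypeR R => u z.1).
    exact: measurableT_comp mu_ measurable_fst.
  have mb : measurable_fun setT (fun z : T * measurableTypeR R =>
      ((0 <= (z.2 : R)) && ((z.2 : R) < 1)) && ((z.2 : R) < u z.1)).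
    apply: measurable_and; first apply: measurable_and.
    - exact: (measurable_fun_ler (measurable_cst _) m2).
    - exact: (measurable_fun_ltr m2 (measurable_cst _)).
    - exact: (measurable_fun_ltr m2 m1).
  have := mb measurableT [set true] I; rewrite setTI; congr measurable.
have xs x : xsection A x = [set` Interval (BLeft 0) (BLeft (Num.min (u x) 1))].
  apply/seteqP; split => t; rewrite /xsection /= inE /A /= in_itv /= lt_min.
    by move=> /andP[/andP[-> ->] ->].
  by move=> /andP[-> /andP[-> ->]].
have ys t : ysection A t = if (0 <= t) && (t < 1) then [set x | t < u x] else set0.
  by apply/seteqP; split => x; rewrite /ysection /= inE /A /=; case: ifP.
have yE t : mu (ysection A t) = cake u t.
  by rewrite ys /cake; case: ifP => //; rewrite measure0.
have mG : measurable_fun setT (fun t : measurableTypeR R => mu (ysection A t)).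
  exact: measurable_fun_ysection.
split; first by move: mG; rewrite (funext yE).
have := indic_fubini_tonelli mu (@lebesgue_measure R) mA.
rewrite (indic_fubini_tonelli_FE _ mA) (indic_fubini_tonelli_GE _ mA) => H.
transitivity (\int[mu]_x (@lebesgue_measure R (xsection A x)))%E; last first.
  by rewrite H; apply: eq_integral => t _ /=; exact: yE.
apply: eq_integral => x _; rewrite xs lebesgue_measure_itv /= lte_fin.
have m0 : 0 <= Num.min (u x) 1 by rewrite le_min u0 ler01.
case: ltP => h; first by rewrite -EFinB subr0.
by congr EFin; apply/eqP; rewrite eq_le h m0.
Qed.

End layer_cake.

Section dimension_one.
Context {R : realType}.
Local Notation E := 'rV[R]_1.
Local Notation mu := (@lebesgue_rV R 1).

Lemma rescales_measure n k (A : 'rV[R]_n -> 'rV[R]_n) (D : set 'rV[R]_n) :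
  rescales k A -> measurable D ->
  (@lebesgue_rV R n (A @^-1` D) = k%:E * @lebesgue_rV R n D)%E.
Proof.
move=> [mA HA] mD; have := HA (\1_D : 'rV[R]_n -> R).
have mAD : measurable (A @^-1` D) by rewrite -[X in measurable X]setTI; exact: mA.
rewrite [X in (_ = _ * X)%E]integral_indic// setIT => <-; last first.
- by move=> x; rewrite indicE.
- exact: measurable_indic.
have := @integral_indic _ _ R (@lebesgue_rV R n) setT measurableT _ mAD; rewrite setIT => <-.
by apply: eq_integral => x _; rewrite !indicE; congr (_%:R%:E); apply/idP/idP; rewrite !inE.
Qed.

(** In dimension one the multiplier is identified by measuring one cube and its preimage. *)
Lemma rescales_scale1 (k : R) : 0 < k -> rescales k^-1 (fun x : E => k *: x).
Proof.
move=> k0; have [c c0 H] := @rescales_scale R 1 k (lt0r_neq0 k0).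
suff -> : k^-1 = c by [].
have := rescales_measure H (@measurable_cube R 1 k).
rewrite (_ : (fun x : E => k *: x) @^-1` cube 1 k = cube 1 1); last first.
  apply/seteqP; split => x h i; have := h i; rewrite mxE normrM (gtr0_norm k0).
    by rewrite -[leRHS]mulr1 ler_pM2l.
  by move=> h'; rewrite -[leRHS]mulr1 ler_pM2l.
rewrite !lebesgue_cube// ?(ltW k0)// -EFinM => -[]; rewrite !expr1 => E1.
by apply: (mulIf (lt0r_neq0 k0)); rewrite mulVf ?lt0r_neq0//; lra.
Qed.

Lemma rescales_affine (k : R) (b : E) : 0 < k -> rescales k (fun z : E => k^-1 *: (z - b)).
Proof.
move=> k0; have k1 : 0 < k^-1 by rewrite invr_gt0.
have := rescales_comp _ _ (rescales_scale1 k1) (rescales_shift (- b)).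
by rewrite invrK mul1r; apply => //; exact: ltW.
Qed.

Lemma measurable_coord_pred (P : set R) : measurable P ->
  measurable [set x : E | P (x ord0 ord0)].
Proof.
by move=> mP; have := @measurable_rV_coord R 1 ord0 measurableT P mP; rewrite setTI.
Qed.

Lemma near_top (A A1 : set E) (a : E) (e : R) : 0 <= e -> measurable A -> measurable A1 ->
  (forall x, A x -> A1 x \/ `|x ord0 ord0 - a ord0 ord0| <= e) ->
  (mu A <= mu A1 + (2 * e)%:E)%E.
Proof.
move=> e0 mA mA1 AA; pose S := (fun x : E => x + - a) @^-1` cube 1 e.
have mS : measurable S.
  rewrite -[X in measurable X]setTI; apply: (rescales_shift (- a)).1 => //.
  exact: measurable_cube.
have muS : mu S = (2 * e)%:E.
  rewrite /S (rescales_measure (rescales_shift (- a)) (@measurable_cube R 1 e)) mul1e.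
  by rewrite lebesgue_cube// expr1.
rewrite -muS; apply: le_trans (measureU2 _ mA1 mS).
apply: le_measure; rewrite ?inE//; first exact: measurableU.
move=> x /AA[|h]; [by left|right] => i; rewrite (ord1 i) !mxE; exact: h.
Qed.

(** If [a] were the top of A and [b] the bottom of B, then (1 - l) A + l b and (1 - l) a + l B would
    be subsets of C meeting in at most one point. Nearly extremal points, accurate to e / 2, replace
    the possibly unattained extrema. *)
Lemma brunn_minkowski1 (A B C : set E) (L l : R) : 0 < l -> l < 1 ->
  measurable A -> measurable B -> measurable C -> A !=set0 -> B !=set0 ->
  A `<=` cube 1 L -> B `<=` cube 1 L ->
  (forall x y, A x -> B y -> C ((1 - l) *: x + l *: y)) ->
  ((1 - l)%:E * mu A + l%:E * mu B <= mu C)%E.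
Proof.
move=> l0 l1 mA mB mC [x0 Ax0] [y0 By0] AL BL ABC.
have k0 : 0 < 1 - l by rewrite subr_gt0.
apply/lee_addgt0Pr => e e0; have e20 : 0 < e / 2 by rewrite divr_gt0.
have [a Aa aA] : exists2 a, A a & forall x, A x -> x ord0 ord0 <= a ord0 ord0 + e / 2.
  pose S := [set x ord0 ord0 | x in A].
  have Ss : has_sup S.
    split; first by exists (x0 ord0 ord0); exists x0.
    exists L => _ [x Ax <-]; apply: le_trans (AL x Ax ord0); exact: ler_norm.
  have [_ [a Aa <-] aS] := sup_adherent e20 Ss; exists a => // x Ax.
  have := ub_le_sup Ss.2 (ex_intro2 _ _ x Ax erefl : S (x ord0 ord0)); lra.
have [b Bb bB] : exists2 b, B b & forall x, B x -> b ord0 ord0 - e / 2 <= x ord0 ord0.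
  pose S := [set x ord0 ord0 | x in B].
  have Ss : has_inf S.
    split; first by exists (y0 ord0 ord0); exists y0.
    exists (- L) => _ [x Bx <-]; have := BL x Bx ord0; rewrite ler_norml => /andP[]//.
  have [_ [b Bb <-] bS] := inf_adherent e20 Ss; exists b => // x Bx.
  have := ge_inf Ss.2 (ex_intro2 _ _ x Bx erefl : S (x ord0 ord0)); lra.
(* Cutting at [a] and [b] puts the two translates on opposite sides of (1 - l) a + l b; each cut
   loses measure at most e. *)
pose A1 := A `&` [set x : E | x ord0 ord0 <= a ord0 ord0].
pose B1 := B `&` [set x : E | b ord0 ord0 < x ord0 ord0].
have mA1 : measurable A1.
  apply: measurableI => //; have := @measurable_coord_pred `]-oo, a ord0 ord0]%classic.
  rewrite (_ : [set x : E | `]-oo, a ord0 ord0]%classic (x ord0 ord0)] =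
    [set x : E | x ord0 ord0 <= a ord0 ord0]); last first.
    by apply/seteqP; split => x /=; rewrite in_itv/=.
  by apply; exact: measurable_itv.
have mB1 : measurable B1.
  apply: measurableI => //; have := @measurable_coord_pred `]b ord0 ord0, +oo[%classic.
  rewrite (_ : [set x : E | `]b ord0 ord0, +oo[%classic (x ord0 ord0)] =
    [set x : E | b ord0 ord0 < x ord0 ord0]); last first.
    by apply/seteqP; split => x /=; rewrite in_itv/= andbT.
  by apply; exact: measurable_itv.
have hA : (mu A <= mu A1 + (2 * (e / 2))%:E)%E.
  apply: (near_top (a := a)) => //; first exact: ltW.
  move=> x Ax; have := aA x Ax; have [xa|xa] := leP (x ord0 ord0) (a ord0 ord0) => h.
    by left; split.
  by right; rewrite ler_norml; apply/andP; split; lra.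
have hB : (mu B <= mu B1 + (2 * (e / 2))%:E)%E.
  apply: (near_top (a := b)) => //; first exact: ltW.
  move=> x Bx; have := bB x Bx; have [xa|xa] := ltP (b ord0 ord0) (x ord0 ord0) => h.
    by left; split.
  by right; rewrite ler_norml; apply/andP; split; lra.
have rA := rescales_affine (l *: b) k0.
have rB := rescales_affine ((1 - l) *: a) l0.
pose P := (fun z : E => (1 - l)^-1 *: (z - l *: b)) @^-1` A1.
pose Q := (fun z : E => l^-1 *: (z - (1 - l) *: a)) @^-1` B1.
have mP : measurable P by rewrite -[X in measurable X]setTI; exact: rA.1.
have mQ : measurable Q by rewrite -[X in measurable X]setTI; exact: rB.1.
have PQ0 : P `&` Q = set0.
  apply/seteqP; split => // z [[_ /= h1] [_ /= h2]].
  move: h1 h2; rewrite !mxE; move: (z _ _) (a _ _) (b _ _) => z1 a1 b1.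
  by rewrite ler_pdivrMl// ltr_pdivlMl// => h1 h2; lra.
have PC : P `<=` C.
  move=> z [h _]; have := ABC _ _ h Bb.
  by rewrite scalerA mulfV ?lt0r_neq0// scale1r subrK.
have QC : Q `<=` C.
  move=> z [h _]; have := ABC _ _ Aa h.
  by rewrite scalerA mulfV ?lt0r_neq0// scale1r addrC subrK.
have PQ : ((1 - l)%:E * mu A1 + l%:E * mu B1 <= mu C)%E.
  rewrite -(rescales_measure rA mA1) -(rescales_measure rB mB1).
  rewrite -measureU//; apply: le_measure; rewrite ?inE//; first exact: measurableU.
  by move=> z [/PC|/QC].
have p3 : (0 <= mu A1)%E by exact: measure_ge0.
have p4 : (0 <= mu B1)%E by exact: measure_ge0.
move: hA hB PQ p3 p4.
move: (mu A) (mu B) (mu A1) (mu B1) (mu C) => m1 m2 m3 m4 m5 hA hB PQ m30 m40.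
apply: (@le_trans _ _ ((1 - l)%:E * (m3 + (2 * (e / 2))%:E) + l%:E * (m4 + (2 * (e / 2))%:E))%E).
  by apply: leeD; apply: lee_wpmul2l => //; rewrite lee_fin ltW.
have ee : (0 <= (2 * (e / 2))%:E)%E by rewrite lee_fin mulr_ge0// ltW.
rewrite (ge0_muleDr _ m30 ee) (ge0_muleDr _ m40 ee).
rewrite addeACA; apply: leeD => //; rewrite -!EFinM -EFinD lee_fin; lra.
Qed.

(** A class of integrable functions stable under sections and marginals, which lets the induction on
    the dimension run. *)
Definition cubed n (M L : R) (f : 'rV[R]_n -> R) := [/\ measurable_fun setT f,
  (forall x, 0 <= f x), (forall x, f x <= M) & (forall x, ~ cube n L x -> f x = 0)].

Lemma cubed_intble n M L (f : 'rV[R]_n -> R) : 0 <= M -> 0 <= L -> cubed M L f ->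
  intble (@lebesgue_rV R n) f.
Proof.
move=> M0 L0 [mf f0 fM fL]; have mc : measurable_fun setT (\1_(cube n L) : 'rV[R]_n -> R).
  by apply: measurable_indic; exact: measurable_cube.
apply: (@intble_dom _ _ _ _ _ (fun x => M * (\1_(cube n L) x : R))) => //.
  move=> x; rewrite ger0_norm// indicE; have [h|h] := pselect (cube n L x).
    by rewrite mem_set// mulr1.
  by rewrite fL// mulr_ge0.
apply: intbleZ; have i0 (x : 'rV[R]_n) : 0 <= (\1_(cube n L) x : R) by rewrite indicE.
apply: (ge0_intbleP _ mc i0).2.
rewrite integral_indic//; last exact: measurable_cube.
rewrite setIT; apply: (lebesgue_cube_sub L0) => //; exact: measurable_cube.
Qed.

Lemma superlevel_nonempty (f : E -> R) (M a : R) : a = sup (range f) -> 0 < a ->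
  (forall x, f x <= M) -> forall t, t < 1 -> [set x | t < f x / a] !=set0.
Proof.
move=> aE a0 fM t t1; have Ss : has_sup (range f).
  by split; [exists (f 0); exists 0|exists M => _ [x _ <-]].
have e0 : 0 < a * (1 - t) by rewrite mulr_gt0// subr_gt0.
have [_ [x _ <-]] := sup_adherent e0 Ss; rewrite -aE => h; exists x => /=.
rewrite ltr_pdivlMr//; move: h; lra.
Qed.

Lemma sup_range_gt0 (f : E -> R) (M : R) : (forall x, 0 <= f x) -> (forall x, f x <= M) ->
  int mu f != 0 -> 0 < sup (range f) /\ forall x, f x <= sup (range f).
Proof.
move=> f0 fM fi; have Ss : has_sup (range f).
  by split; [exists (f 0); exists 0|exists M => _ [x _ <-]].
have fs x : f x <= sup (range f) by apply: ub_le_sup; [exact: Ss.2|exists x].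
split => //; rewrite lt_neqAle eq_sym (le_trans (f0 0) (fs 0)) andbT.
apply/eqP => s0; move/eqP: fi; apply.
rewrite (_ : f = fun=> 0); first exact: int0.
by apply/funext => x; apply/eqP; rewrite eq_le f0 andbT -s0.
Qed.

Lemma cubed_div n M L a (f : 'rV[R]_n -> R) : 0 < a -> cubed M L f ->
  cubed (M / a) L (fun x => f x / a).
Proof.
move=> a0 [mf f0 fM fL]; split.
- exact: measurable_funM.
- by move=> x; rewrite divr_ge0// ltW.
- by move=> x; rewrite ler_pM2r ?invr_gt0.
- by move=> x /fL ->; rewrite mul0r.
Qed.

(** At each level t in [0, 1) the superlevel sets of f and g are nonempty and combine into that of
    h. Brunn-Minkowski at each level and the layer-cake formula give the arithmetic form; on the
    right it bounds the integral of min(h, 1). *)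
Lemma prekopa_normalized (f g h : E -> R) (M L l : R) : 0 <= M -> 0 <= L -> 0 < l -> l < 1 ->
  cubed M L f -> cubed M L g -> cubed M L h -> (forall x, f x <= 1) -> (forall x, g x <= 1) ->
  (forall t, t < 1 -> [set x | t < f x] !=set0) ->
  (forall t, t < 1 -> [set x | t < g x] !=set0) ->
  (forall x y, f x `^ (1 - l) * g y `^ l <= h ((1 - l) *: x + l *: y)) ->
  (1 - l) * int mu f + l * int mu g <= int mu h.
Proof.
move=> M0 L0 l0 l1 cf cg ch f1 g1 fne gne fgh; have k0 : 0 < 1 - l by rewrite subr_gt0.
have [mf f0 _ fL] := cf; have [mg g0 _ gL] := cg; have [mh h0 _ hL] := ch.
have fi := cubed_intble M0 L0 cf; have gi := cubed_intble M0 L0 cg.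
have hi := cubed_intble M0 L0 ch.
have [mcf Ef] := layer_cake mu mf f0; have [mcg Eg] := layer_cake mu mg g0.
have [mch Eh] := layer_cake mu mh h0.
have c0 (u : E -> R) t : (0 <= cake mu u t)%E by rewrite /cake; case: ifP.
have mlev (u : E -> R) t : measurable_fun setT u -> measurable [set x | t < u x].
  move=> mu_; have := mu_ measurableT `]t, +oo[%classic (measurable_itv _).
  rewrite setTI (_ : u @^-1` _ = [set x | t < u x])//.
  by apply/seteqP; split => x /=; rewrite in_itv/= andbT.
rewrite -lee_fin EFinD !EFinM !intE//.
apply: (@le_trans _ _ (\int[mu]_x (Num.min (h x) 1)%:E)%E); last first.
  apply: ge0_le_integral => //.
  - by move=> x _; rewrite lee_fin le_min h0 ler01.
  - by apply/measurable_EFinP; exact: measurable_minr.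
  - by apply/measurable_EFinP.
  - by move=> x _; rewrite lee_fin ge_min lexx.
have -> : (\int[mu]_x (f x)%:E = \int[mu]_x (Num.min (f x) 1)%:E)%E.
  by apply: eq_integral => x _; rewrite (min_idPl (f1 x)).
have -> : (\int[mu]_x (g x)%:E = \int[mu]_x (Num.min (g x) 1)%:E)%E.
  by apply: eq_integral => x _; rewrite (min_idPl (g1 x)).
rewrite Ef Eg Eh -!ge0_integralZl_EFin ?(ltW k0) ?(ltW l0)//.
rewrite -ge0_integralD//; last 4 first.
- by move=> t _; rewrite mule_ge0// lee_fin ltW.
- exact: measurable_funeM.
- by move=> t _; rewrite mule_ge0// lee_fin ltW.
- exact: measurable_funeM.
apply: ge0_le_integral => //.
- by move=> t _; rewrite adde_ge0// mule_ge0// lee_fin ltW.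
- by apply: emeasurable_funD; exact: measurable_funeM.
move=> t _; rewrite /cake; case: ifP => [/andP[t0 t1]|]; last by rewrite !mule0 adde0.
apply: (@brunn_minkowski1 _ _ _ L) => //; [exact: mlev|exact: mlev|exact: mlev|exact: fne|exact: gne|..].
- by move=> x /= tf; apply: contrapT => /fL fx; move: tf; rewrite fx ltNge t0.
- by move=> x /= tf; apply: contrapT => /gL fx; move: tf; rewrite fx ltNge t0.
move=> x y /= tf tg; apply: lt_le_trans (fgh x y).
pose m := Num.min (f x) (g y); have tm : t < m by rewrite lt_min tf tg.
have m0 : 0 < m by apply: le_lt_trans tm.
apply: (lt_le_trans tm); have -> : m = m `^ (1 - l) * m `^ l.
  by rewrite -powRD ?subrK ?powRr1 ?(ltW m0)// (gt_eqF m0) implybT.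
apply: ler_pM; rewrite ?powR_ge0//; apply: ge0_ler_powR;
  rewrite ?nnegrE ?(ltW k0) ?(ltW l0) ?(ltW m0) ?f0 ?g0 ?ge_min ?lexx ?orbT//.
Qed.

(** Dividing by the suprema normalizes f and g; the weighted arithmetic-geometric inequality then
    turns the sum into a product. *)
Lemma prekopa1 (f g h : E -> R) (M L l : R) : 0 <= M -> 0 <= L -> 0 < l -> l < 1 ->
  cubed M L f -> cubed M L g -> cubed M L h ->
  (forall x y, f x `^ (1 - l) * g y `^ l <= h ((1 - l) *: x + l *: y)) ->
  int mu f `^ (1 - l) * int mu g `^ l <= int mu h.
Proof.
move=> M0 L0 l0 l1 cf cg ch fgh; have k0 : 0 < 1 - l by rewrite subr_gt0.
have [mf f0 fM fL] := cf; have [mg g0 gM gL] := cg; have [mh h0 hM hL] := ch.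
have hi : 0 <= int mu h by exact: int_ge0.
have [->|fn] := eqVneq (int mu f) 0; first by rewrite powR0 ?gt_eqF// mul0r.
have [->|gn] := eqVneq (int mu g) 0; first by rewrite powR0 ?gt_eqF// mulr0.
have [a0 fa] := sup_range_gt0 f0 fM fn; have [b0 gb] := sup_range_gt0 g0 gM gn.
have fne := superlevel_nonempty erefl a0 fM; have gne := superlevel_nonempty erefl b0 gM.
move: (sup (range f)) (sup (range g)) a0 fa b0 gb fne gne => a b a0 fa b0 gb fne gne.
pose c := a `^ (1 - l) * b `^ l; have c0 : 0 < c by rewrite mulr_gt0 ?powR_gt0.
pose M' := Num.max (M / a) (Num.max (M / b) (M / c)).
have M'0 : 0 <= M' by rewrite le_max divr_ge0// ltW.
have wid n (K K' : R) (u : 'rV[R]_n -> R) : K <= K' -> cubed K L u -> cubed K' L u.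
  by move=> KK [? ? uK ?]; split => // x; exact: le_trans (uK x) KK.
have cf' : cubed M' L (fun x => f x / a).
  by apply: wid (cubed_div a0 cf); rewrite le_max lexx.
have cg' : cubed M' L (fun x => g x / b).
  by apply: wid (cubed_div b0 cg); rewrite !le_max lexx orbT.
have ch' : cubed M' L (fun x => h x / c).
  by apply: wid (cubed_div c0 ch); rewrite !le_max lexx !orbT.
have H : (1 - l) * int mu (fun x => f x / a) + l * int mu (fun x => g x / b) <=
    int mu (fun x => h x / c).
  apply: (prekopa_normalized M'0 L0 l0 l1 cf' cg' ch') => //.
  - by move=> x; rewrite ler_pdivrMr// mul1r.
  - by move=> x; rewrite ler_pdivrMr// mul1r.
  - move=> x y; rewrite !powRM ?invr_ge0 ?(ltW a0) ?(ltW b0)//.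
    rewrite mulrACA (powRV _ a0) (powRV _ b0) -invfM.
    by rewrite ler_pM2r// invr_gt0.
have Zf (u : E -> R) k : cubed M L u -> int mu (fun x => u x / k) = int mu u / k.
  move=> cu; have := @intZ _ _ _ mu k^-1 u (cubed_intble M0 L0 cu); rewrite mulrC => <-.
  by congr (int mu); apply/funext => x; rewrite mulrC.
move: H; rewrite !Zf// => H.
have F0 : 0 <= int mu f by exact: int_ge0.
have G0 : 0 <= int mu g by exact: int_ge0.
have := le_trans (powR_amgm (divr_ge0 F0 (ltW a0)) (divr_ge0 G0 (ltW b0)) l0 l1) H.
rewrite ler_pdivlMr//; apply: le_trans; rewrite /c.
have -> : int mu f `^ (1 - l) = (int mu f / a) `^ (1 - l) * a `^ (1 - l).
  by rewrite -powRM ?divr_ge0 ?(ltW a0)// divfK// gt_eqF.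
have -> : int mu g `^ l = (int mu g / b) `^ l * b `^ l.
  by rewrite -powRM ?divr_ge0 ?(ltW b0)// divfK// gt_eqF.
by rewrite mulrACA.
Qed.

End dimension_one.

Section prekopa.
Context {R : realType}.

Lemma cubed_section n M L (f : 'rV[R]_n.+1 -> R) (s : R) : cubed M L f ->
  cubed M L (fun z : 'rV[R]_n => f (rV_cons (s, z))) /\
  (L < `|s| -> forall z, f (rV_cons (s, z)) = 0).
Proof.
move=> [mf f0 fM fL]; split; last first.
  move=> Ls z; apply: fL => /(_ ord0); rewrite mxE unlift_none leNgt Ls//.
split => //.
- apply: (measurableT_comp mf).
  apply: (measurableT_comp (@measurable_rV_cons R n)).
  exact: measurable_pair1.
- move=> z zL; apply: fL => h; apply: zL => i; have := h (lift ord0 i).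
  by rewrite mxE liftK.
Qed.

Lemma int_rV1 (F : R -> \bar R) : measurable_fun [set: measurableTypeR R] F -> (forall x, 0 <= F x)%E ->
  (\int[@lebesgue_rV R 1]_x F (x ord0 ord0) = \int[lebesgue_measure]_s F s)%E.
Proof.
move=> mF F0; rewrite ge0_integral_lebesgue_rVS//; last first.
  exact: measurableT_comp mF (@measurable_rV_coord R 1 ord0).
apply: eq_integral => s _.
transitivity (\int[dirac (0%R : 'rV[R]_0)]_z (cst (F s) z))%E.
  by apply: eq_integral => z _; rewrite mxE unlift_none.
by rewrite integral_dirac// diracE mem_set// mul1e.
Qed.

Lemma cubed_marginal n M L (f : 'rV[R]_n.+1 -> R) : 0 <= M -> 0 <= L -> cubed M L f ->
  let F := fun x : 'rV[R]_1 =>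
    int (@lebesgue_rV R n) (fun z => f (rV_cons (x ord0 ord0, z))) in
  cubed (M * (2 * L) ^+ n) L F /\ int (@lebesgue_rV R 1) F = int (@lebesgue_rV R n.+1) f.
Proof.
move=> M0 L0 cf F; have [mf f0 fM fL] := cf.
have is_ s := cubed_intble M0 L0 (cubed_section s cf).1.
pose G (s : R) : R := int (@lebesgue_rV R n) (fun z => f (rV_cons (s, z))).
have mG : measurable_fun [set: measurableTypeR R] (fun s => (G s)%:E).
  have := @measurable_fun_fubini_tonelli_F _ _ (measurableTypeR R) 'rV[R]_n R (@lebesgue_rV R n)
    (fun p => (f (rV_cons p))%:E).
  rewrite /fubini_F (_ : (fun x => _) = (fun s => (G s)%:E)).
    apply; last by move=> p; rewrite lee_fin.
    by apply/measurable_EFinP; exact: measurableT_comp mf (@measurable_rV_cons R n).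
  by apply/funext => s; rewrite /G intE.
have cF : cubed (M * (2 * L) ^+ n) L F.
  split.
  - have := measurableT_comp mG (@measurable_rV_coord R 1 ord0).
    by move/measurable_EFinP.
  - by move=> x; apply: int_ge0.
  - move=> x; have [[ms s0 sM sL] _] := cubed_section (x ord0 ord0) cf.
    have cc : cubed M L (fun z : 'rV[R]_n => M * (\1_(cube n L) z : R)).
      split.
      - by apply: measurable_funM => //; apply: measurable_indic; exact: measurable_cube.
      - by move=> z; rewrite indicE mulr_ge0.
      - by move=> z; rewrite indicE -[leRHS]mulr1 ler_wpM2l// lern1 leq_b1.
      - by move=> z zL; rewrite indicE memNset// mulr0.
    have ic := cubed_intble M0 L0 cc.
    have mc : measurable_fun setT (\1_(cube n L) : 'rV[R]_n -> R).
      by apply: measurable_indic; exact: measurable_cube.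
    have -> : M * (2 * L) ^+ n = int (@lebesgue_rV R n) (fun z => M * (\1_(cube n L) z : R)).
      apply: EFin_inj; rewrite intE//.
      rewrite (eq_integral (fun z => (M%:E * (\1_(cube n L) z)%:E)%E)); last by [].
      rewrite ge0_integralZl_EFin//; last by exact/measurable_EFinP.
      rewrite EFinM integral_indic//; last exact: measurable_cube.
      by rewrite setIT; congr (_ * _)%E; rewrite -(@lebesgue_cube R n L L0).
    apply: int_le => //.
    move=> z; rewrite indicE; have [h|h] := pselect (cube n L z).
      by rewrite mem_set// mulr1.
    by rewrite sL// mulr_ge0.
  - move=> x xL; have Lx : L < `|x ord0 ord0|.
      by rewrite ltNge; apply/negP => h; apply: xL => i; rewrite (ord1 i).
    rewrite /F (_ : (fun z => _) = fun=> 0); first exact: int0.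
    by apply/funext => z; exact: (cubed_section _ cf).2 Lx z.
split => //.
have MM0 : 0 <= M * (2 * L) ^+ n by rewrite mulr_ge0// exprn_ge0// mulr_ge0.
apply: EFin_inj; rewrite (intE (cubed_intble MM0 L0 cF)) (intE (cubed_intble M0 L0 cf)).
rewrite (@int_rV1 (fun s => (G s)%:E) mG); last by move=> s; rewrite lee_fin int_ge0.
rewrite ge0_integral_lebesgue_rVS; [|by apply/measurable_EFinP|by move=> x; rewrite lee_fin].
by apply: eq_integral => s _; rewrite /G intE.
Qed.

(** Induction on the dimension: sections at fixed first coordinates satisfy the hypothesis, so the
    marginals satisfy it in dimension one. *)
Lemma prekopa_leindler n (f g h : 'rV[R]_n -> R) (M L l : R) : 0 <= M -> 0 <= L ->
  0 < l -> l < 1 -> cubed M L f -> cubed M L g -> cubed M L h ->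
  (forall x y, f x `^ (1 - l) * g y `^ l <= h ((1 - l) *: x + l *: y)) ->
  int (@lebesgue_rV R n) f `^ (1 - l) * int (@lebesgue_rV R n) g `^ l <=
  int (@lebesgue_rV R n) h.
Proof.
move=> + L0 l0 l1; elim: n M f g h => [|n ih] M f g h M0 cf cg ch fgh.
  have H (u : 'rV[R]_0 -> R) : cubed M L u -> int (@lebesgue_rV R 0) u = u 0.
    move=> cu; have [mu_ u0 _ _] := cu; apply: EFin_inj; rewrite (intE (cubed_intble M0 L0 cu)).
    rewrite integral_dirac//; last by apply/measurable_EFinP.
    by rewrite diracE mem_set// mul1e.
  by rewrite !H//; have := fgh 0 0; rewrite !scaler0 addr0.
have [cF <-] := cubed_marginal M0 L0 cf; have [cG <-] := cubed_marginal M0 L0 cg.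
have [cH <-] := cubed_marginal M0 L0 ch.
have MM0 : 0 <= M * (2 * L) ^+ n by rewrite mulr_ge0// exprn_ge0// mulr_ge0.
apply: (prekopa1 MM0 L0 l0 l1 cF cG cH) => x y.
apply: (ih M) => //.
- exact: (cubed_section _ cf).1.
- exact: (cubed_section _ cg).1.
- exact: (cubed_section _ ch).1.
move=> z w; have := fgh (rV_cons (x ord0 ord0, z)) (rV_cons (y ord0 ord0, w)).
congr (_ <= h _); apply/rowP => i; rewrite !mxE.
by case: (unlift ord0 i) => [j|] //=; rewrite !mxE.
Qed.

Lemma gaussp_logconcave n t (x y : 'rV[R]_n) l : 0 < t -> 0 < l -> l < 1 ->
  gaussp t x `^ (1 - l) * gaussp t y `^ l <= gaussp t ((1 - l) *: x + l *: y).
Proof.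
move=> t0 l0 l1; have k0 : 0 < 1 - l by rewrite subr_gt0.
have z0 := @gsZ_gt0 R n t t0.
rewrite !gausspE !powRM ?invr_ge0 ?expR_ge0 ?(ltW z0)// mulrACA -powRD ?subrK ?oner_eq0//.
rewrite powRr1 ?invr_ge0 ?(ltW z0)// ler_pM2r ?invr_gt0//.
rewrite -!expRM -expRD ler_expR.
have -> : - (sqn x / (2 * t)) * (1 - l) + - (sqn y / (2 * t)) * l =
  - (((1 - l) * sqn x + l * sqn y) / (2 * t)) by move: (sqn x) (sqn y) => u v; field; rewrite gt_eqF.
rewrite lerN2 ler_pM2r ?invr_gt0 ?mulr_gt0//.
rewrite sqnD !sqnZ dotZl dotZr.
have := sqnB x y; have := sqn_ge0 (x - y).
move: (sqn (x - y)) (sqn x) (sqn y) (dot x y) => u v w s u0 E1.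
have : 0 <= l * (1 - l) * u by rewrite !mulr_ge0// ltW.
rewrite E1; nra.
Qed.

(** Prekopa-Leindler for z -> [gaussp t (u - z) * phi z], with u the two given points and the one
    between them; the product is jointly log-concave in u and z. *)
Lemma conv_logconcave n t M L (phi : 'rV[R]_n -> R) : 0 < t -> 0 <= M -> 0 <= L ->
  cubed M L phi -> logconcave phi -> logconcave (conv t phi).
Proof.
move=> t0 M0 L0 cphi lc x y l l0 l1; rewrite !convdefE.
have [mp p0 pM pL] := cphi.
have Z0 : 0 <= (@gsZ R n t)^-1 by rewrite invr_ge0 ltW// gsZ_gt0.
have cg u : cubed ((@gsZ R n t)^-1 * M) L (fun z => gaussp t (u - z) * phi z).
  split.
  - by apply: measurable_funM => //; exact: measurable_gaussp_at.
  - by move=> z; rewrite mulr_ge0 ?gaussp_ge0.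
  - by move=> z; apply: ler_pM; rewrite ?gaussp_ge0 ?gaussp_le.
  - by move=> z /pL ->; rewrite mulr0.
apply: (prekopa_leindler (mulr_ge0 Z0 M0) L0 l0 l1 (cg x) (cg y) (cg _)) => z w.
have g0 (u : 'rV[R]_n) : 0 <= gaussp t u by exact: gaussp_ge0.
rewrite (powRM _ (g0 (x - z)) (p0 z)) (powRM _ (g0 (y - w)) (p0 w)) mulrACA.
apply: ler_pM; rewrite ?mulr_ge0 ?powR_ge0//; last exact: lc.
apply: le_trans (gaussp_logconcave _ _ t0 l0 l1) _.
rewrite le_eqVlt; apply/orP; left; apply/eqP; congr gaussp.
by apply/rowP => i; rewrite !mxE; ring.
Qed.

End prekopa.

(** * Smooth bumps supported in boxes *)

Lemma sqr_normr (R : realDomainType) (x : R) : `|x| ^+ 2 = x ^+ 2.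
Proof. exact: real_normK (num_real x). Qed.

Lemma is_derive_sqr_bound (R : realType) (f : R -> R) (x d C : R) :
  (forall y, `|f y - f x - (y - x) * d| <= C * (y - x) ^+ 2) -> is_derive x 1 f d.
Proof.
move=> H; have C0 : 0 <= C.
  have := le_trans (normr_ge0 _) (H (x + 1)).
  by rewrite (_ : x + 1 - x = 1) ?expr1n ?mulr1// addrAC subrr add0r.
have c : h^-1 *: ((f \o shift x) (h *: (1 : R)) - f x) @[h --> 0^'] --> d.
  apply/cvgrPdist_le => e e0.
  near=> h; have h0 : h != 0 by near: h; exact: nbhs_dnbhs_neq.
  have hC : `|h| <= e / (C + 1).
    near: h; apply: dnbhs0_le; by rewrite divr_gt0// ltr_wpDl.
  rewrite /= /GRing.scale/= mulr1 distrC.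
  have -> : h^-1 * (f (h + x) - f x) - d = h^-1 * (f (h + x) - f x - (h + x - x) * d).
    by rewrite addrK [in RHS]mulrBr mulrA mulVf// mul1r.
  rewrite normrM normfV; apply: (@le_trans _ _ (`|h|^-1 * (C * h ^+ 2))).
    by rewrite ler_wpM2l ?invr_ge0//; apply: le_trans (H _) _; rewrite addrK.
  have -> : `|h|^-1 * (C * h ^+ 2) = C * `|h|.
    by rewrite -(sqr_normr h); field; rewrite normr_eq0.
  apply: (@le_trans _ _ ((C + 1) * `|h|)); first by rewrite ler_wpM2r// lerDl.
  by rewrite mulrC -ler_pdivlMr// ltr_wpDl.
by apply: DeriveDef; [apply/cvg_ex; exists d|exact: cvg_lim c].
Unshelve. all: by end_near. Qed.

Lemma expRN_inv_le (R : realType) (c w : R) (m : nat) : 0 < c -> 0 < w -> (0 < m)%N ->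
  expR (- (c / w)) <= (m%:R / c) ^+ m * w ^+ m.
Proof.
move=> c0 w0 m0; have m0' : 0 < m%:R :> R by rewrite ltr0n.
have cw : 0 < c / w by rewrite divr_gt0.
rewrite expRN -exprMn -[leRHS]invrK -exprVn lef_pV2 ?posrE ?exprn_gt0 ?expR_gt0//; last first.
  by rewrite invr_gt0 !mulr_gt0 ?invr_gt0.
have -> : (m%:R / c * w)^-1 = c / w / m%:R.
  by field; rewrite !gt_eqF.
have -> : expR (c / w) = expR (c / w / m%:R) ^+ m.
  by rewrite -expRM_natl; congr expR; rewrite mulrCA mulfV ?mulr1// gt_eqF.
rewrite lerXn2r ?nnegrE ?expR_ge0//; first by rewrite divr_ge0// ltW.
by apply: le_trans (expR_ge1Dx _); rewrite lerDr.
Qed.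

Section flat_bump.
Context {R : realType}.
Variable c : R.
Hypothesis c0 : 0 < c.
Implicit Types (p : {poly R}) (k : nat).

(** A family closed under differentiation: a derivative changes the polynomial to [flat_deriv c p k]
    and raises the order of the pole by 2. *)
Definition flat p k (x : R) : R :=
  if `|x| < 1 then p.[x] * (1 - x ^+ 2)^-1 ^+ k * expR (- (c * (1 - x ^+ 2)^-1)) else 0.

Definition flat_deriv p k : {poly R} :=
  p^`() * (1 - 'X ^+ 2) ^+ 2 + (2 * k%:R) *: ('X * p * (1 - 'X ^+ 2)) - (2 * c) *: ('X * p).

Lemma horner_bound p : exists2 K : R, 0 <= K & forall x, `|x| < 1 -> `|p.[x]| <= K.
Proof.
exists (\sum_(i < size p) `|p`_i|) => [|x x1]; first exact: sumr_ge0.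
rewrite horner_coef; apply: le_trans (ler_norm_sum _ _ _) _; apply: ler_sum => i _.
by rewrite normrM normrX -[leRHS]mulr1 ler_wpM2l// exprn_ile1// ltW.
Qed.

(** Using the exponential with power m = k + 2 absorbs the pole of order k and leaves (1 - x^2)^2 <=
    4 (x - z)^2; hence value and derivative vanish at the edge. *)
Lemma flat_edge p k (z : R) : `|z| = 1 -> exists C, forall x, `|flat p k x| <= C * (x - z) ^+ 2.
Proof.
move=> z1; have [K K0 pK] := horner_bound p; pose m := k.+2.
exists (K * (m%:R / c) ^+ m * 4) => x; rewrite /flat; case: ifPn => [x1|_]; last first.
  rewrite normr0; apply: mulr_ge0; last exact: sqr_ge0.
  by apply: mulr_ge0 => //; apply: mulr_ge0 => //; rewrite exprn_ge0// divr_ge0// ltW.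
have w0 : 0 < 1 - x ^+ 2 by rewrite subr_gt0 -sqr_normr exprn_ilt1.
have wz : (1 - x ^+ 2) ^+ 2 <= 4 * (x - z) ^+ 2.
  have -> : 4 * (x - z) ^+ 2 = (2 * `|x - z|) ^+ 2 by rewrite exprMn sqr_normr; ring.
  rewrite lerXn2r ?nnegrE ?(ltW w0) ?mulr_ge0//.
  have h := ler_normB z (z - x); rewrite subKr in h.
  have h2 : 1 - `|x| <= `|x - z|.
    by have := lerB_dist z x; rewrite z1 distrC.
  have -> : 1 - x ^+ 2 = (1 + `|x|) * (1 - `|x|) by rewrite -sqr_normr; ring.
  apply: ler_pM; [by rewrite addr_ge0|by rewrite subr_ge0 ltW| |exact: h2].
  by move: x1; lra.
move: (1 - x ^+ 2) w0 wz => w w0 wz.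
rewrite !normrM (ger0_norm (expR_ge0 _)) (ger0_norm (exprn_ge0 _ _)) ?invr_ge0 ?(ltW w0)//.
have := expRN_inv_le c0 w0 (ltn0Sn k.+1); rewrite -/m => ew.
apply: (@le_trans _ _ (K * (w^-1 ^+ k * ((m%:R / c) ^+ m * w ^+ m)))).
  rewrite -mulrA; apply: ler_pM => //; first by rewrite mulr_ge0 ?expR_ge0// exprn_ge0// invr_ge0 ltW.
    exact: pK.
  by rewrite ler_wpM2l// exprn_ge0// invr_ge0 ltW.
have -> : K * (w^-1 ^+ k * ((m%:R / c) ^+ m * w ^+ m)) = K * (m%:R / c) ^+ m * w ^+ 2.
  rewrite /m -addn2 (exprD w) exprVn; have wk : w ^+ k != 0 by rewrite expf_neq0// gt_eqF.
  by move: (_ ^+ (k + 2)) (w ^+ k) wk => u v v0; field.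
by rewrite -[leRHS]mulrA ler_wpM2l// mulr_ge0// exprn_ge0// divr_ge0// ltW.
Qed.

Lemma flat_is_derive p k (x : R) : is_derive x 1 (flat p k) (flat (flat_deriv p k) k.+2 x).
Proof.
have [x1|x1|x1] := ltgtP `|x| 1; last first.
- have [C HC] := flat_edge p k x1.
  have E0 q l : flat q l x = 0 by rewrite /flat x1 ltxx.
  rewrite E0; apply: (is_derive_sqr_bound (C := C)) => y.
  by rewrite E0 mulr0 !subr0.
- have -> : flat (flat_deriv p k) k.+2 x = 0 by rewrite /flat ltNge ltW.
  refine (near_eq_is_derive (f := cst 0) _ (is_derive_cst _ _ _)).
  have : \forall y \near x, 1 < `|y|.
    by apply: (@cvgr_gt _ _ _ _ _ _ (@norm_continuous _ _ x)).
  by apply: filterS => y y1; rewrite /flat ltNge ltW.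
pose V (y : R) : R := (1 - y ^+ 2)^-1.
have w0 : 1 - x ^+ 2 != 0 by rewrite gt_eqF// subr_gt0 -sqr_normr exprn_ilt1.
have DV : is_derive x 1 V (2 * x * V x ^+ 2).
  have Dw : is_derive x 1 (fun y : R => 1 - y ^+ 2) (- (2 * x)).
    by apply: is_derive_eq; rewrite /GRing.scale/=; ring.
  have := @is_deriveV _ (fun y : R => 1 - y ^+ 2) x _ 1 w0 Dw.
  move=> D; apply: is_derive_eq D _.
  by rewrite /GRing.scale/= /V; field.
have De : is_derive x 1 (fun y => expR (- (c * V y))) (expR (- (c * V x)) * - (c * (2 * x * V x ^+ 2))).
  have Di : is_derive x 1 (fun y => - (c * V y)) (- (c * (2 * x * V x ^+ 2))).
    exact: is_deriveN (is_deriveZ c DV).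
  exact: (is_derive1_comp (is_derive_expR _) Di).
have DVk : is_derive x 1 (fun y => V y ^+ k) (k%:R * (2 * x) * (V x ^+ k * V x)).
  rewrite (_ : (fun y => V y ^+ k) = V ^+ k); last first.
    by elim: k => [|j ih]; apply/funext => y; rewrite ?expr0// !exprS -ih.
  apply: is_derive_eq (is_deriveX k DV) _; rewrite /GRing.scale/=.
  move: (V x) => v; case: k => [|j]; first by rewrite !mul0r.
  by rewrite [j.+1.-1]/= (exprS v j); ring.
have Dall := is_deriveM (is_deriveM (is_derive_poly p x) DVk) De.
refine (near_eq_is_derive (f := (horner p * (fun y => V y ^+ k)) * (fun y => expR (- (c * V y)))) _ _).
  have : \forall y \near x, `|y| < 1.
    by apply: (@cvgr_lt _ _ _ _ _ _ (@norm_continuous _ _ x)).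
  by apply: filterS => y y1; rewrite /flat y1 /V.
apply: is_derive_eq Dall _.
have -> : flat (flat_deriv p k) k.+2 x =
    (flat_deriv p k).[x] * (V x ^+ k * V x * V x) * expR (- (c * V x)).
  by rewrite /flat x1 -(addn2 k) exprD expr2 !mulrA.
rewrite /flat_deriv !hornerE /GRing.scale/=.
have -> : (horner p * (fun y => V y ^+ k)) x = p.[x] * V x ^+ k by [].
move: (expR _) (V x ^+ k) => e u; rewrite /V; move: w0.
by move: (p.[x]) (p^`().[x]) => a b w0; field.
Qed.

End flat_bump.

Section lines.
Context {R : realType} {n : nat}.
Local Notation E := 'rV[R]_n.

Lemma is_derive_line (f : E -> R) (x v : E) (s d : R) :
  is_derive (x + s *: v) v f d -> is_derive s 1 (fun s => f (x + s *: v)) d.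
Proof.
move=> [df dv]; have E1 : (fun h : R => h^-1 *: (((fun s => f (x + s *: v)) \o shift s) (h *: (1 : R)) -
    f (x + s *: v))) = (fun h : R => h^-1 *: ((f \o shift (x + s *: v)) (h *: v) - f (x + s *: v))).
  apply/funext => h /=; congr (_ *: (f _ - _)).
  by rewrite [h *: 1]mulr1 scalerDl addrCA.
by apply: DeriveDef; rewrite ?/derivable ?/derive E1.
Qed.

Lemma is_derive_of_line (f : E -> R) (x v : E) (d : R) :
  is_derive (0 : R) 1 (fun s : R => f (x + s *: v)) d -> is_derive x v f d.
Proof.
move=> [df dv]; have E1 : (fun h : R => h^-1 *: (((fun s => f (x + s *: v)) \o shift 0) (h *: (1 : R)) -
    f (x + 0 *: v))) = (fun h : R => h^-1 *: ((f \o shift x) (h *: v) - f x)).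
  apply/funext => h /=; congr (_ *: (f _ - f _)); last by rewrite scale0r addr0.
  by rewrite [h *: 1]mulr1 addr0 addrC.
by move: df dv; rewrite /derivable /derive E1 => df dv; apply: DeriveDef.
Qed.

Variable F : 'I_n -> nat -> R -> R.
Hypothesis FD : forall i k (x : R), is_derive x 1 (F i k) (F i k.+1 x).

(** The i-th factor has been differentiated [kappa i] times, so a partial derivative just increments
    one entry of [kappa]. *)
Definition prodf (kappa : 'I_n -> nat) (x : E) : R := \prod_i F i (kappa i) (x ord0 i).

Lemma differentiable_prodf kappa x : differentiable (prodf kappa) x.
Proof.
rewrite /prodf; elim: (index_enum _) => [|i r ih].
  rewrite (_ : (fun x => _) = cst 1); first exact: differentiable_cst.
  by apply/funext => y; rewrite big_nil.
rewrite (_ : (fun x => _) = (fun x : E => F i (kappa i) (x ord0 i)) *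
    (fun x : E => \prod_(j <- r) F j (kappa j) (x ord0 j))); last first.
  by apply/funext => y; rewrite big_cons.
apply: differentiableM => //.
apply: (differentiable_comp (f := fun x : E => x ord0 i) (g := F i (kappa i))).
  exact: differentiable_coord.
by apply/derivable1_diffP; have [] := FD i (kappa i) (x ord0 i).
Qed.

Lemma partial_prodf j kappa :
  partial j (prodf kappa) = prodf (fun i => (kappa i + (i == j))%N).
Proof.
apply/funext => x; rewrite /partial; apply: derive_val; apply: is_derive_of_line.
pose C := \prod_(i | i != j) F i (kappa i) (x ord0 i).
have D1 : is_derive (0 : R) 1 (fun s : R => F j (kappa j) (x ord0 j + s)) (F j (kappa j).+1 (x ord0 j)).
  have Ds : is_derive (0 : R) 1 (fun s : R => x ord0 j + s) 1.
    by have := is_deriveD (is_derive_cst (x ord0 j) (0 : R) (1 : R)) (is_derive_id (0 : R) (1 : R)); rewrite add0r.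
  have := FD j (kappa j) (x ord0 j); rewrite -{1}[x ord0 j]addr0 => DF.
  by have := is_derive1_comp DF Ds; rewrite mulr1.
have D2 := is_deriveM (is_derive_cst C (0 : R) 1) D1.
rewrite (_ : (fun s => _) = cst C * (fun s : R => F j (kappa j) (x ord0 j + s))).
  apply: is_derive_eq D2 _; rewrite scaler0 addr0 /GRing.scale/= /prodf (bigD1 j)//= eqxx addn1 mulrC.
  by congr (_ * _); apply: eq_bigr => i ij; rewrite (negbTE ij) addn0.
apply/funext => s; rewrite /prodf (bigD1 j)//= !mxE !eqxx mulr1 mulrC; congr (_ * _).
by apply: eq_bigr => i ij; rewrite !mxE (negbTE ij) andbF mulr0 addr0.
Qed.

Lemma smooth_prodf kappa : smooth (prodf kappa).
Proof.
move=> s x; suff [k' ->] : exists k', foldr (@partial R n) (prodf kappa) s = prodf k'.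
  exact: differentiable_prodf.
elim: s => [|j s [k' ih]] /=; first by exists kappa.
by rewrite ih partial_prodf; eexists.
Qed.

End lines.

Section box_bump.
Context {R : realType} {n : nat}.
Local Notation E := 'rV[R]_n.
Variables (c : R) (z : E) (rho : 'I_n -> R).
Hypotheses (c0 : 0 < c) (rho0 : forall i, 0 < rho i).

Let step (pk : {poly R} * nat) := (flat_deriv c pk.1 pk.2, pk.2.+2).
Let fac i k (x : R) : R := rho i ^- k *
  flat c (iter k step (1, 0%N)).1 (iter k step (1, 0%N)).2 ((x - z ord0 i) / rho i).

Let facD i k (x : R) : is_derive x 1 (fac i k) (fac i k.+1 x).
Proof.
pose pk := iter k step (1, 0%N).
have Da : is_derive x 1 (fun x => (x - z ord0 i) / rho i) (rho i)^-1.
  by apply: is_derive_eq; rewrite /GRing.scale/= subr0 mulr1 mulr0 add0r.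
have D := @is_derive1_comp R (flat c pk.1 pk.2) (fun x => (x - z ord0 i) / rho i) x _ _
  (flat_is_derive c0 pk.1 pk.2 ((x - z ord0 i) / rho i)) Da.
have := is_deriveM (is_derive_cst (rho i ^- k) x 1) D => D2.
apply: is_derive_eq D2 _; rewrite scaler0 addr0 /GRing.scale/= /fac iterS -/pk/=.
by rewrite exprS invfM; move: (flat _ _ _ _) (rho i ^- k) => u v; ring.
Qed.

(** As [c] decreases to 0 the bump increases to the indicator of the open box. *)
Definition box_bump (x : E) : R := \prod_i
  (if `|x ord0 i - z ord0 i| < rho i then
    expR (- (c / (1 - ((x ord0 i - z ord0 i) / rho i) ^+ 2))) else 0).

Lemma box_bump_smooth : smooth box_bump.
Proof.
rewrite (_ : box_bump = prodf fac (fun=> 0%N)); first exact: (smooth_prodf facD).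
apply/funext => x; apply: eq_bigr => i _; rewrite /fac /flat /= expr0 invr1 mul1r hornerC.
rewrite expr0 !mul1r normrM normfV (gtr0_norm (rho0 i)) ltr_pdivrMr// mul1r.
by case: ifP.
Qed.

Lemma box_bump_ge0 (x : E) : 0 <= box_bump x.
Proof. by apply: prodr_ge0 => i _; case: ifP => // _; exact: expR_ge0. Qed.

Lemma box_bump_gt0 (x : E) : (forall i, `|x ord0 i - z ord0 i| < rho i) -> 0 < box_bump x.
Proof. by move=> h; apply: prodr_gt0 => i _; rewrite h expR_gt0. Qed.

Lemma box_bump_eq0 (x : E) i : rho i <= `|x ord0 i - z ord0 i| -> box_bump x = 0.
Proof. by move=> h; rewrite /box_bump (bigD1 i)//= ltNge h mul0r. Qed.

Lemma box_bump_le1 (x : E) : box_bump x <= 1.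
Proof.
apply: prodr_ile1 => i _; case: ifP => h; last by rewrite lexx ler01.
rewrite expR_ge0/=; apply: (@le_trans _ _ (expR 0)); last by rewrite expR0.
rewrite ler_expR oppr_le0 divr_ge0 ?(ltW c0)// subr_ge0.
rewrite -sqr_normr expr_le1// normrM normfV (gtr0_norm (rho0 i)) ler_pdivrMr// mul1r.
exact: ltW.
Qed.

End box_bump.

(** * Compactly supported smooth functions *)

Section smooth_compact.
Context {R : realType} {n : nat}.
Local Notation E := 'rV[R]_n.
Local Notation mu := (@lebesgue_rV R n).

Definition smooth_in_cube (L : R) (f : E -> R) :=
  smooth f /\ (forall x : E, ~ cube n L x -> f x = 0).

Lemma smooth_differentiable (f : E -> R) x : smooth f -> differentiable f x.
Proof. by move=> /(_ [::] x). Qed.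

Lemma smooth_continuous (f : E -> R) : smooth f -> continuous f.
Proof. by move=> sf x; apply: differentiable_continuous; exact: smooth_differentiable. Qed.

Lemma smooth_partial (f : E -> R) i : smooth f -> smooth (partial i f).
Proof. by move=> sf s x; have := sf (rcons s i) x; rewrite foldr_rcons. Qed.

Lemma closed_cube L : closed (cube n L : set E).
Proof.
have -> : (cube n L : set E) = \bigcap_(i in [set: 'I_n]) ((fun x : E => `|x ord0 i|) @^-1` [set r | r <= L]).
  by apply/seteqP; split => x h i; [move=> _; exact: h|exact: h].
apply: closed_bigI => i _; apply: preimage_closed; last exact: closed_le.
move=> x _; apply: continuous_comp; last exact: norm_continuous.
exact: (@coord_continuous R 1 n ord0 i x).
Qed.

Lemma compact_cube L : compact (cube n L : set E).
Proof.
apply: bounded_closed_compact; last exact: closed_cube.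
exists (Num.max 0 L); split; first exact: num_real.
move=> M LM x /= xL; apply: ltW; apply: le_lt_trans LM.
apply: mx_norm_le => [|i]; first by rewrite le_max lexx.
by apply: le_trans (xL i) _; rewrite le_max lexx orbT.
Qed.

Lemma partial_eq0 (f : E -> R) i (A : set E) : open A -> (forall x, A x -> f x = 0) ->
  forall x, A x -> partial i f x = 0.
Proof.
move=> oA f0 x Ax; rewrite /partial (@near_eq_derive _ _ _ f (cst 0)); last first.
  by apply: filterS (open_nbhs_nbhs (conj oA Ax)) => y /f0.
exact: derive_cst.
Qed.

Lemma smooth_in_cube_partial L f i : smooth_in_cube L f -> smooth_in_cube L (partial i f).
Proof.
move=> [sf f0]; split; first exact: smooth_partial.
move=> x xL; apply: (@partial_eq0 _ _ (~` cube n L)) => //; first exact: closed_openC (@closed_cube L).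
Qed.

Lemma smooth_in_cube_bounded L f : smooth_in_cube L f -> exists2 M, 0 <= M & forall x, `|f x| <= M.
Proof.
move=> [sf f0]; have cf : {within (cube n L : set E), continuous f}.
  by apply: continuous_subspaceT; exact: smooth_continuous.
have [M [_ HM]] := compact_bounded (continuous_compact cf (@compact_cube L)).
exists (`|M| + 1) => [|x]; first by rewrite addr_ge0.
have [xL|xL] := pselect (cube n L x); last by rewrite f0// normr0 addr_ge0.
apply: (HM (`|M| + 1)); last by exists x.
by apply: le_lt_trans (ler_norm M) _; rewrite ltrDl.
Qed.

Lemma smooth_in_cube_intble L f : 0 <= L -> smooth_in_cube L f ->
  [/\ measurable_fun setT f, intble mu f & intble mu (fun x => f x ^+ 2)].
Proof.
move=> L0 sf; have [M M0 fM] := smooth_in_cube_bounded sf; have [s0 f0] := sf.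
have mf : measurable_fun setT f by apply: continuous_measurable_rV; exact: smooth_continuous.
have H (g : E -> R) K : 0 <= K -> measurable_fun setT g -> (forall x, `|g x| <= K) ->
    (forall x, ~ cube n L x -> g x = 0) -> intble mu g.
  move=> K0 mg gK g0; apply: (@intble_dom _ _ _ _ _ (fun x => `|g x|)) => //.
  apply: (cubed_intble K0 L0); split => //; first exact: measurableT_comp.
  by move=> x /g0 ->; rewrite normr0.
split => //; first exact: H M0 mf fM f0.
apply: (H _ (M ^+ 2)); [by rewrite sqr_ge0|exact: measurable_funX| |].
- by move=> x; rewrite normrX lerXn2r.
- by move=> x /f0 ->; rewrite expr0n.
Qed.

Lemma smooth_line f (x xi : E) (s : R) : smooth f ->
  is_derive s 1 (fun s => f (x + s *: xi)) (\sum_i xi ord0 i * partial i f (x + s *: xi)).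
Proof.
move=> sf; apply: is_derive_line; set y := x + s *: xi.
have df := smooth_differentiable y sf.
have -> : \sum_i xi ord0 i * partial i f y = 'd f y xi.
  rewrite {2}(row_sum_delta xi) linear_sum; apply: eq_bigr => i _.
  by rewrite linearZ /= /partial deriveE.
by apply: DeriveDef; [exact: diff_derivable|rewrite deriveE].
Qed.

End smooth_compact.

(** * Taylor expansion, integration by parts and the heat form *)

Lemma taylor2 (R : realType) (f0 f1 f2 : R -> R) (M t : R) :
  (forall x : R, is_derive x 1 f0 (f1 x)) -> (forall x : R, is_derive x 1 f1 (f2 x)) ->
  (forall x, `|f2 x| <= M) -> `|f0 t - f0 0 - t * f1 0| <= M * `|t| ^+ 2.
Proof.
move=> d0 d1 h2; have M0 : 0 <= M by apply: le_trans (h2 0).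
have h1 x : `|x| <= `|t| -> `|f1 x - f1 0| <= M * `|t|.
  move=> xt; apply: le_trans (derive_lipschitz d1 h2 _ _) _.
  by rewrite subr0 ler_wpM2l.
have D (y : R) : is_derive y 1 (fun x => f0 x - f0 0 - x * f1 0) (f1 y - f1 0).
  by apply: is_derive_eq; rewrite /GRing.scale/= subr0 mulr0 mulr1 add0r.
have := @derive_lipschitz_segment R _ _ (M * `|t|) t D h1.
by rewrite subrr mul0r !subr0 -mulrA -expr2.
Qed.

Lemma unif_bound (R : realType) (I : finType) (T : Type) (F : I -> T -> R) :
  (forall i, exists2 M, 0 <= M & forall x : T, `|F i x| <= M) ->
  exists2 M, 0 <= M & forall i (x : T), `|F i x| <= M.
Proof.
move=> H; have [M HM] := choice (fun i => let: ex_intro2 M a b := H i in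
  ex_intro (fun M => 0 <= M /\ forall x : T, `|F i x| <= M) M (conj a b)).
exists (\sum_i M i) => [|i x]; first by apply: sumr_ge0 => i _; have [] := HM i.
rewrite (bigD1 i)//= ler_wpDr//; last by have [_] := HM i; exact.
by apply: sumr_ge0 => j _; have [] := HM j.
Qed.

Section smooth_taylor.
Context {R : realType} {n : nat}.
Local Notation E := 'rV[R]_n.
Local Notation mu := (@lebesgue_rV R n).
Implicit Types (f phi psi : E -> R) (x xi : E).

Lemma is_derive_lsum (c : 'I_n -> R) (h dh : 'I_n -> R -> R) (s : R) :
  (forall i, is_derive s 1 (h i) (dh i s)) ->
  is_derive s 1 (fun s => \sum_i c i * h i s) (\sum_i c i * dh i s).
Proof.
move=> H; have D i : is_derive s 1 (c i \*: h i) (c i *: dh i s) by exact: is_deriveZ.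
have := is_derive_sum D; rewrite (_ : \sum_i (c i \*: h i) = (fun s => \sum_i c i * h i s))//.
by apply/funext => t; rewrite fct_sumE.
Qed.

Lemma lsum_bound xi (h : 'I_n -> R) K : (forall i, `|h i| <= K) ->
  `|\sum_i xi ord0 i * h i| <= n%:R * enorm xi * K.
Proof.
move=> hK; apply: le_trans (ler_norm_sum _ _ _) _.
apply: (@le_trans _ _ (\sum_(i < n) enorm xi * K)); last first.
  by rewrite sumr_const card_ord -[X in X <= _]mulr_natl mulrA.
by apply: ler_sum => i _; rewrite normrM; apply: ler_pM => //; exact: coord_le_enorm.
Qed.

Variable L : R.
Hypothesis L0 : 0 <= L.

Lemma smooth_taylor2 phi : smooth_in_cube L phi -> exists2 M, 0 <= M & forall x xi,
  `|phi (x + xi) - phi x - \sum_i xi ord0 i * partial i phi x| <= M * enorm xi ^+ 2.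
Proof.
move=> sp; have sp1 i := smooth_in_cube_partial i sp.
have [M M0 HM] : exists2 M, 0 <= M & forall (ij : 'I_n * 'I_n) x,
    `|partial ij.2 (partial ij.1 phi) x| <= M.
  by apply: unif_bound => -[i j]; exact: smooth_in_cube_bounded (smooth_in_cube_partial j (sp1 i)).
exists (n%:R ^+ 2 * M) => [|x xi]; first by rewrite mulr_ge0// exprn_ge0.
pose f0 (s : R) := phi (x + s *: xi).
pose f1 (s : R) := \sum_i xi ord0 i * partial i phi (x + s *: xi).
pose f2 (s : R) := \sum_i xi ord0 i * \sum_j xi ord0 j * partial j (partial i phi) (x + s *: xi).
have d0 (s : R) : is_derive s 1 f0 (f1 s) by apply: smooth_line; exact: sp.1.
have d1 (s : R) : is_derive s 1 f1 (f2 s).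
  apply: (@is_derive_lsum (fun i => xi ord0 i) (fun i s => partial i phi (x + s *: xi))
    (fun i s => \sum_j xi ord0 j * partial j (partial i phi) (x + s *: xi)) s) => i.
  by apply: smooth_line; exact: (sp1 i).1.
have h2 s : `|f2 s| <= n%:R ^+ 2 * M * enorm xi ^+ 2.
  have -> : n%:R ^+ 2 * M * enorm xi ^+ 2 = n%:R * enorm xi * (n%:R * enorm xi * M) by ring.
  apply: lsum_bound => i; apply: lsum_bound => j; exact: (HM (i, j)).
have := taylor2 1 d0 d1 h2; rewrite /f0 /f1 scale1r scale0r addr0 mul1r normr1 expr1n mulr1.
by [].
Qed.

Lemma smooth_taylor3 phi : smooth_in_cube L phi -> exists2 M, 0 <= M & forall x xi,
  `|phi (x + xi) - phi x - \sum_i xi ord0 i * partial i phi x -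
    2^-1 * \sum_i xi ord0 i * \sum_j xi ord0 j * partial j (partial i phi) x| <= M * enorm xi ^+ 3.
Proof.
move=> sp; have sp1 i := smooth_in_cube_partial i sp.
have sp2 i j := smooth_in_cube_partial j (sp1 i).
have [M M0 HM] : exists2 M, 0 <= M & forall (ij : 'I_n * 'I_n * 'I_n) x,
    `|partial ij.2 (partial ij.1.2 (partial ij.1.1 phi)) x| <= M.
  by apply: unif_bound => -[[i j] k]; exact: smooth_in_cube_bounded (smooth_in_cube_partial k (sp2 i j)).
exists (n%:R ^+ 3 * M) => [|x xi]; first by rewrite mulr_ge0// exprn_ge0.
pose f0 (s : R) := phi (x + s *: xi).
pose f1 (s : R) := \sum_i xi ord0 i * partial i phi (x + s *: xi).
pose g2 i (s : R) := \sum_j xi ord0 j * partial j (partial i phi) (x + s *: xi).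
pose f2 (s : R) := \sum_i xi ord0 i * g2 i s.
pose g3 i (s : R) := \sum_j xi ord0 j *
   \sum_k xi ord0 k * partial k (partial j (partial i phi)) (x + s *: xi).
pose f3 (s : R) := \sum_i xi ord0 i * g3 i s.
have d0 (s : R) : is_derive s 1 f0 (f1 s) by apply: smooth_line; exact: sp.1.
have d1 (s : R) : is_derive s 1 f1 (f2 s).
  apply: (@is_derive_lsum (fun i => xi ord0 i) (fun i s => partial i phi (x + s *: xi)) g2 s) => i.
  by apply: smooth_line; exact: (sp1 i).1.
have d2 (s : R) : is_derive s 1 f2 (f3 s).
  apply: (@is_derive_lsum (fun i => xi ord0 i) g2 g3 s) => i.
  apply: (@is_derive_lsum (fun j => xi ord0 j) (fun j s => partial j (partial i phi) (x + s *: xi))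
    (fun j s => \sum_k xi ord0 k * partial k (partial j (partial i phi)) (x + s *: xi)) s) => j.
  by apply: smooth_line; exact: (sp2 i j).1.
have h3 s : `|s| <= `|1 : R| -> `|f3 s| <= n%:R ^+ 3 * M * enorm xi ^+ 3.
  move=> _; have -> : n%:R ^+ 3 * M * enorm xi ^+ 3 =
    n%:R * enorm xi * (n%:R * enorm xi * (n%:R * enorm xi * M)) by ring.
  apply: lsum_bound => i; apply: lsum_bound => j; apply: lsum_bound => k; exact: (HM (i, j, k)).
have := taylor3 d0 d1 d2 h3.
rewrite /f0 /f1 /f2 /g2 scale1r scale0r addr0 mul1r normr1 !expr1n mulr1 div1r.
by [].
Qed.

Lemma smooth_lipschitz phi : smooth_in_cube L phi -> exists2 M, 0 <= M & forall x xi,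
  `|phi (x + xi) - phi x| <= M * enorm xi /\ `|\sum_i xi ord0 i * partial i phi x| <= M * enorm xi.
Proof.
move=> sp; have sp1 i := smooth_in_cube_partial i sp.
have [M M0 HM] : exists2 M, 0 <= M & forall (i : 'I_n) x, `|partial i phi x| <= M.
  by apply: unif_bound => i; exact: smooth_in_cube_bounded (sp1 i).
have H x xi : `|\sum_i xi ord0 i * partial i phi x| <= n%:R * M * enorm xi.
  have -> : n%:R * M * enorm xi = n%:R * enorm xi * M by ring.
  by apply: lsum_bound => i; exact: HM.
exists (n%:R * M) => [|x xi]; first by rewrite mulr_ge0.
split => //; have d0 (s : R) : is_derive s 1 (fun s => phi (x + s *: xi))
    (\sum_i xi ord0 i * partial i phi (x + s *: xi)) by apply: smooth_line; exact: sp.1.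
have := derive_lipschitz d0 (fun s => H (x + s *: xi) xi) 1 0.
by rewrite scale1r scale0r addr0 subr0 normr1 mulr1.
Qed.

Let sq_intble phi : smooth_in_cube L phi -> intble mu (fun x => phi x ^+ 2).
Proof. by move=> sp; have [] := smooth_in_cube_intble L0 sp. Qed.

Let tf_intble phi : smooth_in_cube L phi -> intble mu phi.
Proof. by move=> sp; have [] := smooth_in_cube_intble L0 sp. Qed.

Lemma intble_smoothM phi f : smooth_in_cube L phi -> intble mu f ->
  intble mu (fun x => phi x * f x).
Proof.
move=> sp fi; have [M M0 phiM] := smooth_in_cube_bounded sp.
by apply: (intble_mulb _ phiM fi); have [] := smooth_in_cube_intble L0 sp.
Qed.

Lemma smooth_shift_intble phi f xi : smooth_in_cube L phi -> intble mu f ->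
  intble mu (fun x => phi (x + xi) * f x).
Proof.
move=> sp fi; have [M M0 phiM] := smooth_in_cube_bounded sp.
apply: (intble_mulb (C := M) _ _ fi) => //.
by apply: intble_mfun; apply: intble_shift; exact: tf_intble.
Qed.

(* Both sides are compared, to second order in the step, with the discrete
   integration by parts given by translation invariance. *)
Lemma integration_by_parts_smooth phi psi i : smooth_in_cube L phi -> smooth_in_cube L psi ->
  int mu (fun x => partial i phi x * psi x) = - int mu (fun x => phi x * partial i psi x).
Proof.
move=> sp sq; have [M M0 HM] := smooth_taylor2 sp; have [K K0 HK] := smooth_taylor2 sq.
have ip := tf_intble sp; have iq := tf_intble sq.
have spi := smooth_in_cube_partial i sp; have sqi := smooth_in_cube_partial i sq.
have i1 := intble_smoothM spi iq; have i2 := intble_smoothM sp (tf_intble sqi).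
set A := int mu _; set B := int mu _.
pose C := M * int mu (fun x => `|psi x|) + K * int mu (fun x => `|phi x|).
have C0 : 0 <= C by rewrite addr_ge0// mulr_ge0// int_ge0.
suff H h : 0 < h -> `|A + B| <= C * h.
  apply/eqP; rewrite -subr_eq0 opprK -normr_le0; apply/ler_addgt0Pr => e e0; rewrite add0r.
  apply: le_trans (H (e / (C + 1)) _) _; first by rewrite divr_gt0// ltr_wpDl.
  by rewrite mulrCA ger_pMr// ler_pdivrMr ?ltr_wpDl// mul1r lerDl.
move=> h0; pose xi : E := h *: delta_mx ord0 i.
have sumE (F : 'I_n -> R) : \sum_j xi ord0 j * F j = h * F i.
  rewrite (bigD1 i)//= big1 ?addr0; first by rewrite !mxE !eqxx mulr1.
  by move=> j ji; rewrite !mxE (negbTE ji) andbF mulr0 mul0r.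
have exi : enorm xi ^+ 2 = h ^+ 2 by rewrite sqr_enorm sqnZ sqn_delta mulr1.
have exiN : enorm (- xi) ^+ 2 = h ^+ 2 by rewrite sqr_enorm sqnN -sqr_enorm.
have j1 := smooth_shift_intble xi sp iq; have j2 := smooth_shift_intble (- xi) sq ip.
have ipq := intble_smoothM sp iq; have iqp := intble_smoothM sq ip.
have E1 : int mu (fun x => phi (x + xi) * psi x) = int mu (fun x => psi (x - xi) * phi x).
  rewrite -(int_shift xi j2); congr (int mu); apply/funext => x.
  by rewrite addrK mulrC.
have E2 : int mu (fun x => phi x * psi x) = int mu (fun x => psi x * phi x).
  by congr (int mu); apply/funext => x; rewrite mulrC.
have H1 : `|int mu (fun x => phi (x + xi) * psi x) - int mu (fun x => phi x * psi x) - h * A| <=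
    M * h ^+ 2 * int mu (fun x => `|psi x|).
  rewrite -intB// -intZ// -intB; [|exact: intbleB|exact: intbleZ].
  rewrite -intZ; last exact: intble_norm.
  apply: int_norm_le.
  - by apply: intbleB; [exact: intbleB|exact: intbleZ].
  - by apply: intbleZ; exact: intble_norm.
  - move=> x; have -> : phi (x + xi) * psi x - phi x * psi x - h * (partial i phi x * psi x) =
      (phi (x + xi) - phi x - h * partial i phi x) * psi x by ring.
    rewrite normrM ler_wpM2r//; have := HM x xi; rewrite sumE exi; exact.
have H2 : `|int mu (fun x => psi (x - xi) * phi x) - int mu (fun x => psi x * phi x) + h * B| <=
    K * h ^+ 2 * int mu (fun x => `|phi x|).
  rewrite -intB// -intZ// -intD; [|exact: intbleB|exact: intbleZ].
  rewrite -intZ; last exact: intble_norm.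
  apply: int_norm_le.
  - by apply: intbleD; [exact: intbleB|exact: intbleZ].
  - by apply: intbleZ; exact: intble_norm.
  - move=> x; have -> : psi (x - xi) * phi x - psi x * phi x + h * (phi x * partial i psi x) =
      (psi (x - xi) - psi x - (- h * partial i psi x)) * phi x by ring.
    rewrite normrM ler_wpM2r//; have := HK x (- xi).
    have -> : \sum_j (- xi) ord0 j * partial j psi x = - h * partial i psi x.
      rewrite mulNr -(sumE (fun j => partial j psi x)) -sumrN; apply: eq_bigr => j _.
      by rewrite [(- xi) _ _]mxE mulNr.
    by rewrite exiN; exact.
move: H1 H2; rewrite E1 E2; move: (int mu (fun x => psi (x - xi) * phi x)) (int mu (fun x => psi x * phi x)).
move=> u v H1 H2; rewrite -(ler_pM2l h0) -[X in X * `|_|](gtr0_norm h0) -normrM.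
have -> : h * (C * h) = M * h ^+ 2 * int mu (fun x => `|psi x|) + K * h ^+ 2 * int mu (fun x => `|phi x|).
  by rewrite /C; move: (int mu (fun x => `|psi x|)) (int mu (fun x => `|phi x|)) => p q; ring.
rewrite [leRHS]addrC; apply: le_trans _ (lerD H2 H1); have -> : h * (A + B) = (u - v + h * B) - (u - v - h * A) by ring.
exact: ler_normB.
Qed.

Definition grad_form phi xi := int mu (fun x => (\sum_i xi ord0 i * partial i phi x) ^+ 2).

Lemma grad_formE phi xi : smooth_in_cube L phi ->
  intble mu (fun x => (\sum_i xi ord0 i * partial i phi x) ^+ 2) /\
  grad_form phi xi = \sum_i \sum_j xi ord0 i * xi ord0 j *
    int mu (fun x => partial i phi x * partial j phi x).
Proof.
move=> sp; have sp1 i := smooth_in_cube_partial i sp.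
have ii i j : intble mu (fun x => xi ord0 i * xi ord0 j * (partial i phi x * partial j phi x)).
  by apply: intbleZ; apply: intble_smoothM (sp1 i) (tf_intble (sp1 j)).
have E1 : (fun x => (\sum_i xi ord0 i * partial i phi x) ^+ 2) =
    (fun x => \sum_i \sum_j xi ord0 i * xi ord0 j * (partial i phi x * partial j phi x)).
  apply/funext => x; rewrite expr2 mulr_suml; apply: eq_bigr => i _.
  by rewrite mulr_sumr; apply: eq_bigr => j _; rewrite mulrACA.
rewrite /grad_form E1; split; first by apply: intble_sum => i; exact: intble_sum.
rewrite int_sum; last by move=> i; exact: intble_sum.
apply: eq_bigr => i _; rewrite int_sum//; apply: eq_bigr => j _.
by rewrite intZ//; apply: intble_smoothM (sp1 i) (tf_intble (sp1 j)).
Qed.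

Let Q phi xi := int mu (fun x => (phi (x + xi) - phi x) ^+ 2).

Let Q_intble phi xi : smooth_in_cube L phi -> intble mu (fun x => (phi (x + xi) - phi x) ^+ 2).
Proof.
move=> sp; have i2 := sq_intble sp; have i2s := intble_shift xi i2.
have ic := smooth_shift_intble xi sp (tf_intble sp).
rewrite (_ : (fun x => _) = (fun x => phi (x + xi) ^+ 2 + phi x ^+ 2 - 2 * (phi (x + xi) * phi x))).
  by apply: intbleB; [exact: intbleD|exact: intbleZ].
by apply/funext => x; ring.
Qed.

Let QE phi xi : smooth_in_cube L phi ->
  int mu (fun x => phi (x + xi) * phi x) = int mu (fun x => phi x ^+ 2) - 2^-1 * Q phi xi.
Proof.
move=> sp; have i2 := sq_intble sp; have i2s := intble_shift xi i2.
have ic := smooth_shift_intble xi sp (tf_intble sp).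
have -> : Q phi xi = int mu (fun x => phi x ^+ 2) + int mu (fun x => phi x ^+ 2) -
    2 * int mu (fun x => phi (x + xi) * phi x).
  rewrite -{1}(int_shift xi i2) -(intZ 2 ic) -intD// -intB; [|exact: intbleD|exact: intbleZ].
  by congr (int mu); apply/funext => x; ring.
by move: (int mu (fun x => phi x ^+ 2)) (int mu _) => u v; field.
Qed.

(** Split the increment into two half steps and use (p + q)^2 <= 2 p^2 + 2 q^2; both halves have the
    same integral by translation invariance. *)
Let Q_double phi xi : smooth_in_cube L phi -> Q phi xi <= 4 * Q phi (2^-1 *: xi).
Proof.
move=> sp; set eta := 2^-1 *: xi; have iq := Q_intble eta sp; have iqs := intble_shift eta iq.
have -> : 4 * Q phi eta = 2 * int mu (fun x => (phi (x + eta + eta) - phi (x + eta)) ^+ 2) + 2 * Q phi eta.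
  by rewrite (int_shift eta iq) -mulrDl; congr (_ * _); ring.
rewrite -!intZ// -intD; [|exact: intbleZ..].
apply: int_le; [exact: Q_intble|by apply: intbleD; exact: intbleZ|].
move=> x; have -> : x + xi = x + eta + eta.
  by rewrite -addrA -scalerDl (_ : 2^-1 + 2^-1 = 1 :> R) ?scale1r//; field.
move: (phi _) (phi (x + eta)) (phi x) => u v w.
by rewrite -subr_ge0 (_ : _ - _ = (u - v - (v - w)) ^+ 2) ?sqr_ge0//; ring.
Qed.

(** Increment and directional derivative differ by O(|xi|^2), so their squares differ by O(|xi|^3),
    within the cube enlarged by 1. *)
Let Q_first_order phi : smooth_in_cube L phi -> exists2 C, 0 <= C &
  forall xi, enorm xi <= 1 -> Q phi xi <= grad_form phi xi + C * enorm xi ^+ 3.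
Proof.
move=> sp; have [M M0 HM] := smooth_taylor2 sp; have [K K0 HK] := smooth_lipschitz sp.
have L10 : 0 <= L + 1 by rewrite addr_ge0.
have cc : cubed 1 (L + 1) (\1_(cube n (L + 1)) : E -> R).
  split.
  - by apply: measurable_indic; exact: measurable_cube.
  - by move=> z; rewrite indicE.
  - by move=> z; rewrite indicE lern1 leq_b1.
  - by move=> z zL; rewrite indicE memNset.
have ic := cubed_intble ler01 L10 cc.
exists (M * (2 * K) * int mu (\1_(cube n (L + 1)) : E -> R)).
  by rewrite !mulr_ge0// int_ge0// => x; rewrite indicE.
move=> xi x1; rewrite mulrAC -intZ// /grad_form -intD; [|exact: (grad_formE xi sp).1|exact: intbleZ].
apply: int_le; [exact: Q_intble|apply: intbleD; [exact: (grad_formE xi sp).1|exact: intbleZ]|].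
move=> x; rewrite indicE; have [xL|xL] := pselect (cube n (L + 1) x); last first.
  have H0 y : enorm (y - x) <= 1 -> phi y = 0.
    move=> yx; apply: sp.2 => yL; apply: xL => i.
    have -> : x ord0 i = y ord0 i - (y - x) ord0 i by rewrite !mxE subKr.
    apply: le_trans (ler_normB _ _) _; apply: lerD; first exact: yL.
    by apply: le_trans (coord_le_enorm _ _) yx.
  rewrite memNset// mulr0 addr0 (H0 (x + xi)); last by rewrite addrAC subrr add0r.
  by rewrite (H0 x) ?subrr ?enorm0// expr0n sqr_ge0.
rewrite mem_set// mulr1; have h1 := HM x xi; have [h2 h3] := HK x xi.
move: (phi (x + xi) - phi x) (\sum_i _) (enorm xi) (enorm_ge0 xi) h1 h2 h3 => u v e e0 h1 h2 h3.
have -> : u ^+ 2 = v ^+ 2 + (u - v) * (u + v) by ring.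
rewrite lerD2l; apply: le_trans (ler_norm _) _; rewrite normrM.
have -> : M * (2 * K) * e ^+ 3 = (M * e ^+ 2) * (K * e + K * e) by ring.
by apply: ler_pM => //; apply: le_trans (ler_normD _ _) _; exact: lerD.
Qed.

Let grad_formZ phi xi (c : R) : smooth_in_cube L phi ->
  grad_form phi (c *: xi) = c ^+ 2 * grad_form phi xi.
Proof.
move=> sp; rewrite /grad_form -intZ; last exact: (grad_formE xi sp).1.
congr (int mu); apply/funext => x; rewrite -exprMn mulr_sumr; congr (_ ^+ 2).
by apply: eq_bigr => i _; rewrite mxE mulrA.
Qed.

(** Repeated halving gives Q(xi) <= 4^k Q(xi / 2^k). The quadratic form absorbs the factor 4^k by
    homogeneity, and the cubic error keeps a factor 2^(-k), which tends to 0. *)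
Let Q_le_grad_form phi xi : smooth_in_cube L phi -> Q phi xi <= grad_form phi xi.
Proof.
move=> sp; have [C C0 HC] := Q_first_order sp.
pose m := Num.bound (enorm xi).
have Qk k : Q phi xi <= 4 ^+ k * Q phi (2^-1 ^+ k *: xi).
  elim: k => [|k ih]; first by rewrite !expr0 mul1r scale1r.
  apply: le_trans ih _; rewrite exprSr -mulrA ler_wpM2l ?exprn_ge0//.
  by apply: le_trans (Q_double _ sp) _; rewrite scalerA -exprS.
have H k : enorm xi <= 2 ^+ k -> Q phi xi <= grad_form phi xi + C * enorm xi ^+ 3 * 2^-1 ^+ k.
  move=> xk; apply: le_trans (Qk k) _.
  have p0 : 0 < 2^-1 ^+ k :> R by rewrite exprn_gt0// invr_gt0.
  have e1 : enorm (2^-1 ^+ k *: xi) = 2^-1 ^+ k * enorm xi.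
    by rewrite enormZ ger0_norm// ltW.
  have h1 : enorm (2^-1 ^+ k *: xi) <= 1 by rewrite e1 exprVn ler_pdivrMl ?exprn_gt0// mulr1.
  have := HC _ h1; rewrite grad_formZ// e1 => h2.
  have p4 : 0 <= 4 ^+ k :> R by rewrite exprn_ge0.
  apply: le_trans (ler_wpM2l p4 h2) _; rewrite le_eqVlt; apply/orP; left; apply/eqP.
  have -> : 4 ^+ k = (2^-1 ^+ k) ^- 2 :> R.
    by rewrite -exprVn -(exprVn 2^-1 k) invrK -exprM mulnC exprM; congr (_ ^+ _); ring.
  by move: (2^-1 ^+ k) p0 (grad_form phi xi) (enorm xi) => p p0 g e; field; rewrite gt_eqF.
apply/ler_addgt0Pr => e e0; pose D := C * enorm xi ^+ 3.
have D0 : 0 <= D by rewrite mulr_ge0// exprn_ge0// enorm_ge0.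
pose k := maxn (Num.bound (enorm xi)) (Num.bound (D / e)).
have two (x : R) : (Num.bound x <= k)%N -> x <= 2 ^+ k.
  move=> xk; apply: le_trans (ler_norm x) _; apply: le_trans (ltW (archi_boundP (normr_ge0 x))) _.
  rewrite -natrX ler_nat; apply: leq_trans (ltnW (ltn_expl k (ltnSn 1))).
  by move: xk; rewrite /Num.bound normr_id.
apply: le_trans (H k (two _ (leq_maxl _ _))) _; rewrite lerD2l -/D exprVn ler_pdivrMr ?exprn_gt0//.
by rewrite mulrC -ler_pdivrMr//; apply: two; exact: leq_maxr.
Qed.

(** Fubini writes the heat form as the integral of phi^2 minus half the Gaussian mean of Q. Q is at
    most the gradient form, of which only the diagonal second moments, all equal to gvar eps,
    survive. *)
Lemma heat_form_smooth phi eps : (0 < n)%N -> 0 < eps -> smooth_in_cube L phi ->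
  int mu (fun x => phi x ^+ 2) -
    2^-1 * (@gvar R n * eps * \sum_i int mu (fun x => partial i phi x ^+ 2)) <=
  int mu (fun x => phi x * conv eps phi x).
Proof.
move=> n0 e0 sp; have [M M0 phiM] := smooth_in_cube_bounded sp.
have [mp ip i2] := smooth_in_cube_intble L0 sp.
have msum : measurable_fun setT (fun z : E * E => phi (z.1 + z.2)).
  apply: (measurableT_comp mp).
  exact: (measurableT_comp (@measurable_rVD R n) (measurable_fun_pair measurable_fst measurable_snd)).
have mF : measurable_fun setT (fun z : E * E => phi z.1 * (gaussp eps z.2 * phi (z.1 + z.2))).
  apply: measurable_funM; first exact: measurableT_comp mp measurable_fst.
  by apply: measurable_funM => //; apply: measurableT_comp measurable_snd; exact: measurable_gaussp.
have ms x : measurable_fun setT (fun xi : E => phi (x + xi)).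
  rewrite (_ : (fun _ => _) = (fun xi : E => phi (xi + x))); last by apply/funext => y; rewrite addrC.
  exact: intble_mfun (intble_shift x ip).
have ix x : intble mu (fun xi => phi x * (gaussp eps xi * phi (x + xi))).
  by apply: intbleZ; exact: intble_gaussp_b e0 (ms x) (fun y => phiM _).
have iy xi : intble mu (fun x => phi x * (gaussp eps xi * phi (x + xi))).
  have := intbleZ (gaussp eps xi) (smooth_shift_intble xi sp ip).
  rewrite (_ : (fun _ => _) = (fun x => phi x * (gaussp eps xi * phi (x + xi))))//.
  by apply/funext => x; ring.
have gx x : intble mu (fun y => gaussp eps (x - y) * phi y) by exact: intble_conv.
have [| | |i1 i3 ->] := @int_fubini_eq _ _ E E R mu mu (fun x xi => phi x * (gaussp eps xi * phi (x + xi)))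
  (fun x => phi x * conv eps phi x)
  (fun xi => gaussp eps xi * int mu (fun x => phi (x + xi) * phi x)) mF _ ix iy.
- have fM := intbleZ M (intble_norm ip).
  apply: (@le_lt_trans _ _ (\int[mu]_y (M * `|phi y|)%:E)%E); last by rewrite -intE// ltry.
  apply: ge0_le_integral => //.
  + by move=> y _; apply: integral_ge0.
  + have := (@measurable_fun_fubini_tonelli_F _ _ _ _ R mu
      (fun z : E * E => (`|phi z.1 * (gaussp eps z.2 * phi (z.1 + z.2))|)%:E)).
    rewrite /fubini_F /=; apply => //.
    by apply/measurable_EFinP/measurableT_comp.
  + by apply/measurable_EFinP; exact: intble_mfun fM.
  + move=> y _; rewrite -intE; last exact/intble_norm/ix.
    rewrite lee_fin.
    have -> : M * `|phi y| = int mu (fun x => (M * `|phi y|) * gaussp eps x).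
      by rewrite intZ ?int_gaussp ?mulr1//; exact: intble_gaussp.
    apply: int_le; [exact/intble_norm/ix|exact/intbleZ/intble_gaussp|].
    move=> x; rewrite (normrM (phi y)) (normrM (gaussp _ _)) gaussp_norm//.
    have -> : M * `|phi y| * gaussp eps x = `|phi y| * (gaussp eps x * M) by ring.
    by rewrite !ler_wpM2l// gaussp_ge0.
- by move=> x; rewrite intZ; [rewrite (convE (gx x)).2|exact: intble_gaussp_b e0 (ms x) (fun y => phiM _)].
- move=> xi; rewrite -intZ; last exact: smooth_shift_intble.
  by congr (int mu); apply/funext => x; ring.
set S := \sum_i _; pose c0 := int mu (fun x => phi x ^+ 2).
have gij i j := @Ex_coord2 R n n0 eps i j e0.
pose a i j := int mu (fun x => partial i phi x * partial j phi x).
have gB : gdom eps (fun xi => \sum_i \sum_j a i j * (xi ord0 i * xi ord0 j)).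
  rewrite /gdom (_ : (fun _ => _) = (fun y : E => \sum_i \sum_j gaussp eps y * (a i j * (y ord0 i * y ord0 j)))).
    by apply: intble_sum => i; apply: intble_sum => j; exact: gdomZ (gij i j).1.
  by apply/funext => y; rewrite mulr_sumr; apply: eq_bigr => i _; rewrite mulr_sumr.
have EB : Ex eps (fun xi => \sum_i \sum_j a i j * (xi ord0 i * xi ord0 j)) = @gvar R n * eps * S.
  rewrite Ex_sum; last first.
    move=> i; rewrite /gdom (_ : (fun _ => _) = (fun y : E => \sum_j gaussp eps y * (a i j * (y ord0 i * y ord0 j)))).
      by apply: intble_sum => j; exact: gdomZ (gij i j).1.
    by apply/funext => y; rewrite mulr_sumr.
  rewrite /S mulr_sumr; apply: eq_bigr => i _; rewrite Ex_sum; last first.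
    by move=> j; exact: gdomZ (gij i j).1.
  rewrite (bigD1 i)//= big1 ?addr0; last first.
    by move=> j ji; rewrite (ExZ _ (gij i j).1) (gij i j).2 eq_sym (negbTE ji) !mulr0.
  by rewrite (ExZ _ (gij i i).1) (gij i i).2 eqxx mulr1 mulrC.
have g1 := @gdom1 R n eps e0.
have -> : c0 - 2^-1 * (@gvar R n * eps * S) =
    Ex eps (fun xi => c0 * 1 - 2^-1 * \sum_i \sum_j a i j * (xi ord0 i * xi ord0 j)).
  rewrite ExB; [|exact: gdomZ g1|exact: gdomZ gB].
  by rewrite (ExZ c0 g1) (ExZ _ gB) EB Ex1// mulr1.
rewrite -ExE; apply: Ex_le => //; first by apply: gdomB; [exact: gdomZ g1|exact: gdomZ gB].
move=> xi; rewrite QE// mulr1 lerD2l lerN2 ler_pM2l ?invr_gt0//.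
apply: le_trans (Q_le_grad_form xi sp) _; rewrite (grad_formE xi sp).2.
rewrite le_eqVlt; apply/orP; left; apply/eqP.
by apply: eq_bigr => i _; apply: eq_bigr => j _; rewrite mulrC.
Qed.

End smooth_taylor.

(** * The fundamental lemma of the calculus of variations *)

Section fundamental_lemma.
Context {R : realType} {n : nat}.
Local Notation E := 'rV[R]_n.
Local Notation mu := (@lebesgue_rV R n).

Definition open_box (z : E) (rho : 'I_n -> R) : set E :=
  [set x | forall i, `|x ord0 i - z ord0 i| < rho i].

Definition closed_box (z : E) (rho : 'I_n -> R) : set E :=
  [set x | forall i, `|x ord0 i - z ord0 i| <= rho i].

Let corner_box (ab : E * E) : set E := [set x | forall i, ab.1 ord0 i < x ord0 i < ab.2 ord0 i].

Lemma closed_closed_box z rho : closed (closed_box z rho).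
Proof.
have -> : closed_box z rho = \bigcap_(i in [set: 'I_n])
    ((fun x : E => `|x ord0 i - z ord0 i|) @^-1` [set r | r <= rho i]).
  by apply/seteqP; split => x h i; [move=> _; exact: h|exact: h].
apply: closed_bigI => i _; apply: preimage_closed; last exact: closed_le.
move=> x _; apply: (@lipschitz_continuous_rV R n (fun x : E => `|x ord0 i - z ord0 i|) 1 ler01) => {}x y.
apply: le_trans (ler_dist_dist _ _) _; rewrite mul1r.
have -> : x ord0 i - z ord0 i - (y ord0 i - z ord0 i) = (x - y) ord0 i by rewrite !mxE; ring.
exact: coord_le_enorm.
Qed.

Lemma box_bump_test c z rho (Om : set E) (L : R) : 0 < c -> (forall i, 0 < rho i) ->
  Om `<=` cube n L -> closed_box z rho `<=` Om -> test_function Om (box_bump c z rho).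
Proof.
move=> c0 rho0 OL bO.
have sub : closure [set x | box_bump c z rho x != 0] `<=` closed_box z rho.
  rewrite [X in _ `<=` X]((closure_id _).1 (@closed_closed_box z rho)).
  apply: closure_subset => x /= h i.
  by rewrite leNgt; apply/negP => hi; move/eqP: h; apply; apply: (@box_bump_eq0 _ _ c z rho x i); exact: ltW.
split; [exact: box_bump_smooth| |exact: subset_trans bO].
apply: (subclosed_compact (@closed_closure _ _) (@compact_cube R n L)).
by apply: subset_trans OL; exact: subset_trans bO.
Qed.

Lemma corner_box_measurable ab : measurable (corner_box ab).
Proof.
have -> : corner_box ab = \bigcap_(i in [set: 'I_n])
    (@rV_coord R n i @^-1` `]ab.1 ord0 i, ab.2 ord0 i[%classic).
  apply/seteqP; split => [x h i _|x h i]; first by rewrite /= in_itv/=; exact: h.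
  by have := h i I; rewrite /= in_itv/=.
apply: fin_bigcap_measurable => // i _; rewrite -[X in measurable X]setTI.
exact: measurable_rV_coord.
Qed.

Lemma corner_box_generate :
  @measurable _ E = <<s [set corner_box ab | ab in [set: E * E]] >>.
Proof.
set G := [set corner_box ab | ab in _]; apply/seteqP; split; last first.
  apply: smallest_sub; first exact: sigma_algebra_measurable.
  by move=> _ [ab _ <-]; exact: corner_box_measurable.
move=> A mA; have : measurable_fun [set: g_sigma_algebraType G] (fun x : g_sigma_algebraType G => x : E).
  apply: measurable_fun_rV => i.
  apply: (measurability _ (RGenOInfty.measurableE R)) => _ [_ [a ->] <-].
  rewrite setTI (_ : _ @^-1` _ = \bigcup_k (corner_box (
     (\row_j (if j == i then a else - k%:R)), (\row_j k%:R)))).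
    apply: bigcupT_measurable => k; apply: sub_sigma_algebra.
    by eexists; last reflexivity.
  apply/seteqP; split => [x /=|x [k _ /(_ i)]]; last first.
    by rewrite /= !mxE eqxx in_itv/= andbT /rV_coord => /andP[].
  rewrite in_itv/= andbT /rV_coord => ax.
  exists (\max_(j < n) Num.bound (x ord0 j))%N => // j; rewrite !mxE.
  have : `|x ord0 j| < (\max_(j < n) Num.bound (x ord0 j))%:R.
    apply: lt_le_trans (archi_boundP (normr_ge0 _)) _; rewrite ler_nat.
    by apply: leq_trans (leq_bigmax j); rewrite /Num.bound normr_id.
  rewrite ltr_norml => /andP[h1 h2]; rewrite h2 andbT.
  by case: eqP => [->|].
by move=> /(_ measurableT A mA); rewrite setTI.
Qed.

Variable v : E -> R.
Hypothesis iv : intble mu v.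

Let mv : measurable_fun setT v. Proof. exact: intble_mfun iv. Qed.

Let setint S : measurable S ->
  (\int[mu]_(x in S) (v x)%:E)%E = (int mu (fun x => (\1_S x : R) * v x))%:E.
Proof.
move=> mS; have mI : measurable_fun setT (\1_S : E -> R) by exact: measurable_indic.
rewrite intE; last first.
  by apply: (intble_mulb mI (C := 1) _ iv) => x; rewrite indicE normr_nat lern1 leq_b1.
transitivity (\int[mu]_x ((EFin \o v) \_ S) x)%E; first exact: integral_mkcond.
apply: eq_integral => x _; rewrite patchE indicE.
by case: ifPn => _; rewrite ?mul1r ?mul0r.
Qed.

Let intble_set S : measurable S -> intble mu (fun x => (\1_S x : R) * v x).
Proof.
move=> mS; have mI : measurable_fun setT (\1_S : E -> R) by exact: measurable_indic.
by apply: (intble_mulb mI (C := 1) _ iv) => x; rewrite indicE normr_nat lern1 leq_b1.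
Qed.

(** Boxes are a pi-system generating the measurable sets, so the integral of [v] vanishes over every
    measurable set, in particular where [v] is positive and where it is negative. *)
Lemma vanishing_corner_boxes :
  (forall ab, int mu (fun x => (\1_(corner_box ab) x : R) * v x) = 0) ->
  int mu v = 0 -> {ae mu, forall x, v x = 0}.
Proof.
move=> H HT; pose P (S : set E) := (\int[mu]_(x in S) (v x)%:E)%E = 0%E.
have PS S : measurable S -> P S.
  rewrite {1}corner_box_generate; apply: (dynkin_induction corner_box_generate).
  - move=> _ _ [ab _ <-] [cd _ <-]; exists (\row_i Num.max (ab.1 ord0 i) (cd.1 ord0 i),
      \row_i Num.min (ab.2 ord0 i) (cd.2 ord0 i)) => //.
    apply/seteqP; split => [x h|x [h1 h2] i]; last first.
      by have := h1 i; have := h2 i; rewrite /= !mxE gt_max lt_min => /andP[-> ->] /andP[-> ->].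
    by split => i; have := h i; rewrite /= !mxE gt_max lt_min => /andP[/andP[? ?] /andP[? ?]]; apply/andP.
  - rewrite /P -intE// HT//.
  - move=> _ [ab _ <-]; rewrite /P setint ?H//; exact: corner_box_measurable.
  - move=> A mA; rewrite /P !setint//; last exact: measurableC.
    move=> [S0]; congr EFin; rewrite -[RHS](subrr (int mu v)) [X in _ = _ - X]HT -S0 -intB//; last exact: intble_set.
    congr (int mu); apply/funext => x; rewrite !indicE in_setC.
    by case: (x \in A) => /=; rewrite ?mul1r ?mul0r ?subrr ?subr0.
  - move=> F mF tF PF; rewrite /P integral_bigcup//.
      by apply: eseries0 => i _ _; exact: PF.
    by apply: integrableS iv => //; exact: bigcupT_measurable.
have mpos : measurable [set x | 0 < v x].
  have := mv measurableT (measurable_itv `]0, +oo[).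
  by rewrite setTI (_ : v @^-1` _ = [set x | 0 < v x])//; apply/seteqP; split => x /=; rewrite in_itv/= andbT.
have mneg : measurable [set x | v x < 0].
  have := mv measurableT (measurable_itv `]-oo, 0[).
  by rewrite setTI (_ : v @^-1` _ = [set x | v x < 0])//; apply/seteqP; split => x /=; rewrite in_itv/=.
have abs0 : int mu (fun x => `|v x|) = 0.
  have h1 := PS _ mpos; have h2 := PS _ mneg; move: h1 h2; rewrite /P !setint// => -[h1] [h2].
  have Ei := intB (intble_set mpos) (intble_set mneg); rewrite h1 h2 subrr in Ei.
  rewrite -[RHS]Ei.
  congr (int mu); apply/funext => x; rewrite !indicE.
  have [x0|x0|->] := ltgtP (v x) 0; last by rewrite normr0 !mulr0 subrr.
    rewrite memNset /=; last by move=> /= ?; lra.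
    by rewrite mem_set// mul0r mul1r sub0r ltr0_norm.
  rewrite mem_set// memNset /=; last by move=> /= ?; lra.
  by rewrite mul0r mul1r subr0 gtr0_norm.
have mE : measurable_fun setT (EFin \o v) by exact/measurable_EFinP.
have := (@ae_eq_integral_abs _ _ R mu setT measurableT (EFin \o v) mE).1.
have -> : (\int[mu]_x `|(EFin \o v) x|)%E = 0%E.
  by rewrite -[RHS](congr1 EFin abs0) intE//; exact: intble_norm.
by move=> /(_ erefl); apply: filterS => x /(_ I) /= [].
Qed.

End fundamental_lemma.

Section fundamental_lemma_open.
Context {R : realType} {n : nat}.
Local Notation E := 'rV[R]_n.
Local Notation mu := (@lebesgue_rV R n).
Variables (Om : set E) (L : R) (v : E -> R).
Hypotheses (oO : open Om) (OL : Om `<=` cube n L) (iv : intble mu v).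
Hypothesis v_test : forall phi, test_function Om phi -> int mu (fun x => v x * phi x) = 0.

Let mv : measurable_fun setT v. Proof. exact: intble_mfun iv. Qed.

Let measurable_open_box z (rho : 'I_n -> R) : measurable (open_box z rho).
Proof.
have -> : open_box z rho = \bigcap_(i in [set: 'I_n])
    (@rV_coord R n i @^-1` `]z ord0 i - rho i, z ord0 i + rho i[%classic).
  apply/seteqP; split => [x h i _|x h i].
    by rewrite /= in_itv/=; have := h i; rewrite ltr_distl.
  by have := h i I; rewrite /= in_itv/= ltr_distl.
apply: fin_bigcap_measurable => // i _; rewrite -[X in measurable X]setTI.
exact: measurable_rV_coord.
Qed.

(** The bumps with c = 1 / (k + 1) are bounded by 1 and converge to the indicator of the box;
    dominated convergence. *)
Lemma vanishing_open_box z rho : (forall i, 0 < rho i) -> closed_box z rho `<=` Om ->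
  int mu (fun x => (\1_(open_box z rho) x : R) * v x) = 0.
Proof.
move=> rho0 bO; have mQ := measurable_open_box z rho.
pose b k := box_bump (k.+1%:R^-1 : R) z rho.
have k0 k : 0 < (k.+1%:R^-1 : R) by rewrite invr_gt0 ltr0n.
have tb k := box_bump_test (k0 k) rho0 OL bO.
have mb k : measurable_fun setT (b k).
  by apply: continuous_measurable_rV; apply: smooth_continuous; exact: box_bump_smooth.
have b1 k x : `|b k x| <= 1.
  by rewrite ger0_norm ?box_bump_ge0// box_bump_le1.
have mI : measurable_fun setT (fun x => (\1_(open_box z rho) x : R) * v x).
  by apply: measurable_funM => //; exact: measurable_indic.
have cb x : b k x @[k --> \oo] --> (\1_(open_box z rho) x : R).
  pose W := \sum_i (1 - ((x ord0 i - z ord0 i) / rho i) ^+ 2)^-1.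
  have [xQ|xQ] := pselect (open_box z rho x); last first.
    rewrite indicE memNset//.
    have [i hi] : exists i, rho i <= `|x ord0 i - z ord0 i|.
      by apply: contrapT => h; apply: xQ => i; rewrite ltNge; apply/negP => hi; apply: h; exists i.
    rewrite (_ : b ^~ x = fun=> 0); first exact: cvg_cst.
    by apply/funext => k; exact: box_bump_eq0 hi.
  rewrite indicE mem_set//; apply: (@cvg_sqrt_bound _ _ _ W) => k.
  have W0 : 0 <= W.
    apply: sumr_ge0 => i _; rewrite invr_ge0 subr_ge0 -sqr_normr exprn_ile1//.
    by rewrite normrM normfV (gtr0_norm (rho0 i)) ler_pdivrMr// mul1r ltW// xQ.
  have -> : b k x = expR (- (k.+1%:R^-1 * W)).
    rewrite /b /box_bump /W mulr_sumr -sumrN expR_sum; apply: eq_bigr => i _.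
    by rewrite xQ.
  have h1 := expR_ge1Dx (- (k.+1%:R^-1 * W)).
  have h2 : expR (- (k.+1%:R^-1 * W)) <= 1.
    apply: (@le_trans _ _ (expR 0)); last by rewrite expR0.
    by rewrite ler_expR oppr_le0 mulr_ge0// ltW.
  rewrite distrC ger0_norm ?subr_ge0//; apply: (@le_trans _ _ (k.+1%:R^-1 * W)).
    by rewrite lerBlDr -lerBlDl.
  rewrite mulrC ler_wpM2l//; have k1 : k.+1%:R^-1 <= 1 :> R by rewrite invf_le1 ?ltr0n// ler1n.
  rewrite -{1}(sqr_sqrtr (ltW (k0 k))) expr2 ler_piMr ?sqrtr_ge0//.
  by rewrite -[leRHS]sqrtr1; apply: ler_wsqrtr.
have int0 k : (\int[mu]_x (v x * b k x)%:E)%E = 0%E.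
  rewrite -[RHS](congr1 EFin (v_test (tb k))) intE//.
  by have := intble_mulb (mb k) (b1 k) iv; under eq_fun do rewrite mulrC.
have [] := @dominated_convergence _ _ R mu setT measurableT
  (fun k x => (v x * b k x)%:E) (fun x => ((\1_(open_box z rho) x : R) * v x)%:E)
  (fun x => (`|v x|)%:E) _ _ _ _ _.
- by move=> k; apply/measurable_EFinP; exact: measurable_funM.
- exact/measurable_EFinP.
- apply: aeW => x _; apply: cvg_EFin; first by apply: nearW.
  by rewrite /= mulrC; apply: cvgM; [exact: cvg_cst|exact: cb].
- exact: intble_norm.
- by apply: aeW => x k _; rewrite abse_EFin lee_fin normrM -[leRHS]mulr1 ler_wpM2l.
move=> ii _; rewrite (_ : [sequence _]_n = fun=> 0%E); last by apply/funext => k; exact: int0.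
move=> /cvg_lim H; have {}H := H (@ereal_hausdorff R); rewrite lim_cst in H; last exact: ereal_hausdorff.
by apply: EFin_inj; rewrite intE.
Qed.

Lemma vanishing_in_box z rho : (forall i, 0 < rho i) -> closed_box z rho `<=` Om ->
  {ae mu, forall x, open_box z rho x -> v x = 0}.
Proof.
move=> rho0 bO; have mQ := measurable_open_box z rho.
have mI : measurable_fun setT (\1_(open_box z rho) : E -> R) by exact: measurable_indic.
have I1 (S : set E) x : `|(\1_S x : R)| <= 1 by rewrite indicE normr_nat lern1 leq_b1.
have iu := intble_mulb mI (@I1 _) iv.
have := @vanishing_corner_boxes R n _ iu; move=> H.
have {}H : {ae mu, forall x, (\1_(open_box z rho) x : R) * v x = 0}.
  apply: H; last exact: vanishing_open_box.
  move=> ab; pose a i := Num.max (ab.1 ord0 i) (z ord0 i - rho i).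
  pose b i := Num.min (ab.2 ord0 i) (z ord0 i + rho i).
  have [abi|/existsNP[i /negP abi]] := pselect (forall i, a i < b i).
    pose z' : E := \row_i ((a i + b i) / 2); pose r' i := (b i - a i) / 2.
    have r'0 i : 0 < r' i by rewrite divr_gt0// subr_gt0.
    have zb : closed_box z' r' `<=` Om.
      apply: subset_trans bO => x h i; have := h i; rewrite mxE /r' !ler_distl => /andP[h1 h2].
      have ha : z ord0 i - rho i <= a i by rewrite le_max lexx orbT.
      have hb : b i <= z ord0 i + rho i by rewrite ge_min lexx orbT.
      by apply/andP; split; lra.
    rewrite -[RHS](vanishing_open_box r'0 zb); congr (int mu); apply/funext => x.
    rewrite mulrA; congr (_ * _); rewrite !indicE -natrM mulnb; congr ((nat_of_bool _)%:R).
    apply/andP/idP => [[]|]; rewrite !inE => h.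
      move=> h' i; have := h i; have := h' i; rewrite !ltr_distl mxE /r' => /andP[u1 u2] /andP[u3 u4].
      have ha : a i < x ord0 i by rewrite gt_max u3 u1.
      have hb : x ord0 i < b i by rewrite lt_min u4 u2.
      by apply/andP; split; lra.
    have hab i : a i < x ord0 i < b i.
      have := h i; rewrite ltr_distl mxE /r' => /andP[u1 u2]; apply/andP; split; lra.
    split => i; have := hab i; rewrite gt_max lt_min => /andP[/andP[? ?] /andP[? ?]].
      exact/andP.
    by rewrite ltr_distl; apply/andP.
  rewrite (_ : (fun x => _) = fun=> 0); first exact: int0.
  apply/funext => x; rewrite mulrA !indicE -natrM mulnb.
  case: (boolP (_ && _)) => [/andP[]|_]; last by rewrite mul0r.
  rewrite !inE => h h'; exfalso; move/negP: abi; apply.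
  have := h i; have := h' i; rewrite ltr_distl => /andP[u1 u2] /andP[u3 u4].
  by rewrite /a /b gt_max !lt_min (lt_trans u3 u4) (lt_trans u3 u2) (lt_trans u1 u4) (lt_trans u1 u2).
apply: filterS H => x + hx; by rewrite indicE mem_set// mul1r.
Qed.

Lemma open_box_cover x : Om x -> exists p : 'rV[rat]_n * rat, [/\ 0 < ratr p.2 :> R,
  open_box (\row_i ratr (p.1 ord0 i)) (fun=> ratr p.2) x &
  closed_box (\row_i ratr (p.1 ord0 i)) (fun=> ratr p.2) `<=` Om].
Proof.
move=> Ox; have /nbhs_ballP[e /= e0 xeU] : nbhs x Om by exact: open_nbhs_nbhs.
have [r] := rat_in_itvoo (divr_gt0 e0 (ltr0n R 2)).
rewrite in_itv/= => /andP[r0 re].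
have H i : {q : rat | `|x ord0 i - ratr q| < ratr r}.
  apply: cid; have [q] := @rat_in_itvoo _ (x ord0 i - ratr r) (x ord0 i + ratr r) ltac:(lra).
  by rewrite in_itv/= => qx; exists q; rewrite ltr_norml; lra.
exists (\row_i sval (H i), r); split => //=.
  by move=> i; rewrite !mxE; exact: svalP (H i).
move=> y /= yp; apply: xeU; split => // i j; rewrite (ord1 i) /ball/=.
have := yp j; rewrite !mxE; have := svalP (H j).
rewrite !ltr_norml !ler_norml; lra.
Qed.

(** [Om] is covered by countably many rational boxes whose closed versions lie in it. *)
Lemma fundamental_lemma : {ae mu, forall x, Om x -> v x = 0}.
Proof.
pose B (p : 'rV[rat]_n * rat) := open_box (\row_i (ratr (p.1 ord0 i) : R)) (fun=> ratr p.2).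
pose good (p : 'rV[rat]_n * rat) := 0 < ratr p.2 :> R /\
  closed_box (\row_i (ratr (p.1 ord0 i) : R)) (fun=> ratr p.2) `<=` Om.
pose N k := [set x | if unpickle k is Some p then good p /\ B p x /\ v x <> 0 else False].
have nN k : mu.-negligible (N k).
  rewrite /N; case: (unpickle k) => [p|]; last first.
    by rewrite (_ : [set _ | False] = set0); [exact: negligible_set0|apply/seteqP; split].
  have [[p0 pO]|ng] := pselect (good p); last first.
    rewrite (_ : [set _ | _] = set0); first exact: negligible_set0.
    by apply/seteqP; split => x //= [].
  apply: negligibleS (vanishing_in_box (fun=> p0) pO) => x /= [_ [Bx vx]] h.
  by apply: vx; exact: h.
apply: negligibleS (negligible_bigcup nN) => x /= /not_implyP[Ox vx].
have [p [p0 px pO]] := open_box_cover Ox.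
by exists (pickle p) => //; rewrite /N /= pickleK.
Qed.

End fundamental_lemma_open.

(** * Square-integrable functions and the Sobolev space *)

Lemma young_split (R : realFieldType) (a b e : R) : 0 < e ->
  (1 * a + -1 * b) ^+ 2 <= (1 + e) * a ^+ 2 + (1 + e^-1) * b ^+ 2.
Proof.
move=> e0; rewrite -subr_ge0 (_ : _ - _ = e^-1 * (e * a + b) ^+ 2); last by field; rewrite gt_eqF.
by rewrite mulr_ge0 ?sqr_ge0// invr_ge0 ltW.
Qed.

(** Numerical core of the density argument: [P] and [S] are the squared norm and energy of a test
    function, [N] the squared distance to it, [c] the pairing with it, [s] and [t] the cross terms
    of the heat form. The square root of [P] is within [e] of 1, and all errors are of order [e]. *)
Lemma form_bound_arith (R : rcfType) (e ge D P N c s t S Y : R) : 0 < e -> e <= 1 -> 0 <= ge ->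
  0 <= D -> 0 <= P -> 0 <= N -> N <= e ^+ 2 -> N = 1 + P - 2 * c -> c ^+ 2 <= P ->
  s ^+ 2 <= N * P -> t ^+ 2 <= N -> S <= D + e * (D + 2) ->
  P - 2^-1 * (ge * S) <= Y ->
  1 - 2^-1 * (ge * D) <= Y + s + t + e * (9 + 2^-1 * (ge * (D + 2))).
Proof.
move=> e0 e1 ge0 D0 P0 N0 Ne NE cP sP tN SD YP.
have p2 := sqr_sqrtr P0; have p0 := sqrtr_ge0 P; move: (Num.sqrt P) p2 p0 => p p2 p0.
have cp : c <= p.
  by apply: le_trans (ler_norm c) _; rewrite -(@ler_pXn2r _ 2) ?nnegrE// sqr_normr p2.
have p1 : `|1 - p| <= e.
  rewrite -(@ler_pXn2r _ 2) ?nnegrE ?(ltW e0)// sqr_normr; apply: le_trans Ne.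
  by rewrite NE -p2; nra.
have tE : - e <= t.
  rewrite lerNl; apply: le_trans (ler_norm (- t)) _; rewrite normrN.
  by rewrite -(@ler_pXn2r _ 2) ?nnegrE ?(ltW e0)// sqr_normr; apply: le_trans Ne.
move: p1; rewrite ler_norml => /andP[p1 p1'].
have sE : - (2 * e) <= s.
  rewrite lerNl; apply: le_trans (ler_norm (- s)) _; rewrite normrN.
  rewrite -(@ler_pXn2r _ 2) ?nnegrE ?mulr_ge0 ?(ltW e0)// sqr_normr; apply: le_trans sP _.
  rewrite exprMn mulrC; apply: ler_pM => //; rewrite -p2.
  by rewrite lerXn2r ?nnegrE//; lra.
have Pe : 1 - 2 * e <= P by rewrite -p2; nra.
have SE : ge * S <= ge * D + ge * (e * (D + 2)) by rewrite -mulrDr ler_wpM2l.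
have -> : e * (9 + 2^-1 * (ge * (D + 2))) = 9 * e + 2^-1 * (ge * (e * (D + 2))) by ring.
move: (ge * (e * (D + 2))) (ge * S) (ge * D) SE YP => u v w SE YP; lra.
Qed.

Section square_integrable.
Context {R : realType} {n : nat}.
Local Notation E := 'rV[R]_n.
Local Notation mu := (@lebesgue_rV R n).
Implicit Types f g : E -> R.

Definition sqint f := measurable_fun setT f /\ intble mu (fun x => f x ^+ 2).

Lemma sqint_mul f g : sqint f -> sqint g -> intble mu (fun x => f x * g x).
Proof.
move=> [mf f2] [mg g2]; apply: intble_dom (intbleD f2 g2); first exact: measurable_funM.
move=> x; rewrite ler_norml; apply/andP; split.
  by rewrite -subr_ge0 (_ : _ - _ = ((f x + g x) ^+ 2 + f x ^+ 2 + g x ^+ 2) / 2);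
    [rewrite divr_ge0// !addr_ge0 ?sqr_ge0|field].
by rewrite -subr_ge0 (_ : _ - _ = ((f x - g x) ^+ 2 + f x ^+ 2 + g x ^+ 2) / 2);
  [rewrite divr_ge0// !addr_ge0 ?sqr_ge0|field].
Qed.

Lemma sqint_comb a b f g : sqint f -> sqint g -> sqint (fun x => a * f x + b * g x) /\
  int mu (fun x => (a * f x + b * g x) ^+ 2) = a ^+ 2 * int mu (fun x => f x ^+ 2) +
    2 * a * b * int mu (fun x => f x * g x) + b ^+ 2 * int mu (fun x => g x ^+ 2).
Proof.
move=> sf sg; have fg := sqint_mul sf sg; have [mf f2] := sf; have [mg g2] := sg.
have E1 : (fun x => (a * f x + b * g x) ^+ 2) =
    (fun x => a ^+ 2 * f x ^+ 2 + 2 * a * b * (f x * g x) + b ^+ 2 * g x ^+ 2).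
  by apply/funext => x; ring.
have i1 := intbleZ (a ^+ 2) f2; have i2 := intbleZ (2 * a * b) fg; have i3 := intbleZ (b ^+ 2) g2.
split; last by rewrite E1 (intD (intbleD i1 i2) i3) (intD i1 i2) !intZ.
split; first by apply: measurable_funD; exact: measurable_funM.
by rewrite E1; exact: intbleD (intbleD i1 i2) i3.
Qed.

Lemma sqint_cs f g : sqint f -> sqint g ->
  int mu (fun x => f x * g x) ^+ 2 <= int mu (fun x => f x ^+ 2) * int mu (fun x => g x ^+ 2).
Proof. by move=> sf sg; apply: cauchy_schwarz; [exact: sf.2|exact: sg.2|exact: sqint_mul]. Qed.

(** Jensen's inequality for the probability density [gaussp t (x - y)], obtained from
    Cauchy-Schwarz, followed by conservation of mass. *)
Lemma conv_sqint t f : 0 < t -> intble mu f -> sqint f -> sqint (conv t f) /\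
  int mu (fun x => conv t f x ^+ 2) <= int mu (fun x => f x ^+ 2).
Proof.
move=> t0 fi [mf f2]; have mc := intble_mfun (intble_convT t0 fi).
have jensen x : conv t f x ^+ 2 <= conv t (fun y => f y ^+ 2) x.
  pose k y := Num.sqrt (gaussp t (x - y)).
  have k2 y : k y ^+ 2 = gaussp t (x - y) by rewrite sqr_sqrtr// gaussp_ge0.
  have e1 : (fun y => k y ^+ 2) = (fun y => gaussp t (x - y)) by apply/funext.
  have e2 : (fun y => (k y * f y) ^+ 2) = (fun y => gaussp t (x - y) * f y ^+ 2).
    by apply/funext => y; rewrite exprMn k2.
  have e3 : (fun y => k y * (k y * f y)) = (fun y => gaussp t (x - y) * f y).
    by apply/funext => y; rewrite mulrA -expr2 k2.
  clearbody k.
  have i1 : intble mu (fun y => k y ^+ 2) by rewrite e1; exact: intble_gaussp_at.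
  have i2 : intble mu (fun y => (k y * f y) ^+ 2) by rewrite e2; exact: intble_conv.
  have i3 : intble mu (fun y => k y * (k y * f y)) by rewrite e3; exact: intble_conv.
  have := cauchy_schwarz i1 i2 i3.
  by rewrite e1 e2 e3 (int_gaussp_at x t0) mul1r -!convdefE.
have ic2 := intble_convT t0 f2.
have is_ : intble mu (fun x => conv t f x ^+ 2).
  apply: intble_dom ic2; first exact: measurable_funX.
  by move=> x; rewrite ger0_norm ?sqr_ge0.
split; first by split.
by rewrite -(int_conv t0 f2); apply: int_le.
Qed.

End square_integrable.

Section sobolev_api.
Context {R : realType} {n : nat}.
Local Notation E := 'rV[R]_n.
Local Notation mu := (@lebesgue_rV R n).
Variables (Om : set E) (L : R).
Hypotheses (oO : open Om) (L0 : 0 <= L) (OL : Om `<=` cube n L).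
Implicit Types (u v w phi psi : E -> R) (g h : 'I_n -> E -> R).

Let mO : measurable Om. Proof. exact: open_measurable_rV oO. Qed.

Lemma ext_in u x : Om x -> (u \_ Om) x = u x.
Proof. by move=> Ox; rewrite patchE mem_set. Qed.

Lemma ext_out u x : ~ Om x -> (u \_ Om) x = 0.
Proof. by move=> Ox; rewrite patchE memNset. Qed.

Lemma ext_comb (a b : R) u v :
  (fun x => a * u x + b * v x) \_ Om = (fun x => a * (u \_ Om) x + b * (v \_ Om) x).
Proof.
apply/funext => x; have [Ox|Ox] := pselect (Om x); first by rewrite !ext_in.
by rewrite !ext_out// !mulr0 addr0.
Qed.

Lemma intble_indic_domain : intble mu (\1_Om : E -> R).
Proof.
apply: (cubed_intble ler01 L0 (_ : cubed 1 L _)); split.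
- exact: measurable_indic.
- by move=> x; rewrite indicE.
- by move=> x; rewrite indicE lern1 leq_b1.
- by move=> x xL; rewrite indicE memNset// => /OL.
Qed.

Lemma sqint_supp f : sqint f -> (forall x, ~ Om x -> f x = 0) -> intble mu f.
Proof.
move=> [mf f2] fO; apply: intble_dom (intbleD intble_indic_domain f2) => // x.
have [Ox|Ox] := pselect (Om x); last by rewrite fO// normr0 addr_ge0 ?sqr_ge0// indicE.
rewrite indicE mem_set// mulr1n -sqr_normr.
rewrite -subr_ge0 (_ : _ - _ = (`|f x| - 1) ^+ 2 / 2 + (`|f x| ^+ 2 + 1) / 2); last by field.
by rewrite addr_ge0// divr_ge0// ?addr_ge0 ?sqr_ge0.
Qed.

Lemma Lnorm2E (f : E -> R) :
  ('N[mu]_2%:E[EFin \o f] = sqrte (\int[mu]_x (f x ^+ 2)%:E))%E.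
Proof.
rewrite unlock /Lnorm poweR12_sqrt; last by apply: integral_ge0 => x _; exact: poweR_ge0.
congr sqrte; apply: eq_integral => x _ /=.
by rewrite powR_mulrn// sqr_normr.
Qed.

Lemma L2P u : L2 Om u <-> sqint (u \_ Om).
Proof.
have I0 : (0%E <= \int[mu]_x ((u \_ Om) x ^+ 2)%:E)%E.
  by apply: integral_ge0 => x _; rewrite lee_fin sqr_ge0.
rewrite /L2; split.
- move=> /andP[]; rewrite !inE /= /finite_norm Lnorm2E => mf' Nf.
  have mf : measurable_fun setT (u \_ Om) by exact: mf'.
  have f0 (x : E) : 0 <= (u \_ Om) x ^+ 2 := sqr_ge0 _.
  have mf2 : measurable_fun setT (fun x : E => (u \_ Om) x ^+ 2) by exact: measurable_funX.
  have H := @ge0_intbleP _ E R mu _ mf2 f0; split; first exact: mf.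
  apply: H.2.
  by rewrite -ge0_fin_numE// -sqrte_fin_num// ge0_fin_numE// sqrte_ge0.
- move=> [mf f2]; apply/andP; rewrite !inE /= /finite_norm Lnorm2E; split => //.
  have f0 (x : E) : 0 <= (u \_ Om) x ^+ 2 := sqr_ge0 _.
  have mf2 : measurable_fun setT (fun x : E => (u \_ Om) x ^+ 2) by exact: measurable_funX.
  have := (@ge0_intbleP _ E R mu _ mf2 f0).1 f2.
  by rewrite -ge0_fin_numE// -sqrte_fin_num// ge0_fin_numE// sqrte_ge0.
Qed.

Lemma L2normE u : sqint (u \_ Om) ->
  L2norm Om u = (Num.sqrt (int mu (fun x => (u \_ Om) x ^+ 2)))%:E.
Proof. by move=> [mf f2]; rewrite /L2norm Lnorm2E -intE. Qed.

Lemma Rintegral_ext (f : E -> R) : (\int[mu]_(x in Om) f x)%R = int mu (f \_ Om).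
Proof. exact: Rintegral_mkcond. Qed.

Lemma ext_mul u v : (fun x => u x * v x) \_ Om = (fun x => (u \_ Om) x * v x).
Proof.
apply/funext => x; have [Ox|Ox] := pselect (Om x); first by rewrite !ext_in.
by rewrite !ext_out// mul0r.
Qed.

Lemma weak_partialP i u v : weak_partial Om i u v <-> forall phi, test_function Om phi ->
  int mu (fun x => (u \_ Om) x * partial i phi x) = - int mu (fun x => (v \_ Om) x * phi x).
Proof.
by split=> H phi tp; have := H phi tp; rewrite !Rintegral_ext !ext_mul.
Qed.

Lemma test_smooth phi : test_function Om phi -> smooth_in_cube L phi /\ phi \_ Om = phi.
Proof.
move=> [sp cp pO].
have p0 x : ~ Om x -> phi x = 0.
  by move=> Ox; apply: contrapT => /eqP px; apply: Ox; apply: pO; exact: subset_closure.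
split; first by split => // x xL; apply: p0 => /OL.
by apply/funext => x; have [Ox|Ox] := pselect (Om x); [rewrite ext_in|rewrite ext_out// p0].
Qed.

Lemma test_sub phi psi : smooth psi -> test_function Om phi ->
  [set x | psi x != 0] `<=` closure [set x | phi x != 0] -> test_function Om psi.
Proof.
move=> sq [_ cp pO] sub.
have sub' : closure [set x | psi x != 0] `<=` closure [set x | phi x != 0].
  rewrite [X in _ `<=` X]((closure_id _).1 (@closed_closure _ _)); exact: closure_subset.
split => //; last exact: subset_trans pO.
exact: subclosed_compact (@closed_closure _ _) cp sub'.
Qed.

Lemma test_partial i phi : test_function Om phi -> test_function Om (partial i phi).
Proof.
move=> tp; have [sp _ _] := tp; apply: (test_sub _ tp); first exact: smooth_partial.
move=> x /= px; apply: contrapT => xc; move/eqP: px; apply.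
apply: (@partial_eq0 R n phi i (~` closure [set x | phi x != 0])) => //.
  exact: closed_openC (@closed_closure _ _).
by move=> y yc; apply: contrapT => /eqP h; apply: yc; exact: subset_closure.
Qed.

Lemma smooth_comb (a b : R) phi psi : smooth phi -> smooth psi ->
  smooth (fun x => a * phi x + b * psi x).
Proof.
move=> sp sq s x.
have H t : foldr (@partial R n) (fun x => a * phi x + b * psi x) t =
    (fun x => a * foldr (@partial R n) phi t x + b * foldr (@partial R n) psi t x).
  elim: t => [//|i t ih] /=; rewrite ih; apply/funext => y; rewrite /partial.
  have dp := @diff_derivable R _ _ (foldr (@partial R n) phi t) y (delta_mx ord0 i) (sp t y).
  have dq := @diff_derivable R _ _ (foldr (@partial R n) psi t) y (delta_mx ord0 i) (sq t y).
  have := is_deriveD (is_deriveZ a (derivableP dp)) (is_deriveZ b (derivableP dq)).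
  by move=> D; exact: (@derive_val _ _ _ _ _ _ _ D).
rewrite H; apply: differentiableD; apply: differentiableM;
  [exact: differentiable_cst|exact: sp|exact: differentiable_cst|exact: sq].
Qed.

Lemma test_comb (a b : R) phi psi : test_function Om phi -> test_function Om psi ->
  test_function Om (fun x => a * phi x + b * psi x).
Proof.
move=> [sp cp pO] [sq cq qO]; set A := closure _ in cp pO; set B := closure _ in cq qO.
have sub : closure [set x | a * phi x + b * psi x != 0] `<=` A `|` B.
  have cAB : closed (A `|` B) by apply: closedU; exact: closed_closure.
  rewrite [X in _ `<=` X]((closure_id _).1 cAB); apply: closure_subset => x /= h.
  have [p0|p0] := eqVneq (phi x) 0; last by left; exact: subset_closure.
  right; apply: subset_closure => /=; apply/eqP => q0.
  by move: h; rewrite p0 q0 !mulr0 addr0 eqxx.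
split; first exact: smooth_comb.
- by apply: subclosed_compact sub; [exact: closed_closure|exact: compactU].
- by apply: subset_trans sub _ => x [/pO|/qO].
Qed.

Lemma weak_gradient_comb (a b : R) u v g h : L2 Om u -> L2 Om v ->
  weak_gradient Om u g -> weak_gradient Om v h ->
  weak_gradient Om (fun x => a * u x + b * v x) (fun i x => a * g i x + b * h i x).
Proof.
move=> /L2P u2 /L2P v2 ug vh i; have [/L2P g2 /weak_partialP wg] := ug i.
have [/L2P h2 /weak_partialP wh] := vh i; split.
  by apply/L2P; rewrite ext_comb; exact: (sqint_comb a b g2 h2).1.
apply/weak_partialP => phi tp; rewrite !ext_comb.
have [sp _] := test_smooth tp; have spi := smooth_in_cube_partial i sp.
have sq psi : smooth_in_cube L psi -> sqint psi.
  by move=> s; have [] := smooth_in_cube_intble L0 s.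
have k1 := sqint_mul u2 (sq _ spi); have k2 := sqint_mul v2 (sq _ spi).
have k3 := sqint_mul g2 (sq _ sp); have k4 := sqint_mul h2 (sq _ sp).
have -> : (fun x => (a * (u \_ Om) x + b * (v \_ Om) x) * partial i phi x) =
  (fun x => a * ((u \_ Om) x * partial i phi x) + b * ((v \_ Om) x * partial i phi x)).
  by apply/funext => x; ring.
have -> : (fun x => (a * (g i \_ Om) x + b * (h i \_ Om) x) * phi x) =
  (fun x => a * ((g i \_ Om) x * phi x) + b * ((h i \_ Om) x * phi x)).
  by apply/funext => x; ring.
rewrite (intD (intbleZ a k1) (intbleZ b k2)) (intD (intbleZ a k3) (intbleZ b k4)) !intZ//.
by rewrite wg// wh//; ring.
Qed.

Lemma test_L2 phi : test_function Om phi -> L2 Om phi.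
Proof.
move=> tp; have [sp pO] := test_smooth tp; apply/L2P; rewrite pO.
by have [] := smooth_in_cube_intble L0 sp.
Qed.

Lemma weak_gradient_test phi : test_function Om phi ->
  weak_gradient Om phi (fun i => partial i phi).
Proof.
move=> tp i; split; first by apply: test_L2; exact: test_partial.
have [sp pO] := test_smooth tp; have [_ piO] := test_smooth (test_partial i tp).
apply/weak_partialP => psi tq; rewrite pO piO; have [sq _] := test_smooth tq.
rewrite (integration_by_parts_smooth L0 i sp sq) opprK//.
Qed.

(** The difference of the two gradients annihilates all test functions, so the fundamental lemma
    makes it vanish almost everywhere on [Om]. *)
Lemma weak_gradient_unique u g h i : weak_gradient Om u g -> weak_gradient Om u h ->
  int mu (fun x => (g i \_ Om) x ^+ 2) = int mu (fun x => (h i \_ Om) x ^+ 2).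
Proof.
move=> ug uh; have [/L2P g2 /weak_partialP wg] := ug i; have [/L2P h2 /weak_partialP wh] := uh i.
pose v x := 1 * (g i \_ Om) x + (- 1) * (h i \_ Om) x.
have v2 : sqint v := (sqint_comb 1 (- 1) g2 h2).1.
have iv : intble mu v by apply: sqint_supp v2 _ => x Ox; rewrite /v !ext_out// !mulr0 addr0.
have H : {ae mu, forall x, Om x -> v x = 0}.
  apply: (fundamental_lemma oO OL iv) => phi tp; have [sp _] := test_smooth tp.
  have sq : sqint phi by have [] := smooth_in_cube_intble L0 sp.
  have -> : (fun x => v x * phi x) = (fun x => (g i \_ Om) x * phi x - (h i \_ Om) x * phi x).
    by apply/funext => x; rewrite /v; ring.
  rewrite (intB (sqint_mul g2 sq) (sqint_mul h2 sq)).
  by apply/eqP; rewrite subr_eq0 -eqr_opp -wg// -wh.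
apply: ae_eq_int; [exact: measurable_funX g2.1|exact: measurable_funX h2.1|].
apply: filterS H => x Hx; have [Ox|Ox] := pselect (Om x); last by rewrite !ext_out.
by have := Hx Ox; rewrite /v mul1r mulN1r => /eqP; rewrite subr_eq0 => /eqP ->.
Qed.

Definition dirichlet g := \sum_i int mu (fun x => (g i \_ Om) x ^+ 2).

Lemma dirichlet_ge0 g : 0 <= dirichlet g.
Proof. by apply: sumr_ge0 => i _; apply: int_ge0 => x; exact: sqr_ge0. Qed.

(** [energy] uses the gradient selected by [xget]; uniqueness allows any weak gradient in its
    place. *)
Lemma energyE u g : weak_gradient Om u g -> energy Om u = (dirichlet g)%:E.
Proof.
move=> ug; have uw : weak_gradient Om u (wgrad Om u) by apply: xgetPex; exists g.
have w2 i : intble mu (fun x => ((wgrad Om u) i \_ Om) x ^+ 2) by have [/L2P[]] := uw i.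
have -> : dirichlet g = int mu (fun x => \sum_i ((wgrad Om u) i \_ Om) x ^+ 2).
  rewrite int_sum//; apply: eq_bigr => i _; exact: weak_gradient_unique ug uw.
rewrite intE; last exact: intble_sum.
rewrite /energy.
transitivity (\int[mu]_x (((fun x => (\sum_i (wgrad Om u i x) ^+ 2)%:E) \_ Om) x))%E.
  exact: integral_mkcond.
apply: eq_integral => x _; rewrite patchE.
case: ifPn => xO; congr EFin.
  by apply: eq_bigr => i _; rewrite patchE xO.
by rewrite big1// => i _; rewrite patchE (negbTE xO) expr0n.
Qed.

Lemma W12normE u g : L2 Om u -> weak_gradient Om u g ->
  W12norm Om u = (Num.sqrt (int mu (fun x => (u \_ Om) x ^+ 2) + dirichlet g))%:E.
Proof.
move=> /L2P u2 ug; rewrite /W12norm (energyE ug) L2normE// -EFin_expe -EFinD /=.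
by rewrite sqr_sqrtr// int_ge0// => x; exact: sqr_ge0.
Qed.

Lemma W12_wgrad u : W12 Om u -> weak_gradient Om u (wgrad Om u).
Proof. by move=> [_ [g ug]]; apply: xgetPex; exists g. Qed.

Lemma W012_comb (a b : R) u phi : W012 Om u -> test_function Om phi ->
  W012 Om (fun x => a * u x + b * phi x).
Proof.
move=> [[u2 [g ug]] uap] tp; split.
  split; first by apply/L2P; rewrite ext_comb; apply: (sqint_comb _ _ _ _).1; apply/L2P => //; exact: test_L2.
  by eexists; exact: weak_gradient_comb u2 (test_L2 tp) ug (weak_gradient_test tp).
move=> e e0; have e' : 0 < e / (`|a| + 1) by rewrite divr_gt0// ltr_wpDl.
have [psi tq Hd] := uap _ e'; exists (fun x => a * psi x + b * phi x); first exact: test_comb.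
have q2 := test_L2 tq; have qg := weak_gradient_test tq.
have dg := weak_gradient_comb 1 (- 1) u2 q2 ug qg.
have d2 : L2 Om (fun x => 1 * u x + -1 * psi x).
  by apply/L2P; rewrite ext_comb; apply: (sqint_comb _ _ _ _).1; exact/L2P.
have Ed : (u \- psi) = (fun x => 1 * u x + -1 * psi x) by apply/funext => x /=; ring.
have Ea : ((fun x => a * u x + b * phi x) \- (fun x => a * psi x + b * phi x)) =
    (fun x => a * (1 * u x + -1 * psi x) + 0 * (1 * u x + -1 * psi x)).
  by apply/funext => x /=; ring.
have ag := weak_gradient_comb a 0 d2 d2 dg dg.
have a2 : L2 Om (fun x => a * (1 * u x + -1 * psi x) + 0 * (1 * u x + -1 * psi x)).
  by apply/L2P; rewrite ext_comb; apply: (sqint_comb _ _ _ _).1; exact/L2P.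
have W0 : 0 <= int mu (fun x => ((fun x => 1 * u x + -1 * psi x) \_ Om) x ^+ 2) +
    dirichlet (fun i x => 1 * g i x + -1 * partial i psi x).
  by rewrite addr_ge0 ?dirichlet_ge0// int_ge0// => x; exact: sqr_ge0.
move: Hd; rewrite Ed (W12normE d2 dg) lte_fin => H.
rewrite Ea (W12normE a2 ag) lte_fin.
have -> : int mu (fun x => ((fun x => a * (1 * u x + -1 * psi x) + 0 * (1 * u x + -1 * psi x)) \_ Om) x ^+ 2) =
   a ^+ 2 * int mu (fun x => ((fun x => 1 * u x + -1 * psi x) \_ Om) x ^+ 2).
  rewrite -intZ; last by have /L2P[] := d2.
  by congr (int mu); apply/funext => x; rewrite ext_comb; ring.
have -> : dirichlet (fun i x => a * (1 * g i x + -1 * partial i psi x) + 0 * (1 * g i x + -1 * partial i psi x)) =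
   a ^+ 2 * dirichlet (fun i x => 1 * g i x + -1 * partial i psi x).
  rewrite /dirichlet mulr_sumr; apply: eq_bigr => i _; rewrite -intZ; last by have [/L2P[]] := dg i.
  by congr (int mu); apply/funext => x; rewrite ext_comb; ring.
rewrite -mulrDr sqrtrM ?sqr_ge0// sqrtr_sqr.
apply: (@le_lt_trans _ _ (`|a| * (e / (`|a| + 1)))); first by rewrite ler_wpM2l// ltW.
by rewrite mulrCA gtr_pMr// ltr_pdivrMr ?ltr_wpDl// mul1r ltrDl.
Qed.

Lemma W012_test phi : test_function Om phi -> W012 Om phi.
Proof.
move=> tp; split; first by split; [exact: test_L2|eexists; exact: weak_gradient_test].
move=> e e0; exists phi => //; have p2 := test_L2 tp; have pg := weak_gradient_test tp.
have zg := weak_gradient_comb 0 0 p2 p2 pg pg.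
have z2 : L2 Om (fun x => 0 * phi x + 0 * phi x).
  by apply/L2P; rewrite ext_comb; apply: (sqint_comb _ _ _ _).1; exact/L2P.
have -> : phi \- phi = (fun x => 0 * phi x + 0 * phi x) by apply/funext => x /=; ring.
rewrite (W12normE z2 zg) lte_fin.
have z (w : E -> R) : int mu (fun x => ((fun x => 0 * w x + 0 * w x) \_ Om) x ^+ 2) = 0.
  rewrite (_ : (fun x => _) = fun=> 0); first exact: int0.
  by apply/funext => x; rewrite ext_comb !mul0r addr0 expr0n.
by rewrite z /dirichlet big1 ?addr0 ?sqrtr0// => i _; exact: z.
Qed.

(* Density of test functions transfers the heat-form bound to W_0^{1,2}. *)
Lemma heat_form_S2 w eps Lam : (0 < n)%N -> 0 < eps -> S2 Om w -> (energy Om w <= Lam%:E)%E ->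
  [/\ sqint (w \_ Om), intble mu (w \_ Om), int mu (fun x => (w \_ Om) x ^+ 2) = 1 &
  1 - 2^-1 * (@gvar R n * eps * Lam) <= int mu (fun x => (w \_ Om) x * conv eps (w \_ Om) x)].
Proof.
move=> n0 e0 [[[w2 [g wg]] wap] Nw]; rewrite (energyE wg) lee_fin => gL.
have /L2P sf := w2; set f := w \_ Om in sf *.
have fO x : ~ Om x -> f x = 0 by exact: ext_out.
have fi := sqint_supp sf fO.
have f1 : int mu (fun x => f x ^+ 2) = 1.
  move: Nw; rewrite (L2normE sf) => -[] h.
  by rewrite -[LHS]sqr_sqrtr ?h ?expr1n// int_ge0// => x; exact: sqr_ge0.
split => //; have gv := @gvar_gt0 R n n0; have ge : 0 < @gvar R n * eps by rewrite mulr_gt0.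
set X := int mu (fun x => f x * conv eps f x); set D := dirichlet g in gL *.
have D0 : 0 <= D := dirichlet_ge0 g.
suff H e : 0 < e -> e <= 1 -> 1 - 2^-1 * (@gvar R n * eps * D) <=
    X + e * (9 + 2^-1 * (@gvar R n * eps * (D + 2))).
  apply: (@le_trans _ _ (1 - 2^-1 * (@gvar R n * eps * D))).
    by rewrite lerD2l lerN2 ler_pM2l// ler_pM2l.
  pose K := 9 + 2^-1 * (@gvar R n * eps * (D + 2)).
  have K0 : 0 < K by rewrite ltr_pwDl// mulr_ge0// mulr_ge0 ?addr_ge0// ltW.
  apply/ler_addgt0Pr => e e00; pose e1 := Num.min 1 (e / K).
  have e10 : 0 < e1 by rewrite lt_min ltr01 divr_gt0.
  apply: le_trans (H e1 e10 _) _; first by rewrite ge_min lexx.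
  by rewrite lerD2l -/K -ler_pdivlMr// ge_min lexx orbT.
move=> e00 e11; have [phi tp] := wap _ e00.
have p2 := test_L2 tp; have pg := weak_gradient_test tp; have [sp pO] := test_smooth tp.
pose del := fun x => 1 * w x + -1 * phi x.
have dg := weak_gradient_comb 1 (- 1) w2 p2 wg pg.
have d2 : L2 Om del by apply/L2P; rewrite ext_comb; apply: (sqint_comb _ _ _ _).1; exact/L2P.
have -> : w \- phi = del by apply/funext => x /=; rewrite /del; ring.
rewrite (W12normE d2 dg) lte_fin; set G := dirichlet _; set N := int mu _ => NG.
have N0 : 0 <= N by apply: int_ge0 => x; exact: sqr_ge0.
have G0 : 0 <= G by exact: dirichlet_ge0.
have NG2 : N + G <= e ^+ 2.
  rewrite -[leLHS]sqr_sqrtr ?addr_ge0// lerXn2r ?nnegrE ?sqrtr_ge0 ?(ltW e00)//; exact: ltW.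
have sphi : sqint phi by have [] := smooth_in_cube_intble L0 sp.
have iphi : intble mu phi by have [] := smooth_in_cube_intble L0 sp.
have sd : sqint (del \_ Om) by exact/L2P.
have delE : del \_ Om = (fun x => 1 * f x + -1 * phi x) by rewrite /del ext_comb pO.
have id : intble mu (del \_ Om) by apply: sqint_supp sd _ => x; exact: ext_out.
have [_ Nexp] := sqint_comb 1 (- 1) sf sphi.
set P := int mu (fun x => phi x ^+ 2) in Nexp; have P0 : 0 <= P by apply: int_ge0 => x; exact: sqr_ge0.
have NE : N = 1 + P - 2 * int mu (fun x => f x * phi x).
  rewrite /N delE Nexp f1; ring.
set c := int mu (fun x => f x * phi x) in NE Nexp.
have c2 : c ^+ 2 <= P by have := sqint_cs sf sphi; rewrite f1 mul1r.
have GE : \sum_i int mu (fun x => partial i phi x ^+ 2) <= D + e * (D + 2).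
  have ug := weak_gradient_comb 1 (- 1) w2 d2 wg dg.
  have Ep : (fun x => 1 * w x + -1 * del x) = phi by apply/funext => x; rewrite /del; ring.
  rewrite Ep in ug.
  have -> : \sum_i int mu (fun x => partial i phi x ^+ 2) =
     \sum_i int mu (fun x => ((fun x => 1 * g i x + -1 * (1 * g i x + -1 * partial i phi x)) \_ Om) x ^+ 2).
    apply: eq_bigr => i _; rewrite -(weak_gradient_unique i pg ug).
    by rewrite (test_smooth (test_partial i tp)).2.
  have gi i : sqint (g i \_ Om) by apply/L2P; exact: (wg i).1.
  have hi i : sqint ((fun x => 1 * g i x + -1 * partial i phi x) \_ Om) by apply/L2P; exact: (dg i).1.
  apply: (@le_trans _ _ ((1 + e) * D + (1 + e^-1) * G)).
    rewrite /D /G /dirichlet !mulr_sumr -big_split /=; apply: ler_sum => i _.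
    rewrite -(intZ (1 + e) (gi i).2) -(intZ (1 + e^-1) (hi i).2) -intD; [|exact: intbleZ (gi i).2|exact: intbleZ (hi i).2].
    apply: int_le.
    - by rewrite ext_comb; exact: (sqint_comb 1 (- 1) (gi i) (hi i)).1.2.
    - by apply: intbleD; [exact: intbleZ (gi i).2|exact: intbleZ (hi i).2].
    - move=> x; rewrite ext_comb; move: ((g i \_ Om) x) (((fun x => 1 * g i x + -1 * partial i phi x) \_ Om) x) => a b.
      exact: young_split e00.
  apply: (@le_trans _ _ ((1 + e) * D + (1 + e^-1) * e ^+ 2)).
    rewrite lerD2l; apply: ler_wpM2l; first by rewrite addr_ge0// invr_ge0 ltW.
    by apply: le_trans NG2; rewrite lerDr.
  have -> : (1 + e) * D + (1 + e^-1) * e ^+ 2 = D + e * (D + 1 + e) by field; rewrite gt_eqF.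
  by rewrite lerD2l ler_wpM2l ?(ltW e00)// -addrA lerD2l; lra.
have form := heat_form_smooth L0 n0 e0 sp.
set Y := int mu (fun x => phi x * conv eps phi x) in form.
have [spc spc2] := conv_sqint e0 iphi sphi; have [sdc sdc2] := conv_sqint e0 id sd.
have XY : X = Y + int mu (fun x => (del \_ Om) x * conv eps phi x) + int mu (fun x => f x * conv eps (del \_ Om) x).
  have fE x : f x = phi x + (del \_ Om) x by rewrite delE; ring.
  have cE x : conv eps f x = conv eps phi x + conv eps (del \_ Om) x.
    rewrite !convdefE -intD; [|exact: intble_conv..]; congr (int mu); apply/funext => y.
    by rewrite fE mulrDr.
  rewrite /Y -(intD (sqint_mul sphi spc) (sqint_mul sd spc)) -intD.
  - by congr (int mu); apply/funext => x; rewrite cE fE; ring.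
  - exact: intbleD (sqint_mul sphi spc) (sqint_mul sd spc).
  - exact: sqint_mul sf sdc.
have b1 := le_trans (sqint_cs sd spc) (ler_wpM2l N0 spc2).
have b2 := sqint_cs sf sdc; rewrite f1 mul1r in b2; have {}b2 := le_trans b2 sdc2.
rewrite -/N in b2; rewrite -/N -/P in b1.
move: XY b1 b2; move: (int mu (fun x => (del \_ Om) x * conv eps phi x)) (int mu (fun x => f x * conv eps (del \_ Om) x)).
move=> s t XY b1 b2; rewrite XY.
apply: (form_bound_arith e00 e11 (ltW ge) D0 P0 N0 _ NE c2 b1 b2 GE form).
by apply: le_trans NG2; rewrite lerDl.
Qed.

End sobolev_api.

(** * The Rayleigh quotient and the Euler-Lagrange equation *)

(** At s = - p / (|q| + 1) the quadratic is negative unless p = 0. *)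
Lemma quadratic_ge0_linear (R : realFieldType) (p q : R) :
  (forall s, 0 <= 2 * s * p + s ^+ 2 * q) -> p = 0.
Proof.
move=> H; have k0 : 0 < `|q| + 1 by rewrite ltr_wpDl.
have := H (- p / (`|q| + 1)); have qk : q <= `|q| + 1 by apply: le_trans (ler_norm q) _; rewrite lerDl.
move: (`|q| + 1) k0 qk => k k0 qk.
have -> : 2 * (- p / k) * p + (- p / k) ^+ 2 * q = (p / k) ^+ 2 * (q - 2 * k) by field; rewrite gt_eqF.
have [->//|p0] := eqVneq p 0; rewrite leNgt nmulr_llt0 ?exprn_even_gt0 //=; last by lra.
by rewrite mulf_neq0// invr_neq0// gt_eqF.
Qed.

Section euler_lagrange.
Context {R : realType} {n : nat}.
Local Notation E := 'rV[R]_n.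
Local Notation mu := (@lebesgue_rV R n).
Variables (Om : set E) (L : R).
Hypotheses (oO : open Om) (L0 : 0 <= L) (OL : Om `<=` cube n L) (Om0 : Om !=set0).
Implicit Types (u v w phi psi : E -> R) (g h : 'I_n -> E -> R).

Lemma test_function_exists : exists2 J, test_function Om J & 0 < int mu (fun x => J x ^+ 2).
Proof.
have [x Ox] := Om0; have [[z r] [/= r0 xr bO]] := open_box_cover oO Ox.
have tJ := box_bump_test ltr01 (fun=> r0) OL bO; eexists; first exact: tJ.
have [sJ _] := test_smooth OL tJ; have [_ _ J2] := smooth_in_cube_intble L0 sJ.
have oD : open [set y : E | 0 < box_bump 1 (\row_i (ratr (z ord0 i) : R)) (fun=> ratr r) y].
  rewrite (_ : [set y | _] = box_bump 1 (\row_i (ratr (z ord0 i) : R)) (fun=> ratr r) @^-1` [set t | 0 < t])//.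
  by apply: open_comp; [move=> y _; exact: smooth_continuous sJ.1 y|exact: open_gt].
apply: (int_gt0 J2 (fun y => sqr_ge0 _) (open_measurable_rV oD)).
  by apply: open_rV_gt0 => //; exists x; exact: box_bump_gt0.
by move=> y /= yb; rewrite exprn_gt0.
Qed.

(** Both sides are homogeneous of degree two, so [w] may be normalized into [S2]. *)
Lemma rayleigh w g : W012 Om w -> weak_gradient Om w g ->
  (lambda1 Om * (int mu (fun x => (w \_ Om) x ^+ 2))%:E <= (dirichlet Om g)%:E)%E.
Proof.
move=> Ww wg; have [J tJ _] := test_function_exists.
set N := int mu _; have N0 : 0 <= N by apply: int_ge0 => x; exact: sqr_ge0.
have D0 : 0 <= dirichlet Om g by exact: dirichlet_ge0.
have [->|Nn] := eqVneq N 0; first by rewrite mule0 lee_fin.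
have Np : 0 < N by rewrite lt_neqAle eq_sym Nn.
pose a := (Num.sqrt N)^-1; have a2 : a ^+ 2 = N^-1 by rewrite exprVn sqr_sqrtr.
have [[w2 _] _] := Ww; have J2 := test_L2 L0 OL tJ; have Jg := weak_gradient_test L0 OL tJ.
(* The multiple a w is presented as a combination with zero times a test function, the form that
   [W012_comb] handles. *)
have Wa := W012_comb oO L0 OL a 0 Ww tJ.
have ga := weak_gradient_comb L0 OL a 0 w2 J2 wg Jg.
have sa : sqint ((fun x => a * w x + 0 * J x) \_ Om) by apply/L2P; exact: Wa.1.1.
have sw : sqint (w \_ Om) by exact/L2P.
have Na : int mu (fun x => ((fun x => a * w x + 0 * J x) \_ Om) x ^+ 2) = 1.
  rewrite -[RHS](mulVf Nn) -a2 -(intZ (a ^+ 2) sw.2); congr (int mu); apply/funext => x.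
  by rewrite ext_comb; ring.
have Sa : S2 Om (fun x => a * w x + 0 * J x) by split => //; rewrite L2normE// Na sqrtr1.
have Ea : energy Om (fun x => a * w x + 0 * J x) = (N^-1 * dirichlet Om g)%:E.
  rewrite (energyE oO L0 OL ga) -a2; congr EFin; rewrite /dirichlet mulr_sumr; apply: eq_bigr => i _.
  have gi : sqint (g i \_ Om) by apply/L2P => //; exact: (wg i).1.
  by rewrite -(intZ (a ^+ 2) gi.2); congr (int mu); apply/funext => x; rewrite ext_comb; ring.
have lE : (lambda1 Om <= (N^-1 * dirichlet Om g)%:E)%E.
  by rewrite -Ea; apply: ereal_inf_lbound; eexists; first exact: Sa.
have -> : (dirichlet Om g)%:E = ((N^-1 * dirichlet Om g)%:E * N%:E)%E.
  by rewrite -EFinM mulrAC mulVf// mul1r.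
by apply: lee_wpmul2r => //; rewrite lee_fin.
Qed.

Lemma lambda1_fin : lambda1 Om \is a fin_num /\ (0 <= lambda1 Om)%E.
Proof.
have l0 : (0 <= lambda1 Om)%E.
  apply: le_ereal_inf_tmp => _ [w [[[w2 [g wg]] _] _] <-].
  by rewrite (energyE oO L0 OL wg) lee_fin dirichlet_ge0.
split => //; rewrite ge0_fin_numE//; have [J tJ J0] := test_function_exists.
have := rayleigh (W012_test oO L0 OL tJ) (weak_gradient_test L0 OL tJ).
rewrite (test_smooth OL tJ).2; move: l0; case: (lambda1 Om) => [l|//|//] _; first by rewrite ltry.
by rewrite gt0_mulye ?lte_fin// leye_eq.
Qed.

(** First variation: u + s J obeys the Rayleigh bound for every s, so the term linear in s vanishes.
    The definition of the weak gradient of [u] then moves the remaining derivative onto [J]. *)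
Lemma euler_lagrange u J (lam : R) : S2 Om u -> energy Om u = lambda1 Om ->
  lambda1 Om = lam%:E -> test_function Om J ->
  lam * int mu (fun x => (u \_ Om) x * J x) =
  - int mu (fun x => (u \_ Om) x * \sum_i partial i (partial i J) x).
Proof.
move=> [Wu Nu] uE lE tJ; have [[u2 [g ug]] _] := Wu.
have J2 := test_L2 L0 OL tJ; have Jg := weak_gradient_test L0 OL tJ.
have [sJ JO] := test_smooth OL tJ.
have su : sqint (u \_ Om) by exact/L2P.
have sqJ psi : smooth_in_cube L psi -> sqint psi.
  by move=> s; have [] := smooth_in_cube_intble L0 s.
have sgi i : sqint (g i \_ Om) by apply/L2P => //; exact: (ug i).1.
have sJi i := sqJ _ (smooth_in_cube_partial i sJ).
have u1 : int mu (fun x => (u \_ Om) x ^+ 2) = 1.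
  move: Nu; rewrite L2normE// => -[] h.
  by rewrite -[LHS]sqr_sqrtr ?h ?expr1n// int_ge0// => x; exact: sqr_ge0.
have dE : dirichlet Om g = lam by move: uE; rewrite lE (energyE oO L0 OL ug) => -[].
set A := int mu _; pose B := \sum_i int mu (fun x => (g i \_ Om) x * partial i J x).
have BE : B = - int mu (fun x => (u \_ Om) x * \sum_i partial i (partial i J) x).
  have sJii i := sqJ _ (smooth_in_cube_partial i (smooth_in_cube_partial i sJ)).
  have -> : (fun x => (u \_ Om) x * \sum_i partial i (partial i J) x) =
      (fun x => \sum_i (u \_ Om) x * partial i (partial i J) x).
    by apply/funext => x; rewrite mulr_sumr.
  rewrite int_sum; last by move=> i; exact: sqint_mul su (sJii i).
  rewrite -sumrN; apply: eq_bigr => i _; have [_ /weak_partialP wu] := ug i.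
  by rewrite wu ?opprK//; exact: test_partial.
rewrite -BE; apply/eqP; rewrite eq_sym -subr_eq0; apply/eqP.
apply: (@quadratic_ge0_linear _ _ (\sum_i int mu (fun x => partial i J x ^+ 2) - lam * int mu (fun x => J x ^+ 2))).
move=> s; have Ws := W012_comb oO L0 OL 1 s Wu tJ.
have gs_ := weak_gradient_comb L0 OL 1 s u2 J2 ug Jg.
have := rayleigh Ws gs_; rewrite lE -EFinM lee_fin ext_comb JO (sqint_comb 1 s su (sqJ _ sJ)).2 u1.
have -> : dirichlet Om (fun i x => 1 * g i x + s * partial i J x) =
   lam + 2 * s * B + s ^+ 2 * \sum_i int mu (fun x => partial i J x ^+ 2).
  rewrite -dE /dirichlet /B !mulr_sumr -!big_split /=; apply: eq_bigr => i _.
  rewrite ext_comb (test_smooth OL (test_partial i tJ)).2 (sqint_comb 1 s (sgi i) (sJi i)).2.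
  by ring.
rewrite -/A; move: (int mu (fun x => J x ^+ 2)) (\sum_i _) => p q; lra.
Qed.

End euler_lagrange.

(** * A positive supersolution built from the first eigenfunction *)

Lemma ae_subset_measure d (T : measurableType d) (R : realType)
    (mu : {measure set T -> \bar R}) (A P : set T) : measurable A -> measurable P ->
  {ae mu, forall x, A x -> P x} -> (mu A <= mu (A `&` P))%E.
Proof.
move=> mA mP H; have mN : measurable (A `\` P) by exact: measurableD.
have N0 : mu (A `\` P) = 0%E.
  apply/eqP; rewrite eq_le measure_ge0 andbT.
  have [N [mN' N0 sub]] := H; rewrite -N0; apply: le_measure; rewrite ?inE//.
  by move=> x [Ax nP]; apply: sub => /= h; exact: nP (h Ax).
have := measureU2 mu (measurableI _ _ mA mP) mN; rewrite setUIDK => /le_trans; apply.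
by rewrite -[leRHS]adde0; apply: leeD => //; rewrite le_eqVlt; apply/orP; left; apply/eqP; exact: N0.
Qed.

Section supersolution.
Context {R : realType} {n : nat}.
Local Notation E := 'rV[R]_n.
Local Notation mu := (@lebesgue_rV R n).

Lemma partial_shift (f : E -> R) i (z : E) :
  partial i (fun y => f (y - z)) = (fun y => partial i f (y - z)).
Proof.
apply/funext => y; rewrite /partial /derive.
have -> : (fun h : R => h^-1 *: (((fun y => f (y - z)) \o shift y) (h *: delta_mx ord0 i) - f (y - z))) =
    (fun h : R => h^-1 *: ((f \o shift (y - z)) (h *: delta_mx ord0 i) - f (y - z))).
  by apply/funext => h /=; congr (_ *: (f _ - _)); rewrite addrA.
by [].
Qed.

Lemma Ex_coord1 i t : 0 < t -> gdom t (fun y : E => y ord0 i) /\ Ex t (fun y : E => y ord0 i) = 0.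
Proof.
move=> t0; have g1 : gdom t (fun y : E => enorm y ^+ 1) by exact: gdom_enorm.
have gi : gdom t (fun y : E => y ord0 i).
  apply: gdom_le g1 => //; first exact: (@measurable_rV_coord R n i).
  by move=> y; rewrite expr1 coord_le_enorm.
split => //; have [gN] := @Ex_coordN R n i id t gi.
have -> : (fun y : E => id (- y ord0 i)) = (fun y : E => (-1) * y ord0 i).
  by apply/funext => y; rewrite mulN1r.
by rewrite (ExZ _ gi) /=; move: (Ex _ _) => e; lra.
Qed.

Local Opaque partial.

Variables (Om : set E) (L : R) (U : E -> R) (lam q : R).
Hypotheses (n0 : (0 < n)%N) (oO : open Om) (L0 : 0 <= L) (OL : Om `<=` cube n L) (Om0 : Om !=set0).
Hypothesis cvxO : forall x y l, 0 < l -> l < 1 -> Om x -> Om y -> Om ((1 - l) *: x + l *: y).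
Hypotheses (q0 : 0 < q) (q1 : q < 1).
Hypotheses (iU : intble mu U) (U0 : forall x, 0 <= U x).
Hypothesis Upos : {ae mu, forall x, Om x -> 0 < U x}.
Hypothesis EL : forall J, test_function Om J ->
  lam * int mu (fun x => U x * J x) = - int mu (fun x => U x * \sum_i partial i (partial i J) x).

Let mU : measurable_fun setT U. Proof. exact: intble_mfun iU. Qed.

(** The mollification [H] of [U] by a bump satisfies - Laplacian H = lam H wherever the bump stays
    in [Om]. The homothety [shr] of ratio q carries all of [Om] there, which costs the factor q^2.
    Expanding under the Gaussian, odd moments vanish, the second moments produce the Laplacian, and
    the third-order remainder is a multiple of h because h >= m > 0 on [Om]. *)
Lemma supersolution : exists (h : E -> R) (m M C : R), [/\ 0 < m, 0 <= C, measurable_fun setT h,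
  (forall x, 0 <= h x <= M) /\ (forall x, Om x -> m <= h x) &
  forall eps x, 0 < eps -> Om x -> conv eps h x <=
    (1 - 2^-1 * (q ^+ 2 * @gvar R n * eps * lam) + C * Num.sqrt eps ^+ 3) * h x].
Proof.
have [x1 [[z0 r] [/= r0 _ bO]]] : exists x : E, exists p : 'rV[rat]_n * rat, [/\ 0 < ratr p.2 :> R,
  open_box (\row_i ratr (p.1 ord0 i)) (fun=> ratr p.2) x &
  closed_box (\row_i ratr (p.1 ord0 i)) (fun=> ratr p.2) `<=` Om].
  by have [x Ox] := Om0; exists x; exact: open_box_cover.
move: (\row_i ratr (z0 ord0 i)) (ratr r) r0 bO => xs rad r0 bO {z0 r x1}.
(* In the choice of [del] below, 2 del / (1 - q) equals the half-width [rad] of a box in [Om] around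
   [xs]: one [del] is for the support of the bump, the other for passing to a closure. *)
have k0 : 0 < 1 - q by rewrite subr_gt0.
pose del := (1 - q) * rad / 2; have del0 : 0 < del by rewrite divr_gt0// mulr_gt0.
(* By convexity, boxes of half-width 2 del around the image of [Om] stay in [Om]: their points are
   convex combinations of x and a point of the box around [xs]. *)
pose shr (x : E) : E := xs + q *: (x - xs).
have shrO (x y : E) : Om x -> (forall i, `|y ord0 i - shr x ord0 i| <= 2 * del) -> Om y.
  move=> Ox yx; pose w : E := xs + (1 - q)^-1 *: (y - shr x).
  have Ow : Om w.
    apply: bO => i; rewrite !mxE addrAC subrr add0r normrM gtr0_norm ?invr_gt0//.
    rewrite ler_pdivrMl//; have := yx i; rewrite !mxE /del; lra.
  have -> : y = (1 - q) *: w + q *: x; last exact: cvxO.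
  rewrite /w scalerDr scalerA mulfV ?gt_eqF// scale1r.
  by apply/rowP => i; rewrite !mxE; ring.
pose J : E -> R := box_bump 1 0 (fun=> del).
have sJ : smooth_in_cube del J.
  split; first exact: box_bump_smooth.
  move=> x /existsNP[i /negP]; rewrite -ltNge => xi.
  by apply: (@box_bump_eq0 _ _ _ _ _ x i); rewrite mxE subr0 ltW.
have JE (z : E) : (fun y : E => J (y - z)) = box_bump 1 z (fun=> del).
  by apply/funext => y; apply: eq_bigr => i _; rewrite !mxE subr0.
have del_ge0 := ltW del0.
have J0 y : 0 <= J y by exact: box_bump_ge0.
have J1 y : J y <= 1 by apply: box_bump_le1.
clearbody J.
have bnd f : smooth_in_cube del f -> forall z : E, intble mu (fun y => U y * f (y - z)).
  move=> sf z; have := smooth_shift_intble del_ge0 (- z) sf iU.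
  by under eq_fun do rewrite mulrC.
pose HH (f : E -> R) (z : E) := int mu (fun y => U y * f (y - z)).
pose H := HH J; pose h x := H (shr x).
have H0 z : 0 <= H z by apply: int_ge0 => y; rewrite mulr_ge0.
have HM z : H z <= int mu U.
  by apply: int_le => //; [exact: bnd|move=> y; rewrite ler_piMr].
have [K K0 HK] := smooth_lipschitz sJ.
have HL z w : `|H z - H w| <= (K * int mu U) * enorm (z - w).
  rewrite /H /HH -(intB (bnd _ sJ z) (bnd _ sJ w)) mulrAC -(intZ (K * enorm (z - w)) iU).
  apply: int_norm_le; [exact: intbleB (bnd _ sJ z) (bnd _ sJ w)|exact: intbleZ|].
  move=> y; rewrite -mulrBr normrM (ger0_norm (U0 y)) mulrC ler_wpM2r//.
  have [+ _] := HK (y - w) (w - z); rewrite addrA subrK => hk.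
  by apply: le_trans hk _; rewrite (enormBC w).
have KU0 : 0 <= K * int mu U by rewrite mulr_ge0// int_ge0.
have cH : continuous H := lipschitz_continuous_rV KU0 HL.
have Hpos z : closed_box z (fun=> del) `<=` Om -> 0 < H z.
  move=> zO; have mP : measurable [set x | 0 < U x].
    have := mU measurableT (measurable_itv `]0, +oo[).
    by rewrite setTI (_ : U @^-1` _ = [set x | 0 < U x])//; apply/seteqP; split => x /=; rewrite in_itv/= andbT.
  have oD : open [set y : E | 0 < J (y - z)].
    rewrite (_ : [set y | _] = (fun y => J (y - z)) @^-1` [set t | 0 < t])//.
    apply: open_comp; last exact: open_gt.
    by move=> y _; rewrite JE; exact: smooth_continuous (box_bump_smooth _ _ _) y.
  have mD := open_measurable_rV oD.
  apply: (int_gt0 (D := [set y : E | 0 < J (y - z)] `&` [set x | 0 < U x])).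
  - exact: bnd.
  - by move=> y; rewrite mulr_ge0.
  - exact: measurableI.
  - apply: (@lt_le_trans _ _ (mu [set y : E | 0 < J (y - z)])).
      apply: open_rV_gt0 => //; exists z; rewrite /= [J _](congr1 (@^~ z) (JE z)).
      by apply: box_bump_gt0 => // i; rewrite subrr normr0.
    apply: le_trans (ae_subset_measure mD mP _) _ => //.
    apply: filterS Upos => x Ux Jx; apply: Ux; apply: zO => i.
    rewrite leNgt; apply/negP => hi; move: Jx => /=.
    by rewrite [J _](congr1 (@^~ x) (JE z)) (@box_bump_eq0 _ _ _ _ _ x i) ?ltxx// ltW.
  - by move=> y [Jy Uy]; rewrite mulr_gt0.
(* Compactness of this closure, on which [H] is positive, provides the lower bound m. *)
pose Z := closure (shr @` Om).
have Zcube : Z `<=` cube n L.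
  rewrite /Z [X in _ `<=` X]((closure_id _).1 (@closed_cube R n L)); apply: closure_subset.
  have Oxs : Om xs by apply: bO => i; rewrite subrr normr0 ltW.
  move=> _ [x Ox <-] i; have := OL Ox i; have := OL Oxs i; rewrite !mxE !ler_norml.
  move: (xs ord0 i) (x ord0 i) => s t /andP[h1 h2] /andP[h3 h4].
  have e1 : 0 <= (1 - q) * (L - s) by rewrite mulr_ge0 ?(ltW k0)// subr_ge0.
  have e2 : 0 <= q * (L - t) by rewrite mulr_ge0 ?(ltW q0)// subr_ge0.
  have e3 : 0 <= (1 - q) * (s + L) by rewrite mulr_ge0 ?(ltW k0)//; lra.
  have e4 : 0 <= q * (t + L) by rewrite mulr_ge0 ?(ltW q0)//; lra.
  by apply/andP; split; lra.
have cZ : compact Z by apply: subclosed_compact Zcube; [exact: closed_closure|exact: compact_cube].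
have ZO z : Z z -> closed_box z (fun=> del) `<=` Om.
  move=> Zz y yz; have [_ [[x Ox <-] [_ zx]]] := Zz _ (nbhsx_ballx z del del0).
  apply: (shrO x) => // i; have := zx ord0 i; rewrite /ball/= => hx.
  have -> : y ord0 i - shr x ord0 i = (y ord0 i - z ord0 i) + (z ord0 i - shr x ord0 i) by ring.
  by apply: le_trans (ler_normD _ _) _; have := yz i; move: hx => /ltW; lra.
have Zshr x : Om x -> Z (shr x) by move=> Ox; apply: subset_closure; exists x.
have [zm Zzm Hzm] : exists2 c, c \in Z & forall t, t \in Z -> H c <= H t.
  apply: EVT_min_rV => //; first by have [x Ox] := Om0; exists (shr x); exact: Zshr.
  exact: continuous_subspaceT.
have m0 : 0 < H zm by apply: Hpos; apply: ZO; rewrite inE in Zzm.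
have hm x : Om x -> H zm <= h x by move=> Ox; apply: Hzm; rewrite inE; exact: Zshr.
have [M M0 HT] := smooth_taylor3 sJ.
pose g3 := @gmom R n 1 3; have g30 : 0 <= g3 by apply: Ex_ge0 => // y; rewrite exprn_ge0// enorm_ge0.
have mh : measurable_fun setT h.
  apply: continuous_measurable_rV; apply: (lipschitz_continuous_rV (L := K * int mu U * q)).
    by rewrite mulr_ge0// ltW.
  move=> x y; apply: le_trans (HL _ _) _; rewrite -(mulrA (K * int mu U)).
  apply: ler_wpM2l => //; rewrite le_eqVlt; apply/orP; left; apply/eqP.
  have -> : shr x - shr y = q *: (x - y) by apply/rowP => i; rewrite !mxE; ring.
  by rewrite enormZ gtr0_norm.
have sJi i := smooth_in_cube_partial i sJ.
have sJij i j := smooth_in_cube_partial j (sJi i).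
(* The first-order term is negative because moving z by eta moves the argument of [J] by - eta. *)
have TH z eta : H (z + eta) <= H z - \sum_i eta ord0 i * HH (partial i J) z +
    2^-1 * \sum_i eta ord0 i * \sum_j eta ord0 j * HH (partial j (partial i J)) z + M * int mu U * enorm eta ^+ 3.
  have i1 i := intbleZ (eta ord0 i) (bnd _ (sJi i) z).
  have i2 i j := intbleZ (eta ord0 j) (bnd _ (sJij i j) z).
  have i2s i : intble mu (fun y => eta ord0 i * \sum_j eta ord0 j * (U y * partial j (partial i J) (y - z))).
    by apply: intbleZ; apply: intble_sum => j; exact: i2.
  have I0 := bnd _ sJ z.
  have I1 : intble mu (fun y => \sum_i eta ord0 i * (U y * partial i J (y - z))) by exact: intble_sum.
  have I2 : intble mu (fun y => \sum_i eta ord0 i * \sum_j eta ord0 j * (U y * partial j (partial i J) (y - z))).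
    exact: intble_sum.
  have I3 := intbleZ (M * enorm eta ^+ 3) iU.
  have e1 : int mu (fun y => \sum_i eta ord0 i * (U y * partial i J (y - z))) =
      \sum_i eta ord0 i * HH (partial i J) z.
    rewrite int_sum//; apply: eq_bigr => i _; apply: intZ; exact: bnd.
  have e2 : int mu (fun y => \sum_i eta ord0 i * \sum_j eta ord0 j * (U y * partial j (partial i J) (y - z))) =
      \sum_i eta ord0 i * \sum_j eta ord0 j * HH (partial j (partial i J)) z.
    rewrite int_sum//; apply: eq_bigr => i _.
    apply: etrans (intZ _ _) _; first by apply: intble_sum => j; exact: i2.
    congr (_ * _); apply: etrans (int_sum _ _) _; first by move=> j; exact: i2.
    by apply: eq_bigr => j _; apply: intZ; exact: bnd.
  have e3 : int mu (fun y => M * enorm eta ^+ 3 * U y) = M * int mu U * enorm eta ^+ 3.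
    by rewrite intZ//; ring.
  suff main : H (z + eta) <= H z - int mu (fun y => \sum_i eta ord0 i * (U y * partial i J (y - z))) +
      2^-1 * int mu (fun y => \sum_i eta ord0 i * \sum_j eta ord0 j * (U y * partial j (partial i J) (y - z))) +
      int mu (fun y => M * enorm eta ^+ 3 * U y).
    apply: le_trans main _; rewrite le_eqVlt; apply/orP; left; apply/eqP.
    by congr (_ - _ + 2^-1 * _ + _).
  rewrite /H /HH -(intB I0 I1) -(intZ 2^-1 I2) -intD; [|exact: intbleB|exact: intbleZ].
  rewrite -intD//; last by apply: intbleD; [exact: intbleB|exact: intbleZ].
  apply: int_le; [exact: bnd|by apply: intbleD => //; apply: intbleD; [exact: intbleB|exact: intbleZ]|].
  move=> y; have := HT (y - z) (- eta); rewrite enormN ler_norml => /andP[_].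
  have -> : y - z - eta = y - (z + eta) by rewrite opprD addrA.
  have -> : \sum_i (- eta) ord0 i * partial i J (y - z) = - \sum_i eta ord0 i * partial i J (y - z).
    by rewrite -sumrN; apply: eq_bigr => i _; rewrite [(- eta) _ _]mxE mulNr.
  have -> : \sum_i (- eta) ord0 i * (\sum_j (- eta) ord0 j * partial j (partial i J) (y - z)) =
      \sum_i eta ord0 i * (\sum_j eta ord0 j * partial j (partial i J) (y - z)).
    apply: eq_bigr => i _; rewrite [(- eta) _ _]mxE mulNr -mulrN -sumrN; congr (_ * _).
    by apply: eq_bigr => j _; rewrite [(- eta) _ _]mxE mulNr opprK.
  have -> : \sum_i eta ord0 i * (U y * partial i J (y - z)) = U y * \sum_i eta ord0 i * partial i J (y - z).
    by rewrite mulr_sumr; apply: eq_bigr => i _; rewrite mulrCA.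
  have -> : \sum_i eta ord0 i * (\sum_j eta ord0 j * (U y * partial j (partial i J) (y - z))) =
      U y * \sum_i eta ord0 i * (\sum_j eta ord0 j * partial j (partial i J) (y - z)).
    rewrite mulr_sumr; apply: eq_bigr => i _; rewrite mulrCA; congr (_ * _).
    by rewrite mulr_sumr; apply: eq_bigr => j _; rewrite mulrCA.
  move: (J (y - (z + eta))) (J (y - z)) (\sum_i _) (\sum_i _) (enorm eta ^+ 3) => a b s2 s1 e Hy.
  rewrite -subr_ge0.
  have -> : U y * b - U y * s1 + 2^-1 * (U y * s2) + M * e * U y - U y * a =
      U y * (M * e - (a - b - - s1 - 2^-1 * s2)) by ring.
  by rewrite mulr_ge0// subr_ge0.
exists h, (H zm), (int mu U), (M * int mu U * g3 / H zm); split => //.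
- by rewrite divr_ge0 ?mulr_ge0 ?(ltW m0)// int_ge0.
- by split => [x|//]; rewrite H0 HM.
move=> eps x e0 Ox; set z := shr x; have zO := ZO _ (Zshr _ Ox).
have hb y : `|h y| <= int mu U by rewrite ger0_norm ?H0// HM.
rewrite (convE (intble_convb x e0 mh hb)).2.
have gh : gdom eps (fun y : E => h (x + y)) by exact: gdom_shift mh hb.
have hE y : h (x + y) = H (z + q *: y).
  by rewrite /h; congr H; apply/rowP => i; rewrite !mxE; ring.
pose a1 i := - q * HH (partial i J) z; pose a2 i j := 2^-1 * q ^+ 2 * HH (partial j (partial i J)) z.
have gi i := (Ex_coord1 i e0).1.
have gij i j := (@Ex_coord2 R n n0 eps i j e0).1.
have gg3 : gdom eps (fun y : E => enorm y ^+ 3) by exact: gdom_enorm.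
have gS (F : 'I_n -> E -> R) : (forall i, gdom eps (F i)) -> gdom eps (fun y => \sum_i F i y).
  move=> GF; rewrite /gdom (_ : (fun _ => _) = (fun y : E => \sum_i gaussp eps y * F i y)).
    by apply: intble_sum => i; exact: GF.
  by apply/funext => y; rewrite mulr_sumr.
have G1 : gdom eps (fun y : E => \sum_i a1 i * y ord0 i) by apply: (gS _) => i; exact: gdomZ.
have G2 : gdom eps (fun y : E => \sum_i \sum_j a2 i j * (y ord0 i * y ord0 j)).
  by apply: (gS _) => i; apply: (gS _) => j; exact: gdomZ.
have G0 := gdomZ (H z) (@gdom1 R n eps e0).
pose c3 := M * int mu U * q ^+ 3; have G3 := gdomZ c3 gg3.
have E1 : Ex eps (fun y : E => \sum_i a1 i * y ord0 i) = 0.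
  rewrite Ex_sum; last by move=> i; exact: gdomZ.
  by rewrite big1// => i _; rewrite (ExZ _ (gi i)) (Ex_coord1 i e0).2 mulr0.
(* The diagonal second moments give the Laplacian of [H] at z; the Euler-Lagrange equation tested
   with the bump centred at z identifies it with - lam H z. *)
have E2 : Ex eps (fun y : E => \sum_i \sum_j a2 i j * (y ord0 i * y ord0 j)) =
    - (2^-1 * (q ^+ 2 * @gvar R n * eps * lam)) * H z.
  have tJ : test_function Om (fun y => J (y - z)) by rewrite JE; exact: box_bump_test OL zO.
  have := EL tJ; rewrite -/(HH J z) -/H => EH.
  have -> : - (2^-1 * (q ^+ 2 * @gvar R n * eps * lam)) * H z = 2^-1 * q ^+ 2 * @gvar R n * eps * (- (lam * H z)) by ring.
  rewrite EH opprK.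
  have -> : int mu (fun y => U y * \sum_i partial i (partial i (fun y => J (y - z))) y) =
      \sum_i HH (partial i (partial i J)) z.
    have -> : (fun y => U y * \sum_i partial i (partial i (fun y => J (y - z))) y) =
        (fun y => \sum_i U y * partial i (partial i J) (y - z)).
      by apply/funext => y; rewrite mulr_sumr; apply: eq_bigr => i _; rewrite !partial_shift.
    by rewrite int_sum// => i; exact: bnd.
  rewrite Ex_sum; last by move=> i; apply: (gS _) => j; exact: gdomZ.
  rewrite mulr_sumr; apply: eq_bigr => i _; rewrite Ex_sum; last by move=> j; exact: gdomZ.
  rewrite (bigD1 i)//= big1 ?addr0; last first.
    by move=> j ji; rewrite (ExZ _ (gij i j)) (@Ex_coord2 R n n0 eps i j e0).2 eq_sym (negbTE ji) !mulr0.
  rewrite (ExZ _ (gij i i)) (@Ex_coord2 R n n0 eps i i e0).2 eqxx mulr1n /a2.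
  by move: (HH _ _) => u; ring.
have E3 : Ex eps (fun y : E => enorm y ^+ 3) = Num.sqrt eps ^+ 3 * g3 by exact: Ex_enorm.
apply: (@le_trans _ _ (Ex eps (fun y : E => H z * 1 + \sum_i a1 i * y ord0 i +
    \sum_i \sum_j a2 i j * (y ord0 i * y ord0 j) + c3 * enorm y ^+ 3))).
  apply: Ex_le => //; first exact: gdomD (gdomD (gdomD G0 G1) G2) G3.
  move=> y; rewrite hE; apply: le_trans (TH z (q *: y)) _.
  rewrite le_eqVlt; apply/orP; left; apply/eqP; rewrite mulr1; congr (_ + _ + _ + _).
  - by rewrite -sumrN; apply: eq_bigr => i _; rewrite [(q *: y) _ _]mxE /a1; ring.
  - rewrite mulr_sumr; apply: eq_bigr => i _; rewrite !mulr_sumr; apply: eq_bigr => j _.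
    by rewrite ![(q *: y) _ _]mxE /a2; move: (HH _ _) => u; ring.
  - by rewrite enormZ (gtr0_norm q0) exprMn /c3 mulrA.
rewrite (ExD (gdomD (gdomD G0 G1) G2) G3) (ExD (gdomD G0 G1) G2) (ExD G0 G1) (ExZ _ (@gdom1 R n eps e0)) (ExZ _ gg3).
rewrite Ex1// E1 E2 E3 mulr1 addr0 /h -/z.
have hz : H zm <= H z := hm _ Ox.
have s30 : 0 <= Num.sqrt eps ^+ 3 by rewrite exprn_ge0// sqrtr_ge0.
have c3M : c3 <= M * int mu U.
  by rewrite /c3 ler_piMr ?mulr_ge0 ?int_ge0// exprn_ile1// ltW.
have iU0 : 0 <= int mu U by exact: int_ge0.
move: (Num.sqrt eps ^+ 3) (int mu U) (2^-1 * _) (H z) (H zm) m0 hz s30 c3M iU0 => s I p Hz hzm m0 hz s30 c3M iU0.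
have : c3 * (s * g3) <= M * I * g3 / hzm * s * Hz.
  apply: (@le_trans _ _ (M * I * (s * g3))); first by rewrite ler_wpM2r// mulr_ge0.
  have -> : M * I * (s * g3) = M * I * g3 * s by ring.
  have -> : M * I * g3 / hzm * s * Hz = M * I * g3 * s * (Hz / hzm) by ring.
  by rewrite ler_peMr ?mulr_ge0// ler_pdivlMr// mul1r.
move: (c3 * _) (M * I * g3 / hzm * s) => u v; lra.
Qed.

End supersolution.

(** * The killed heat operator and its quotients *)

Lemma geometric_lt (R : realType) (K kappa q : R) : 0 <= K -> 0 < kappa -> 0 <= q -> q < kappa ->
  exists k, forall N, (k <= N)%N -> K * q ^+ N < kappa ^+ N.+1.
Proof.
move=> K0 k0 q0 qk.
have z1 : `|q / kappa| < 1 by rewrite ger0_norm ?divr_ge0 ?(ltW k0)// ltr_pdivrMr// mul1r.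
have e0 : 0 < kappa / (K + 1) by rewrite divr_gt0// ltr_wpDl.
have /cvgr0_norm_lt /(_ _ e0) [k _ Hk] := cvg_expr z1.
exists k => N kN; have := Hk N kN; rewrite /= ger0_norm ?exprn_ge0 ?divr_ge0 ?(ltW k0)//.
rewrite exprMn exprVn ltr_pdivrMr ?exprn_gt0// mulrAC -exprS ltr_pdivlMr ?ltr_wpDl//.
by apply: le_lt_trans; rewrite mulrC ler_wpM2l ?exprn_ge0// lerDl.
Qed.

Lemma norm_le_half_sqr (R : realFieldType) (u : R) : `|u| <= 2^-1 * (u ^+ 2 + 1).
Proof. by rewrite -real_normK ?num_real//; have := sqr_ge0 (`|u| - 1); rewrite sqrrB expr1n; lra. Qed.

Lemma logconcaveM (R : realType) (n : nat) (f g : 'rV[R]_n -> R) : (forall x, 0 <= f x) ->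
  (forall x, 0 <= g x) -> logconcave f -> logconcave g -> logconcave (fun x => f x * g x).
Proof.
move=> f0 g0 lf lg x y l l0 l1; rewrite (powRM _ (f0 x) (g0 x)) (powRM _ (f0 y) (g0 y)) mulrACA.
by apply: ler_pM; rewrite ?mulr_ge0 ?powR_ge0//; [exact: lf|exact: lg].
Qed.

Lemma abs_le_of_diff (R : realDomainType) (u v s t K : R) :
  u - v <= s -> v - u <= t -> s <= K -> t <= K -> `|u| <= `|v| + K.
Proof.
move=> h1 h2 h3 h4; have h5 := ler_norm v; have h6 := ler_norm (- v); rewrite normrN in h6.
by rewrite ler_norml; apply/andP; split; lra.
Qed.

Lemma quotient_arith (R : realFieldType) (G Z : R) (u v p q I J r : R) : 0 <= r -> forall c0, 0 < c0 ->
  `|u - v| <= G * I * r -> `|q - p| <= G * J * r -> `|v| <= Z * I -> c0 <= p -> c0 <= q ->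
  0 <= I -> 0 <= J ->
  u / p - v / q <= (G / c0 + Z * G * J / c0 ^+ 2) * I * r.
Proof.
move=> r0 c c0 uv qp vI cp cq I0 J0; have p0 : 0 < p by apply: lt_le_trans cp.
have q0 : 0 < q by apply: lt_le_trans cq.
have -> : u / p - v / q = (u - v) / p + v * (q - p) / (p * q) by field; rewrite !gt_eqF.
have -> : (G / c + Z * G * J / c ^+ 2) * I * r = G * I * r / c + (Z * I) * (G * J * r) / (c * c).
  by field; rewrite gt_eqF.
apply: lerD.
  apply: (@le_trans _ _ (`|u - v| / p)); first by rewrite ler_pM2r ?invr_gt0// ler_norm.
  apply: ler_pM => //; first by rewrite invr_ge0 ltW.
  by rewrite lef_pV2 ?posrE.
apply: (@le_trans _ _ (`|v * (q - p)| / (p * q))).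
  by rewrite ler_pM2r ?invr_gt0 ?mulr_gt0// ler_norm.
apply: ler_pM => //; first by rewrite invr_ge0 mulr_ge0 ?(ltW p0) ?(ltW q0).
  by rewrite normrM; apply: ler_pM.
by rewrite lef_pV2 ?posrE ?mulr_gt0//; apply: ler_pM => //; exact: ltW.
Qed.

Section killed_heat.
Context {R : realType} {n : nat}.
Local Notation E := 'rV[R]_n.
Local Notation mu := (@lebesgue_rV R n).
Variables (Om : set E) (L d eps : R).
Hypotheses (oO : open Om) (L0 : 0 <= L) (OL : Om `<=` cube n L) (Om0 : Om !=set0).
Hypothesis cvxO : forall x y l, 0 < l -> l < 1 -> Om x -> Om y -> Om ((1 - l) *: x + l *: y).
Hypotheses (Od : forall x y, Om x -> Om y -> enorm (x - y) <= d) (e0 : 0 < eps).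

Let mO : measurable Om. Proof. exact: open_measurable_rV oO. Qed.

(** One heat step with killing outside [Om] at its end; the iterates stand in for the Dirichlet heat
    semigroup. *)
Definition killed_conv (f : E -> R) : E -> R := fun x => (\1_Om x : R) * conv eps f x.

Local Notation T := killed_conv.
Local Notation f1 := (\1_Om : E -> R).

Let mI : measurable_fun setT f1. Proof. exact: measurable_indic. Qed.

Let I1 x : `|f1 x| <= 1. Proof. by rewrite indicE normr_nat lern1 leq_b1. Qed.

Let i1 : intble mu f1. Proof. exact: (intble_indic_domain oO L0 OL). Qed.

Lemma killed_in f x : Om x -> T f x = conv eps f x.
Proof. by move=> Ox; rewrite /killed_conv indicE mem_set// mul1r. Qed.

Lemma killed_out f x : ~ Om x -> T f x = 0.
Proof. by move=> Ox; rewrite /killed_conv indicE memNset// mul0r. Qed.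

Lemma killed_intble f : intble mu f -> intble mu (T f) /\ int mu (fun x => `|T f x|) <= int mu (fun x => `|f x|).
Proof.
move=> fi; have ic := intble_convT e0 fi; have iT := intble_mulb mI I1 ic.
split => //; have ica := intble_convT e0 (intble_norm fi).
apply: (@le_trans _ _ (int mu (conv eps (fun x => `|f x|)))); last first.
  by rewrite int_conv//; exact: intble_norm.
apply: int_le; [exact: intble_norm|exact: ica|move=> x].
rewrite normrM; apply: (@le_trans _ _ `|conv eps f x|); first by rewrite ler_piMl.
rewrite !convdefE; apply: int_norm_le; [exact: intble_conv|exact: intble_conv (intble_norm fi)|].
by move=> y; rewrite normrM gaussp_norm.
Qed.

Lemma killed_bounded f x : intble mu f ->
  `|T f x| <= (@gsZ R n eps)^-1 * int mu (fun y => `|f y|).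
Proof.
move=> fi; rewrite normrM; apply: (@le_trans _ _ `|conv eps f x|); first by rewrite ler_piMl.
exact: conv_norm_le.
Qed.

Lemma iter_killed_intble N f : intble mu f -> intble mu (iter N T f) /\
  int mu (fun x => `|iter N T f x|) <= int mu (fun x => `|f x|).
Proof.
move=> fi; elim: N => [//|N [ih1 ih2]]; have [h1 h2] := killed_intble ih1.
by split => //; exact: le_trans h2 ih2.
Qed.

Lemma iter_killed_out N f x : (forall x, ~ Om x -> f x = 0) -> ~ Om x -> iter N T f x = 0.
Proof. by case: N => [|N] fO Ox; [exact: fO|exact: killed_out]. Qed.

Lemma iter_killed_bounded N f x : intble mu f ->
  `|iter N.+1 T f x| <= (@gsZ R n eps)^-1 * int mu (fun y => `|f y|).
Proof.
move=> fi; have [h1 h2] := iter_killed_intble N fi.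
apply: le_trans (killed_bounded x h1) _; rewrite ler_wpM2l// invr_ge0 ltW// gsZ_gt0//.
Qed.

Lemma killed_comb (a b : R) f g : intble mu f -> intble mu g ->
  T (fun x => a * f x + b * g x) = (fun x => a * T f x + b * T g x).
Proof.
move=> fi gi; apply/funext => x; rewrite /killed_conv.
have -> : conv eps (fun x => a * f x + b * g x) x = a * conv eps f x + b * conv eps g x.
  rewrite !convdefE -(intZ a (intble_conv x e0 fi)) -(intZ b (intble_conv x e0 gi)) -intD.
  - by congr (int mu); apply/funext => y; ring.
  - by apply: intbleZ; exact: intble_conv.
  - by apply: intbleZ; exact: intble_conv.
by ring.
Qed.

Lemma iter_killed_comb N (a b : R) f g : intble mu f -> intble mu g ->
  iter N T (fun x => a * f x + b * g x) = (fun x => a * iter N T f x + b * iter N T g x).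
Proof.
move=> fi gi; elim: N => [//|N ih]; rewrite iterS ih.
by rewrite (killed_comb a b (iter_killed_intble N fi).1 (iter_killed_intble N gi).1).
Qed.

Lemma killed_sym (a b : E -> R) (C : R) : intble mu a -> (forall x : E, ~ Om x -> a x = 0) ->
  measurable_fun setT b -> (forall x : E, `|b x| <= C) -> (forall x : E, ~ Om x -> b x = 0) ->
  int mu (fun x => a x * T b x) = int mu (fun x => T a x * b x).
Proof.
move=> ia aO mb bC bO; have [_ _ _ E1] := conv_sym e0 ia mb bC.
have -> : (fun x => a x * T b x) = (fun y => a y * conv eps b y).
  apply/funext => x; have [Ox|Ox] := pselect (Om x); first by rewrite killed_in.
  by rewrite aO// !mul0r.
rewrite -E1; congr (int mu); apply/funext => x; have [Ox|Ox] := pselect (Om x).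
  by rewrite killed_in// mulrC.
by rewrite bO// mulr0 mul0r.
Qed.

(** Let m(j) = <f, T^j f>. Symmetry gives m(2 j) = |T^j f|^2, and Cauchy-Schwarz with |f| = 1 gives
    m(j)^2 <= m(2 j); repeated doubling yields the powers of 2. *)
Lemma killed_form_lower f kappa : sqint f -> (forall x, ~ Om x -> f x = 0) ->
  int mu (fun x => f x ^+ 2) = 1 -> 0 <= kappa -> kappa <= int mu (fun x => f x * conv eps f x) ->
  forall k, kappa ^+ (2 ^ k) <= int mu (fun x => f x * iter (2 ^ k) T f x).
Proof.
move=> sf fO f21 k0 kf; have fi := sqint_supp oO L0 OL sf fO.
pose g j := iter j T f; pose m j := int mu (fun x => f x * g j x).
have gi j : intble mu (g j) by exact: (iter_killed_intble j fi).1.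
have gO j x : ~ Om x -> g j x = 0 by exact: iter_killed_out.
have gb j x := iter_killed_bounded j x fi.
have sg j : sqint (g j).
  case: j => [//|j]; split; first exact: intble_mfun (gi _).
  have := intble_mulb (intble_mfun (gi j.+1)) (gb j) (gi j.+1).
  by under eq_fun do rewrite -expr2.
have shift j i : (i < j)%N -> int mu (fun x => g i x * g (j.*2 - i)%N x) =
    int mu (fun x => g i.+1 x * g (j.*2 - i.+1)%N x).
  move=> ij; have -> : (j.*2 - i)%N = (j.*2 - i.+1).+1 by lia.
  have [k jk] : exists k, (j.*2 - i.+1)%N = k.+1 by exists (j.*2 - i.+2)%N; lia.
  rewrite jk; apply: killed_sym (gi i) (gO i) (intble_mfun (gi k.+1)) (gb k) (gO k.+1).
have sq j i : (i <= j)%N -> m j.*2 = int mu (fun x => g i x * g (j.*2 - i)%N x).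
  elim: i => [|i ih] ij; first by rewrite subn0.
  by rewrite (ih (ltnW ij)) shift.
have mm j : m j ^+ 2 <= m j.*2.
  rewrite (sq j j (leqnn _)) (_ : j.*2 - j = j)%N; last by lia.
  have := sqint_cs sf (sg j); rewrite f21 mul1r => /le_trans; apply.
  by rewrite le_eqVlt; apply/orP; left; apply/eqP; congr (int mu); apply/funext => x; rewrite expr2.
have m1 : kappa <= m 1%N.
  apply: le_trans kf _; rewrite le_eqVlt; apply/orP; left; apply/eqP; congr (int mu).
  apply/funext => x; have [Ox|Ox] := pselect (Om x); first by rewrite /g /= killed_in.
  by rewrite fO// !mul0r.
elim=> [|k ih]; first by rewrite expn0 expr1; exact: m1.
have e2k : (2 ^ k.+1 = (2 ^ k).*2)%N by rewrite expnS mul2n.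
rewrite e2k; apply: le_trans (mm _); rewrite -muln2 exprM.
by rewrite lerXn2r ?nnegrE ?exprn_ge0//; apply: le_trans ih; rewrite exprn_ge0.
Qed.

Let lcI : logconcave f1.
Proof.
move=> x y l l0 l1; have k0 : 0 < 1 - l by rewrite subr_gt0.
rewrite !indicE; have [Ox|Ox] := pselect (Om x); last first.
  by rewrite memNset// powR0 ?gt_eqF// mul0r.
have [Oy|Oy] := pselect (Om y); last first.
  by rewrite [y \in _]memNset// powR0 ?gt_eqF// mulr0.
by rewrite !mem_set ?powR1 ?mulr1//; exact: cvxO.
Qed.

Local Notation fN N := (iter N T f1).

(** Log-concavity survives Gaussian convolution and multiplication by the indicator of a convex
    set. *)
Lemma fN_cubed N : cubed 1 L (fN N) /\ logconcave (fN N).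
Proof.
have fO N' x : ~ Om x -> fN N' x = 0.
  by apply: iter_killed_out => y Oy; rewrite indicE memNset.
elim: N => [|N [[ih1 ih2 ih3 ih4] ih5]].
  split; last exact: lcI.
  split; [exact: mI|by move=> x; rewrite /= indicE|by move=> x; rewrite /= indicE lern1 leq_b1|].
  by move=> x xL; rewrite /= indicE memNset// => /OL.
have ii := cubed_intble ler01 L0 (And4 ih1 ih2 ih3 ih4).
have c0 x : 0 <= conv eps (fN N) x by exact: conv_ge0.
split; first split.
- exact: intble_mfun (killed_intble ii).1.
- by move=> x; rewrite iterS /killed_conv mulr_ge0// indicE.
- move=> x; apply: le_trans (ler_norm _) _; rewrite iterS normrM -[leRHS]mulr1; apply: ler_pM => //.
  by apply: conv_normb_le => // y; rewrite ger0_norm.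
- by move=> x xL; apply: (fO N.+1) => /OL.
have lc := conv_logconcave e0 ler01 L0 (And4 ih1 ih2 ih3 ih4) ih5.
by apply: logconcaveM lc => // x; rewrite indicE.
Qed.

Let fN_intble N : intble mu (fN N).
Proof. exact: (iter_killed_intble N i1).1. Qed.

Let fN_ge0 N x : 0 <= fN N x. Proof. by have [[]] := fN_cubed N. Qed.

Let fN_out N x : ~ Om x -> fN N x = 0.
Proof. by apply: iter_killed_out => y Oy; rewrite indicE memNset. Qed.

Let muO : (0 < mu Om)%E. Proof. exact: open_rV_gt0. Qed.

Lemma fN_gt0 N x : Om x -> 0 < fN N x.
Proof.
elim: N x => [|N ih] x Ox; first by rewrite /= indicE mem_set.
by rewrite iterS killed_in//; apply: (conv_pos (fN_intble N) (fN_ge0 N) mO muO).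
Qed.

(** Comparison principle: convolution preserves the inequality with a multiple of h, each step on
    [Om] costs a factor [fac], and outside [Om] the left side is 0. *)
Lemma fN_upper (h : E -> R) (m M fac : R) : 0 < m -> 0 <= fac -> measurable_fun setT h ->
  (forall x, 0 <= h x <= M) -> (forall x, Om x -> m <= h x) ->
  (forall x, Om x -> conv eps h x <= fac * h x) ->
  forall N x, fN N x <= fac ^+ N / m * h x.
Proof.
move=> m0 fac0 mh hM hm hT; have hb y : `|h y| <= M by have /andP[h0] := hM y; rewrite ger0_norm.
elim=> [|N ih] x; (have [Ox|Ox] := pselect (Om x); last first);
  try by rewrite fN_out// mulr_ge0 ?divr_ge0 ?exprn_ge0 ?(ltW m0)//; have /andP[] := hM x.
  by rewrite /= indicE mem_set// expr0 div1r mulrC ler_pdivlMr// mul1r hm.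
rewrite iterS killed_in//.
apply: (@le_trans _ _ (fac ^+ N / m * conv eps h x)); last first.
  have -> : fac ^+ N.+1 / m * h x = fac ^+ N / m * (fac * h x) by rewrite exprSr; ring.
  by rewrite ler_wpM2l ?divr_ge0 ?exprn_ge0 ?(ltW m0)//; exact: hT.
have ih' := intble_convb x e0 mh hb.
rewrite !convdefE -(intZ (fac ^+ N / m) ih'); apply: int_le; [exact: intble_conv|exact: intbleZ|].
by move=> y; rewrite mulrCA ler_wpM2l// gaussp_ge0.
Qed.

(** Uniform lower bound on [Om] for the average of the indicator: between points of [Om] the kernel
    is at least its value at distance d. *)
Let c0 := expR (- (d ^+ 2 / (2 * eps))) / (@gsZ R n eps) * int mu f1.

Let c0_gt0 : 0 < c0.
Proof.
rewrite /c0 mulr_gt0// ?divr_gt0 ?expR_gt0 ?gsZ_gt0//.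
by apply: (int_gt0 i1 _ mO muO) => x; rewrite indicE// => Ox; rewrite mem_set.
Qed.

Let f1_lower x : Om x -> c0 <= conv eps f1 x.
Proof.
move=> Ox; rewrite /c0 -(intZ _ i1) convdefE; apply: int_le; [exact: intbleZ|exact: intble_conv|].
move=> y; have [Oy|Oy] := pselect (Om y); last by rewrite indicE memNset// !mulr0.
apply: ler_wpM2r; first by rewrite indicE.
rewrite gausspE ler_pM2r ?invr_gt0 ?gsZ_gt0// ler_expR lerN2 ler_pM2r ?invr_gt0 ?mulr_gt0//.
rewrite -sqr_enorm lerXn2r ?nnegrE ?enorm_ge0//; first exact: le_trans (enorm_ge0 _) (Od Ox Oy).
exact: Od.
Qed.

Variables (i0 : 'I_n) (r0 a : R).
Hypotheses (r0_gt0 : 0 < r0) (aE : a = pi / (2 * r0)) (d0 : 0 <= d) (dr : d < r0).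

Let a0 : 0 < a. Proof. by rewrite aE divr_gt0 ?pi_gt0// mulr_gt0. Qed.

Let cosad : 0 < cos (a * d).
Proof.
have adp : a * d < pi / 2.
  have -> : pi / 2 = a * r0 by rewrite aE; field; rewrite gt_eqF.
  by rewrite ltr_pM2l.
apply: cos_gt0_pihalf; rewrite adp andbT.
by apply: (@lt_le_trans _ _ 0); [have := @pi_gt0 R; lra|rewrite mulr_ge0// ltW].
Qed.

(** One convolution makes the quotient Lipschitz, with constant proportional to the L^1 norm of f;
    at distances up to d < r0 the sine modulus dominates a multiple of the distance. *)
Lemma quotient_initial : exists2 A, 0 <= A & forall f, intble mu f ->
  forall x y, Om x -> Om y -> T f x / fN 1 x - T f y / fN 1 y <=
    A * int mu (fun y => `|f y|) * sine_modulus r0 (enorm (x - y)).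
Proof.
have [G G0 HG] := @conv_lipschitz R n eps e0.
pose Z := (@gsZ R n eps)^-1; have Z0 : 0 <= Z by rewrite invr_ge0 ltW// gsZ_gt0.
have J0 : 0 <= int mu (fun z => `|f1 z|) by exact: int_ge0.
pose K := G / c0 + Z * G * int mu (fun z => `|f1 z|) / c0 ^+ 2.
have K0 : 0 <= K.
  exact: addr_ge0 (divr_ge0 G0 (ltW c0_gt0)) (divr_ge0 (mulr_ge0 (mulr_ge0 Z0 G0) J0) (exprn_ge0 2 (ltW c0_gt0))).
exists (K / (cos (a * d) * a)).
  by rewrite divr_ge0// mulr_ge0 ?(ltW a0) ?(ltW cosad).
move=> f fi x y Ox Oy; rewrite /= !killed_in//.
have I0 : 0 <= int mu (fun z => `|f z|) by exact: int_ge0.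
have h1 := HG f fi x y; have h2 := HG f1 i1 y x; rewrite (enormBC y) in h2.
have h3 := conv_norm_le y e0 fi; have h4 := f1_lower Ox; have h5 := f1_lower Oy.
have r_ge0 := enorm_ge0 (x - y); have rd := Od Ox Oy.
have lin : cos (a * d) * (a * enorm (x - y)) <= sine_modulus r0 (enorm (x - y)).
  rewrite sine_modulusE; last by rewrite ger0_norm// (le_trans rd)// ltW.
  rewrite -aE; apply: sin_ge_linear; rewrite ?mulr_ge0 ?(ltW a0)//; first by rewrite ler_pM2l.
  have -> : pi = a * r0 + a * r0 :> R by rewrite aE; field; rewrite gt_eqF.
  by apply: (@le_trans _ _ (a * r0)); [rewrite ler_pM2l// ltW|rewrite lerDl mulr_ge0// ltW].
apply: (@le_trans _ _ (K * int mu (fun z => `|f z|) * enorm (x - y))); last first.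
  have -> : K * int mu (fun z => `|f z|) * enorm (x - y) =
     K / (cos (a * d) * a) * int mu (fun z => `|f z|) * (cos (a * d) * (a * enorm (x - y))).
    by move: (int _ _) (cos _) cosad (K : R) => u v v0 k; field; rewrite !gt_eqF.
  by rewrite ler_wpM2l// mulr_ge0// divr_ge0// mulr_ge0 ?(ltW a0) ?(ltW cosad).
rewrite /K; move: h1 h2 h3 h4 h5 I0 J0; rewrite -/Z.
move: (conv eps f x) (conv eps f y) (conv eps f1 x) (conv eps f1 y) (int mu (fun z => `|f z|)) (int mu (fun z => `|f1 z|)) (enorm (x - y)) r_ge0 (c0 : R) c0_gt0.
exact: quotient_arith.
Qed.

(** Isolates what the iteration uses of [contraction] at the fixed time [eps]. *)
Definition quotient_contraction (theta : R) := forall (phi g : E -> R) (A' C0 : R),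
  0 <= A' -> intble mu phi -> (forall y, 0 <= phi y) ->
  (forall y, Om y -> 0 < phi y) -> (forall y, ~ Om y -> phi y = 0) ->
  (forall s, 0 < s -> logconcave (conv s phi)) -> (forall y, Om y -> `|g y| <= C0) ->
  (forall x y, Om x -> Om y -> g x - g y <= A' * sine_modulus r0 (enorm (x - y))) ->
  forall x y, Om x -> Om y ->
    conv eps (fun z => phi z * g z) x / conv eps phi x - conv eps (fun z => phi z * g z) y / conv eps phi y <=
    A' * theta * sine_modulus r0 (enorm (x - y)).

(** Each quotient is the average of the preceding one, weighted by the matching iterate of the
    indicator, whose convolutions are log-concave; so every step gains a factor [theta]. *)
Lemma quotient_modulus : exists2 A, 0 <= A & forall theta, 0 <= theta -> quotient_contraction theta ->
  forall f, intble mu f -> (forall x, ~ Om x -> f x = 0) -> forall N x y, Om x -> Om y ->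
    iter N.+1 T f x / fN N.+1 x - iter N.+1 T f y / fN N.+1 y <=
    A * int mu (fun y => `|f y|) * theta ^+ N * sine_modulus r0 (enorm (x - y)).
Proof.
have [A A0 HA] := quotient_initial; exists A => // theta th0 contr f fi fO.
have I0 : 0 <= int mu (fun z => `|f z|) by exact: int_ge0.
elim=> [|N ih] x y Ox Oy; first by rewrite expr0 mulr1; exact: HA.
pose g z := iter N.+1 T f z / fN N.+1 z.
have [x0 Ox0] := Om0.
have A'0 : 0 <= A * int mu (fun z => `|f z|) * theta ^+ N by rewrite !mulr_ge0// exprn_ge0.
have [cu lc] := fN_cubed N.+1.
have gb z : Om z -> `|g z| <= `|g x0| + A * int mu (fun z => `|f z|) * theta ^+ N.
  move=> Oz; have h1 := ih _ _ Oz Ox0; have h2 := ih _ _ Ox0 Oz.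
  have s1 r : A * int mu (fun z => `|f z|) * theta ^+ N * sine_modulus r0 r <= A * int mu (fun z => `|f z|) * theta ^+ N.
    by rewrite ler_piMr//; have [_ _ + _ _] := sine_modulus_ok r0_gt0 => /(_ r); rewrite ler_norml => /andP[].
  exact: abs_le_of_diff h1 h2 (s1 _) (s1 _).
have := contr (fN N.+1) g _ _ A'0 (fN_intble _) (fN_ge0 _) (fN_gt0 N.+1) (fN_out N.+1)
  (fun s s0 => conv_logconcave s0 ler01 L0 cu lc) gb ih x y Ox Oy.
have -> : (fun z => fN N.+1 z * g z) = iter N.+1 T f.
  apply/funext => z; have [Oz|Oz] := pselect (Om z).
    by rewrite /g mulrC divfK// gt_eqF// fN_gt0.
  by rewrite fN_out// mul0r iter_killed_out.
rewrite (iterS N.+1 T f) (iterS N.+1 T f1) !killed_in// => /le_trans; apply.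
by rewrite exprSr !mulrA.
Qed.

(** A zero at [xs] would bound the quotient by its oscillation, hence the iterate by a multiple of
    (theta fac)^N on all of [Om]; pairing with f contradicts the lower bound kappa^(N + 1). N
    depends on the constants alone and so serves every f. *)
Lemma killed_nonvanishing (h : E -> R) (m M fac theta kappa : R) (xs : E) :
  0 < m -> 0 < fac -> measurable_fun setT h -> (forall x, 0 <= h x <= M) ->
  (forall x, Om x -> m <= h x) -> (forall x, Om x -> conv eps h x <= fac * h x) ->
  0 <= theta -> quotient_contraction theta -> theta * fac < kappa -> Om xs ->
  exists N, forall f, sqint f -> (forall x, ~ Om x -> f x = 0) ->
    int mu (fun x => f x ^+ 2) = 1 -> kappa <= int mu (fun x => f x * conv eps f x) ->
    iter N.+1 T f xs <> 0.
Proof.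
move=> m0 fac0 mh hM hm hT th0 contr tk Oxs.
have [A A0 HA] := quotient_modulus.
(* Bound for the L^1 norm of every normalized f, from |f| <= (f^2 + 1) / 2 on [Om]. *)
pose V := 2^-1 * (1 + int mu f1).
have V0 : 0 <= V by rewrite mulr_ge0// addr_ge0// int_ge0.
have M0 : 0 <= M by have /andP[h1 h2] := hM xs; exact: le_trans h1 h2.
pose K := A * V ^+ 2 * M * fac / m.
have K0 : 0 <= K by rewrite divr_ge0 ?(ltW m0)// mulr_ge0 ?(ltW fac0)// mulr_ge0// mulr_ge0// exprn_ge0.
have k0 : 0 < kappa by apply: le_lt_trans tk; rewrite mulr_ge0// ltW.
have [k Hk] := geometric_lt K0 k0 (mulr_ge0 th0 (ltW fac0)) tk.
(* The lower bound holds at exponents that are powers of 2, hence N + 1 = 2^k; this also ensures k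
   <= N. *)
exists (2 ^ k).-1; set N := (2 ^ k).-1.
have N1 : (2 ^ k = N.+1)%N by rewrite prednK// expn_gt0.
have kN : (k <= N)%N by rewrite -ltnS -N1 ltn_expl.
move=> f sf fO f21 kf z0; have fi := sqint_supp oO L0 OL sf fO.
have fV : int mu (fun x => `|f x|) <= V.
  rewrite /V -[X in _ * (X + _)]f21 -(intD sf.2 i1) -intZ; last exact: intbleD sf.2 i1.
  apply: int_le; [exact: intble_norm|by apply: intbleZ; exact: intbleD sf.2 i1|move=> x].
  have [Ox|Ox] := pselect (Om x); last by rewrite fO// normr0 mulr_ge0// addr_ge0// sqr_ge0.
  rewrite indicE mem_set//; exact: norm_le_half_sqr.
pose B := A * V * theta ^+ N * (fac ^+ N.+1 / m * M).
have fb x : `|iter N.+1 T f x| <= B.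
  have [Ox|Ox] := pselect (Om x); last first.
    rewrite iter_killed_out// normr0 mulr_ge0//; first by rewrite mulr_ge0 ?exprn_ge0// mulr_ge0.
    by rewrite mulr_ge0// divr_ge0 ?exprn_ge0 ?(ltW fac0) ?(ltW m0).
  have p0 := fN_gt0 N.+1 Ox.
  have pb : fN N.+1 x <= fac ^+ N.+1 / m * M.
    apply: le_trans (fN_upper m0 (ltW fac0) mh hM hm hT N.+1 x) _.
    by rewrite ler_wpM2l ?divr_ge0 ?exprn_ge0 ?(ltW fac0) ?(ltW m0)//; have /andP[] := hM x.
  have A1 : 0 <= A * int mu (fun y => `|f y|) * theta ^+ N.
    by rewrite mulr_ge0 ?exprn_ge0// mulr_ge0// int_ge0.
  have sm r : sine_modulus r0 r <= 1.
    by have [_ _ + _ _] := sine_modulus_ok r0_gt0 => /(_ r); rewrite ler_norml => /andP[].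
  have h1 := le_trans (HA _ th0 contr _ fi fO N _ _ Ox Oxs) (ler_wpM2l A1 (sm _)).
  have h2 := le_trans (HA _ th0 contr _ fi fO N _ _ Oxs Ox) (ler_wpM2l A1 (sm _)).
  rewrite mulr1 z0 mul0r subr0 ler_pdivrMr// in h1.
  rewrite mulr1 z0 mul0r sub0r -mulNr ler_pdivrMr// in h2.
  apply: (@le_trans _ _ (A * int mu (fun y => `|f y|) * theta ^+ N * fN N.+1 x)).
    by rewrite ler_norml h1 andbT lerNl.
  rewrite /B; refine (ler_pM A1 (ltW p0) _ pb).
  by rewrite ler_wpM2r ?exprn_ge0// ler_wpM2l.
have B0 : 0 <= B := le_trans (normr_ge0 _) (fb xs).
have up : int mu (fun x => f x * iter N.+1 T f x) <= B * V.
  apply: (@le_trans _ _ (int mu (fun x => B * `|f x|))).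
    apply: int_le; [|by apply: intbleZ; exact: intble_norm|].
      have -> : (fun x => f x * iter N.+1 T f x) = (fun x => iter N.+1 T f x * f x).
        by apply/funext => x; exact: mulrC.
      exact: intble_mulb (intble_mfun (iter_killed_intble N.+1 fi).1) fb fi.
    move=> x; apply: le_trans (ler_norm _) _; rewrite normrM mulrC.
    by rewrite ler_wpM2r.
  by rewrite intZ; [rewrite ler_wpM2l|exact: intble_norm].
have lo := killed_form_lower sf fO f21 (ltW k0) kf k.
rewrite N1 in lo; have {up lo} := le_trans lo up.
have -> : B * V = K * (theta * fac) ^+ N.
  by rewrite /B /K [(theta * fac) ^+ N]exprMn [fac ^+ N.+1]exprS; move: (theta ^+ N) (fac ^+ N) (V : R) => u v w; field; rewrite gt_eqF.
by move/(lt_le_trans (Hk N kN)); rewrite ltxx.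
Qed.

End killed_heat.

(** * Choice of the time step and of the homothety ratio *)

(** With eps = s^2, the product minus 1 - p s^2 is s^2 times - (t + u - p) + O(s); this is negative
    for small s because p < t + u. *)
Lemma small_time (R : rcfType) (t u p C1 C2 : R) : 0 <= t -> 0 <= u -> 0 <= C1 -> 0 <= C2 -> p < t + u ->
  exists eps, [/\ 0 < eps, 0 <= 1 - t * eps + C1 * Num.sqrt eps ^+ 3,
    0 < 1 - u * eps + C2 * Num.sqrt eps ^+ 3 &
    (1 - t * eps + C1 * Num.sqrt eps ^+ 3) * (1 - u * eps + C2 * Num.sqrt eps ^+ 3) < 1 - p * eps].
Proof.
move=> t0 u0 C10 C20 ptu; pose K := t * u + C1 + C2 + C1 * C2.
have K0 : 0 <= K by rewrite !addr_ge0 ?mulr_ge0.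
pose w := Num.min (t + u - p) 1.
have w0 : 0 < w by rewrite lt_min ltr01 andbT subr_gt0.
have w1 : w <= 1 by rewrite ge_min lexx orbT.
have wp : w <= t + u - p by rewrite ge_min lexx.
have D1 : 0 <= K + t + u by apply: addr_ge0 => //; exact: addr_ge0.
have D0 : 0 < K + t + u + 1 by rewrite ltr_wpDl.
have [s s0 sD] : exists2 s, 0 < s & s * (K + t + u + 1) = w.
  by exists (w / (K + t + u + 1)); rewrite ?divr_gt0// divfK// gt_eqF.
have sE c : c < K + t + u + 1 -> s * c < w by rewrite -sD ltr_pM2l.
have st : s * t < w by apply: sE; lra.
have su : s * u < w by apply: sE; lra.
have sK : s * K < w by apply: sE; lra.
have s1 : s <= 1.
  by apply: le_trans w1; rewrite -sD -[leLHS]mulr1 ler_pM2l// lerDr.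
exists (s ^+ 2); rewrite sqrtr_sqr gtr0_norm//.
have s3 : 0 <= s ^+ 3 by rewrite exprn_ge0// ltW.
have h1 : t * s ^+ 2 <= s * t by rewrite expr2 mulrA mulrC [s * t]mulrC ler_piMl// mulr_ge0// ltW.
have h2 : u * s ^+ 2 <= s * u by rewrite expr2 mulrA mulrC [s * u]mulrC ler_piMl// mulr_ge0// ltW.
have h3 := mulr_ge0 C10 s3; have h4 := mulr_ge0 C20 s3.
split; [exact: exprn_gt0|lra|lra|].
have -> : (1 - t * s ^+ 2 + C1 * s ^+ 3) * (1 - u * s ^+ 2 + C2 * s ^+ 3) =
  1 - p * s ^+ 2 + s ^+ 2 * (s * K - (t + u - p) - s * (1 - s) * (t * u) - s * (1 - s ^+ 3) * (C1 * C2)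
    - s ^+ 3 * (t * C2 + u * C1)) by rewrite /K; ring.
rewrite gtrDl pmulr_rlt0 ?exprn_gt0//.
have h5 : 0 <= s * (1 - s) * (t * u) by rewrite mulr_ge0 ?mulr_ge0 ?subr_ge0// ltW.
have h6 : 0 <= s * (1 - s ^+ 3) * (C1 * C2).
  by rewrite mulr_ge0 ?mulr_ge0 ?subr_ge0 ?exprn_ile1// ltW.
have h7 : 0 <= s ^+ 3 * (t * C2 + u * C1) by rewrite mulr_ge0// addr_ge0 ?mulr_ge0.
lra.
Qed.

(** For q = 1 - e one has q^2 X >= X - 2 e X, and e is chosen so that 2 e X < X - Lam. *)
Lemma shrink_gap (R : realFieldType) (Lam X : R) : 0 < X -> Lam < X -> 0 <= Lam ->
  exists q, [/\ 0 < q, q < 1 & Lam < q ^+ 2 * X].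
Proof.
move=> X0 LX L0; have D0 : 0 < 2 * X + (X - Lam) by lra.
pose e := (X - Lam) / (2 * X + (X - Lam)).
have e0 : 0 < e by rewrite divr_gt0// subr_gt0.
have e1 : e < 1 by rewrite ltr_pdivrMr//; lra.
have eE : e * (2 * X + (X - Lam)) = X - Lam by rewrite divfK// gt_eqF.
exists (1 - e); split; [lra|lra|].
have h1 : 0 < e * (X - Lam) by rewrite mulr_gt0// subr_gt0.
have h2 : 0 <= e ^+ 2 * X by rewrite mulr_ge0 ?sqr_ge0// ltW.
have -> : (1 - e) ^+ 2 * X = X - e * (2 * X) + e ^+ 2 * X by ring.
rewrite mulrDr in eE; lra.
Qed.

(** * A zero of the evaluated heat flow along a path *)

Section path_zero.
Context {R : realType} {n : nat}.
Local Notation E := 'rV[R]_n.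
Local Notation mu := (@lebesgue_rV R n).
Variables (Om : set E) (L eps : R).
Hypotheses (oO : open Om) (L0 : 0 <= L) (OL : Om `<=` cube n L) (e0 : 0 < eps).

Let mO : measurable Om. Proof. exact: open_measurable_rV oO. Qed.

Local Notation T := (killed_conv Om eps).
Local Notation I01 := (`[0%R : R, 1%R]%classic).

Let Zi := (@gsZ R n eps)^-1.

(** The kernel is bounded, and on the bounded set [Om] the L^1 norm is controlled by the L^2 norm;
    evaluation of an iterate at a point is therefore L^2-continuous. *)
Lemma killed_pointwise : exists2 B, 0 <= B & forall N (f : E -> R) (x : E), sqint f -> (forall y, ~ Om y -> f y = 0) ->
  `|iter N.+1 T f x| <= B * Num.sqrt (int mu (fun y => f y ^+ 2)).
Proof.
have Z0 : 0 <= Zi by rewrite invr_ge0 ltW// gsZ_gt0.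
have i1 := intble_indic_domain oO L0 OL.
have s1 : sqint (\1_Om : E -> R).
  split; first exact: intble_mfun i1.
  have -> : (fun x => (\1_Om x : R) ^+ 2) = (\1_Om : E -> R); last exact: i1.
  by apply/funext => x; rewrite indicE; case: (_ \in _); rewrite ?expr1n ?expr0n.
pose B := Num.sqrt (int mu (fun y => (\1_Om y : R) ^+ 2)).
exists (Zi * B); first by rewrite mulr_ge0// sqrtr_ge0.
move=> N f x sf fO; have fi := sqint_supp oO L0 OL sf fO.
apply: le_trans (iter_killed_bounded oO e0 N x fi) _.
rewrite -/Zi -mulrA ler_wpM2l//.
have sa : sqint (fun y => `|f y|).
  split; first exact: intble_mfun (intble_norm fi).
  have -> : (fun x => `|f x| ^+ 2) = (fun x => f x ^+ 2); last exact: sf.2.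
  by apply/funext => y; rewrite real_normK// num_real.
have -> : int mu (fun y => `|f y|) = int mu (fun y => (\1_Om y : R) * `|f y|).
  congr (int mu); apply/funext => y; have [Oy|Oy] := pselect (Om y).
    by rewrite indicE mem_set// mul1r.
  by rewrite fO// normr0 mulr0.
have cs := sqint_cs s1 sa.
have E1 : int mu (fun y => `|f y| ^+ 2) = int mu (fun y => f y ^+ 2).
  by congr (int mu); apply/funext => y; rewrite real_normK// num_real.
rewrite E1 in cs.
have i0 : 0 <= int mu (fun y => (\1_Om y : R) * `|f y|) by apply: int_ge0 => y; rewrite mulr_ge0// indicE.
rewrite -[leLHS](ger0_norm i0) -sqrtr_sqr /B -sqrtrM; first exact: ler_wsqrtr.
by apply: int_ge0 => y; rewrite sqr_ge0.
Qed.

Lemma killed_ae (f g : E -> R) : measurable_fun setT f -> measurable_fun setT g ->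
  {ae mu, forall x, f x = g x} -> T f = T g.
Proof.
move=> mf mg fg; apply/funext => x; rewrite /killed_conv !convdefE; congr (_ * _).
apply: ae_eq_int; [apply: measurable_funM => //; exact: measurable_gaussp_at|apply: measurable_funM => //; exact: measurable_gaussp_at|].
by apply: filterS fg => y ->.
Qed.

(** Evaluation at [xs] is continuous along the path and opposite at its two ends: intermediate value
    theorem. *)
Lemma path_vanishes (sigma : R -> E -> R) (u : E -> R) N (xs : E) :
  Gamma Om u (\- u) sigma -> exists2 t, I01 t & iter N.+1 T (sigma t \_ Om) xs = 0.
Proof.
move=> [sS sC s0 s1].
have sq t : I01 t -> sqint (sigma t \_ Om) by move=> /sS [[[/L2P ? _] _] _].
have si t : I01 t -> intble mu (sigma t \_ Om).
  by move=> ts; apply: (sqint_supp oO L0 OL (sq t ts)); exact: ext_out.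
have [B B0 HB] := killed_pointwise.
pose a t := iter N.+1 T (sigma t \_ Om) xs.
have ext_sub s t : (sigma s \- sigma t) \_ Om = (fun x => 1 * (sigma s \_ Om) x + (-1) * (sigma t \_ Om) x).
  rewrite -ext_comb; congr (_ \_ Om); apply/funext => x /=; ring.
have bound s t : I01 s -> I01 t -> `|a s - a t| <= B * fine (W12norm Om (sigma s \- sigma t)).
  move=> ss tt; have [[[us [gs hs]] _] _] := sS s ss; have [[[ut [gt ht]] _] _] := sS t tt.
  have gc := weak_gradient_comb L0 OL 1 (-1) us ut hs ht.
  have cE : (fun x => 1 * sigma s x + (-1) * sigma t x) = sigma s \- sigma t by apply/funext => x /=; ring.
  rewrite cE in gc.
  have sd : sqint ((sigma s \- sigma t) \_ Om).
    by rewrite ext_sub; exact: (sqint_comb 1 (-1) (sq s ss) (sq t tt)).1.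
  rewrite (W12normE oO L0 OL ((L2P _ _).2 sd) gc) /=.
  have -> : a s - a t = iter N.+1 T ((sigma s \- sigma t) \_ Om) xs.
    by rewrite ext_sub (iter_killed_comb oO e0 N.+1 1 (-1) (si s ss) (si t tt)) /a; ring.
  apply: le_trans (HB N _ xs sd (@ext_out _ _ _ _)) _.
  by rewrite ler_wpM2l// ler_wsqrtr// lerDl dirichlet_ge0.
have ac : {within `[0, 1], continuous a}.
  apply/subspace_continuousP => t tt; apply/cvgrPdist_lt => e e0'.
  have B1 : 0 < B + 1 by rewrite ltr_wpDl.
  have Hc := (@cvgrPdist_lt _ _ _ _ _ _ _).1 (fine_cvg (sC t tt)) _ (divr_gt0 e0' B1).
  near=> s; have ss : I01 s by near: s; exact: withinT.
  rewrite distrC; apply: le_lt_trans (bound s t ss tt) _.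
  have : `|0 - (fine \o (fun s => W12norm Om (sigma s \- sigma t))) s| < e / (B + 1).
    by near: s; exact: Hc.
  rewrite /= sub0r normrN => Hs; have := le_lt_trans (ler_norm _) Hs.
  rewrite ltr_pdivlMr// => h; have w0 : 0 <= fine (W12norm Om (sigma s \- sigma t)).
    by apply: fine_ge0; exact: sqrte_ge0.
  by apply: le_lt_trans h; rewrite mulrC mulrDr mulr1 lerDl.
have z01 : I01 0 by rewrite /= in_itv /= lexx ler01.
have o01 : I01 1 by rewrite /= in_itv /= lexx ler01.
(* The endpoints match [u] and its opposite only almost everywhere; one application of the operator
   erases null sets, hence the exponent N.+1. *)
have end_opp : a 1 = - a 0.
  rewrite /a !iterSr.
  have -> : T (sigma 1 \_ Om) = T (fun x => (-1) * (sigma 0 \_ Om) x + 0 * (sigma 0 \_ Om) x).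
    apply: killed_ae; [exact: (sq 1 o01).1|exact: (sqint_comb (-1) 0 (sq 0 z01) (sq 0 z01)).1.1|].
    apply: filterS2 s0 s1 => x h0 h1; have [Ox|Ox] := pselect (Om x).
      by rewrite !ext_in// h0// h1//=; ring.
    by rewrite !ext_out//; ring.
  rewrite (killed_comb Om e0 (-1) 0 (si 0 z01) (si 0 z01)).
  have Ti := (killed_intble oO e0 (si 0 z01)).1.
  by rewrite (iter_killed_comb oO e0 N (-1) 0 Ti Ti); ring.
have [c cI ac0] : exists2 c, c \in `[0, 1] & a c = 0.
  apply: (IVT ler01 ac); rewrite end_opp ge_min le_max.
  by have [h|h] := leP 0 (a 0); rewrite ?oppr_le0 ?oppr_ge0 ?h ?(ltW h) ?orbT.
by exists c.
Unshelve. all: by end_near. Qed.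

End path_zero.

(** * The gap inequality *)

Section spectral_gap.
Context {R : realType} {n : nat}.
Local Notation E := 'rV[R]_n.
Local Notation mu := (@lebesgue_rV R n).
Local Notation I01 := (`[0%R : R, 1%R]%classic).

(** If Lam were smaller, a suitable q < 1 and time step would make theta fac < kappa. No normalized
    function of energy at most Lam could then have an iterate vanishing at [xs], yet the path
    contains one. *)
Lemma path_energy_lower (Om : set E) (L d lam Lam : R) (U u : E -> R) (sigma : R -> E -> R) (i0 : 'I_n) :
  open Om -> 0 <= L -> Om `<=` cube n L -> Om !=set0 ->
  (forall x y l, 0 < l -> l < 1 -> Om x -> Om y -> Om ((1 - l) *: x + l *: y)) ->
  0 < d -> (forall x y, Om x -> Om y -> enorm (x - y) <= d) ->
  0 <= lam -> intble mu U -> (forall x, 0 <= U x) -> {ae mu, forall x, Om x -> 0 < U x} ->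
  (forall J, test_function Om J ->
    lam * int mu (fun x => U x * J x) = - int mu (fun x => U x * \sum_i partial i (partial i J) x)) ->
  Gamma Om u (\- u) sigma -> 0 <= Lam -> (forall t, I01 t -> (energy Om (sigma t) <= Lam%:E)%E) ->
  lam + pi ^+ 2 / d ^+ 2 <= Lam.
Proof.
move=> oO L0 OL Om0 cvxO d0 Od lam0 iU U0 Upos EL sG Lam0 sE; rewrite leNgt; apply/negP => LX.
have n0 : (0 < n)%N by apply: leq_ltn_trans (ltn_ord i0).
have X0 : 0 < lam + pi ^+ 2 / d ^+ 2 by apply: le_lt_trans LX.
have [q [q0 q1 qL]] := shrink_gap X0 LX Lam0.
have [h [m [M [C2 [m0 C20 mh [hM hm] hT]]]]] :=
  supersolution n0 oO OL Om0 cvxO q0 q1 iU U0 Upos EL.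
(* With this r0 one has 4 a^2 = q^2 pi^2 / d^2, so both parts of the decay rate lose the same factor
   q^2. *)
pose r0 := d / q; have r0_gt0 : 0 < r0 by rewrite divr_gt0.
have dr : d < r0 by rewrite ltr_pdivlMr// gtr_pMr.
pose a := pi / (2 * r0).
have [C1 C10 HC] := contraction i0 r0_gt0 (erefl a) (ltW d0) dr Om0 Od.
pose g := @gvar R n; have g0 : 0 < g by exact: gvar_gt0.
have t0 : 0 <= 2 * a ^+ 2 * g by rewrite mulr_ge0 ?(ltW g0)// mulr_ge0// sqr_ge0.
have u0 : 0 <= 2^-1 * (q ^+ 2 * g * lam).
  by rewrite mulr_ge0// mulr_ge0// mulr_ge0 ?(ltW g0)// sqr_ge0.
(* Rates per unit time: energy on the left, modulus and supersolution on the right, all proportional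
   to the variance [g]. *)
have ptu : 2^-1 * (g * Lam) < 2 * a ^+ 2 * g + 2^-1 * (q ^+ 2 * g * lam).
  have -> : 2 * a ^+ 2 * g + 2^-1 * (q ^+ 2 * g * lam) = 2^-1 * (g * (q ^+ 2 * (lam + pi ^+ 2 / d ^+ 2))).
    rewrite /a /r0; move: (pi : R) (g : R) => p v; field; rewrite !gt_eqF//.
  by rewrite ltr_pM2l// ltr_pM2l.
have [eps [e0 th0 fac0 kap]] := small_time t0 u0 C10 C20 ptu.
have [xs Oxs] := Om0.
have mO : measurable Om by exact: open_measurable_rV oO.
have muO : (0 < mu Om)%E by exact: open_rV_gt0.
have hT' x : Om x -> conv eps h x <= (1 - 2^-1 * (q ^+ 2 * g * lam) * eps + C2 * Num.sqrt eps ^+ 3) * h x.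
  move=> Ox; have := hT eps x e0 Ox; rewrite -/g.
  by have -> : 2^-1 * (q ^+ 2 * g * eps * lam) = 2^-1 * (q ^+ 2 * g * lam) * eps by ring.
have contr : quotient_contraction Om eps r0 (1 - 2 * a ^+ 2 * g * eps + C1 * Num.sqrt eps ^+ 3).
  move=> phi v A' C0 A'0 iphi phi0 phiO phiN lc vb vm.
  exact: (HC phi v Om A' C0 eps e0 iphi phi0 mO muO phiO phiN lc A'0 vb vm).
have [N HN] := killed_nonvanishing oO L0 OL Om0 cvxO Od e0 r0_gt0 (erefl a) (ltW d0) dr m0 fac0 mh hM hm hT'
  th0 contr kap Oxs.
have [t tI tz] := path_vanishes oO L0 OL e0 N xs sG.
have [sS _ _ _] := sG.
have [sf _ s1 sk] := heat_form_S2 oO L0 OL n0 e0 (sS t tI) (sE t tI).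
apply: HN sf _ s1 _ tz; first exact: ext_out.
by have -> : 2^-1 * (g * Lam) * eps = 2^-1 * (g * eps * Lam) by ring.
Qed.

Lemma enorm_cube (L : R) (x y : E) : 0 <= L -> cube n L x -> cube n L y ->
  enorm (x - y) <= Num.sqrt (n%:R * (2 * L) ^+ 2).
Proof.
move=> L0 xL yL; rewrite /enorm ler_wsqrtr//.
apply: (@le_trans _ _ (\sum_(i < n) (2 * L) ^+ 2)); last first.
  by rewrite sumr_const card_ord [leRHS]mulr_natl.
apply: ler_sum => i _; rewrite !mxE -real_normK ?num_real// lerXn2r ?nnegrE ?mulr_ge0//.
by apply: le_trans (ler_normB _ _) _; have := xL i; have := yL i; lra.
Qed.

Lemma diam_bound (A : set E) (L : R) (x y : E) : 0 <= L -> A `<=` cube n L -> A x -> A y ->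
  enorm (x - y) <= diam A.
Proof.
move=> L0 AL Ax Ay; apply: ub_le_sup; last by exists x => //; exists y.
by exists (Num.sqrt (n%:R * (2 * L) ^+ 2)) => _ [a Aa [b Ab <-]]; apply: enorm_cube => //; exact: AL.
Qed.

Lemma open_diam_gt0 (A : set E) (L : R) (i : 'I_n) : 0 <= L -> A `<=` cube n L -> open A -> A !=set0 -> 0 < diam A.
Proof.
move=> L0 AL oA [x Ax].
have /nbhs_ballP[r /= r0 rA] := oA x Ax.
have Ay : A (x + (r / 2) *: delta_mx 0 i).
  apply: rA; rewrite -ball_normE /ball_ /= opprD addNKr normrN.
  rewrite normrZ gtr0_norm ?divr_gt0//.
  apply: (@le_lt_trans _ _ (r / 2 * 1)); last by rewrite mulr1 ltr_pdivrMr// mulr_natr mulr2n ltrDl.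
  rewrite ler_wpM2l ?divr_ge0 ?(ltW r0)//; apply: mx_norm_le => // j.
  by rewrite mxE normr_nat lern1 leq_b1.
apply: lt_le_trans (diam_bound L0 AL Ay Ax).
rewrite addrC addKr /enorm sqrtr_gt0 (bigD1 i)//= !mxE !eqxx mulr1.
by rewrite ltr_pwDl ?exprn_gt0 ?divr_gt0// sumr_ge0// => j _; rewrite sqr_ge0.
Qed.

Lemma bounded_cube (A : set E) : bounded_set A -> exists2 L, 0 <= L & A `<=` cube n L.
Proof.
move=> [M [_ HM]]; exists (`|M| + 1); first by rewrite addr_ge0.
move=> x Ax i; have := HM (`|M| + 1) _ x Ax; rewrite ltr_pwDr ?ler_norm// => /(_ isT).
apply: le_trans; rewrite -[`|x|]/(mx_norm x) mx_normrE.
exact: (le_bigmax _ (fun ij : 'I_1 * 'I_n => `|x ij.1 ij.2|) (ord0, i)).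
Qed.

Lemma convex_segment (A : set E) : convex_set A ->
  forall x y l, 0 < l -> l < 1 -> A x -> A y -> A ((1 - l) *: x + l *: y).
Proof.
move=> cA x y l l0 l1 Ax Ay.
have := cA y x (Itv01 (ltW l0) (ltW l1)) (mem_set Ay) (mem_set Ax); rewrite inE /=.
by rewrite addrC.
Qed.

End spectral_gap.

Theorem corollary3p9 (R : realType) (n : nat) (Omega : set 'rV[R]_n) :
  (2 <= n)%N ->
  Omega !=set0 -> open Omega -> bounded_set Omega -> convex_set Omega ->
  smooth_boundary Omega ->
  ((pi ^+ 2 / diam Omega ^+ 2)%:E <= lambda2 Omega - lambda1 Omega)%E.
Proof.
move=> n2 Om0 oO /bounded_cube[L L0 OL] /convex_segment cvxO _.
have i0 : 'I_n := Ordinal (leq_trans (isT : 1 < 2)%N n2).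
have d0 := open_diam_gt0 i0 L0 OL oO Om0.
have Od x y : Omega x -> Omega y -> enorm (x - y) <= diam Omega by exact: diam_bound L0 OL.
have [lfin lge] := lambda1_fin oO L0 OL Om0.
have [lam lamE] : exists lam, lambda1 Omega = lam%:E by exists (fine (lambda1 Omega)); rewrite fineK.
have lam0 : 0 <= lam by move: lge; rewrite lamE lee_fin.
(* Otherwise some admissible path keeps its energy, supremum included, below lambda_1 + pi^2 /
   d^2. *)
rewrite lamE leeBrDr// -EFinD addrC leNgt; apply/negP => /ereal_inf_lt[_ [sigma sG <-] slt].
have [sS _ s0 _] := sG.
pose u := first_eigenfunction Omega; rewrite -/u in sG s0.
have z01 : `[0%R : R, 1%R]%classic 0 by rewrite /= in_itv /= lexx ler01.
set s := ereal_sup _ in slt.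
have es t : `[0%R : R, 1%R]%classic t -> (energy Omega (sigma t) <= s)%E.
  by move=> tI; apply: ereal_sup_ubound; exists t.
have l1s : (lambda1 Omega <= s)%E.
  by apply: le_trans (es 0 z01); apply: ereal_inf_lbound; exists (sigma 0) => //; exact: sS.
have [Lam LamE] : exists Lam, s = Lam%:E.
  exists (fine s); rewrite fineK// fin_numE; apply/andP; split.
    by apply: contraTN l1s => /eqP ->; rewrite lamE.
  by apply: contraTN slt => /eqP ->; rewrite -leNgt leey.
rewrite LamE lte_fin in slt; rewrite LamE lamE lee_fin in l1s.
(* [xget] returns a first eigenfunction if there is one and the default 0 otherwise; in the latter
   case a path would start at 0 almost everywhere, against its unit norm. *)
have [i1 [eig|noeig]] : True /\ (is_first_eigenfunction Omega u \/ u = (fun=> 0)).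
  split=> //; have [[y Py]|no] := pselect (exists y, is_first_eigenfunction Omega y).
    by left; apply: (@xgetPex _ (fun=> 0 : R) (is_first_eigenfunction Omega)); exists y.
  by right; apply: xgetPN => y Py; apply: no; exists y.
  have [uS uE upos] := eig.
  have [[[/L2P uL _] _] _] := uS.
  have iu : intble (@lebesgue_rV R n) (u \_ Omega) by apply: (sqint_supp oO L0 OL uL); exact: ext_out.
  (* [u] is positive only almost everywhere on [Omega]; the absolute value of its extension is
     nonnegative everywhere and has the same integrals. *)
  have ua : {ae @lebesgue_rV R n, forall x, `|(u \_ Omega) x| = (u \_ Omega) x}.
    apply: filterS upos => x ux; have [Ox|Ox] := pselect (Omega x).
      by rewrite ext_in// gtr0_norm// ux.
    by rewrite ext_out// normr0.
  have aeU v : measurable_fun setT v ->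
      int (@lebesgue_rV R n) (fun x => `|(u \_ Omega) x| * v x) = int (@lebesgue_rV R n) (fun x => (u \_ Omega) x * v x).
    move=> mv; apply: ae_eq_int.
    - exact: measurable_funM (intble_mfun (intble_norm iu)) mv.
    - exact: measurable_funM uL.1 mv.
    - by apply: filterS ua => x ->.
  suff : lam + pi ^+ 2 / diam Omega ^+ 2 <= Lam by move=> /(lt_le_trans slt); rewrite ltxx.
  apply: (path_energy_lower i0 oO L0 OL Om0 cvxO d0 Od lam0 (intble_norm iu) _ _ _ sG).
  - by move=> x.
  - apply: filterS upos => x ux Ox; rewrite ext_in// normr_gt0 gt_eqF//; exact: ux.
  - move=> J tJ; have [sJ _] := test_smooth OL tJ; rewrite !aeU; first exact: (euler_lagrange oO L0 OL Om0 uS uE lamE tJ).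
    + apply: measurable_sum => i; have := smooth_in_cube_partial i (smooth_in_cube_partial i sJ).
      by move=> /(smooth_in_cube_intble L0)[].
    + by have [] := smooth_in_cube_intble L0 sJ.
  - exact: le_trans lam0 l1s.
  - by move=> t tI; rewrite -LamE; exact: es.
have [[[/L2P sL _] _] sN] := sS 0 z01.
move: sN; rewrite (L2normE sL).
have -> : int (@lebesgue_rV R n) (fun x => (sigma 0 \_ Omega) x ^+ 2) = int (@lebesgue_rV R n) (fun _ : 'rV[R]_n => 0 : R).
  apply: ae_eq_int; [exact: measurable_funX sL.1|exact: measurable_cst|].
  apply: filterS s0 => x h0; have [Ox|Ox] := pselect (Omega x); last by rewrite ext_out// expr0n.
  by rewrite ext_in// h0// noeig expr0n.
rewrite int0 sqrtr0 => -[] /eqP; rewrite eq_sym oner_eq0//.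
Qed.
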